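(* Let $(X_t:t\ge0)$ be the solution of the stochastic equation, for $t\ge 0$ and $x>0$, $$X_{t}(x)= X_{0}(x+t)- X_{0}(t)+\int_{0}^{t} \int_{0}^{\langle X_{s-}, \alpha\rangle} \int_{E} \int_{0}^{p(A_{\alpha}( X_{s-},y), n)} \sum_{i=1}^{n} 1_{\{0<z_{i}-(t-s) \le x\}}\, M(d s, d u, d w, d v).$$ For $f \in C_{0}^{1}(0, \infty)$ with the first derivative vanishing at $0$ and $F \in C^{1}[0, \infty)$, let $F_{f}(\mu)=F(\langle\mu, f\rangle)$ and let $$\mathscr{L}_{0} F_{f}(\mu)=-\langle\mu, f^{\prime}\rangle F^{\prime}(\langle\mu, f\rangle) - \sum_{n \in \mathbb{N}} \int_{0}^{\infty} \alpha(y) p(y, n)\int_{(0, \infty)^{\infty}}\Big[F(\langle\mu, f\rangle)- F\Big(\langle\mu, f\rangle+\sum_{i=1}^{n}f(z_i)\Big)\Big] G^{\infty}(dz)\,\mu(d y).$$ Then $$F_{f}(X_{t})=F_{f}(X_{0})+\int_{0}^{t} \mathscr{L}_{0} F_{f}(X_{s})\, d s+\text{mart.},$$ i.e. $t\mapsto F_{f}(X_{t})-F_{f}(X_{0})-\int_{0}^{t} \mathscr{L}_{0} F_{f}(X_{s})\, d s$ is a martingale.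
   Context: Notation. $\mathbb{N}=\{0,1,2,\ldots\}$; ''positive'' means nonnegative. $\mathfrak{M}(0,\infty)$ is the set of finite Borel measures on $(0,\infty)$ with the weak convergence topology. $\mathfrak{D}(0,\infty)$ is the set of bounded positive right-continuous increasing functions $f$ on $\mathbb{R}$ with $f(x)=0$ for $x\le 0$; $\nu\in\mathfrak{M}(0,\infty)$ is identified with its distribution function $\nu(x)=\nu((0,x])$, $x>0$, in $\mathfrak{D}(0,\infty)$. $C^1(0,\infty)$ is the set of bounded continuous functions on $(0,\infty)$ with bounded continuous first derivative; $C_0^1(0,\infty)$ is the subset of functions vanishing on $\{0\}\cup\{+\infty\}$ (as limits); superscript $+$ denotes the subset of positive elements. $C^1[0,\infty)$ is the set of bounded continuous functions on $[0,\infty)$ with bounded continuous first derivative. By convention any function on $A\subset\mathbb{R}$ is extended by $0$ to $\mathbb{R}\setminus A$, and likewise $p(\infty,n)=0$. $\langle\nu,f\rangle=\int_{(0,\infty)}f(x)\,\nu(dx)$. In integrals, $\int_a^b=\int_{(a,b]}$ and $\int_a^\infty=\int_{(a,\infty)}$. Parameters. $\alpha\in C^1(0,\infty)^+$. For each $x\in(0,\infty)$, $\{p(x,i):i\in\mathbb{N}\}$ is a probability distribution on $\mathbb{N}$, with $p(\cdot,i)\in C^1(0,\infty)^+$ for every $i\in\mathbb{N}$ and $\sup_{x>0}\sum_{i\ge1}i\,p(x,i)<\infty$. $G$ is a continuous probability distribution on $(0,\infty)$. For $\mu\in\mathfrak{D}(0,\infty)$ and $0\le y\le 1$, $A_\alpha(\mu,y)=\inf\{z\ge0:\langle\mu,\alpha1_{(0,z]}\rangle>\langle\mu,\alpha\rangle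 y\}$ with $\inf\emptyset=\infty$. $(\Omega,\mathscr{F},\mathscr{F}_t,\mathbf{P})$ is a filtered probability space satisfying the usual hypotheses. $E=(0,1]\times\mathbb{N}\times(0,\infty)^\infty$, with generic element $w=(y,n,z)$, $z=(z_1,z_2,\ldots)$. $M(dt,du,dw,dv)$ is an $(\mathscr{F}_t)$-Poisson random measure on $(0,\infty)^2\times E\times(0,1]$ with intensity $dt\,du\,K(dw)\,dv$, where $K(dw)=dy\,\pi(dn)\,G^\infty(dz)$, $\pi$ is the counting measure on $\mathbb{N}$ and $G^\infty$ is the infinite product measure of $G$ on $(0,\infty)^\infty$. $X_0$ is an $\mathscr{F}_0$-measurable random element of $\mathfrak{D}(0,\infty)$. $X_{s-}$ denotes the left limit at time $s$. For any initial value $X_0\in\mathfrak{D}(0,\infty)$ the equation has a pathwise unique strong solution with infinite lifetime.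
   Formalization: It is assumed that f ≥ 0 or that F is C^1 on the whole line (F extended by 0 fails for signed f); for random X_0 the process is shown to be a local martingale, and a martingale when E⟨X_0,1⟩ < ∞ (it may fail to be integrable otherwise). *)

(* Defs.v *)
From HB Require Import structures.
From mathcomp Require Import all_boot all_order all_algebra.
From mathcomp Require Import all_classical all_reals all_analysis.
From mathcomp Require Import measurable_realfun.

Set Implicit Arguments.
Unset Strict Implicit.
Unset Printing Implicit Defensive.

Import Order.TTheory GRing.Theory Num.Theory.
Import numFieldNormedType.Exports.

Local Open Scope classical_set_scope.
Local Open Scope ring_scope.

Section function_spaces.
Context {R : realType}.
Implicit Types (D : set R) (g : R -> R).

Definition bounded_continuous D g :=
  [bounded g x | x in D] /\ {within D, continuous g}.

(* [g'] is the derivative of [g] relative to [D]: two-sided at interior points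
   of [D], one-sided at an endpoint such as 0 in [0, +oo[. *)
Definition derivative_on D g (g' : R -> R) := forall x, D x ->
  h^-1 * (g (x + h) - g x) @[h --> within [set h | D (x + h)] (0 : R)^'] --> g' x.

(* g belongs to C^1(D), with derivative g'. *)
Definition C1_deriv D g (g' : R -> R) :=
  [/\ bounded_continuous D g, bounded_continuous D g' & derivative_on D g g'].

Definition C1 D g := exists g', C1_deriv D g g'.

Definition positive_on D g := forall x, D x -> 0 <= g x.

End function_spaces.

Section finite_measures.
Context {R : realType}.

(* Finite Borel measures on ]0, +oo[, as measures on the line that do not
   charge ]-oo, 0]. *)
Record posMeasure := PosMeasure {
  pos_measure :> {finite_measure set (measurableTypeR R) -> \bar R} ;
  pos_measure_le0 : pos_measure `]-oo, 0]%classic = 0%E }.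

Implicit Types (mu nu : posMeasure) (g : R -> R).

Definition dist_fun mu (x : R) : R := fine (mu `]0, x]%classic).

Definition pairing mu g : R := \int[mu]_(x in `]0, +oo[) g x.

(* Open sets of the weak convergence topology, that is, of the initial topology
   of the maps [pairing ^~ g] for g bounded continuous on ]0, +oo[. *)
Definition weak_open (U : set posMeasure) := forall mu, U mu ->
  exists (n : nat) (g : 'I_n -> R -> R) (e : R),
  [/\ 0 < e, forall i, bounded_continuous `]0, +oo[ (g i) &
      forall nu, (forall i, `|pairing nu (g i) - pairing mu (g i)| < e) -> U nu].

Definition weakly_right_continuous (Y : R -> posMeasure) := forall t g, 0 <= t ->
  bounded_continuous `]0, +oo[ g ->
  pairing (Y r) g @[r --> t^'+] --> pairing (Y t) g.

(* [mu] is the left limit of [Y] at [s].  The atoms move to the left at unit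
   speed and disappear on reaching 0, so that just before such a time mass
   accumulates at 0 and no limit exists in the weak topology of ]0, +oo[.  The
   limit is thus taken against the bounded continuous functions vanishing at 0;
   it is unique, and is the weak limit whenever the latter exists. *)
Definition left_limit (Y : R -> posMeasure) (s : R) (mu : posMeasure) :=
  forall g, bounded_continuous `]0, +oo[ g -> g x @[x --> 0^'+] --> 0 ->
  pairing (Y r) g @[r --> s^'-] --> pairing mu g.

End finite_measures.
Arguments posMeasure : clear implicits.

Section parameters.
Context {R : realType}.

Definition offspring_law (p : R -> nat -> R) :=
  [/\ forall i, C1 `]0, +oo[ (p ^~ i) /\ positive_on `]0, +oo[ (p ^~ i),
      forall x, 0 < x -> (\sum_(0 <= i <oo) (p x i)%:E = 1)%E &
      (ereal_sup [set \sum_(1 <= i <oo) (i%:R * p x i)%:E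
                  | x in (`]0%R, +oo[%classic : set R)] < +oo)%E].

(* p(., n) extended by 0 outside ]0, +oo[, and at +oo. *)
Definition extp (p : R -> nat -> R) (a : \bar R) (n : nat) : R :=
  if a is x%:E then if 0 < x then p x n else 0 else 0.

(* The value is +oo when the set is empty. *)
Definition A_ (alpha : R -> R) (mu : posMeasure R) (y : R) : \bar R :=
  ereal_inf [set z%:E | z in [set z : R | 0 <= z /\
    pairing mu alpha * y < pairing mu (fun x => alpha x * \1_`]0, z] x)]].

Definition continuous_law (G : probability (measurableTypeR R) R) :=
  G `]0, +oo[%classic = 1%E /\ forall x : R, G [set x] = 0%E.

End parameters.

Section marks.
Context {R : realType}.

Definition cylinder1 : set (set (nat -> R)) :=
  [set A | exists (i : nat) (B : set (measurableTypeR R)),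
     measurable B /\ A = [set z | B (z i)]].

(* Real sequences, with the product sigma-algebra; the coordinates z_1, z_2, ...
   are numbered from 0 here. *)
Definition seqT := g_sigma_algebraType cylinder1.

Definition posseq : set seqT := [set z | forall i : nat, 0 < z i].

Definition product_law (G : probability (measurableTypeR R) R)
    (Ginf : probability seqT R) :=
  forall (n : nat) (B : 'I_n -> set (measurableTypeR R)),
    (forall i, measurable (B i)) ->
    (Ginf [set z : seqT | forall i : 'I_n, B i (z i)] = \prod_(i < n) G (B i))%E.

(* w = (y, n, z) *)
Definition markT := (measurableTypeR R * nat * seqT)%type.

Definition E_ : set markT :=
  [set w | [/\ 0 < w.1.1, w.1.1 <= 1 & posseq w.2]].

(* (s, u, w, v) *)
Definition pointT :=
  (measurableTypeR R * measurableTypeR R * markT * measurableTypeR R)%type.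

Definition time_of (q : pointT) : R := q.1.1.1.

Definition point_domain : set pointT :=
  [set q | let: (s, u, w, v) := q in
    [/\ 0 < s, 0 < u, E_ w & 0 < v /\ v <= 1]].

(* ds du K(dw) dv with K(dw) = dy pi(dn) Ginf(dz), carried by ]0, +oo[ x
   ]0, +oo[ x E x ]0, 1]. *)
Definition intensity (Ginf : probability seqT R) (B : set pointT) : \bar R :=
  let leb := @lebesgue_measure R in
  (leb \x leb \x (leb \x @counting nat R \x Ginf) \x leb)%E (B `&` point_domain).

End marks.
Arguments seqT : clear implicits.
Arguments markT : clear implicits.
Arguments pointT : clear implicits.

Section filtered_space.
Context {R : realType} d {Omega : measurableType d} (P : probability Omega R).

(* Filtrations are indexed by [0, +oo[; the values at negative times are
   irrelevant. *)
Definition usual_filtration (Ft : R -> set (set Omega)) :=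
  [/\ forall t, 0 <= t -> sigma_algebra setT (Ft t) /\ Ft t `<=` measurable,
      forall s t, 0 <= s -> s <= t -> Ft s `<=` Ft t,
      forall t, 0 <= t -> \bigcap_(s in `]t, +oo[) Ft s = Ft t &
      forall N, P.-negligible N -> Ft 0 N].

Definition sub_measurable d' (T : measurableType d') (Ft : set (set Omega))
  (Y : Omega -> T) := forall B, measurable B -> Ft (Y @^-1` B).

(* Y = E[X | Ft], for a sub-sigma-algebra Ft. *)
Definition is_cond_exp (Ft : set (set Omega)) (X Y : Omega -> R) :=
  [/\ sub_measurable Ft (Y : Omega -> measurableTypeR R),
      P.-integrable setT (EFin \o Y) &
      forall A, Ft A -> (\int[P]_(w in A) (Y w)%:E = \int[P]_(w in A) (X w)%:E)%E].

Definition martingale (Ft : R -> set (set Omega)) (N : R -> Omega -> R) :=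
  (forall t, 0 <= t ->
     sub_measurable (Ft t) (N t : Omega -> measurableTypeR R) /\
     P.-integrable setT (EFin \o N t)) /\
  (forall s t, 0 <= s -> s <= t -> is_cond_exp (Ft s) (N t) (N s)).

Definition stopping_time (Ft : R -> set (set Omega)) (tau : Omega -> \bar R) :=
  (forall w, (0 <= tau w)%E) /\
  (forall t, 0 <= t -> Ft t [set w | (tau w <= t%:E)%E]).

Definition stopped (N : R -> Omega -> R) (tau : Omega -> \bar R) (t : R)
  (w : Omega) : R := N (fine (Order.min t%:E (tau w))) w.

Definition local_martingale (Ft : R -> set (set Omega)) (N : R -> Omega -> R) :=
  exists tau : nat -> Omega -> \bar R,
  [/\ forall k, stopping_time Ft (tau k),
      {ae P, forall w, nondecreasing_seq (tau ^~ w) /\ tau ^~ w @ \oo --> +oo%E} &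
      forall k, martingale Ft (stopped N (tau k))].

(* Random element of the space of finite measures on ]0, +oo[ with the Borel
   sigma-algebra of the weak topology. *)
Definition weakly_measurable (Ft : set (set Omega)) (Y : Omega -> posMeasure R) :=
  forall B, <<s weak_open >> B -> Ft (Y @^-1` B).

Section poisson_random_measure.
Context d' {T : measurableType d'}.
Implicit Type M : Omega -> {measure set T -> \bar R}.

(* The second argument of [poisson_prob] is a phantom. *)
Definition poisson_random_measure (m : set T -> \bar R) M :=
  [/\ forall B, measurable B -> measurable_fun setT ((fun w => M w B) : Omega -> \bar R),
      forall B, measurable B -> (m B < +oo)%E -> forall k : nat,
        P [set w | M w B = k%:R%:E] = poisson_prob (fine (m B)) 0 [set k] &
      forall (n : nat) (B : 'I_n -> set T) (C : 'I_n -> set (\bar R)),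
        (forall i, measurable (B i)) -> (forall i, measurable (C i)) ->
        trivIset setT B ->
        (P [set w | forall i, C i (M w (B i))] =
         \prod_(i < n) P [set w | C i (M w (B i))])%E].

(* The sigma-algebra generated by the values of M on the measurable subsets
   of D. *)
Definition sigma_of M (D : set T) : set (set Omega) :=
  <<s [set A | exists (B : set T) (C : set (\bar R)),
    [/\ measurable B, B `<=` D, measurable C & A = [set w | C (M w B)]]] >>.

(* M is adapted to Ft, and after each time t it is independent of Ft t;
   [time] is the time coordinate. *)
Definition filtered_poisson (time : T -> R) (Ft : R -> set (set Omega))
    (m : set T -> \bar R) M :=
  [/\ poisson_random_measure m M,
      forall t, 0 <= t -> sigma_of M [set q | time q <= t] `<=` Ft t &
      forall t, 0 <= t -> forall A B, Ft t A ->
        sigma_of M [set q | t < time q] B -> (P (A `&` B) = P A * P B)%E].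

End poisson_random_measure.

Section equation.
Variables (alpha : R -> R) (p : R -> nat -> R).

(* The domain of integration in the equation, [Xm s] standing for X_{s-}. *)
Definition birth_domain (Xm : R -> posMeasure R) (t : R) : set (pointT R) :=
  [set q | let: (s, u, (y, n, z), v) := q in
    [/\ 0 < s <= t, 0 < u <= pairing (Xm s) alpha, E_ (y, n, z) &
        0 < v <= extp p (A_ alpha (Xm s) y) n]].

Definition births (t x : R) (q : pointT R) : R :=
  let: (s, u, (y, n, z), v) := q in
  \sum_(i < n) \1_`]0, x] (z i - (t - s)).

Definition is_solution (Ft : R -> set (set Omega))
    (M : Omega -> {measure set (pointT R) -> \bar R})
    (X : R -> Omega -> posMeasure R) :=
  (forall t, 0 <= t -> weakly_measurable (Ft t) (X t)) /\
  {ae P, forall w, weakly_right_continuous (X ^~ w) /\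
     exists Xm : R -> posMeasure R,
       (forall s, 0 < s -> left_limit (X ^~ w) s (Xm s)) /\
       (forall t x, 0 <= t -> 0 < x ->
         ((dist_fun (X t w) x)%:E =
          (dist_fun (X 0 w) (x + t) - dist_fun (X 0 w) t)%:E +
          \int[M w]_(q in birth_domain Xm t) (births t x q)%:E)%E)}.

End equation.

End filtered_space.

Section generator.
Context {R : realType}.
Variables (alpha : R -> R) (p : R -> nat -> R) (Ginf : probability (seqT R) R).
Variables (f f' F F' : R -> R).

(* L_0 F_f (mu), where f' and F' are the derivatives of f and F. *)
Definition generator (mu : posMeasure R) : R :=
  - pairing mu f' * F' (pairing mu f) -
  \big[+%R/0]_(0 <= n <oo)
    pairing mu (fun y => alpha y * p y n *
      \int[Ginf]_(z in posseq)
        (F (pairing mu f) - F (pairing mu f + \sum_(i < n) f (z i)))).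

Definition mart_part (Omega : Type) (X : R -> Omega -> posMeasure R) (t : R)
    (w : Omega) : R :=
  F (pairing (X t w) f) - F (pairing (X 0 w) f) -
  \int[lebesgue_measure]_(s in `]0, t]) generator (X s w).

End generator.

(* Main.v *)
Require Import Defs.
From HB Require Import structures.
From mathcomp Require Import all_boot all_order all_algebra.
From mathcomp Require Import all_classical all_reals all_analysis.
From mathcomp Require Import measurable_realfun.
From mathcomp Require Import ring lra.

(** Up to time T the population is described by one finite measure L on the
    plane: an atom that is at x at time 0 is recorded as (0, x), and the i-th
    child of a birth at time s, with life length z_i, as (s, s + z_i), the pair of
    its birth and death times ([ancestral_measure]).  The equation says that
    X_t is the image under r |-> r - t of the part of L with s <= t < r
    ([transport_integral]), so that y_t = <X_t, f> is an integral against L.  A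
    path is thus a flow to the left at unit speed, interrupted by the births,
    which are points of the Poisson measure and come one at a time.  Between
    births y_t has right derivative - <X_t, f'>; at a birth it jumps by the sum of
    the f (z_i).  A continuity argument turns this into the change of variables

      F (y_t) = F (y_0) - int_0^t F' (y_s) <X_s, f'> ds
                        + sum over births (F (y_{s-} + sum_i f (z_i)) - F (y_{s-})),

    see [ito_formula] and [path_formula].  That the births with children are finitely
    many, counted by integers and never simultaneous comes from the Poisson measure
    ([ae_nat_valued], [ae_simple_times]) and from the moment bound below.

    The sum over births is an integral against the Poisson measure of a
    predictable integrand over a predictable domain ([measurable_birth_set]).
    Such an integral has the same mean as the one against the intensity
    ([poisson_compensation]), also on every event of the past, whence a martingale
    ([compensated_mean]).  For the births the compensator is computed with the law
    of the quantile A_alpha: under the uniform law of y the parent is drawn from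
    alpha mu / <mu, alpha> ([quantile_law], [compensator_formula]).  It is the
    integral of the second term of the generator, evaluated at the left limits
    X_{s-}; these are X_s for almost every s ([ae_left_limit]).  Since f vanishes at
    0, the left limit in the equation, which forgets the atoms dying at s, gives
    the correct value of y_{s-}.

    Integrability rests on [litter_moment]: if X_0 has finite mean mass on an event
    Theta of F_0, then so does the number of children born on Theta before t.
    It is a Gronwall estimate for the births that occur while the mass is below
    K, followed by K -> +oo; the mass is at most its initial value plus the number
    of children, which excludes explosion ([no_explosion]).  On the complement of
    Theta the process is multiplied by 0, and null sets are absorbed by the
    completeness of F_0.  The events where the mass of X_0 is at most k then give
    the localizing sequence, and Theta = Omega gives the second claim.

    When f >= 0, only the values of F on [0, +oo[ enter, and F is replaced by its
    extension to the line by reflection at (0, F 0), which is again C^1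
    ([C1_reflection]). *)

Set Implicit Arguments.
Unset Strict Implicit.
Unset Printing Implicit Defensive.

Import Order.TTheory GRing.Theory Num.Theory.
Import numFieldNormedType.Exports.

Local Open Scope classical_set_scope.
Local Open Scope ring_scope.


(** * Induction on nonnegative functions and bounded convergence *)

Section function_induction.
Import HBNNSimple.

(** The simple functions that approximate f from below are finite sums of
    multiples of indicators, and f is their increasing limit. This carries
    identities from sets to integrands. *)
Lemma ge0_measurable_fun_ind d (Z : measurableType d) (R : realType)
    (C : (Z -> \bar R) -> Prop) :
  (forall A, measurable A -> C (EFin \o \1_A)) ->
  (forall f g : Z -> \bar R, measurable_fun setT f -> measurable_fun setT g ->
    (forall z, 0 <= f z)%E -> (forall z, 0 <= g z)%E ->
    C f -> C g -> C (fun z => f z + g z)%E) ->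
  (forall (k : R) (f : Z -> \bar R), (0 <= k) -> measurable_fun setT f -> (forall z, 0 <= f z)%E ->
    C f -> C (fun z => k%:E * f z)%E) ->
  (forall (F : (Z -> \bar R)^nat) (f : Z -> \bar R), (forall n, measurable_fun setT (F n)) ->
    (forall n z, 0 <= F n z)%E ->
    (forall z, nondecreasing_seq (F ^~ z)) ->
    (forall z, F ^~ z @ \oo --> f z) -> (forall n, C (F n)) -> C f) ->
  forall f : Z -> \bar R, measurable_fun setT f -> (forall z, 0 <= f z)%E -> C f.
Proof.
move=> C1 CD CZ Clim f mf f0.
pose f_ := nnsfun_approx measurableT mf.
refine (Clim (fun n z => (f_ n z)%:E) f _ _ _ _ _).
- by move=> n; exact/measurable_EFinP.
- by move=> n z; rewrite lee_fin.
- by move=> z m n mn; rewrite lee_fin; exact/lefP/nd_nnsfun_approx.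
- by move=> z; exact: cvg_nnsfun_approx.
move=> n; set g := f_ n.
have -> : (fun z => (g z)%:E) =
   (fun z => \sum_(r <- finmap.enum_fset (fset_set (range g))) (Num.max r 0 * \1_(g @^-1` [set r]) z)%:E)%E.
  apply/funext => z; rewrite fimfunE fsbig_finite//= sumEFin; congr EFin.
  apply: eq_bigr => r _.
  have [r0|r0] := leP 0 r; first by [].
  by rewrite preimage_nnfun0// indic0 !mulr0.
have mi (r : R) : measurable (g @^-1` [set r]) by exact: measurable_funPTI.
elim: (finmap.enum_fset _) => [|r s IH].
  have -> : (fun z : Z => \sum_(r <- [::]) (Num.max r 0 * \1_(g @^-1` [set r]) z)%:E)%E
          = EFin \o \1_(set0 : set Z).
    by apply/funext => z; rewrite big_nil /= indic0.
  exact: C1.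
have -> : (fun z => \sum_(j <- r :: s) (Num.max j 0 * \1_(g @^-1` [set j]) z)%:E)%E =
  (fun z => (Num.max r 0)%:E * (EFin \o \1_(g @^-1` [set r])) z +
   \sum_(j <- s) (Num.max j 0 * \1_(g @^-1` [set j]) z)%:E)%E.
  by apply/funext => z; rewrite big_cons EFinM.
have m1 (j : R) : measurable_fun setT (EFin \o \1_(g @^-1` [set j]) : Z -> \bar R).
  by apply/measurable_EFinP; exact: measurable_indic.
have r0 j : 0 <= Num.max j 0 :> R by rewrite le_max lexx orbT.
apply: CD => //.
- by apply: measurable_funeM.
- apply: emeasurable_sum => j.
  by apply/measurable_EFinP; apply: measurable_funM => //; exact: measurable_indic.
- by move=> z; rewrite mule_ge0// ?lee_fin//= ?lee_fin.
- by move=> z; apply: sume_ge0 => j _; rewrite lee_fin mulr_ge0.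
apply: CZ => //; first by move=> z; rewrite lee_fin.
exact: C1.
Qed.

End function_induction.

Lemma cvg_bounded_Rintegral d (Z : measurableType d) (R : realType)
    (mu : {measure set Z -> \bar R}) (D : set Z) (C : R)
    (F : (Z -> R)^nat) (f : Z -> R) : measurable D -> (mu D < +oo)%E ->
  (forall n, measurable_fun D (F n)) -> (forall n z, D z -> `|F n z| <= C) ->
  (forall z, D z -> F ^~ z @ \oo --> f z) ->
  (\int[mu]_(z in D) F n z) @[n --> \oo] --> \int[mu]_(z in D) f z.
Proof.
move=> mD muD mF bF Ff.
have mf : measurable_fun D f by apply: measurable_fun_cvg mF Ff.
have [|||||] := @dominated_convergence _ Z R mu D mD (fun n z => (F n z)%:E)
    (fun z => (f z)%:E) (fun=> C%:E).
- by move=> n; exact/measurable_EFinP.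
- exact/measurable_EFinP.
- by apply/aeW => z Dz; apply: cvg_EFin; [exact: nearW|exact: Ff].
- apply: (measurable_bounded_integrable mD muD (f := cst C)); first exact: measurable_cst.
  by exists `|C|; split => // M CM z _ /=; exact: ltW.
- by apply/aeW => z n Dz; rewrite /= lee_fin; exact: bF.
move=> h1 _ h2.
by apply: fine_cvg; rewrite fineK//; exact: integrable_fin_num.
Qed.

(** One-sided limits are tested on sequences, which brings the claim back to
    dominated convergence. *)
Lemma cvg_at_left_bounded_Rintegral d (Z : measurableType d) (R : realType)
    (mu : {measure set Z -> \bar R}) (D : set Z) (C a t : R)
    (F : R -> Z -> R) (f : Z -> R) : a < t -> measurable D -> (mu D < +oo)%E ->
  (forall r, measurable_fun D (F r)) ->
  (forall r z, a < r < t -> D z -> `|F r z| <= C) ->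
  (forall z, D z -> F ^~ z r @[r --> t^'-] --> f z) ->
  (\int[mu]_(z in D) F r z) @[r --> t^'-] --> \int[mu]_(z in D) f z.
Proof.
move=> at_ mD muD mF bF Ff.
apply/cvg_at_leftP => u [ut uc].
have [N _ HN] : \forall n \near \oo, a < u n.
  by move/cvgrPdist_lt/(_ (t - a)): uc; rewrite subr_gt0 => /(_ at_);
    apply: filterS => n; rewrite ltr_distlC => /andP[]; rewrite opprB addrC subrK.
rewrite -(cvg_shiftn N) /=.
apply: (@cvg_bounded_Rintegral _ Z R mu D C (fun n => F (u (n + N)%N))) => //.
- by move=> n z Dz; apply: bF => //; rewrite ut HN//= leq_addl.
- move=> z Dz; rewrite (cvg_shiftn N (fun n => F (u n) z)).
  by move/cvg_at_leftP: (Ff z Dz); apply.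
Qed.

Lemma cvg_at_right_bounded_Rintegral d (Z : measurableType d) (R : realType)
    (mu : {measure set Z -> \bar R}) (D : set Z) (C b t : R)
    (F : R -> Z -> R) (f : Z -> R) : t < b -> measurable D -> (mu D < +oo)%E ->
  (forall r, measurable_fun D (F r)) ->
  (forall r z, t < r < b -> D z -> `|F r z| <= C) ->
  (forall z, D z -> F ^~ z r @[r --> t^'+] --> f z) ->
  (\int[mu]_(z in D) F r z) @[r --> t^'+] --> \int[mu]_(z in D) f z.
Proof.
move=> tb mD muD mF bF Ff.
apply/cvg_at_rightP => u [ut uc].
have [N _ HN] : \forall n \near \oo, u n < b.
  by move/cvgrPdist_lt/(_ (b - t)): uc; rewrite subr_gt0 => /(_ tb);
    apply: filterS => n; rewrite ltr_distlC => /andP[_]; rewrite addrC subrK.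
rewrite -(cvg_shiftn N) /=.
apply: (@cvg_bounded_Rintegral _ Z R mu D C (fun n => F (u (n + N)%N))) => //.
- by move=> n z Dz; apply: bF => //; rewrite ut HN//= leq_addl.
- move=> z Dz; rewrite (cvg_shiftn N (fun n => F (u n) z)).
  by move/cvg_at_rightP: (Ff z Dz); apply.
Qed.

(** * Poisson counts and filtrations *)

Section poisson_law.
Context {R : realType}.
Local Open Scope ereal_scope.

Lemma poisson_probE (r : R) k (j : nat) : poisson_prob r k [set j] =
  if (0 < r)%R then (poisson_pmf r j)%:E else (j == 0%N)%:R%:E.
Proof.
rewrite /poisson_prob; case: ifPn => r0.
  by rewrite esum_set1// lee_fin poisson_pmf_ge0.
rewrite diracE (_ : (0%N \in [set j]) = (j == 0%N))//.
by apply/idP/eqP => [|->]; rewrite inE.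
Qed.

Lemma poisson_prob_sum1 (r : R) k : \sum_(j <oo) poisson_prob r k [set j] = 1.
Proof.
have <- : poisson_prob r k setT = 1 by exact: probability_setT.
rewrite [in RHS](_ : setT = \bigcup_j [set j]); last first.
  by apply/seteqP; split => // j _; exists j.
by rewrite measure_semi_bigcup//; apply/trivIsetP => i j _ _ ij;
  apply/seteqP; split => // x [/= -> ]; exact/eqP.
Qed.

Lemma poisson_prob_mean (r : R) k : (0 <= r)%R ->
  \sum_(j <oo) j%:R%:E * poisson_prob r k [set j] = r%:E.
Proof.
move=> r0; rewrite nneseries_recl//; last by move=> j; rewrite mule_ge0// lee_fin.
rewrite mul0e add0e.
rewrite -(@nneseries_addn _ _ 1); last by move=> j; rewrite mule_ge0// lee_fin.
transitivity (\sum_(j <oo) r%:E * poisson_prob r k [set j]).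
  apply: eq_eseriesr => j _; rewrite !poisson_probE addn1.
  case: ifPn => rp; last first.
    by rewrite /= mule0 (_ : r = 0%R) ?mul0e//; apply/eqP; rewrite eq_le r0 leNgt rp.
  rewrite -!EFinM; congr EFin; rewrite /poisson_pmf rp exprS factS natrM.
  have : (j`!%:R != 0 :> R)%R by rewrite pnatr_eq0 -lt0n fact_gt0.
  have : (j.+1%:R != 0 :> R)%R by rewrite pnatr_eq0.
  by move: (j.+1%:R : R) (j`!%:R : R) => x y x0 y0; field; rewrite y0 x0.
by rewrite nneseriesZl// poisson_prob_sum1 mule1.
Qed.

(** By exp (- r) >= 1 - r. This quadratic bound is what makes simultaneous
    points negligible. *)
Lemma poisson_prob01 (r : R) k : (0 <= r)%R ->
  1 - poisson_prob r k [set 0%N] - poisson_prob r k [set 1%N] <= (r ^+ 2)%:E.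
Proof.
move=> r0; rewrite !poisson_probE; case: ifPn => rp; last first.
  by rewrite /= sube0 -EFinB subrr lee_fin sqr_ge0.
rewrite -!EFinB lee_fin /poisson_pmf rp expr0 expr1 fact0 invr1 !mulr1 mul1r.
have := @expR_ge1Dx R (- r); nra.
Qed.

End poisson_law.

Section filtration.
Context {R : realType} {d} {Omega : measurableType d} {P : probability Omega R}
  {Ft : R -> set (set Omega)}.
Hypothesis hFt : usual_filtration P Ft.

Lemma filt_measurable t A : 0 <= t -> Ft t A -> measurable A.
Proof. by case: hFt => h _ _ _ t0; apply: (h t t0).2. Qed.

Lemma filtS s t A : 0 <= s -> s <= t -> Ft s A -> Ft t A.
Proof. by case: hFt => _ h _ _ s0 st; apply: h. Qed.

Lemma filtC t A : 0 <= t -> Ft t A -> Ft t (~` A).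
Proof.
by case: hFt => h _ _ _ t0; case: (h t t0).1 => _ + _ => /[apply]; rewrite setTD.
Qed.

Lemma filt_bigcup t (A : (set Omega)^nat) : 0 <= t -> (forall n, Ft t (A n)) ->
  Ft t (\bigcup_n A n).
Proof. by case: hFt => h _ _ _ t0; case: (h t t0).1 => _ _; apply. Qed.

Lemma filt0 t : 0 <= t -> Ft t set0.
Proof. by case: hFt => h _ _ _ t0; case: (h t t0).1. Qed.

Lemma filtT t : 0 <= t -> Ft t setT.
Proof. by move=> t0; rewrite -setC0; apply: filtC => //; exact: filt0. Qed.

Lemma filtU t A B : 0 <= t -> Ft t A -> Ft t B -> Ft t (A `|` B).
Proof.
move=> t0 FA FB; rewrite -bigcup2E; apply: filt_bigcup => // -[|[|n]] //=.
exact: filt0.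
Qed.

Lemma filtI t A B : 0 <= t -> Ft t A -> Ft t B -> Ft t (A `&` B).
Proof.
move=> t0 FA FB; rewrite -(setCK (A `&` B)) setCI.
by apply: filtC => //; apply: filtU => //; exact: filtC.
Qed.

Lemma filt_negligible t A : 0 <= t -> P.-negligible A -> Ft t A.
Proof.
by case: hFt => _ _ _ h t0 nA; apply: (@filtS 0) => //; exact: h.
Qed.

Lemma filt_ae t (A : set Omega) : 0 <= t -> {ae P, forall w, A w} -> Ft t A.
Proof.
move=> t0 nA; rewrite -(setCK A).
by apply: filtC => //; exact: filt_negligible.
Qed.

(** The null sets are measurable, so the values off a set of full measure do not
    matter. *)
Lemma ae_measurable_fun_setT d' (T : measurableType d') (A : set Omega)
    (f : Omega -> T) : {ae P, forall w, A w} -> measurable_fun A f ->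
  measurable_fun setT f.
Proof.
move=> aeA mf _ B mB.
have mA : measurable A by exact: (filt_measurable (lexx _) (filt_ae (lexx _) aeA)).
rewrite setTI (_ : f @^-1` B = (A `&` f @^-1` B) `|` (~` A `&` f @^-1` B)).
  apply: measurableU; first exact: mf.
  apply: (filt_measurable (lexx 0)); apply: filt_negligible => //.
  by apply: negligibleS aeA => w [].
by rewrite -setIUl setUv setTI.
Qed.

End filtration.

Section counts.
Context {R : realType} {d} {Omega : measurableType d} {P : probability Omega R}
  {Ft : R -> set (set Omega)} {d'} {T : measurableType d'} {time : T -> R}
  {m : set T -> \bar R} {M : Omega -> {measure set T -> \bar R}}.
Hypothesis hFt : usual_filtration P Ft.
Hypothesis hM : filtered_poisson P time Ft m M.
Local Open Scope ereal_scope.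

Lemma measurable_count B : measurable B -> measurable_fun setT (fun w => M w B).
Proof. by case: hM => -[h _ _] _ _; exact: h. Qed.

Lemma measurable_count_eq B (c : \bar R) : measurable B ->
  measurable [set w | M w B = c].
Proof.
move=> mB; rewrite (_ : mkset _ = (fun w => M w B) @^-1` [set c])//.
by rewrite -[X in measurable X]setTI; exact: measurable_count.
Qed.

(** The Poisson probabilities of the integers add up to 1. *)
Lemma ae_count_nat B : measurable B -> m B < +oo ->
  {ae P, forall w, exists k : nat, M w B = k%:R%:E}.
Proof.
move=> mB fB; case: hM => -[_ hp _] _ _.
pose E := \bigcup_k [set w | M w B = k%:R%:E].
have mE : measurable E by apply: bigcup_measurable => k _; exact: measurable_count_eq.
exists (~` E); split => [|//|w]; first exact: measurableC.
- rewrite probability_setC//.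
  suff -> : P E = 1 by rewrite subee.
  rewrite measure_semi_bigcup//; first last.
  + by apply/trivIsetP => i j _ _ ij; apply/seteqP; split => // w [/= e0 e1];
      have [/eqP] := etrans (esym e0) e1; rewrite eqr_nat; exact/negP.
  + by move=> k; exact: measurable_count_eq.
  + by rewrite -[RHS](@poisson_prob_sum1 R (fine (m B)) 0); apply: eq_eseriesr => k _; exact: hp.
- by apply: contra_not => -[k _ /= Mk]; exists k.
Qed.

Lemma count_gt1_le B : measurable B -> m B < +oo -> 0 <= m B ->
  P [set w | 1 < M w B] <= m B * m B.
Proof.
move=> mB fB m0; case: (hM) => -[_ hp _] _ _.
have fmB : m B \is a fin_num by rewrite ge0_fin_numE.
pose E0 := [set w | M w B = 0%:R%:E]; pose E1 := [set w | M w B = 1%:R%:E].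
have mE0 : measurable E0 by exact: measurable_count_eq.
have mE1 : measurable E1 by exact: measurable_count_eq.
have m1 : measurable [set w | 1 < M w B].
  by rewrite -[X in measurable X]setTI; apply: emeasurable_fun_o_infty => //;
    exact: measurable_count.
apply: (@le_trans _ _ (P (~` (E0 `|` E1)))).
  apply: le_measure; rewrite ?inE//; first by apply: measurableC; exact: measurableU.
  by move=> w /= w1 [e|e]; move: w1; rewrite e ?lte_fin ?ltxx// ltr10.
rewrite probability_setC//; last exact: measurableU.
rewrite measureU//; last first.
  by apply/seteqP; split => // w [/= e0 e1]; have [/eqP] := etrans (esym e0) e1;
    rewrite eqr_nat.
rewrite [X in _ - (X + _)](_ : _ = poisson_prob (fine (m B)) 0 [set 0%N]); last exact: hp.
rewrite [X in _ - (_ + X)](_ : _ = poisson_prob (fine (m B)) 0 [set 1%N]); last exact: hp.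
rewrite -[m B in leRHS]fineK// -EFinM -expr2 oppeD; last first.
  by rewrite ge0_adde_def// inE.
rewrite addeA.
by apply: poisson_prob01; rewrite fine_ge0.
Qed.

(** After time r the measure M is independent of the events known at time r, and
    the mean of M(B) is m(B). *)
Lemma integral_count_past r A B : (0 <= r)%R -> Ft r A -> measurable B ->
  B `<=` [set q | (r < time q)%R] -> m B < +oo -> 0 <= m B ->
  \int[P]_(w in A) M w B = P A * m B.
Proof.
move=> r0 FA mB rB fB m0; case: (hM) => -[_ hp _] _ hind.
have mA := filt_measurable hFt r0 FA.
have fmB : m B \is a fin_num by rewrite ge0_fin_numE.
pose E k := [set w | M w B = k%:R%:E].
have mE k : measurable (E k) by exact: measurable_count_eq.
have mbE : measurable (\bigcup_k E k) by exact: bigcup_measurable.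
have mN : measurable_fun setT (fun w => M w B) by exact: measurable_count.
have tE : trivIset setT (fun k => A `&` E k).
  by apply/trivIsetP => i j _ _ ij; apply/seteqP; split => // w [[_ /= e0] [_ /= e1]];
    have [/eqP] := etrans (esym e0) e1; rewrite eqr_nat; exact/negP.
rewrite (@ge0_negligible_integral _ _ _ P A (~` \bigcup_k E k))//; first last.
- have [N [mN' N0 EN]] := ae_count_nat mB fB.
  apply/eqP; rewrite eq_le measure_ge0 andbT -N0; apply: le_measure; rewrite ?inE//.
    exact: measurableC.
  by move=> w nE; apply: EN => /= -[k Ek]; apply: nE; exists k.
- exact: measurable_funTS.
- exact: measurableC.
rewrite setDE setCK setI_bigcupr ge0_integral_bigcup//; first last.
- exact: measurable_funTS.
- by move=> k; exact: measurableI.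
transitivity (\sum_(k <oo) P A * (k%:R%:E * poisson_prob (fine (m B)) 0 [set k])).
  apply: eq_eseriesr => k _.
  rewrite (@eq_integral _ _ _ _ _ (cst k%:R%:E)); last by move=> w; rewrite inE => -[].
  rewrite integral_cst; last exact: measurableI.
  rewrite [X in _ * X](_ : _ = P A * poisson_prob (fine (m B)) 0 [set k]); first by rewrite muleCA.
  rewrite -hp//; apply: (hind r r0 A (E k)) => //.
  by apply: sub_gen_smallest; exists B, [set k%:R%:E]; split.
rewrite -[P A in LHS]fineK ?fin_num_measure//.
rewrite nneseriesZl; last by move=> k _; rewrite mule_ge0// lee_fin.
by rewrite poisson_prob_mean ?fine_ge0// !fineK ?fin_num_measure.
Qed.

End counts.

(** * Predictable integrands and their compensation *)

Section predictable.
Context {R : realType} {d} {Omega : measurableType d} {d'} {T : measurableType d'}.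
Variables (Ft : R -> set (set Omega)) (time : T -> R).

(** Rectangles A x B with A known at time r and B strictly after r; they
    generate the predictable sigma-algebra. The second factor is any space
    carrying a time coordinate, so that the same notion serves for times and for
    points. *)
Definition pred_gen : set (set (Omega * T)) :=
  [set S | exists (r : R) (A : set Omega) (B : set T),
    [/\ 0 <= r, Ft r A, measurable B, B `<=` [set q | r < time q] & S = A `*` B]].

Definition predT := g_sigma_algebraType pred_gen.

Definition pos_time : set T := [set q | 0 < time q].

End predictable.
Arguments predT {R d Omega d' T}.

Section predictable_theory.
Context {R : realType} {d} {Omega : measurableType d} {P : probability Omega R}
  {Ft : R -> set (set Omega)} {d'} {T : measurableType d'} {time : T -> R}.
Hypothesis hFt : usual_filtration P Ft.
Local Notation G := (pred_gen Ft time).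

Lemma pred_genI : setI_closed G.
Proof.
move=> _ _ [r [A [B [r0 FA mB rB ->]]]] [s [A' [B' [s0 FA' mB' sB' ->]]]].
exists (Num.max r s), (A `&` A'), (B `&` B'); split.
- by rewrite le_max r0.
- by apply: (filtI hFt); rewrite ?le_max ?r0//;
    [apply: (filtS hFt r0) FA|apply: (filtS hFt s0) FA']; rewrite le_max lexx ?orbT.
- exact: measurableI.
- by move=> q [/rB /= rq /sB' /= sq]; rewrite gt_max rq sq.
- by rewrite setXI.
Qed.

Lemma pred_gen_measurable : G `<=` measurable.
Proof.
move=> _ [r [A [B [r0 FA mB rB ->]]]].
by apply: measurableX => //; exact: (filt_measurable hFt r0 FA).
Qed.

Lemma pred_measurable (S : set (Omega * T)) : <<s G >> S -> measurable S.
Proof.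
by move: S; apply: smallest_sub;
  [exact: sigma_algebra_measurable|exact: pred_gen_measurable].
Qed.

Lemma pred_measurable_funT d'' (Y : measurableType d'') (H : Omega * T -> Y) :
  measurable_fun setT (H : predT Ft time -> Y) -> measurable_fun setT H.
Proof.
by move=> mH _ B mB; apply: pred_measurable; exact: mH.
Qed.

Lemma pred_section d'' (Y : measurableType d'') (H : Omega * T -> Y) w :
  measurable_fun setT (H : predT Ft time -> Y) ->
  measurable_fun setT (fun q => H (w, q)).
Proof.
move=> /pred_measurable_funT mH.
by apply: measurableT_comp => //; exact: measurable_pair1.
Qed.

Section kernels.
Variables (N N' : Omega -> {measure set T -> \bar R}) (Q : (set T)^nat).
Local Open Scope ereal_scope.
Hypothesis mQ : forall k, measurable (Q k).
Hypothesis ndQ : nondecreasing_seq Q.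
Hypothesis covQ : \bigcup_k Q k = pos_time time.
Hypothesis finN : forall k, {ae P, forall w, N w (Q k) < +oo}.
Hypothesis finN' : forall k, {ae P, forall w, N' w (Q k) < +oo}.
Hypothesis mN : forall B, measurable B -> measurable_fun setT (fun w => N w B).
Hypothesis mN' : forall B, measurable B -> measurable_fun setT (fun w => N' w B).
Hypothesis fint : forall k, \int[P]_w N w (Q k) < +oo.
Hypothesis eqN : forall r A B k, (0 <= r)%R -> Ft r A -> measurable B ->
  B `<=` [set q | (r < time q)%R] -> B `<=` Q k ->
  \int[P]_(w in A) N w B = \int[P]_(w in A) N' w B.

Let sec (L : Omega -> {measure set T -> \bar R}) k S w := L w (xsection S w `&` Q k).

Let Qpos k : Q k `<=` pos_time time.
Proof. by rewrite -covQ; exact: bigcup_sup. Qed.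

Let mpos : measurable (pos_time time).
Proof. by rewrite -covQ; exact: bigcup_measurable. Qed.

Let ae_meas_sec (L : Omega -> {measure set T -> \bar R}) k A B :
  (forall k, {ae P, forall w, L w (Q k) < +oo}) ->
  measurable A -> measurable B -> B `<=` A ->
  measurable_fun setT (sec L k A) -> measurable_fun setT (sec L k B) ->
  measurable_fun setT (sec L k (A `\` B)).
Proof.
move=> finL mA mB BA mLA mLB.
apply: (ae_measurable_fun_setT hFt (finL k)).
apply: (@eq_measurable_fun _ _ _ _ _ (fun w => sec L k A w - sec L k B w)).
  move=> w; rewrite inE => fw; rewrite /sec xsectionD//.
  have -> : (xsection A w `\` xsection B w) `&` Q k =
      (xsection A w `&` Q k) `\` (xsection B w `&` Q k).
    by rewrite predeqE => q; rewrite /setD /setI /=; tauto.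
  rewrite measureD//=.
  - congr (_ - L w _); apply/esym/setIidr.
    by apply: setSI; exact: le_xsection.
  - by apply: measurableI => //; exact: measurable_xsection.
  - by apply: measurableI => //; exact: measurable_xsection.
  - apply: le_lt_trans fw; apply: le_measure; rewrite ?inE//.
    by apply: measurableI => //; exact: measurable_xsection.
by apply: measurable_funTS; exact: emeasurable_funB.
Qed.

Let sec_nd (L : Omega -> {measure set T -> \bar R}) k (F : (set (Omega * T))^nat) w :
  nondecreasing_seq F -> (forall n, measurable (F n)) ->
  nondecreasing_seq (fun n => sec L k (F n) w) /\
  sec L k (F n) w @[n --> \oo] --> sec L k (\bigcup_n F n) w.
Proof.
move=> ndF mF; split.
  move=> i j ij; rewrite /sec; apply: le_measure; rewrite ?inE.
  - by apply: measurableI => //; exact: measurable_xsection.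
  - by apply: measurableI => //; exact: measurable_xsection.
  - by apply: setSI; apply: le_xsection; exact/subsetPset/ndF.
rewrite /sec xsection_bigcup setI_bigcupl.
apply: nondecreasing_cvg_mu.
- by move=> n; apply: measurableI => //; exact: measurable_xsection.
- by apply: bigcup_measurable => n _; apply: measurableI => //; exact: measurable_xsection.
- by move=> i j ij; apply/subsetPset; apply: setSI; apply: le_xsection; exact/subsetPset/ndF.
Qed.

(** The kernels agree on the generating rectangles. Cut down to Q k, which has
    finite mass, the sets on which they agree form a lambda-system. *)
Let kernel_sec k S : <<s G >> S ->
  [/\ measurable_fun setT (sec N k S), measurable_fun setT (sec N' k S) &
      \int[P]_w sec N k S w = \int[P]_w sec N' k S w].
Proof.
pose C := [set S : set (Omega * T) | measurable S /\
  [/\ measurable_fun setT (sec N k S), measurable_fun setT (sec N' k S) &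
      \int[P]_w sec N k S w = \int[P]_w sec N' k S w]].
suff : <<s G >> `<=` C by move=> h /h [].
have secT L : sec L k setT = fun w => L w (Q k).
  by apply/funext => w; rewrite /sec xsectionE preimage_setT setTI.
apply: lambda_system_subset => //.
- exact: pred_genI.
- split => //.
  + split => //; rewrite !secT; split; [exact: mN|exact: mN'|].
    by apply: (@eqN 0%R setT (Q k) k) => //; exact: (filtT hFt).
  + move=> A B BA [mA [mNA mN'A eA]] [mB [mNB mN'B eB]]; split; first exact: measurableD.
    have m1 : measurable_fun setT (sec N k (A `\` B)) by exact: ae_meas_sec.
    have m2 : measurable_fun setT (sec N' k (A `\` B)) by exact: ae_meas_sec.
    split => //.
    have dec L w : sec L k A w = sec L k (A `\` B) w + sec L k B w.
      rewrite /sec -measureU.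
      - congr (L w _); rewrite xsectionD; have BxA : xsection B w `<=` xsection A w by exact: le_xsection.
        apply/seteqP; split => q.
          move=> [qA qQ]; have [qB|qB] := pselect (xsection B w q); first by right.
          by left.
        by move=> [[[]]|[/BxA]].
      - by apply: measurableI => //; apply: measurable_xsection; exact: measurableD.
      - by apply: measurableI => //; exact: measurable_xsection.
      - by rewrite xsectionD; apply/seteqP; split => // x [[[_ nB] _] [Bx _]].
    move: eA; under eq_integral do rewrite dec.
    under [in RHS]eq_integral do rewrite dec.
    rewrite ge0_integralD// ge0_integralD// eB.
    suff fB : \int[P]_w sec N' k B w \is a fin_num.
      by move=> /(congr1 (fun x => x - \int[P]_w sec N' k B w)); rewrite !addeK.
    rewrite -eB ge0_fin_numE ?integral_ge0//.
    apply: le_lt_trans (fint k); apply: ge0_le_integral => //; first exact: mN.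
    by move=> w _; apply: le_measure; rewrite ?inE//; apply: measurableI => //;
      exact: measurable_xsection.
  + move=> F ndF CF.
    have mF n : measurable (F n) by case: (CF n).
    have mbF : measurable (\bigcup_n F n) by exact: bigcup_measurable.
    split => //; split.
    * apply: (@emeasurable_fun_cvg _ _ _ _ (fun n => sec N k (F n))) => //.
        by move=> n; case: (CF n) => _ [].
      by move=> w _; apply: (sec_nd N k w ndF mF).2.
    * apply: (@emeasurable_fun_cvg _ _ _ _ (fun n => sec N' k (F n))) => //.
        by move=> n; case: (CF n) => _ [].
      by move=> w _; apply: (sec_nd N' k w ndF mF).2.
    * have lim L : (forall n, measurable_fun setT (sec L k (F n))) ->
        \int[P]_w sec L k (F n) w @[n --> \oo] --> \int[P]_w sec L k (\bigcup_n F n) w.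
        move=> mL; under eq_integral do rewrite -(cvg_lim _ (sec_nd L k _ ndF mF).2)//.
        apply: cvg_monotone_convergence => //.
        by move=> w _ i j; apply: (sec_nd L k w ndF mF).1.
      apply: (cvg_unique _ (lim N _)) => //=; first by move=> n; case: (CF n) => _ [].
      rewrite (_ : (fun n => _) = (fun n => \int[P]_w sec N' k (F n) w)); last first.
        by apply/funext => n; case: (CF n) => _ [].
      by apply: lim => n; case: (CF n) => _ [].
- move=> _ [r [A [B [r0 FA mB rB ->]]]].
  have mA := filt_measurable hFt r0 FA.
  have secX L : sec L k (A `*` B) = ((fun w => L w (B `&` Q k)) \_ A).
    apply/funext => w; rewrite /sec patchE; case: ifPn => wA.
      by rewrite in_xsectionX.
    by rewrite notin_xsectionX// set0I measure0.
  have mBQ : measurable (B `&` Q k) by exact: measurableI.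
  split; first exact: measurableX.
  rewrite !secX; split.
  + by apply/(measurable_restrictT _ mA).1; apply: measurable_funTS; exact: mN.
  + by apply/(measurable_restrictT _ mA).1; apply: measurable_funTS; exact: mN'.
  + rewrite -!integral_mkcond; apply: (@eqN r _ _ k) => //.
    by move=> q [/rB].
Qed.

Let inner (L : Omega -> {measure set T -> \bar R}) (H : Omega * T -> \bar R) w :=
  \int[L w]_(q in pos_time time) H (w, q).

(** From sets to integrands, the sets Q k exhausting the positive times. *)
Lemma pred_kernel_eq (H : Omega * T -> \bar R) :
  measurable_fun setT (H : predT Ft time -> \bar R) -> (forall z, 0 <= H z) ->
  [/\ measurable_fun setT (fun w => \int[N w]_(q in pos_time time) H (w, q)),
      measurable_fun setT (fun w => \int[N' w]_(q in pos_time time) H (w, q)) &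
   \int[P]_w \int[N w]_(q in pos_time time) H (w, q) =
   \int[P]_w \int[N' w]_(q in pos_time time) H (w, q)].
Proof.
pose C (H : predT Ft time -> \bar R) := [/\ measurable_fun setT (inner N H),
  measurable_fun setT (inner N' H) & \int[P]_w inner N H w = \int[P]_w inner N' H w].
have inner_ge0 L K w : (forall z, 0 <= K z) -> 0 <= inner L K w.
  by move=> K0; apply: integral_ge0.
move: H; apply: (@ge0_measurable_fun_ind _ (predT Ft time) R C).
- move=> S mS.
  have mS' : measurable (S : set (Omega * T)) by exact: pred_measurable.
  have innerE L w : inner L (EFin \o \1_S) w = L w (xsection S w `&` pos_time time).
    rewrite /inner (eq_integral (fun q => (\1_(xsection S w) q)%:E)); last first.
      by move=> q _ /=; rewrite !indicE mem_xsection.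
    by rewrite integral_indic//; exact: measurable_xsection.
  have cvgL L w : nondecreasing_seq (fun k => sec L k S w) /\
      sec L k S w @[k --> \oo] --> inner L (EFin \o \1_S) w.
    rewrite innerE -covQ setI_bigcupr; split.
      move=> i j ij; apply: le_measure; rewrite ?inE.
      - by apply: measurableI => //; exact: measurable_xsection.
      - by apply: measurableI => //; exact: measurable_xsection.
      - by apply: setIS; exact/subsetPset/ndQ.
    apply: nondecreasing_cvg_mu.
    + by move=> n; apply: measurableI => //; exact: measurable_xsection.
    + by apply: bigcup_measurable => n _; apply: measurableI => //; exact: measurable_xsection.
    + by move=> i j ij; apply/subsetPset; apply: setIS; exact/subsetPset/ndQ.
  have lim L : (forall k, measurable_fun setT (sec L k S)) ->
      \int[P]_w sec L k S w @[k --> \oo] --> \int[P]_w inner L (EFin \o \1_S) w.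
    move=> mL; under eq_integral do rewrite -(cvg_lim _ (cvgL L _).2)//.
    apply: cvg_monotone_convergence => //.
    by move=> w _ i j; apply: (cvgL L w).1.
  split.
  + apply: (@emeasurable_fun_cvg _ _ _ _ (fun k => sec N k S)) => //.
      by move=> k; case: (kernel_sec k mS).
    by move=> w _; apply: (cvgL N w).2.
  + apply: (@emeasurable_fun_cvg _ _ _ _ (fun k => sec N' k S)) => //.
      by move=> k; case: (kernel_sec k mS).
    by move=> w _; apply: (cvgL N' w).2.
  + apply: (cvg_unique _ (lim N _)) => //=; first by move=> k; case: (kernel_sec k mS).
    rewrite (_ : (fun k => _) = (fun k => \int[P]_w sec N' k S w)); last first.
      by apply/funext => k; case: (kernel_sec k mS).
    by apply: lim => k; case: (kernel_sec k mS).
- move=> f g mf mg f0 g0 [mNf mN'f ef] [mNg mN'g eg].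
  have innerD L w : inner L (fun z => f z + g z) w = inner L f w + inner L g w.
    by rewrite /inner ge0_integralD//; apply: measurable_funTS; exact: pred_section.
  rewrite /C (_ : inner N _ = fun w => inner N f w + inner N g w); last exact/funext.
  rewrite (_ : inner N' _ = fun w => inner N' f w + inner N' g w); last exact/funext.
  split; [exact: emeasurable_funD|exact: emeasurable_funD|].
  have intD L : measurable_fun setT (inner L f) -> measurable_fun setT (inner L g) ->
      \int[P]_w (inner L f w + inner L g w) = \int[P]_w inner L f w + \int[P]_w inner L g w.
    by move=> mLf mLg; apply: ge0_integralD => // w _; exact: inner_ge0.
  by rewrite (intD N)// (intD N')// ef eg.
- move=> c f c0 mf f0 [mNf mN'f ef].
  have innerZ L w : inner L (fun z => c%:E * f z) w = c%:E * inner L f w.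
    by rewrite /inner ge0_integralZl_EFin//; apply: measurable_funTS; exact: pred_section.
  rewrite /C (_ : inner N _ = fun w => c%:E * inner N f w); last exact/funext.
  rewrite (_ : inner N' _ = fun w => c%:E * inner N' f w); last exact/funext.
  split; [exact: measurable_funeM|exact: measurable_funeM|].
  have intZ L : measurable_fun setT (inner L f) ->
      \int[P]_w (c%:E * inner L f w) = c%:E * \int[P]_w inner L f w.
    by move=> mLf; apply: ge0_integralZl_EFin => // w _; exact: inner_ge0.
  by rewrite (intZ N)// (intZ N')// ef.
- move=> F f mF F0 ndF Ff CF.
  have cvgL L w : nondecreasing_seq (fun n => inner L (F n) w) /\
      inner L (F n) w @[n --> \oo] --> inner L f w.
    split.
      move=> i j ij; apply: ge0_le_integral => //; try by
        apply: measurable_funTS; exact: pred_section.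
      by move=> q _; exact: ndF.
    rewrite /inner; under eq_integral do rewrite -(cvg_lim _ (Ff _))//.
    apply: cvg_monotone_convergence => //.
    by move=> n; apply: measurable_funTS; exact: pred_section.
  have lim L : (forall n, measurable_fun setT (inner L (F n))) ->
      \int[P]_w inner L (F n) w @[n --> \oo] --> \int[P]_w inner L f w.
    move=> mL; under eq_integral do rewrite -(cvg_lim _ (cvgL L _).2)//.
    apply: cvg_monotone_convergence => //.
      by move=> n w _; exact: inner_ge0.
    by move=> w _ i j; apply: (cvgL L w).1.
  split.
  + apply: (@emeasurable_fun_cvg _ _ _ _ (fun n => inner N (F n))) => //.
      by move=> n; case: (CF n).
    by move=> w _; apply: (cvgL N w).2.
  + apply: (@emeasurable_fun_cvg _ _ _ _ (fun n => inner N' (F n))) => //.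
      by move=> n; case: (CF n).
    by move=> w _; apply: (cvgL N' w).2.
  + apply: (cvg_unique _ (lim N _)) => //=; first by move=> n; case: (CF n).
    rewrite (_ : (fun n => _) = (fun n => \int[P]_w inner N' (F n) w)); last first.
      by apply/funext => n; case: (CF n).
    by apply: lim => n; case: (CF n).
Qed.

End kernels.
End predictable_theory.

Section compensation.
Context {R : realType} {d} {Omega : measurableType d} {P : probability Omega R}
  {Ft : R -> set (set Omega)} {d'} {T : measurableType d'} {time : T -> R}
  {m : {measure set T -> \bar R}} {M : Omega -> {measure set T -> \bar R}}.
Hypothesis hFt : usual_filtration P Ft.
Hypothesis hM : filtered_poisson P time Ft m M.
Variable Q : (set T)^nat.
Hypothesis mQ : forall k, measurable (Q k).
Hypothesis ndQ : nondecreasing_seq Q.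
Hypothesis covQ : \bigcup_k Q k = pos_time time.
Local Open Scope ereal_scope.
Hypothesis finQ : forall k, m (Q k) < +oo.

(** The random measure and its intensity are two kernels that have equal means
    on the predictable rectangles, by independence of the future from the past. *)
Theorem poisson_compensation (H : Omega * T -> \bar R) :
  measurable_fun setT (H : predT Ft time -> \bar R) -> (forall z, 0 <= H z) ->
  [/\ measurable_fun setT (fun w => \int[M w]_(q in pos_time time) H (w, q)),
      measurable_fun setT (fun w => \int[m]_(q in pos_time time) H (w, q)) &
   \int[P]_w \int[M w]_(q in pos_time time) H (w, q) =
   \int[P]_w \int[m]_(q in pos_time time) H (w, q)].
Proof.
apply: (@pred_kernel_eq _ _ _ P Ft _ _ time hFt M (fun=> m) Q) => //.
- move=> k; apply: filterS (ae_count_nat hM (mQ k) (finQ k)) => w [n ->].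
  exact: ltry.
- by move=> k; exact/aeW.
- exact: (measurable_count hM).
- move=> k; rewrite (integral_count_past hFt hM (r := 0%R))//.
  + by rewrite probability_setT mul1e.
  + exact: (filtT hFt).
  + by rewrite -[X in _ `<=` X]covQ; exact: bigcup_sup.
- move=> r A B k r0 FA mB rB BQ; rewrite (integral_count_past hFt hM r0)//; last first.
    apply: le_lt_trans (finQ k); apply: le_measure; rewrite ?inE//.
  by rewrite /= integral_cst; [exact: muleC|exact: (filt_measurable hFt r0 FA)].
Qed.

End compensation.

(** * The space of points and its intensity *)

Section sigma_finite_product.
Context {d1 d2} {T1 : measurableType d1} {T2 : measurableType d2} {R : realType}.
Variables (m1 : {sigma_finite_measure set T1 -> \bar R})
          (m2 : {sigma_finite_measure set T2 -> \bar R}).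
Local Open Scope ereal_scope.

Lemma product_sigma_finite : sigma_finite setT (m1 \x m2).
Proof.
have /sigma_finiteP[F [TF ndF Foo]] := sigma_finiteT m1.
have /sigma_finiteP[G [TG ndG Goo]] := sigma_finiteT m2.
exists (fun n => F n `*` G n).
 rewrite -setXTT TF TG predeqE => -[x y]; split.
    move=> [/= [n _ Fnx] [k _ Gky]]; exists (maxn n k) => //; split.
    - by move: x Fnx; exact/subsetPset/ndF/leq_maxl.
    - by move: y Gky; exact/subsetPset/ndG/leq_maxr.
  by move=> [n _ []/= ? ?]; split; exists n.
move=> k; have [? ?] := Foo k; have [? ?] := Goo k.
split; first exact: measurableX.
by rewrite product_measure1E// lte_mul_pinfty// ge0_fin_numE.
Qed.

(** The product packed with the proof of its sigma-finiteness, so that products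
    can be iterated. *)
Definition sfprod : {sigma_finite_measure set (T1 * T2)%type -> \bar R} :=
  HB.pack (m1 \x m2) (Measure_isSigmaFinite.Build _ _ _ (m1 \x m2) product_sigma_finite).

Lemma sfprodE : sfprod = m1 \x m2 :> (set (T1 * T2) -> \bar R).
Proof. by []. Qed.

Lemma integral_sfprod (f : T1 * T2 -> \bar R) : measurable_fun setT f ->
  (forall z, 0 <= f z) ->
  \int[sfprod]_z f z = \int[m1]_x \int[m2]_y f (x, y).
Proof. by move=> mf f0; exact: fubini_tonelli1. Qed.

End sigma_finite_product.

Section six_fold_product.
Context {d1 d2 d3 d4 d5 d6} {T1 : measurableType d1} {T2 : measurableType d2}
  {T3 : measurableType d3} {T4 : measurableType d4} {T5 : measurableType d5}
  {T6 : measurableType d6} {R : realType}.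
Variables (m1 : {sigma_finite_measure set T1 -> \bar R})
  (m2 : {sigma_finite_measure set T2 -> \bar R})
  (m3 : {sigma_finite_measure set T3 -> \bar R})
  (m4 : {sigma_finite_measure set T4 -> \bar R})
  (m5 : {sigma_finite_measure set T5 -> \bar R})
  (m6 : {sigma_finite_measure set T6 -> \bar R}).
Local Open Scope ereal_scope.

Lemma integral_sfprod6 (f : T1 * T2 * (T3 * T4 * T5) * T6 -> \bar R) :
  measurable_fun setT f -> (forall z, 0 <= f z) ->
  \int[sfprod (sfprod (sfprod m1 m2) (sfprod (sfprod m3 m4) m5)) m6]_q f q =
  \int[m1]_a \int[m2]_b \int[m3]_c \int[m4]_e \int[m5]_g \int[m6]_h f ((a, b), ((c, e), g), h).
Proof.
move=> mf f0.
rewrite integral_sfprod//.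
pose f1 q := \int[m6]_v f (q, v).
have mf1 : measurable_fun setT f1 by exact: measurable_fun_fubini_tonelli_F.
have f10 q : 0 <= f1 q by exact: integral_ge0.
apply: etrans (integral_sfprod _ _ mf1 f10) _.
pose f2 p := \int[sfprod (sfprod m3 m4) m5]_w f1 (p, w).
have mf2 : measurable_fun setT f2 by exact: measurable_fun_fubini_tonelli_F.
have f20 q : 0 <= f2 q by exact: integral_ge0.
apply: etrans (integral_sfprod _ _ mf2 f20) _.
apply: eq_integral => s _; apply: eq_integral => u _.
have mf1su : measurable_fun setT (fun w => f1 ((s, u), w)).
  by apply: measurableT_comp => //; exact: measurable_pair1.
apply: etrans (integral_sfprod _ _ mf1su _) _; first by move=> z; exact: f10.
pose f3 p := \int[m5]_z f1 ((s, u), (p, z)).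
have mf3 : measurable_fun setT f3.
  exact: (@measurable_fun_fubini_tonelli_F _ _ _ _ _ m5 (fun w => f1 ((s, u), w))).
have f30 q : 0 <= f3 q by exact: integral_ge0.
exact: (integral_sfprod _ _ mf3 f30).
Qed.

End six_fold_product.

Section point_space.
Context {R : realType}.
Variable Ginf : probability (seqT R) R.
Local Notation leb := (@lebesgue_measure R).
Local Notation RT := (measurableTypeR R).
Local Notation c := (HB.pack_for {sigma_finite_measure set nat -> \bar R} (@counting nat R)
  (@Measure_isSigmaFinite.Build _ _ _ (@counting nat R) (sigma_finite_counting R))).
Definition sfcounting : {sigma_finite_measure set nat -> \bar R} := c.

Definition point_measure : {sigma_finite_measure set (pointT R) -> \bar R} :=
  sfprod (sfprod (sfprod leb leb) (sfprod (sfprod leb sfcounting) Ginf)) leb.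

Local Open Scope ereal_scope.

Lemma integral_point_measure (f : pointT R -> \bar R) : measurable_fun setT f ->
  (forall z, 0 <= f z) ->
  \int[point_measure]_q f q = \int[leb]_s \int[leb]_u \int[leb]_y
    \sum_(n <oo) \int[Ginf]_z \int[leb]_v f ((s, u), ((y, n), z), v).
Proof.
move=> mf f0; apply: etrans (integral_sfprod6 _ _ _ _ _ _ mf f0) _.
apply: eq_integral => s _; apply: eq_integral => u _; apply: eq_integral => y _.
by apply: ge0_integral_count => n; do 2 apply: integral_ge0 => ? _; exact: f0.
Qed.

Lemma integral_mrestr d (T : measurableType d) (mu : {measure set T -> \bar R}) (D : set T)
    (mD : measurable D) (f : T -> \bar R) :
  measurable_fun setT f -> (forall x, 0 <= f x) ->
  \int[mrestr mu mD]_x f x = \int[mu]_(x in D) f x.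
Proof.
move: f; apply: ge0_measurable_fun_ind.
- by move=> A mA; rewrite !integral_indic//= setIT.
- move=> f g mf mg f0 g0 ef eg; transitivity (\int[mrestr mu mD]_x f x + \int[mrestr mu mD]_x g x).
    exact: ge0_integralD.
  by rewrite ef eg; apply/esym/ge0_integralD => //; exact: measurable_funTS.
- move=> k f k0 mf f0 ef; transitivity (k%:E * \int[mrestr mu mD]_x f x); first exact: ge0_integralZl_EFin.
  by rewrite ef; apply/esym/ge0_integralZl_EFin => //; exact: measurable_funTS.
- move=> F f mF F0 ndF Ff eF.
  have -> : f = fun x => limn (F ^~ x) by apply/funext => x; rewrite (cvg_lim _ (Ff x)).
  have e1 : \int[mrestr mu mD]_x limn (F ^~ x) = limn (fun n => \int[mrestr mu mD]_x F n x).
    exact: monotone_convergence.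
  have e2 : \int[mu]_(x in D) limn (F ^~ x) = limn (fun n => \int[mu]_(x in D) F n x).
    by apply: monotone_convergence => // n; exact: measurable_funTS.
  apply: (etrans e1); apply: (etrans _ (esym e2)).
  by congr (limn _); apply/funext => n; exact: eF.
Qed.

Let mcomp d (T1 : measurableType d) d' (T2 : measurableType d') (f : T1 -> T2) (B : set T2) :
  measurable_fun setT f -> measurable B -> measurable (f @^-1` B).
Proof. by move=> mf mB; rewrite -[X in measurable X]setTI; exact: mf. Qed.

Definition life_of (q : pointT R) : R := q.1.1.2.
Definition mark_of (q : pointT R) : R := q.1.2.1.1.
Definition litter_of (q : pointT R) : nat := q.1.2.1.2.
Definition lives_of (q : pointT R) : seqT R := q.1.2.2.
Definition level_of (q : pointT R) : R := q.2.

Lemma measurable_time_of : measurable_fun setT (@time_of R : pointT R -> RT).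
Proof.
exact: (measurableT_comp measurable_fst (measurableT_comp measurable_fst measurable_fst)).
Qed.

Lemma measurable_life_of : measurable_fun setT (life_of : pointT R -> RT).
Proof.
exact: (measurableT_comp measurable_snd (measurableT_comp measurable_fst measurable_fst)).
Qed.

Lemma measurable_mark_of : measurable_fun setT (mark_of : pointT R -> RT).
Proof.
exact: (measurableT_comp measurable_fst (measurableT_comp measurable_fst
  (measurableT_comp measurable_snd measurable_fst))).
Qed.

Lemma measurable_litter_of : measurable_fun setT (litter_of : pointT R -> nat).
Proof.
exact: (measurableT_comp measurable_snd (measurableT_comp measurable_fst
  (measurableT_comp measurable_snd measurable_fst))).
Qed.

Lemma measurable_lives_of : measurable_fun setT (lives_of : pointT R -> seqT R).
Proof.
exact: (measurableT_comp measurable_snd (measurableT_comp measurable_snd measurable_fst)).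
Qed.

Lemma measurable_level_of : measurable_fun setT (level_of : pointT R -> RT).
Proof. exact: measurable_snd. Qed.

Lemma measurable_coord (i : nat) : measurable_fun setT ((fun z => z i) : seqT R -> RT).
Proof.
move=> _ B mB; rewrite setTI; apply: sub_sigma_algebra.
by exists i, B.
Qed.

Lemma measurable_posseq : measurable (@posseq R).
Proof.
rewrite (_ : posseq = \bigcap_i ((fun z : seqT R => z i) @^-1` `]0%R, +oo[)); last first.
  apply/seteqP; split => z h i; first by move=> _ /=; rewrite in_itv/= andbT; exact: h.
  by have := h i Logic.I; rewrite /= in_itv/= andbT.
by apply: bigcapT_measurable => i; apply: mcomp => //; exact: measurable_coord.
Qed.

Lemma point_domainE : @point_domain R =
  @time_of R @^-1` `]0%R, +oo[ `&` life_of @^-1` `]0%R, +oo[ `&`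
  mark_of @^-1` `]0%R, 1%R] `&` lives_of @^-1` @posseq R `&` level_of @^-1` `]0%R, 1%R].
Proof.
apply/seteqP; split => -[[[s u] [[y n] z]] v] /=.
  by move=> [s0 u0 [/= y0 y1 pz] [v0 v1]]; rewrite !in_itv/= s0 u0 y0 y1 v0 v1.
rewrite /time_of/life_of/mark_of/level_of/= !in_itv/= !andbT.
by move=> [[[[-> ->] /andP[y0 y1]] pz] /andP[v0 v1]].
Qed.

Lemma measurable_point_domain : measurable (@point_domain R).
Proof.
rewrite point_domainE; repeat apply: measurableI; apply: mcomp => //.
- exact: measurable_time_of.
- exact: measurable_life_of.
- exact: measurable_mark_of.
- exact: measurable_lives_of.
- exact: measurable_posseq.
- exact: measurable_level_of.
Qed.

(** Convertible to [intensity Ginf]: a Poisson measure for the one is a Poisson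
    measure for the other. *)
Definition intensity_measure : {measure set (pointT R) -> \bar R} :=
  mrestr point_measure measurable_point_domain.

(** Sets of finite intensity that increase to the set of all points at positive
    times. The points outside [point_domain] carry no intensity; they are
    included for the sake of this union. *)
Definition window (k : nat) : set (pointT R) :=
  @time_of R @^-1` `]0%R, +oo[ `&` (~` @point_domain R `|`
   (@time_of R @^-1` `]-oo, k%:R] `&` life_of @^-1` `]-oo, k%:R] `&` litter_of @^-1` `I_k.+1)).

Lemma measurable_window k : measurable (window k).
Proof.
apply: measurableI; first by apply: mcomp => //; exact: measurable_time_of.
apply: measurableU; first by apply: measurableC; exact: measurable_point_domain.
repeat apply: measurableI; apply: mcomp => //.
- exact: measurable_time_of.
- exact: measurable_life_of.
- exact: measurable_litter_of.
Qed.

Lemma nd_window : nondecreasing_seq window.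
Proof.
move=> i j ij; apply/subsetPset => q [s0 h]; split => //; case: h => [nd|[[h1 h2] h3]].
  by left.
right; move: h1 h2 h3; rewrite /= !in_itv/= => h1 h2 h3; split; first split.
- by rewrite (le_trans h1)// ler_nat.
- by rewrite (le_trans h2)// ler_nat.
- exact: (leq_trans h3).
Qed.

Lemma bigcup_window : \bigcup_k window k = pos_time (@time_of R).
Proof.
apply/seteqP; split => q; first by move=> [k _ [/= + _]]; rewrite in_itv/= andbT.
move=> q0; pose k := maxn (maxn (Num.truncn (time_of q)).+1 (Num.truncn (life_of q)).+1) (litter_of q).
exists k => //; split; first by rewrite /= in_itv/= q0.
right; split; first split; rewrite /= ?in_itv/=.
- by apply/ltW/(lt_le_trans (truncnS_gt _)); rewrite ler_nat !leq_max leqnn.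
- by apply/ltW/(lt_le_trans (truncnS_gt _)); rewrite ler_nat !leq_max leqnn orbT.
- by rewrite ltnS !leq_max leqnn orbT.
Qed.

(** In the window the life coordinate is confined to a length k and the litter
    to k + 1 values; the remaining coordinates have total mass at most 1. *)
Lemma intensity_window_le k (a b : R) : (a <= b)%R ->
  intensity_measure (@time_of R @^-1` `]a, b] `&` window k) <=
  ((b - a) * (k%:R * k.+1%:R))%:E.
Proof.
move=> ab; rewrite /intensity_measure/= /mrestr.
pose box : set (pointT R) :=
  (`]a, b]%classic `*` `]0%R, k%:R]%classic) `*`
  ((`]0%R, 1%R]%classic `*` `I_k.+1) `*` setT) `*` `]0%R, 1%R]%classic.
have m1 : measurable (`]a, b]%classic `*` `]0%R, k%:R]%classic : set (RT * RT)).
  exact: measurableX.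
have m2 : measurable (`]0%R, 1%R]%classic `*` `I_k.+1 : set (RT * nat)).
  exact: measurableX.
have m3 : measurable ((`]0%R, 1%R]%classic `*` `I_k.+1) `*` setT : set (RT * nat * seqT R)).
  exact: measurableX.
have mbox : measurable box by repeat apply: measurableX.
apply: (@le_trans _ _ (point_measure box)).
  apply: le_measure; rewrite ?inE//.
    apply: measurableI; last exact: measurable_point_domain.
    apply: measurableI; last exact: measurable_window.
    by apply: mcomp => //; exact: measurable_time_of.
  move=> q; rewrite point_domainE => -[[sab [s0 h]]] D.
  have {h} [[h1 h2] h3] : ((@time_of R @^-1` `]-oo, k%:R] `&` life_of @^-1` `]-oo, k%:R]) `&` litter_of @^-1` `I_k.+1) q.
    by case: h => //; rewrite point_domainE.
  case: D => -[[[_ u0] y01] z0] v01.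
  move: u0 h2; rewrite /= !in_itv/= andbT => u0 h2.
  repeat split => //=; rewrite in_itv/=.
  by apply/andP; split; [exact: u0|exact: h2].
rewrite /point_measure sfprodE product_measure1E; [|exact: measurableX|by []].
rewrite [X in X * _]product_measure1E//.
rewrite [X in X * _ * _]product_measure1E//.
rewrite [X in _ * X * _]product_measure1E//.
rewrite [X in _ * (X * _) * _]product_measure1E//.
rewrite [X in _ * (_ * X) * _](_ : _ = 1); last exact: probability_setT.
rewrite (_ : sfcounting _ = k.+1%:R%:E); last first.
  by rewrite /sfcounting/= /counting asboolT// (@card_fset_set _ _ k.+1)//; exact: card_eqxx.
have L (x y : R) : (x <= y)%R -> leb `]x, y]%classic = (y - x)%:E.
  move=> xy; apply: etrans (lebesgue_measure_itv _) _ => /=; rewrite lte_fin.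
  by case: ltP => // yx; congr EFin; apply/esym/eqP; rewrite subr_eq0 eq_le yx.
rewrite [X in X * _ * _ * _](_ : _ = (b - a)%:E); last exact: L.
rewrite [X in _ * X * _ * _](_ : _ = k%:R%:E); last by apply: etrans (L _ _ _) _; rewrite ?subr0.
rewrite [X in _ * _ * (X * _ * _) * _](_ : _ = 1); last by apply: etrans (L _ _ _) _; rewrite ?subr0.
rewrite [X in _ * _ * _ * X](_ : _ = 1); last by apply: etrans (L _ _ _) _; rewrite ?subr0.
by rewrite !mule1 mul1e -!EFinM mulrA lee_fin.
Qed.

Lemma intensity_window_fin k : intensity_measure (window k) < +oo.
Proof.
apply: (@le_lt_trans _ _ (intensity_measure (@time_of R @^-1` `]0%R, k%:R] `&` window k))).
  apply: (le_measure point_measure); rewrite ?inE.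
  - by apply: measurableI; [exact: measurable_window|exact: measurable_point_domain].
  - apply: measurableI; last exact: measurable_point_domain.
    apply: measurableI; last exact: measurable_window.
    by apply: mcomp => //; exact: measurable_time_of.
  - move=> q [[s0 h] D]; split=> //; split=> //; case: h => [//|[[h1 _] _]].
    move: s0 h1; rewrite /= !in_itv/= andbT => s0 h1.
    by apply/andP.
apply: le_lt_trans (intensity_window_le _ _) _; first exact: ler0n.
exact: ltry.
Qed.

End point_space.

(** * Integer-valued measures *)

Section countably_generated.

(** Used to make the Poisson measure integer-valued on all measurable sets
    simultaneously, outside a single null set. *)
Definition countably_generated d (T : measurableType d) :=
  exists (I : countType) (g : I -> set T),
    (forall i, measurable (g i)) /\ (@measurable _ T) `<=` <<s range g >>.

Lemma countably_generated_nat : countably_generated nat.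
Proof.
exists nat, (fun n => [set n]); split => // A _.
rewrite (_ : A = \bigcup_(n in A) [set n]); last first.
  by apply/seteqP; split => [n An|n [k Ak /= ->]//]; exists n.
rewrite bigcup_mkcond; apply: sigma_algebra_bigcup => n.
by case: ifPn => _; [apply: sub_sigma_algebra; exists n|exact: sigma_algebra0].
Qed.

Lemma countably_generated_real (R : realType) : countably_generated (measurableTypeR R).
Proof.
pose g (ab : rat * rat) : set (measurableTypeR R) := `]ratr ab.1, ratr ab.2[%classic.
exists (rat * rat)%type, g; split; first by move=> ab; exact: measurable_itv.
have -> : @measurable _ (measurableTypeR R) = <<s @RGenOpens.G R >> by exact: RGenOpens.measurableE.
apply: smallest_sub; first exact: smallest_sigma_algebra.
move=> _ [x0 [y0 ->]]; set U := `]x0, y0[%classic; have oU : open U by exact: interval_open.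
rewrite (_ : U = \bigcup_n (if unpickle n is Some ab then
    if `[< g ab `<=` U >] then g ab else set0 else set0)); last first.
  apply/seteqP; split => x; last first.
    by move=> [n _]; case: (unpickle n) => // ab; case: asboolP => // gU /gU.
  move=> Ux.
  have /(filterI (@nbhs_right_gt R 0)) /filter_ex[r [/= r0 rU]] := open_itvoo_subset oU Ux.
  have [p] := @rat_in_itvoo R (x - r) x ltac:(by rewrite gtrBl).
  have [q] := @rat_in_itvoo R x (x + r) ltac:(by rewrite ltrDl).
  rewrite !in_itv/= => /andP[xq qr] /andP[rp px].
  have [n nE] : exists n, unpickle n = Some (p, q) by exists (pickle (p, q)); exact: pickleK.
  exists n => //; rewrite nE asboolT; first by rewrite /g/= in_itv/= px xq.
  by move=> y; rewrite /g/= in_itv/= => /andP[py yq]; apply: rU;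
    rewrite /= in_itv/= (lt_trans rp py) (lt_trans yq qr).
apply: sigma_algebra_bigcup => n.
case: (unpickle n) => [ab|]; last exact: sigma_algebra0.
by case: asboolP => _; [apply: sub_sigma_algebra; exists ab|exact: sigma_algebra0].
Qed.

Lemma sub_g_preimage {aT rT : Type} (f : aT -> rT) (S : set (set aT)) (G : set (set rT)) :
  (forall B, G B -> <<s S >> (f @^-1` B)) ->
  forall B, <<s G >> B -> <<s S >> (f @^-1` B).
Proof.
move=> GS; apply: smallest_sub; last exact: GS.
split => [|A|F] /=.
- by rewrite preimage_set0; exact: sigma_algebra0.
- by rewrite setTD preimage_setC => /sigma_algebraCD; rewrite setTD.
- by move=> SF; rewrite preimage_bigcup; exact: sigma_algebra_bigcup.
Qed.

Lemma countably_generated_prod d1 (T1 : measurableType d1) d2 (T2 : measurableType d2) :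
  countably_generated T1 -> countably_generated T2 -> countably_generated (T1 * T2)%type.
Proof.
move=> [I [g [mg sg]]] [J [h [mh sh]]].
pose k (x : I + J) : set (T1 * T2) :=
  match x with inl i => fst @^-1` g i | inr j => snd @^-1` h j end.
exists (I + J)%type, k; split.
  by case=> i; rewrite /k -[X in measurable X]setTI; [exact: measurable_fst|exact: measurable_snd].
rewrite measurable_prod_measurableType.
apply: smallest_sub; first exact: smallest_sigma_algebra.
move=> _ [A mA [B mB <-]].
rewrite (_ : A `*` B = fst @^-1` A `&` snd @^-1` B)//.
have FA : <<s range k >> (fst @^-1` A).
  apply: (@sub_g_preimage _ _ _ _ (range g)); last exact: sg.
  by move=> _ [i _ <-]; apply: sub_sigma_algebra; exists (inl i).
have FB : <<s range k >> (snd @^-1` B).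
  apply: (@sub_g_preimage _ _ _ _ (range h)); last exact: sh.
  by move=> _ [i _ <-]; apply: sub_sigma_algebra; exists (inr i).
exact: (@measurableI _ (g_sigma_algebraType (range k)) _ _ FA FB).
Qed.

Lemma countably_generated_seqT (R : realType) : countably_generated (seqT R).
Proof.
have [I [g [mg sg]]] := countably_generated_real R.
pose k (x : nat * I) : set (seqT R) := (fun z : seqT R => z x.1) @^-1` g x.2.
exists (nat * I)%type, k; split.
  move=> [n i]; rewrite /k -[X in measurable X]setTI.
  by apply: measurable_coord => //; exact: mg.
apply: smallest_sub; first exact: smallest_sigma_algebra.
move=> _ [n [B [mB ->]]].
apply: (@sub_g_preimage _ _ (fun z : seqT R => z n) _ (range g)); last exact: sg.
by move=> _ [i _ <-]; apply: sub_sigma_algebra; exists (n, i).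
Qed.

Lemma countably_generated_point (R : realType) : countably_generated (pointT R).
Proof.
by repeat apply: countably_generated_prod; try exact: countably_generated_real;
  [exact: countably_generated_nat|exact: countably_generated_seqT].
Qed.

End countably_generated.

Section integer_valued.
Context {R : realType} {d} {T : measurableType d}.
Local Open Scope ereal_scope.

Definition nat_valued (x : \bar R) := exists k : nat, x = k%:R%:E.

(** A convergent sequence of integers is eventually constant. *)
Lemma nat_valued_cvg (u : (\bar R)^nat) l : (forall n, nat_valued (u n)) ->
  u @ \oo --> l -> l < +oo -> nat_valued l.
Proof.
move=> /choice[k uE] ul lfin.
have ln : l \is a fin_num.
  rewrite ge0_fin_numE// -(cvg_lim _ ul)//; apply: lime_ge; first by apply/cvg_ex; exists l.
  by apply: nearW => n; rewrite uE lee_fin.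
have kl : (k n)%:R @[n --> \oo] --> fine l.
  move: ul; rewrite -(fineK ln) => /fine_cvgP[_].
  by rewrite (_ : fine \o u = (fun n => (k n)%:R))//; apply/funext => n /=; rewrite uE.
have /cvgrPdist_lt/(_ (1/2)%R) := kl; rewrite divr_gt0// => /(_ isT)[N _ HN].
exists (k N); rewrite -[LHS]fineK//; congr EFin.
have kN n : k (n + N)%N = k N.
  have := HN _ (leqnn N); have /= := HN (n + N)%N (leq_addl _ _).
  rewrite !ltr_norml => /andP[h1 h2] /andP[h3 h4].
  by apply/eqP; rewrite eqn_leq; apply/andP; split; rewrite -ltnS -(ltr_nat R) -natr1; lra.
move: kl; rewrite -(cvg_shiftn N); under eq_fun do rewrite kN.
by move=> /cvg_lim <-//; exact: lim_cst.
Qed.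

(** Inside Q, which has finite mass, differences and increasing limits preserve
    integrality: the sets of integer mass form a lambda-system. *)
Lemma nat_valued_measure (mu : {measure set T -> \bar R}) (Q : set T) (G : set (set T)) :
  measurable Q -> nat_valued (mu Q) -> G `<=` measurable -> setI_closed G ->
  measurable `<=` <<s G >> ->
  (forall A, G A -> nat_valued (mu (A `&` Q))) ->
  forall A, measurable A -> nat_valued (mu (A `&` Q)).
Proof.
move=> mQ [N QN] Gm GI mG GQ A mA.
suff : <<s G >> `<=` [set A | measurable A /\ nat_valued (mu (A `&` Q))].
  by move=> /(_ A (mG _ mA)) [].
have finI B : measurable B -> mu (B `&` Q) < +oo.
  move=> mB; apply: (@le_lt_trans _ _ (mu Q)); last by rewrite QN ltry.
  by apply: le_measure; rewrite ?inE//; exact: measurableI.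
apply: lambda_system_subset => //; last by move=> B GB; split; [exact: Gm|exact: GQ].
split => //.
- by split => //; rewrite setTI; exists N.
- move=> B C CB [mB [i Bi]] [mC [j Cj]]; split; first exact: measurableD.
  exists (i - j)%N.
  have -> : (B `\` C) `&` Q = (B `&` Q) `\` (C `&` Q).
    by rewrite predeqE => q; rewrite /setD /setI /=; tauto.
  rewrite measureD//; [|exact: measurableI|exact: measurableI|exact: finI].
  have -> : B `&` Q `&` (C `&` Q) = C `&` Q by apply: setIidr; exact: setSI.
  have : mu (C `&` Q) <= mu (B `&` Q).
    by apply: le_measure; rewrite ?inE//; [exact: measurableI|exact: measurableI|exact: setSI].
  rewrite Bi Cj lee_fin ler_nat => ji.
  rewrite [X in X - _](_ : _ = i%:R%:E); last exact: Bi.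
  rewrite [X in _ - X](_ : _ = j%:R%:E); last exact: Cj.
  by rewrite -EFinB natrB.
- move=> F ndF HF; have mF n : measurable (F n) by case: (HF n).
  have mU : measurable (\bigcup_n F n) by exact: bigcup_measurable.
  split => //.
  apply: (@nat_valued_cvg (fun n => mu (F n `&` Q))); last exact: finI.
    by move=> n; case: (HF n).
  rewrite setI_bigcupl; apply: nondecreasing_cvg_mu.
  + by move=> n; exact: measurableI.
  + by apply: bigcup_measurable => n _; exact: measurableI.
  + by move=> i j ij; apply/subsetPset; apply: setSI; exact/subsetPset/ndF.
Qed.

(** Every level set of f has mass 0 or 1; the constant is the supremum of the
    levels r such that f < r has mass 0. *)
Lemma zero_one_ae_cst (mu : {measure set T -> \bar R}) (f : T -> R) :
  measurable_fun setT f -> mu setT = 1 ->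
  (forall A, measurable A -> mu A = 0 \/ mu A = 1) ->
  exists c : R, {ae mu, forall x, f x = c}.
Proof.
move=> mf mu1 mu01.
have mlt r : measurable [set x | (f x < r)%R].
  rewrite (_ : mkset _ = f @^-1` `]-oo, r[); last by apply/seteqP; split => x; rewrite /= in_itv.
  by rewrite -[X in measurable X]setTI; exact: mf.
have mge r : measurable [set x | (r <= f x)%R].
  rewrite (_ : mkset _ = f @^-1` `[r, +oo[); last by apply/seteqP; split => x; rewrite /= in_itv/= andbT.
  by rewrite -[X in measurable X]setTI; exact: mf.
have compl0 A : measurable A -> mu A = 1 -> mu (~` A) = 0.
  move=> mA e.
  have : mu (A `|` ~` A) = mu A + mu (~` A).
    by apply: measureU => //; [exact: measurableC|exact: setICr].
  rewrite setUv mu1 e; case: (mu (~` A)) => [r [h]| |] //; congr EFin; lra.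
have bigcup0 (F : (set T)^nat) : (forall n, measurable (F n)) -> (forall n, mu (F n) = 0) ->
    mu (\bigcup_n F n) = 0.
  move=> mF F0; apply/negligibleP; first exact: bigcup_measurable.
  by apply: negligible_bigcup => n; apply/negligibleP; [exact: mF|exact: F0].
have ltgeC r : mu [set x | (f x < r)%R] = 1 -> mu [set x | (r <= f x)%R] = 0.
  move=> e; rewrite (_ : mkset _ = ~` [set x | (f x < r)%R]); first exact: compl0.
  by apply/seteqP; split => x /=; rewrite leNgt => /negP.
have exge : exists n : nat, mu [set x | (- n%:R <= f x)%R] = 1.
  apply: contrapT => /forallNP h.
  have : mu setT = 0.
    rewrite (_ : setT = \bigcup_n [set x | (- n%:R <= f x)%R]); last first.
      apply/seteqP; split => x // _; exists (Num.truncn (- f x)).+1 => //=.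
      by rewrite lerNl; exact/ltW/truncnS_gt.
    by apply: bigcup0 => // n; case: (mu01 _ (mge (- n%:R)%R)) => // /h.
  by rewrite mu1 => -[] /eqP; rewrite oner_eq0.
have exlt : exists n : nat, mu [set x | (f x < n%:R)%R] = 1.
  apply: contrapT => /forallNP h.
  have : mu setT = 0.
    rewrite (_ : setT = \bigcup_n [set x | (f x < n%:R)%R]); last first.
      apply/seteqP; split => x // _; exists (Num.truncn (f x)).+1 => //=.
      exact: truncnS_gt.
    by apply: bigcup0 => // n; case: (mu01 _ (mlt n%:R)) => // /h.
  by rewrite mu1 => -[] /eqP; rewrite oner_eq0.
pose S := [set r | mu [set x | (f x < r)%R] = 0].
have ubS : has_ubound S.
  have [n hn] := exlt; exists n%:R => r Sr; rewrite leNgt; apply/negP => nr.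
  have : 1 <= mu [set x | (f x < r)%R].
    rewrite -hn; apply: le_measure; rewrite ?inE// => x /= xn; exact: lt_trans nr.
  by rewrite Sr lee_fin ler10.
have S0 : S !=set0.
  have [n hn] := exge; exists (- n%:R)%R; rewrite /S/=.
  rewrite (_ : mkset _ = ~` [set x | (- n%:R <= f x)%R]); first exact: compl0.
  by apply/seteqP; split => x /=; rewrite ltNge => /negP.
pose c := sup S.
have below n : mu [set x | (f x < c - n.+1%:R^-1)%R] = 0.
  have [r Sr rc] := @sup_adherent R S n.+1%:R^-1 ltac:(by rewrite invr_gt0) (conj S0 ubS).
  apply/eqP; rewrite eq_le measure_ge0 andbT -Sr; apply: le_measure; rewrite ?inE//.
  by move=> x /= /lt_trans; apply.
have above n : mu [set x | (c + n.+1%:R^-1 <= f x)%R] = 0.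
  apply: ltgeC; case: (mu01 _ (mlt (c + n.+1%:R^-1)%R)) => // h.
  have : (c + n.+1%:R^-1 <= c)%R by apply: ub_le_sup.
  by rewrite gerDl leNgt invr_gt0 ltr0n.
exists c; exists (\bigcup_n ([set x | (f x < c - n.+1%:R^-1)%R] `|` [set x | (c + n.+1%:R^-1 <= f x)%R])); split.
- by apply: bigcup_measurable => n _; exact: measurableU.
- apply: bigcup0 => n; first exact: measurableU.
  by rewrite measureU0.
move=> x /= /eqP; rewrite neq_lt => /orP[fc|cf].
  exists (Num.truncn (c - f x)^-1) => //; left => /=.
  rewrite ltrBrDl -ltrBrDr; rewrite -[ltRHS]invrK ltf_pV2 ?posrE ?invr_gt0 ?subr_gt0//.
  exact: truncnS_gt.
exists (Num.truncn (f x - c)^-1) => //; right => /=.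
rewrite -lerBrDl -[leRHS]invrK lef_pV2 ?posrE ?invr_gt0 ?subr_gt0//.
exact/ltW/truncnS_gt.
Qed.

End integer_valued.

(** * Regularity of the Poisson measure *)

Section count_structure.
Context {R : realType} {d} {Omega : measurableType d} {P : probability Omega R}
  {Ft : R -> set (set Omega)} {d'} {T : measurableType d'} {time : T -> R}
  {m : {measure set T -> \bar R}} {M : Omega -> {measure set T -> \bar R}}.
Hypothesis hM : filtered_poisson P time Ft m M.
Variable Q : set T.
Hypothesis mQ : measurable Q.
Local Open Scope ereal_scope.
Hypothesis finQ : m Q < +oo.

(** The finite intersections of countably many generators are a countable pi-
    system; one null set serves for all its members, and [nat_valued_measure]
    does the rest. *)
Lemma ae_nat_valued : countably_generated T ->
  {ae P, forall w, forall B, measurable B -> nat_valued (M w (B `&` Q))}.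
Proof.
move=> [I [g [mg sg]]].
pose G (s : seq I) := \big[setI/setT]_(i <- s) g i.
have mG s : measurable (G s) by apply: bigsetI_measurable.
have GI : setI_closed (range G).
  by move=> _ _ [s _ <-] [t _ <-]; exists (s ++ t) => //; rewrite /G big_cat.
have sG : measurable `<=` <<s range G >>.
  apply: (subset_trans sg); apply: sub_sigma_algebra2.
  by move=> _ [i _ <-]; exists [:: i] => //; rewrite /G big_seq1.
have mB B : measurable B -> m (B `&` Q) < +oo.
  move=> mB; apply: le_lt_trans finQ; apply: le_measure; rewrite ?inE//.
  exact: measurableI.
have h1 : {ae P, forall w, forall n, nat_valued (M w (odflt setT (omap G (unpickle n)) `&` Q))}.
  apply: ae_foralln => n.
  have mO : measurable (odflt setT (omap G (unpickle n))).
    by case: (unpickle n) => [s|]//=; exact: mG.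
  by apply: (ae_count_nat hM); [exact: measurableI|exact: mB].
have h2 : {ae P, forall w, nat_valued (M w Q)} by exact: (ae_count_nat hM).
apply: filterS2 h1 h2 => w h1 h2 B measB.
apply: (@nat_valued_measure _ _ _ (M w) Q (range G)) => //.
  by move=> _ [s _ <-]; exact: mG.
move=> _ [s _ <-]; have := h1 (pickle s).
by rewrite pickleK.
Qed.

(** Cut the times into cells of length 1 / j. A cell has intensity O(1 / j),
    hence contains two points with probability O(1 / j^2), and the number of
    cells is O(j). *)
Lemma ae_simple_times (K : nat) (c : R) : (0 <= c)%R -> measurable_fun setT time ->
  (forall a b : R, (a <= b)%R -> m (time @^-1` `]a, b] `&` Q) <= ((b - a) * c)%:E) ->
  Q `<=` time @^-1` `]0%R, K%:R] ->
  {ae P, forall w, forall s : R, M w (time @^-1` [set s] `&` Q) <= 1}.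
Proof.
move=> c0 mt mc QK.
have mpre A : measurable A -> measurable (time @^-1` A).
  by move=> mA; rewrite -[X in measurable X]setTI; exact: mt.
pose cell (j i : nat) := time @^-1` `](i%:R / j.+1%:R)%R, (i.+1%:R / j.+1%:R)%R] `&` Q.
have mcell j i : measurable (cell j i) by apply: measurableI => //; exact: mpre.
pose A j i := [set w | 1 < M w (cell j i)].
have mA j i : measurable (A j i).
  rewrite -[X in measurable X]setTI; apply: emeasurable_fun_o_infty => //.
  exact: (measurable_count hM).
pose E j := \big[setU/set0]_(i < K * j.+1) A j i.
have mE j : measurable (E j) by apply: bigsetU_measurable.
have PE j : P (E j) <= (K%:R * c ^+ 2 / j.+1%:R)%:E.
  apply: le_trans (Boole_inequality _ _) _; first by move=> i _.
  apply: (@le_trans _ _ (\sum_(i < K * j.+1) ((c / j.+1%:R) ^+ 2)%:E)).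
    apply: lee_sum => i _.
    have mcl : m (cell j i) <= (c / j.+1%:R)%:E.
      apply: le_trans (mc _ _ _) _; first by rewrite ler_pM2r ?invr_gt0// ler_nat.
      by rewrite lee_fin -mulrBl -natrB// subSnn mul1r mulrC.
    apply: le_trans (count_gt1_le hM (mcell j i) _ _) _ => //.
      exact: le_lt_trans mcl (ltry _).
    by rewrite expr2 EFinM; apply: lee_pmul.
  rewrite sumEFin lee_fin sumr_const card_ord -[X in (X <= _)%R]mulr_natr natrM expr_div_n.
  have : (j.+1%:R != 0 :> R)%R by rewrite pnatr_eq0.
  by move: (j.+1%:R : R) => x x0; rewrite le_eqVlt; apply/orP; left; apply/eqP; field.
exists (\bigcap_j E j); split.
- exact: bigcapT_measurable.
- apply/eqP; rewrite eq_le measure_ge0 andbT; apply/lee_addgt0Pr => e e0; rewrite add0e.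
  pose j := Num.truncn (K%:R * c ^+ 2 / e)%R.
  apply: (@le_trans _ _ (P (E j))).
    by apply: le_measure; rewrite ?inE//; [exact: bigcapT_measurable|exact: bigcap_inf].
  apply: le_trans (PE j) _; rewrite lee_fin ler_pdivrMr ?ltr0n// [X in (_ <= X)%R]mulrC -ler_pdivrMr//.
  exact/ltW/truncnS_gt.
- move=> w /existsNP[s /negP]; rewrite -ltNge => s1 j _.
  have sK : (0 < s <= K%:R)%R.
    apply: contrapT => sK.
    have e : time @^-1` [set s] `&` Q = set0.
      by apply/seteqP; split => // q [/= e' /QK]; rewrite /= in_itv/= e' => h; apply: sK; rewrite h.
    by move: s1; rewrite e measure0 lte_fin ltr10.
  move/andP: sK => [s0 sK].
  (* the cell that contains s *)
  have [i iK /andP[is_ si]] : exists2 i : nat, (i < K * j.+1)%N &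
      ((i%:R / j.+1%:R)%R < s <= (i.+1%:R / j.+1%:R))%R.
    have ex : exists i, (s * j.+1%:R <= i.+1%:R)%R.
      by exists (Num.truncn (s * j.+1%:R)%R); exact/ltW/truncnS_gt.
    have j0 : (0 < j.+1%:R :> R)%R by rewrite ltr0n.
    case: (ex_minnP ex) => -[|i] si imin.
      exists 0%N; last by rewrite mul0r s0 ler_pdivlMr.
      rewrite muln_gt0 andbT lt0n; apply/eqP => K0.
      by move: (lt_le_trans s0 sK); rewrite K0 ltxx.
    have si' : (i.+1%:R < s * j.+1%:R)%R.
      by rewrite ltNge; apply/negP => /imin; rewrite ltnn.
    exists i.+1; last by rewrite ltr_pdivrMr// ler_pdivlMr// si'.
    by rewrite -(ltr_nat R) natrM; apply: (lt_le_trans si'); rewrite ler_pM2r.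
  rewrite /E -bigcup_mkord; exists i => //=.
  apply: (lt_le_trans s1); apply: le_measure; rewrite ?inE//.
    by apply: measurableI => //; exact: mpre.
  by move=> q [/= e Qq]; split => //=; rewrite in_itv/= e is_ si.
Qed.

End count_structure.

(** * Finite measures on the half-line and their pairings *)

Section density_measure.
Context {R : realType} {d} {T : measurableType d}.
Variables (mu : {measure set T -> \bar R}) (f : T -> R).
Hypothesis mf : measurable_fun setT f.
Hypothesis f0 : forall x, 0 <= f x.
Local Open Scope ereal_scope.

Let dens (A : set T) : \bar R := \int[mu]_(x in A) (f x)%:E.

Let dens0 : dens set0 = 0. Proof. exact: integral_set0. Qed.

Let dens_ge0 A : 0 <= dens A. Proof. by apply: integral_ge0 => x _; rewrite lee_fin. Qed.

Let dens_sigma : semi_sigma_additive dens.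
Proof.
move=> F mF tF mUF.
rewrite /dens ge0_integral_bigcup//; first last.
- by move=> x _; rewrite lee_fin.
- by apply/measurable_EFinP; exact: measurable_funTS.
by apply: is_cvg_ereal_nneg_natsum => n _; apply: integral_ge0 => x _; rewrite lee_fin.
Qed.

Definition density_measure : {measure set T -> \bar R} :=
  HB.pack dens (isMeasure.Build _ _ _ dens dens0 dens_ge0 dens_sigma).

Lemma density_measureE A : density_measure A = \int[mu]_(x in A) (f x)%:E.
Proof. by []. Qed.

Lemma integral_density (g : T -> \bar R) :
  measurable_fun setT g -> (forall x, 0 <= g x) ->
  \int[density_measure]_x g x = \int[mu]_x ((f x)%:E * g x).
Proof.
move: g; apply: ge0_measurable_fun_ind.
- move=> A mA; rewrite integral_indic// setIT density_measureE integral_mkcond.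
  apply: eq_integral => x _; rewrite patchE/= indicE.
  by case: (x \in A); rewrite ?mule1 ?mule0.
- move=> g h mg mh g0 h0 eg eh.
  rewrite ge0_integralD// eg eh.
  under [RHS]eq_integral do rewrite ge0_muleDr//.
  apply/esym/ge0_integralD => //; try by move=> x _; rewrite mule_ge0// lee_fin.
    by apply: emeasurable_funM => //; exact/measurable_EFinP.
  by apply: emeasurable_funM => //; exact/measurable_EFinP.
- move=> k g k0 mg g0 eg; rewrite ge0_integralZl_EFin// eg.
  under [RHS]eq_integral do rewrite muleCA.
  apply/esym/ge0_integralZl_EFin => //; first by move=> x _; rewrite mule_ge0// lee_fin.
  by apply: emeasurable_funM => //; exact/measurable_EFinP.
- move=> F g mF F0 ndF Fg eF.
  have e1 : \int[density_measure]_x limn (F ^~ x) = limn (fun n => \int[density_measure]_x F n x).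
    exact: monotone_convergence.
  have -> : g = fun x => limn (F ^~ x) by apply/funext => x; rewrite (cvg_lim _ (Fg x)).
  apply: (etrans e1).
  have e2 : \int[mu]_x limn (fun n => (f x)%:E * F n x) = limn (fun n => \int[mu]_x ((f x)%:E * F n x)).
    apply: monotone_convergence => //.
    + by move=> n; apply: emeasurable_funM => //; exact/measurable_EFinP.
    + by move=> n x _; rewrite mule_ge0// lee_fin.
    + by move=> x _ i j ij; apply: lee_wpmul2l; [rewrite lee_fin|exact: ndF].
  rewrite (_ : (fun n => _) = (fun n => \int[mu]_x ((f x)%:E * F n x))); last by apply/funext.
  apply: (etrans (esym e2)); apply: eq_integral => x _; apply: cvg_lim => //.
  by apply: cvgeZl => //; rewrite (cvg_lim _ (Fg x)).
Qed.

End density_measure.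

Section pos_measure_theory.
Context {R : realType}.
Implicit Types (mu : posMeasure R) (g : R -> R).
Local Notation D0 := (`]0, +oo[%classic : set R).

Definition mass mu : R := fine (mu setT).

Lemma pos_measure_fin mu (A : set (measurableTypeR R)) : measurable A -> (mu A < +oo)%E.
Proof.
move=> mA; rewrite -ge0_fin_numE//; exact: fin_num_measure.
Qed.

Lemma massE mu : (mass mu)%:E = mu setT.
Proof. by rewrite fineK// fin_num_measure. Qed.

Lemma mass_ge0 mu : 0 <= mass mu. Proof. exact: fine_ge0. Qed.

Lemma mass_D0 mu : mu D0 = mu setT.
Proof.
transitivity (mu (`]-oo, 0]%classic `|` D0)); last by rewrite -setCitvl setUv.
apply/esym; apply: etrans (measureU _ _ _ _) _ => //; first by rewrite -setCitvl setICr.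
by rewrite [X in (X + _)%E](_ : _ = 0%E) ?add0e//; exact: pos_measure_le0.
Qed.

Lemma bounded_continuous_measurable g : bounded_continuous D0 g ->
  measurable_fun D0 g.
Proof. by move=> [_ cg]; exact: subspace_continuous_measurable_fun. Qed.

Lemma bounded_continuous_bound (D : set R) g : bounded_continuous D g ->
  exists2 C : R, 0 <= C & forall x, D x -> `|g x| <= C.
Proof.
move=> [[M0 [M0r h]] _]; exists (`|M0| + 1); first by rewrite addr_ge0.
by move=> x Dx; apply: (h (`|M0| + 1)) => //; rewrite ltr_pwDr// ler_norm.
Qed.

Lemma bounded_byP {U : Type} (D : set U) (g : U -> R) (C : R) : (forall x, D x -> `|g x| <= C) ->
  [bounded g x | x in D].
Proof.
move=> bg; exists `|C|; split => // M CM x Dx.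
by apply: le_trans (bg _ Dx) _; apply/ltW/(le_lt_trans (ler_norm _) CM).
Qed.

Lemma pairing_integrable mu g (C : R) : measurable_fun D0 g ->
  (forall x, D0 x -> `|g x| <= C) -> mu.-integrable D0 (EFin \o g).
Proof.
move=> mg bg; apply: measurable_bounded_integrable => //.
  exact: pos_measure_fin.
exact: bounded_byP bg.
Qed.

Lemma pairing_le mu g (C : R) : measurable_fun D0 g ->
  (forall x, D0 x -> `|g x| <= C) -> `|pairing mu g| <= C * mass mu.
Proof.
move=> mg bg; have ig := pairing_integrable mu mg bg.
apply: le_trans (le_normr_Rintegral _ ig) _ => //.
rewrite /mass -mass_D0 -Rintegral_cst//.
apply: le_Rintegral => //.
  exact: integrable_norm.
exact: finite_measure_integrable_cst.
Qed.

Lemma pairing_cst mu (c : R) : pairing mu (fun=> c) = c * mass mu.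
Proof. by rewrite /pairing Rintegral_cst//; congr (_ * fine _); exact: mass_D0. Qed.

Lemma pairing_cvg mu (G_ : (R -> R)^nat) g (C : R) : (forall n, measurable_fun D0 (G_ n)) ->
  (forall n x, D0 x -> `|G_ n x| <= C) -> (forall x, D0 x -> G_ ^~ x @ \oo --> g x) ->
  pairing mu (G_ n) @[n --> \oo] --> pairing mu g.
Proof.
by move=> mG bG cG; apply: (@cvg_bounded_Rintegral _ _ _ mu D0 C) => //; exact: pos_measure_fin.
Qed.

(** The left limits of a solution are known against functions vanishing at 0.
    These functions vanish at 0 and increase to 1, so they give access to the
    other test functions. *)
Definition cutoff (n : nat) (x : R) : R := Num.min 1 (n%:R * x).

Lemma cutoff_bc g n : bounded_continuous D0 g ->
  bounded_continuous D0 (fun x => g x * cutoff n x) /\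
  g x * cutoff n x @[x --> 0^'+] --> 0.
Proof.
move=> bg; have [C C0 gC] := bounded_continuous_bound bg.
have cut01 x : 0 < x -> 0 <= cutoff n x <= 1.
  by move=> x0; rewrite /cutoff le_min ge_min lexx ler01/= mulr_ge0// ltW.
have ccut : continuous (cutoff n).
  move=> x; apply: continuous_min; first exact: cst_continuous.
  exact: mulrl_continuous.
split; first split.
- apply: (@bounded_byP _ _ _ C) => x Dx; rewrite normrM.
  have x0 : 0 < x by move: Dx; rewrite /= in_itv/= andbT.
  have /andP[c0 c1] := cut01 _ x0.
  rewrite -[leRHS]mulr1 (ger0_norm c0).
  by apply: ler_pM => //; exact: gC.
- move=> x; apply: cvgM; first exact: (bg.2 x).
  by apply: continuous_subspaceT.
- apply/cvgrPdist_le => e e0; near=> x.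
  have x0 : 0 < x by near: x; exact: nbhs_right_gt.
  rewrite sub0r normrN normrM.
  have /andP[c0 _] := cut01 _ x0.
  apply: (@le_trans _ _ (C * (n%:R * x))).
    by rewrite (ger0_norm c0); apply: ler_pM => //; [apply: gC; rewrite /= in_itv/= x0|rewrite ge_min lexx orbT].
  have : x <= e / (C * n%:R + 1).
    near: x; apply: nbhs_right_le; rewrite divr_gt0// ltr_wpDl// mulr_ge0//.
  rewrite ler_pdivlMr; last by rewrite ltr_wpDl// mulr_ge0.
  by rewrite mulrDr mulr1; have := ltW x0; lra.
Unshelve. all: by end_near.
Qed.

Lemma cutoff_cvg x : 0 < x -> cutoff n x @[n --> \oo] --> (1 : R).
Proof.
move=> x0; apply: cvg_near_cst; near=> n.
rewrite /cutoff; apply/eqP; rewrite min_l//.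
rewrite -ler_pdivrMr// div1r; near: n; exact: nbhs_infty_ger.
Unshelve. all: by end_near.
Qed.

Lemma pairing_cutoff mu g : bounded_continuous D0 g ->
  pairing mu (fun x => g x * cutoff n x) @[n --> \oo] --> pairing mu g.
Proof.
move=> bg; have [C C0 gC] := bounded_continuous_bound bg.
apply: (@pairing_cvg _ _ _ C).
- by move=> n; apply: bounded_continuous_measurable; exact: (cutoff_bc n bg).1.
- move=> n x Dx; rewrite normrM.
  have x0 : 0 < x by move: Dx; rewrite /= in_itv/= andbT.
  rewrite -[leRHS]mulr1; apply: ler_pM => //; first exact: gC.
  by rewrite ger0_norm /cutoff ?le_min ?ge_min ?lexx// ler01/= mulr_ge0// ltW.
- move=> x Dx; have x0 : 0 < x by move: Dx; rewrite /= in_itv/= andbT.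
  have := cvgM (cvg_cst (g x) : (fun=> g x) @ \oo --> g x) (cutoff_cvg x0).
  by rewrite mulr1; apply.
Qed.

End pos_measure_theory.

(** * The law of the quantile *)

Section pushforward.
Context {R : realType} {d1 d2} {T1 : measurableType d1} {T2 : measurableType d2}.
Variables (m : {measure set T1 -> \bar R}) (f : T1 -> T2).
Hypothesis mf : measurable_fun setT f.

(** The image measure, taken together with the measurability of f. *)
Definition push : {measure set T2 -> \bar R} :=
  ltac:(by unshelve refine (pushforward m f : {measure set T2 -> \bar R})).

Lemma integral_push (g : T2 -> \bar R) : measurable_fun setT g ->
  (forall y, 0 <= g y)%E -> (\int[push]_y g y = \int[m]_x g (f x))%E.
Proof.
move=> mg g0; apply: etrans (@ge0_integral_pushforward _ _ _ _ R f mf m setT g measurableT mg _) _ => //.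
Qed.

End pushforward.

Lemma cvg_EFin' {R : realType} (u : R^nat) (l : R) :
  (u n)%:E @[n --> \oo] --> l%:E -> u n @[n --> \oo] --> l.
Proof. by move=> /fine_cvgP[]. Qed.

Section cdf_uniqueness.
Context {R : realType}.
Variables m1 m2 : {measure set (measurableTypeR R) -> \bar R}.
Hypothesis m1fin : (m1 setT < +oo)%E.

Lemma measure_unique_lt :
  (forall x : R, m1 `]-oo, x[%classic = m2 `]-oo, x[%classic) ->
  forall A, measurable A -> m1 A = m2 A.
Proof.
move=> e A mA.
have mE : @measurable _ (measurableTypeR R) = <<s @RGenInftyO.G R >>.
  exact: RGenInftyO.measurableE.
apply: (@g_sigma_algebra_measure_unique _ R (measurableTypeR R) (@RGenInftyO.G R) _
  (fun n => `]-oo, n%:R[%classic)).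
- by rewrite mE; exact: sub_sigma_algebra.
- by move=> i; exists i%:R.
- apply/seteqP; split => // x _; exists (Num.truncn x).+1 => //=.
  by rewrite in_itv/=; exact: truncnS_gt.
- move=> _ _ [x ->] [y ->]; exists (Num.min x y).
  by apply/seteqP; split => z; rewrite /= !in_itv/= lt_min; [move=> [-> ->]|move/andP].
- by move=> _ [x ->]; exact: e.
- move=> k; apply: le_lt_trans m1fin; apply: le_measure; rewrite ?inE//.
- by rewrite -mE.
Qed.

Lemma measure_unique_le :
  (forall x : R, m1 `]-oo, x]%classic = m2 `]-oo, x]%classic) ->
  forall A, measurable A -> m1 A = m2 A.
Proof.
move=> e; apply: measure_unique_lt => x.
have xE : `]-oo, x[%classic = \bigcup_n `]-oo, x - n.+1%:R^-1]%classic :> set (measurableTypeR R).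
  apply/seteqP; split => y /=.
    rewrite in_itv/= => yx; exists (Num.truncn (x - y)^-1) => //=.
    rewrite in_itv/= lerBrDl -lerBrDr -[leRHS]invrK lef_pV2 ?posrE ?invr_gt0 ?subr_gt0//.
    exact/ltW/truncnS_gt.
  by move=> [n _ /=]; rewrite !in_itv/= => /le_lt_trans; apply; rewrite gtrBl invr_gt0.
have nd : nondecreasing_seq (fun n => `]-oo, x - n.+1%:R^-1]%classic : set (measurableTypeR R)).
  move=> i j ij; apply/subsetPset => y; rewrite /= !in_itv/= => /le_trans; apply.
  by rewrite lerD2l lerN2 lef_pV2 ?posrE// ler_nat.
have c (m : {measure set (measurableTypeR R) -> \bar R}) :
    m `]-oo, x - n.+1%:R^-1]%classic @[n --> \oo] --> m `]-oo, x[%classic.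
  by rewrite xE; apply: nondecreasing_cvg_mu => //; exact: bigcup_measurable.
apply: (cvg_unique _ (c m1)) => //.
by rewrite (_ : (fun n => m1 _) = (fun n => m2 `]-oo, x - n.+1%:R^-1]%classic)); [exact: c|apply/funext => n; exact: e].
Qed.

End cdf_uniqueness.

Section quantile.
Context {R : realType}.
Local Notation D0 := (`]0, +oo[%classic : set R).
Local Notation leb := (@lebesgue_measure R).
Variables (alpha : R -> R) (mu : posMeasure R) (C : R).
Hypothesis malpha : measurable_fun D0 alpha.
Hypothesis alpha0 : forall x, D0 x -> 0 <= alpha x.
Hypothesis alphaC : forall x, D0 x -> `|alpha x| <= C.

Definition ext0 (k : R -> R) (a : \bar R) : R :=
  if a is x%:E then if 0 < x then k x else 0 else 0.

Let ab := alpha \_ D0.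
Let mab : measurable_fun (setT : set (measurableTypeR R)) ab.
Proof. by apply/(measurable_restrictT _ _).1. Qed.
Let ab0 x : 0 <= ab x.
Proof. by rewrite /ab patchE; case: ifPn => //; rewrite inE; exact: alpha0. Qed.

Let rho := density_measure mu mab ab0.
Let c := pairing mu alpha.
Let cdf z := pairing mu (fun x => alpha x * \1_`]0, z] x).

Let int_alpha (k : R -> R) : (forall x, D0 x -> 0 <= k x) ->
  (\int[mu]_x ((ab x)%:E * ((k \_ D0) x)%:E) = \int[mu]_(x in D0) (alpha x * k x)%:E)%E.
Proof.
move=> k0; rewrite [RHS]integral_mkcond; apply: eq_integral => x _.
by rewrite /ab !patchE; case: ifPn => _; rewrite -EFinM ?mulr0.
Qed.

Let cdfE z : (cdf z)%:E = rho `]-oo, z]%classic.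
Proof.
rewrite /cdf /pairing /Rintegral fineK; last first.
  apply: integrable_fin_num => //; apply: (@pairing_integrable _ _ _ C).
    by apply: measurable_funM => //; apply: measurable_funTS; exact: measurable_indic.
  move=> x Dx; rewrite normrM -[leRHS]mulr1; apply: ler_pM => //; first exact: alphaC.
  by rewrite indicE; case: (_ \in _); rewrite ?normr1// normr0.
rewrite /rho density_measureE [LHS]integral_mkcond [RHS]integral_mkcond.
apply: eq_integral => x _; rewrite /ab !patchE !mem_setE !in_itv/= andbT.
by rewrite indicE mem_setE in_itv/=; case: (ltP 0 x) => x0; case: ifPn => xz; rewrite ?mulr1 ?mulr0.
Qed.

Let cE : c%:E = rho setT.
Proof.
rewrite /c /pairing /Rintegral fineK; last first.
  by apply: integrable_fin_num => //; exact: (@pairing_integrable _ _ _ C).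
rewrite /rho density_measureE [LHS]integral_mkcond.
by apply: eq_integral => x _; rewrite /ab !patchE; case: ifPn.
Qed.

Let c0 : 0 <= c.
Proof. by rewrite -lee_fin cE. Qed.

Let rhoN z : z <= 0 -> rho `]-oo, z]%classic = 0%E.
Proof.
move=> z0; rewrite /rho density_measureE; apply: integral0_eq => x /=.
rewrite in_itv/= => xz; rewrite /ab patchE ifF//.
by rewrite mem_setE in_itv/= andbT ltNge (le_trans xz).
Qed.

Let rho_fin A : measurable A -> rho A \is a fin_num.
Proof.
move=> mA; rewrite ge0_fin_numE//; apply: (@le_lt_trans _ _ (rho setT)).
  by apply: le_measure; rewrite ?inE.
by rewrite -cE ltry.
Qed.

Let r z : R := fine (rho `]-oo, z[%classic).

Let r_le z : 0 <= r z <= c.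
Proof.
apply/andP; split; first exact: fine_ge0.
rewrite -lee_fin cE fineK ?rho_fin//.
by apply: le_measure; rewrite ?inE.
Qed.

(** The masses of ]-oo, z - 1/n] increase to that of ]-oo, z[: if the latter
    exceeds c y, some level below z does too, and conversely. *)
Let A_lt (y z : R) : 0 < y -> 0 < c -> (A_ alpha mu y < z%:E)%E <-> c * y < r z.
Proof.
move=> y0 cp; split.
  move=> /ereal_inf_lt[_ [s /= [s0 cs] <-]]; rewrite lte_fin => sz.
  apply: (lt_le_trans cs); rewrite -lee_fin cdfE fineK ?rho_fin//.
  apply: le_measure; rewrite ?inE// => x /=; rewrite !in_itv/= => xs.
  exact: le_lt_trans xs sz.
move=> cyr.
have xE : `]-oo, z[%classic = \bigcup_n `]-oo, z - n.+1%:R^-1]%classic :> set (measurableTypeR R).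
  apply/seteqP; split => u /=.
    rewrite in_itv/= => yx; exists (Num.truncn (z - u)^-1) => //=.
    rewrite in_itv/= lerBrDl -lerBrDr -[leRHS]invrK lef_pV2 ?posrE ?invr_gt0 ?subr_gt0//.
    exact/ltW/truncnS_gt.
  by move=> [n _ /=]; rewrite !in_itv/= => /le_lt_trans; apply; rewrite gtrBl invr_gt0.
have nd : nondecreasing_seq (fun n => `]-oo, z - n.+1%:R^-1]%classic : set (measurableTypeR R)).
  move=> i j ij; apply/subsetPset => u; rewrite /= !in_itv/= => /le_trans; apply.
  by rewrite lerD2l lerN2 lef_pV2 ?posrE// ler_nat.
have cv : rho `]-oo, z - n.+1%:R^-1]%classic @[n --> \oo] --> rho `]-oo, z[%classic.
  by rewrite xE; apply: nondecreasing_cvg_mu => //; exact: bigcup_measurable.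
have cv' : cdf (z - n.+1%:R^-1) @[n --> \oo] --> r z.
  apply: cvg_EFin'; rewrite /r fineK ?rho_fin//.
  by rewrite (_ : (fun n => (cdf _)%:E) = (fun n => rho `]-oo, z - n.+1%:R^-1]%classic))//; apply/funext => n; exact: cdfE.
have [n ncdf] : exists n, c * y < cdf (z - n.+1%:R^-1).
  have /cvgrPdist_lt/(_ (r z - c * y)) := cv'; rewrite subr_gt0 => /(_ cyr)[N _ HN].
  exists N; have := HN N (leqnn N); rewrite /= ltr_norml => /andP[_].
  by rewrite ltrD2l ltrN2.
apply: (@le_lt_trans _ _ (z - n.+1%:R^-1)%:E); last by rewrite lte_fin gtrBl invr_gt0.
apply: ereal_inf_lbound; exists (z - n.+1%:R^-1) => //; split => //.
rewrite leNgt; apply/negP => /ltW zn0.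
have := cdfE (z - n.+1%:R^-1); rewrite rhoN// => -[e].
by move: ncdf; rewrite e ltNge mulr_ge0// ltW.
Qed.

Let A_fin y : 0 < y < 1 -> 0 < c -> A_ alpha mu y = (fine (A_ alpha mu y))%:E.
Proof.
move=> /andP[y0 y1] cp.
have r0 : r 0 = 0.
  apply/eqP; rewrite eq_le (andP (r_le 0)).1 andbT -lee_fin fineK ?rho_fin//.
  by rewrite -[leRHS](rhoN (lexx 0)); apply: le_measure; rewrite ?inE// => x /=; rewrite !in_itv/=; exact: ltW.
have A0 : (0 <= A_ alpha mu y)%E.
  by rewrite leNgt; apply/negP => /(A_lt _ y0 cp); rewrite r0 ltNge mulr_ge0// ltW.
have [z yz] : exists z, c * y < r z.
  have cv : rho `]-oo, n%:R[%classic @[n --> \oo] --> rho setT.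
    rewrite (_ : setT = \bigcup_n `]-oo, n%:R[%classic :> set (measurableTypeR R)); last first.
      apply/seteqP; split => // x _; exists (Num.truncn x).+1 => //=.
      by rewrite in_itv/=; exact: truncnS_gt.
    apply: nondecreasing_cvg_mu => //; first exact: bigcup_measurable.
    move=> i j ij; apply/subsetPset => u; rewrite /= !in_itv/= => /lt_le_trans; apply.
    by rewrite ler_nat.
  have cv' : r n%:R @[n --> \oo] --> c.
    apply: cvg_EFin'; rewrite cE (_ : (fun n => _) = (fun n => rho `]-oo, n%:R[%classic))//.
    by apply/funext => n; rewrite /r fineK ?rho_fin.
  have cyc : c * y < c by rewrite gtr_pMr.
  have /cvgrPdist_lt/(_ (c - c * y)) := cv'; rewrite subr_gt0 => /(_ cyc)[N _ HN].
  exists N%:R; have := HN N (leqnn N); rewrite /= ltr_norml => /andP[_].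
  by rewrite ltrD2l ltrN2.
have Az : (A_ alpha mu y < z%:E)%E by apply/A_lt.
have fA : A_ alpha mu y \is a fin_num by rewrite ge0_fin_numE// (lt_trans Az)// ltry.
by rewrite fineK.
Qed.

Let Qf y : R := fine (A_ alpha mu y).

Let mQf : 0 < c -> measurable_fun (`]0, 1[%classic : set (measurableTypeR R)) Qf.
Proof.
move=> cp; apply: (measurability _ (RGenInftyO.measurableE R)) => //.
move=> _ [_ [z ->] <-]; apply: is_interval_measurable => u v /= [].
rewrite !in_itv/= => /andP[u0 u1]; rewrite -lte_fin -(A_fin _ cp) ?u0// => /(A_lt _ u0 cp) ur.
move=> [/andP[v0 v1] + w /andP[uw wv]].
rewrite -lte_fin -(A_fin _ cp) ?v0// => /(A_lt _ v0 cp) vr.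
have w01 : 0 < w < 1 by rewrite (lt_le_trans u0 uw) (le_lt_trans wv v1).
split; first by rewrite in_itv.
rewrite /= in_itv/= -lte_fin -(A_fin w01 cp); apply/A_lt => //; first by case/andP: w01.
by apply: le_lt_trans vr; rewrite ler_pM2l.
Qed.

(** For y uniform, A_alpha(mu, y) < z has probability r z / c by [A_lt]: the law
    of the quantile is the measure of density alpha with respect to mu,
    normalized. *)
Lemma quantile_law (k : R -> R) : measurable_fun D0 k -> (forall x, D0 x -> 0 <= k x) ->
  ((pairing mu alpha)%:E * \int[leb]_(y in `]0%R, 1%R]) (ext0 k (A_ alpha mu y))%:E =
   \int[mu]_(x in D0) (alpha x * k x)%:E)%E.
Proof.
move=> mk k0; rewrite -/c -int_alpha//.
have mkb : measurable_fun (setT : set (measurableTypeR R)) (k \_ D0).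
  by apply/(measurable_restrictT _ _).1.
have kb0 x : 0 <= (k \_ D0) x.
  by rewrite patchE; case: ifPn => //; rewrite inE; exact: k0.
rewrite -(integral_density mu mab ab0); [|exact/measurable_EFinP|by move=> x; rewrite lee_fin].
rewrite -/rho.
move: c0; rewrite le_eqVlt => /orP[/eqP c_eq0|cp].
  rewrite -c_eq0 mul0e; apply/esym/null_set_integral => //.
    exact/measurable_EFinP.
  by rewrite -cE -c_eq0.
pose Q0 : measurableTypeR R -> measurableTypeR R := Qf \_ `]0%R, 1%R[%classic.
have Q0E y : 0 < y < 1 -> Q0 y = Qf y.
  by move=> y01; rewrite /Q0 patchE mem_setE in_itv/= y01.
have mQ0 : measurable_fun setT Q0.
  by apply/(measurable_restrictT _ _).1 => //; exact: mQf.
pose l01 : {measure set (measurableTypeR R) -> \bar R} :=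
  mrestr leb (measurable_itv `]0%R, 1%R[ : measurable (`]0%R, 1%R[%classic : set (measurableTypeR R))).
pose pQ : {measure set (measurableTypeR R) -> \bar R} := push l01 mQ0.
pose nu : {measure set (measurableTypeR R) -> \bar R} := mscale (NngNum c0) pQ.
(* c times the law of the quantile is the measure rho of density alpha *)
have nurho (A : set (measurableTypeR R)) : measurable A -> nu A = rho A.
  apply: measure_unique_lt.
    by rewrite /nu/= /mscale/= /pushforward /mrestr preimage_setT setTI lebesgue_measure_itv/= lte_fin ltr01 -EFinB -EFinM ltry.
  move=> z; rewrite /nu/= /mscale/= /pushforward /mrestr.
  rewrite (_ : _ `&` _ = `]0, r z / c[%classic); last first.
    apply/seteqP; split => y /=; rewrite !in_itv/=.
      move=> [+ y01]; rewrite Q0E// -lte_fin -(A_fin y01 cp).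
      have /andP[y0 y1] := y01.
      by move=> /(A_lt _ y0 cp) yr; rewrite y0 ltr_pdivlMr// mulrC.
    move=> /andP[y0 yr].
    have y01 : 0 < y < 1.
      by rewrite y0 (lt_le_trans yr)// ler_pdivrMr// mul1r; case/andP: (r_le z).
    split => //; rewrite Q0E// -lte_fin -(A_fin y01 cp).
    by apply/A_lt => //; rewrite mulrC -ltr_pdivlMr.
  rewrite lebesgue_measure_itv/= lte_fin; have [rz0|rz0] := ltP 0 (r z / c).
    by rewrite -EFinB -EFinM subr0 mulrCA divff ?gt_eqF// mulr1 /r fineK ?rho_fin.
  have rz : r z = 0.
    apply/eqP; rewrite eq_le (andP (r_le z)).1 andbT.
    by move: rz0; rewrite pmulr_lle0// invr_gt0.
  by apply: (@etrans _ _ (r z)%:E); [rewrite mule0 rz|rewrite /r fineK ?rho_fin].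
rewrite (eq_measure_integral nu); last by move=> A mA _; exact/esym/nurho.
pose kb (x : measurableTypeR R) : \bar R := ((k \_ D0) x)%:E.
have mkbE : measurable_fun setT kb by exact/measurable_EFinP.
have kbE0 x : (0 <= kb x)%E by rewrite lee_fin.
have e1 : (\int[nu]_x kb x = c%:E * \int[pQ]_x kb x)%E.
  by apply: (@ge0_integral_mscale _ _ _ pQ setT measurableT (NngNum c0) kb).
have e2 : (\int[pQ]_x kb x = \int[l01]_y kb (Q0 y))%E by exact: integral_push.
have e3 : (\int[l01]_y kb (Q0 y) = \int[leb]_(y in `]0%R, 1%R[) kb (Q0 y))%E.
  by apply: integral_mrestr => //; exact: measurableT_comp.
apply: (etrans _ (esym e1)); congr (_ * _)%E.
apply: (etrans _ (esym e2)); apply: (etrans _ (esym e3)).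
have eA y : y \in `]0%R, 1%R[%classic -> (ext0 k (A_ alpha mu y))%:E = kb (Q0 y).
  rewrite mem_setE in_itv/= => y01; rewrite (A_fin y01 cp) /kb patchE mem_setE in_itv/= andbT.
  by rewrite Q0E//.
rewrite -integral_itv_bndo_bndc.
  by apply: eq_integral => y; exact: eA.
apply: (@eq_measurable_fun _ _ _ _ _ (fun y => kb (Q0 y))).
  by move=> y y01; rewrite eA.
by apply: measurable_funTS; exact: measurableT_comp.
Qed.

End quantile.

(** * Predictability of the birth domain *)

Section adapted_limits.
Context {R : realType} {d} {Omega : measurableType d} {P : probability Omega R}
  {Ft : R -> set (set Omega)}.
Hypothesis hFt : usual_filtration P Ft.
Variable Theta : set Omega.
Hypothesis FTheta : Ft 0 Theta.
Local Notation RT := (measurableTypeR R).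

Lemma sub_g_filt {rT : Type} (f : Omega -> rT) (t : R) (G : set (set rT)) : 0 <= t ->
  (forall B, G B -> Ft t (f @^-1` B)) -> forall B, <<s G >> B -> Ft t (f @^-1` B).
Proof.
move=> t0 GS; apply: smallest_sub; last exact: GS.
split => [|A|F] /=.
- by rewrite preimage_set0; exact: (filt0 hFt).
- by rewrite setTD preimage_setC => FA; apply: (filtC hFt).
- by move=> SF; rewrite preimage_bigcup; exact: (filt_bigcup hFt).
Qed.

Lemma measurable_truncn_fiber (i : nat) (c : R) : 0 < c ->
  measurable ([set s : R | 0 < s /\ Num.truncn (s * c) = i] : set RT).
Proof.
move=> c0; rewrite (_ : mkset _ = `]0, +oo[ `&` `[i%:R / c, i.+1%:R / c[).
  by apply: measurableI; exact: measurable_itv.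
apply/seteqP; split => s /=; rewrite !in_itv/= andbT ler_pdivrMr// ltr_pdivlMr//.
  move=> [s0 <-]; split=> //; rewrite truncn_le ?mulr_ge0 ?ltW//.
  exact: truncnS_gt.
by move=> [s0 h]; split => //; apply: truncn_def.
Qed.

Section predictable_limit.
Context {d'} {T : measurableType d'} {time : T -> R}.
Hypothesis mtime : measurable_fun setT (time : T -> RT).

Definition past : set (predT Ft time) := Theta `*` pos_time time.

Lemma measurable_past : measurable past.
Proof.
apply: sub_sigma_algebra; exists 0, Theta, (pos_time time); split => //.
rewrite (_ : pos_time time = time @^-1` `]0, +oo[); last first.
  by apply/seteqP; split => q; rewrite /pos_time/= in_itv/= andbT.
by rewrite -[X in measurable X]setTI; apply: mtime.
Qed.

(** Sample Y on the grid of mesh 1 / (j + 1), at a grid point strictly before s.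
    The approximation takes its value on countably many predictable rectangles,
    and it converges to the left limit. *)
Lemma predictable_left_limit (Y : R -> Omega -> R) (L : Omega -> R -> R) :
  (forall r, 0 <= r -> sub_measurable (Ft r) (Y r : Omega -> RT)) ->
  (forall w s, Theta w -> 0 < s -> Y r w @[r --> s^'-] --> L w s) ->
  measurable_fun past (fun z => L z.1 (time z.2)).
Proof.
move=> aY YL.
(* the predecessor keeps the sampling point strictly before s *)
pose idx (j : nat) (s : R) : nat := (Num.truncn (s * j.+1%:R)).-1.
pose rho (j : nat) (s : R) : R := (idx j s)%:R / j.+1%:R.
have rho_lt j s : 0 < s -> rho j s < s.
  move=> s0; rewrite /rho ltr_pdivrMr ?ltr0n//.
  have sj0 : 0 < s * j.+1%:R by rewrite mulr_gt0.
  rewrite /idx; case E : (Num.truncn _) => [|n] //=.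
  have : (Num.truncn (s * j.+1%:R))%:R <= s * j.+1%:R by rewrite truncn_le ltW.
  rewrite E; apply: lt_le_trans.
  by rewrite ltr_nat.
have rho_cvg s : 0 < s -> rho j s @[j --> \oo] --> s.
  move=> s0; apply/cvgrPdist_le => e e0; near=> j.
  rewrite ger0_norm ?subr_ge0; last exact/ltW/rho_lt.
  rewrite /rho lerBlDr -lerBlDl ler_pdivlMr ?ltr0n//.
  have : s * j.+1%:R <= (idx j s)%:R + 2%:R.
    rewrite -natrD; apply: le_trans (ltW (truncnS_gt _)) _; rewrite ler_nat /idx.
    by case: (Num.truncn _) => // n /=; rewrite addn2.
  have : 2 <= e * j.+1%:R.
    rewrite mulrC -ler_pdivrMr//; apply: (@le_trans _ _ j%:R); last by rewrite ler_nat.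
    by near: j; exact: nbhs_infty_ger.
  by rewrite mulrBl; lra.
pose G j (z : predT Ft time) : RT := Y (rho j (time z.2)) z.1.
apply: (@measurable_fun_cvg _ (predT Ft time) R past G (fun z => L z.1 (time z.2))); last first.
  move=> [w q] [/= Tw q0]; rewrite /G/=.
  have /cvg_at_leftP := YL w _ Tw q0; apply; split; last exact: rho_cvg.
  by move=> n; exact: rho_lt.
move=> j _ B mB.
rewrite (_ : past `&` _ = \bigcup_i ((Theta `&` Y (i%:R / j.+1%:R) @^-1` B) `*`
   (time @^-1` [set s | 0 < s /\ idx j s = i]))); last first.
  apply/seteqP; split => -[w q].
    by move=> [[/= Tw q0] YB]; exists (idx j (time q)).
  by move=> [i _ [/= [Tw YB] [q0 qi]]]; split => //; rewrite /G/= /rho qi.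
apply: bigcupT_measurable => i; apply: sub_sigma_algebra.
exists (i%:R / j.+1%:R), (Theta `&` Y (i%:R / j.+1%:R) @^-1` B),
  (time @^-1` [set s | 0 < s /\ idx j s = i]).
have ij0 : 0 <= i%:R / j.+1%:R :> R by rewrite divr_ge0.
split => //.
- by apply: (filtI hFt) => //; [exact: (filtS hFt (lexx 0) ij0)|exact: aY].
- rewrite -[X in measurable X]setTI; apply: mtime => //.
  rewrite (_ : mkset _ = \bigcup_(n in [set n : nat | n.-1 = i])
     [set s : R | 0 < s /\ Num.truncn (s * j.+1%:R) = n]); last first.
    apply/seteqP; split => s /=.
      by move=> [s0 <-]; exists (Num.truncn (s * j.+1%:R)).
    by move=> [n /= <- [s0 <-]].
  by apply: bigcup_measurable => n _; exact: measurable_truncn_fiber.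
- by move=> q [/= q0 <-]; exact: rho_lt.
Unshelve. all: by end_near.
Qed.

End predictable_limit.

(** Omega with the sigma-algebra of time t, to express measurability at time t. *)
Definition FtT (t : R) := g_sigma_algebraType (Ft t).

Lemma FtTE t (A : set Omega) : 0 <= t -> measurable (A : set (FtT t)) = Ft t A.
Proof.
move=> t0; apply/propext; split; last exact: sub_sigma_algebra.
have [h _] : sigma_algebra setT (Ft t) /\ Ft t `<=` measurable by case: hFt => h _ _ _; exact: h.
by rewrite /measurable/= (sigma_algebra_id h).
Qed.

(** Sample Y at the next grid point after s, but no later than t so that only
    what is known at time t is used; right-continuity gives the convergence. *)
Lemma progressive_right_limit (Y : R -> Omega -> R) (t : R) : 0 <= t ->
  (forall r, 0 <= r -> sub_measurable (Ft r) (Y r : Omega -> RT)) ->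
  (forall w s, Theta w -> 0 <= s -> Y r w @[r --> s^'+] --> Y s w) ->
  measurable_fun (Theta `*` `]0, t]%classic : set (FtT t * RT)) (fun z => Y z.2 z.1).
Proof.
move=> t0 aY YL.
pose rho (j : nat) (s : R) : R := Num.min t ((Num.truncn (s * j.+1%:R)).+1%:R / j.+1%:R).
pose G j (z : FtT t * RT) : RT := Y (rho j z.2) z.1.
have rho_gt (j : nat) (s : R) : s < (Num.truncn (s * j.+1%:R)).+1%:R / j.+1%:R.
  by rewrite ltr_pdivlMr ?ltr0n//; exact: truncnS_gt.
apply: (@measurable_fun_cvg _ (FtT t * RT)%type R _ G); last first.
  move=> [w s] [/= Tw]; rewrite in_itv/= => /andP[s0 st]; rewrite /G/=.
  have gcvg : (Num.truncn (s * j.+1%:R)).+1%:R / j.+1%:R @[j --> \oo] --> s.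
    apply/cvgrPdist_le => e e0; near=> j.
    rewrite ler0_norm ?subr_le0; last exact/ltW/rho_gt.
    rewrite opprB lerBlDr ler_pdivrMr ?ltr0n//.
    have sj0 : 0 <= s * j.+1%:R by rewrite mulr_ge0// ltW.
    rewrite -natr1; have : (Num.truncn (s * j.+1%:R))%:R <= s * j.+1%:R by rewrite truncn_le.
    have : 1 <= e * j.+1%:R.
      rewrite mulrC -ler_pdivrMr//; apply: (@le_trans _ _ j%:R); last by rewrite ler_nat.
      by near: j; exact: nbhs_infty_ger.
    by rewrite mulrDl; lra.
  move: st; rewrite le_eqVlt => /orP[/eqP st|st].
    rewrite st; apply: cvg_near_cst; near=> j.
    by rewrite /rho min_l// -st; exact/ltW/rho_gt.
  have /cvg_at_rightP Yc := YL w s Tw (ltW s0).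
  have := Yc (fun j => (Num.truncn (s * j.+1%:R)).+1%:R / j.+1%:R) (conj (fun j => rho_gt j s) gcvg).
  apply: cvg_trans; apply: near_eq_cvg; near=> j.
  rewrite /rho min_r//; near: j.
  by apply: filterS (cvgr_le s gcvg t st).
move=> j _ B mB.
rewrite (_ : _ `&` _ = \bigcup_i ((Theta `&` Y (Num.min t (i.+1%:R / j.+1%:R)) @^-1` B) `*`
   (`]0, t]%classic `&` [set s | 0 < s /\ Num.truncn (s * j.+1%:R) = i]))); last first.
  apply/seteqP; split => -[w s].
    move=> [[/= Tw st] YB]; exists (Num.truncn (s * j.+1%:R)) => //; split => //; split => //=.
    by move: st; rewrite in_itv/= => /andP[].
  by move=> [i _ [/= [Tw YB] [st [s0 si]]]]; split => //; rewrite /G/= /rho si.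
apply: bigcupT_measurable => i; apply: measurableX; last first.
  by apply: measurableI => //; exact: measurable_truncn_fiber.
rewrite FtTE//; apply: (filtI hFt) => //; first exact: (filtS hFt (lexx 0) t0).
have m0 : 0 <= Num.min t (i.+1%:R / j.+1%:R) by rewrite le_min t0 divr_ge0.
apply: (filtS hFt m0); first by rewrite ge_min lexx.
exact: aY.
Unshelve. all: by end_near.
Qed.

End adapted_limits.

Section weak_measurability.
Context {R : realType} {d} {Omega : measurableType d} {P : probability Omega R}
  {Ft : R -> set (set Omega)}.
Hypothesis hFt : usual_filtration P Ft.
Local Notation D0 := (`]0, +oo[%classic : set R).

Lemma sub_measurable_pairing t (Y : Omega -> posMeasure R) g : 0 <= t ->
  weakly_measurable (Ft t) Y -> bounded_continuous D0 g ->
  sub_measurable (Ft t) ((fun w => pairing (Y w) g) : Omega -> measurableTypeR R).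
Proof.
move=> t0 mY bg B mB.
apply: (sub_g_filt hFt t0 (G := @RGenInftyO.G R)); last first.
  by have <- : @measurable _ (measurableTypeR R) = <<s @RGenInftyO.G R >> by exact: RGenInftyO.measurableE.
move=> _ [x ->].
rewrite (_ : _ @^-1` _ = Y @^-1` [set mu | pairing mu g < x]); last first.
  by apply/seteqP; split => w; rewrite /= in_itv.
apply: mY; apply: sub_sigma_algebra => mu /= mux.
exists 1%N, (fun=> g), (x - pairing mu g); split => //; first by rewrite subr_gt0.
move=> nu /(_ ord0); rewrite ltr_norml => /andP[_].
by rewrite ltrBlDr subrK.
Qed.

End weak_measurability.

Lemma measurable_ltr_set {R : realType} {d} {T : measurableType d} (D : set T) (f g : T -> R) :
  measurable D -> measurable_fun D f -> measurable_fun D g ->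
  measurable (D `&` [set x | f x < g x]).
Proof. by move=> mD mf mg; have := measurable_fun_ltr mf mg mD (_ : measurable [set true]); exact. Qed.

Lemma measurable_ler_set {R : realType} {d} {T : measurableType d} (D : set T) (f g : T -> R) :
  measurable D -> measurable_fun D f -> measurable_fun D g ->
  measurable (D `&` [set x | f x <= g x]).
Proof. by move=> mD mf mg; have := measurable_fun_ler mf mg mD (_ : measurable [set true]); exact. Qed.

Section birth_predictable.
Context {R : realType} {d} {Omega : measurableType d} {P : probability Omega R}
  {Ft : R -> set (set Omega)}.
Hypothesis hFt : usual_filtration P Ft.
Local Notation D0 := (`]0, +oo[%classic : set R).
Local Notation RT := (measurableTypeR R).
Variables (alpha : R -> R) (p : R -> nat -> R).
Hypothesis halpha : bounded_continuous D0 alpha.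
Hypothesis alpha0 : positive_on D0 alpha.
Hypothesis hp : forall n, bounded_continuous D0 (p ^~ n).
Hypothesis hp1 : forall n x, D0 x -> 0 <= p x n <= 1.
Variables (X : R -> Omega -> posMeasure R) (Xm : Omega -> R -> posMeasure R).
Variable Theta : set Omega.
Hypothesis FTheta : Ft 0 Theta.
Hypothesis mX : forall t, 0 <= t -> weakly_measurable (Ft t) (X t).
Hypothesis XmE : forall w s, Theta w -> 0 < s -> left_limit (X ^~ w) s (Xm w s).

Section time_index.
Context {d'} {T : measurableType d'} {time : T -> R}.
Hypothesis mtime : measurable_fun setT (time : T -> RT).
Local Notation pst := (@past R _ Omega Ft Theta _ _ time).

(** The left limits are known against functions vanishing at 0; the others are
    reached by the cutoffs. *)
Lemma predictable_pairing g : bounded_continuous D0 g ->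
  measurable_fun pst (fun z => pairing (Xm z.1 (time z.2)) g).
Proof.
move=> bg.
pose G n (z : predT Ft time) : R := pairing (Xm z.1 (time z.2)) (fun x => g x * cutoff n x).
apply: (@measurable_fun_cvg _ (predT Ft time) R pst G); last first.
  by move=> z _; exact: pairing_cutoff.
move=> n; have [bgn gn0] := cutoff_bc n bg.
apply: (@predictable_left_limit _ _ _ _ _ hFt _ FTheta _ _ _ mtime
  (fun r w => pairing (X r w) (fun x => g x * cutoff n x))
  (fun w s => pairing (Xm w s) (fun x => g x * cutoff n x))).
  by move=> r r0; apply: (sub_measurable_pairing hFt) => //; exact: mX.
by move=> w s Tw s0; exact: XmE.
Qed.

(** Continuous approximations of the indicator of ]-oo, a], which is itself no
    test function for the weak topology. *)
Definition ramp (a : R) (n : nat) (x : R) : R := Num.min 1 (Num.max 0 (1 - n%:R * (x - a))).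

Lemma ramp_bc a n g : bounded_continuous D0 g -> bounded_continuous D0 (fun x => g x * ramp a n x).
Proof.
move=> bg; have [C C0 gC] := bounded_continuous_bound bg.
have cr : continuous (ramp a n).
  move=> x; apply: (@continuous_min R R (cst 1) (fun x => Num.max 0 (1 - n%:R * (x - a)))).
    exact: cst_continuous.
  apply: (@continuous_max R R (cst 0)); first exact: cst_continuous.
  apply: continuousB; first exact: cst_continuous.
  apply: continuousM; first exact: cst_continuous.
  by apply: continuousB => //; exact: cst_continuous.
split.
- apply: (@bounded_byP _ _ _ _ C) => x Dx; rewrite normrM -[leRHS]mulr1.
  apply: ler_pM => //; first exact: gC.
  by rewrite ger0_norm /ramp ?le_min ?le_max ?ge_min ?lexx ?ler01.
- by move=> x; apply: cvgM; [exact: (bg.2 x)|exact: continuous_subspaceT].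
Qed.

Lemma ramp_cvg a x : ramp a n x @[n --> \oo] --> (\1_`]-oo, a] x : R).
Proof.
rewrite indicE mem_setE in_itv/=; apply: cvg_near_cst; case: (leP x a) => xa.
  near=> n; apply/eqP; rewrite /ramp min_l// le_max; apply/orP; right.
  by rewrite lerDl oppr_ge0 mulr_ge0_le0// subr_le0.
near=> n; apply/eqP; rewrite /ramp max_l ?min_r//.
rewrite subr_le0 -ler_pdivrMr ?subr_gt0//; near: n; exact: nbhs_infty_ger.
Unshelve. all: by end_near.
Qed.

Lemma predictable_cdf a :
  measurable_fun pst (fun z => pairing (Xm z.1 (time z.2)) (fun x => alpha x * \1_`]0, a] x)).
Proof.
pose G n (z : predT Ft time) : R := pairing (Xm z.1 (time z.2)) (fun x => alpha x * ramp a n x).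
have [C C0 gC] := bounded_continuous_bound halpha.
apply: (@measurable_fun_cvg _ (predT Ft time) R pst G); last first.
  move=> z _; apply: (@pairing_cvg _ _ _ _ C).
  - by move=> n; apply: bounded_continuous_measurable; exact: ramp_bc.
  - move=> n x Dx; rewrite normrM -[leRHS]mulr1.
    apply: ler_pM => //; first exact: gC.
    by rewrite ger0_norm /ramp ?le_min ?le_max ?ge_min ?lexx ?ler01.
  - move=> x Dx; rewrite (_ : \1_`]0, a] x = \1_`]-oo, a] x :> R); last first.
      by move: Dx; rewrite !indicE !mem_setE /= !in_itv/= andbT => ->.
    by apply: cvgM; [exact: cvg_cst|exact: ramp_cvg].
by move=> n; apply: predictable_pairing; exact: ramp_bc.
Qed.

End time_index.

Local Notation time := (@time_of R).
Local Notation mt := (measurable_time_of (R := R)).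
Local Notation pst := (@past R _ Omega Ft Theta _ _ time).

Lemma predictable_point d'' (Y : measurableType d'') (g : pointT R -> Y) :
  measurable_fun setT g -> measurable_fun pst (fun z => g z.2).
Proof.
move=> mg _ B mB; apply: sub_sigma_algebra.
exists 0, Theta, (pos_time time `&` g @^-1` B); split => //.
- apply: measurableI.
    rewrite (_ : pos_time time = time @^-1` `]0, +oo[); last first.
      by apply/seteqP; split => q; rewrite /pos_time/= in_itv/= andbT.
    by rewrite -[X in measurable X]setTI; apply: mt.
  by rewrite -[X in measurable X]setTI; exact: mg.
- by apply/seteqP; split => -[w q]; [move=> [[? ?] ?]|move=> [? [? ?]]].
Qed.

(** The infimum is below c exactly when a rational level in [0, c[ already
    carries more than the fraction y of the weight; the condition at each level
    is predictable. *)
Lemma predictable_quantile :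
  measurable_fun pst (fun z => A_ alpha (Xm z.1 (time z.2)) (mark_of z.2)).
Proof.
pose A (z : predT Ft time) := A_ alpha (Xm z.1 (time z.2)) (mark_of z.2).
have mA (c : R) : measurable (pst `&` [set z | (A z < c%:E)%E]).
  rewrite (_ : _ `&` _ = \bigcup_(q : rat) (if (0 <= q) && (ratr q < c) then
      pst `&` [set z : predT Ft time | pairing (Xm z.1 (time z.2)) alpha * mark_of z.2 <
       pairing (Xm z.1 (time z.2)) (fun x => alpha x * \1_`]0, ratr q] x)] else set0)); last first.
    apply/seteqP; split => z.
      move=> [pz /= /ereal_inf_lt[_ [s [/= s0 hs] <-]]]; rewrite lte_fin => sc.
      have [q] := rat_in_itvoo sc; rewrite in_itv/= => /andP[sq qc].
      exists q => //; have q0 : 0 <= q.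
        by rewrite -(ler0q R) (le_trans s0)// ltW.
      rewrite q0 qc/=; split => //=; apply: (lt_le_trans hs).
      have [C C0 gC] := bounded_continuous_bound halpha.
      have mal := bounded_continuous_measurable halpha.
      have int1 b : (Xm z.1 (time z.2)).-integrable D0 (EFin \o (fun x => alpha x * \1_`]0, b] x)).
        apply: (@pairing_integrable _ _ _ C).
          by apply: measurable_funM => //; apply: measurable_funTS; exact: measurable_indic.
        move=> x Dx; rewrite normrM -[leRHS]mulr1; apply: ler_pM => //; first exact: gC.
        by rewrite indicE; case: (_ \in _); rewrite ?normr1// normr0.
      apply: le_Rintegral => //= x Dx; apply: ler_wpM2l; first exact: alpha0.
      rewrite !indicE !mem_setE !in_itv/=.
      by case: (0 < x) => //=; case: (leP x s) => //= xs; rewrite (le_trans xs (ltW sq)).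
    move=> [q _]; case: ifPn => // /andP[q0 qc] [pz /= h]; split => //=.
    apply: (@le_lt_trans _ _ (ratr q)%:E); last by rewrite lte_fin.
    by apply: ereal_inf_lbound; exists (ratr q) => //=; split => //; rewrite ler0q.
  apply: bigcupT_measurable_rat => q; case: ifPn => // _.
  rewrite (_ : [set z | _] = [set z : predT Ft time | (fun z : predT Ft time => pairing (Xm z.1 (time z.2)) alpha * mark_of z.2) z <
    (fun z : predT Ft time => pairing (Xm z.1 (time z.2)) (fun x => alpha x * \1_`]0, ratr q] x)) z])//.
  apply: measurable_ltr_set.
  - exact: (measurable_past FTheta mt).
  - apply: measurable_funM; first exact: (predictable_pairing mt halpha).
    exact: (predictable_point measurable_mark_of).
  - exact: (predictable_cdf mt).
apply: (measurability _ (ErealGenInftyO.measurableE R)) => //.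
move=> _ [_ [c ->] <-].
rewrite (_ : _ `&` _ = pst `&` [set z | (A z < c%:E)%E]); first exact: mA.
by apply/seteqP; split => z [pz]; rewrite /= in_itv.
Qed.

Lemma measurable_extp n : measurable_fun setT (fun a => extp p a n).
Proof.
have -> : (fun a => extp p a n) = (fun a => ((p ^~ n) \_ D0) (fine a)).
  by apply/funext => -[x| |] /=; rewrite patchE mem_setE in_itv/= ?ltxx// andbT.
apply: (measurableT_comp (f := (p ^~ n) \_ D0)); last exact: fine_measurable.
apply/(measurable_restrictT _ _).1 => //; exact: bounded_continuous_measurable.
Qed.

(** All the birth domains at once, as a subset of Omega times the space of
    points, where predictability makes sense; [birth_domainE] recovers each of
    them. *)
Definition birth_set : set (predT Ft time) := [set z | pst z /\
  [/\ 0 < life_of z.2 <= pairing (Xm z.1 (time z.2)) alpha,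
      E_ z.2.1.2 & 0 < level_of z.2 <= extp p (A_ alpha (Xm z.1 (time z.2)) (mark_of z.2)) (litter_of z.2)]].

Lemma measurable_birth_set : measurable birth_set.
Proof.
have mp : measurable (pst : set (predT Ft time)) by exact: (measurable_past FTheta mt).
have mpt (g : pointT R -> RT) : measurable_fun setT g -> measurable (pst `&` [set z | 0 < g z.2]).
  move=> mg; rewrite (_ : _ `&` _ = pst `&` (fun z => g z.2) @^-1` `]0, +oo[).
    by apply: (predictable_point mg).
  by apply/seteqP; split => z [pz]; rewrite /= in_itv/= andbT.
have mE : measurable (pst `&` [set z | E_ z.2.1.2]).
  rewrite (_ : _ `&` _ = (pst `&` (fun z => mark_of z.2) @^-1` `]0%R, 1%R]) `&`
      (pst `&` (fun z => lives_of z.2) @^-1` @posseq R)).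
    apply: measurableI.
      exact: (predictable_point measurable_mark_of).
    by apply: (predictable_point measurable_lives_of) => //; exact: measurable_posseq.
  apply/seteqP; split => z; rewrite /= in_itv/=.
    by move=> [pz [h1 h2 h3]]; rewrite /mark_of h1 h2.
  by move=> [[pz /andP[h1 h2]] [_ h3]].
have mlev n : measurable (pst `&` [set z | level_of z.2 <= extp p (A_ alpha (Xm z.1 (time z.2)) (mark_of z.2)) n]).
  rewrite (_ : [set z | _] = [set z : predT Ft time | (fun z : predT Ft time => level_of z.2) z <=
    (fun z : predT Ft time => extp p (A_ alpha (Xm z.1 (time z.2)) (mark_of z.2)) n) z])//.
  apply: measurable_ler_set => //.
  - exact: (predictable_point measurable_level_of).
  - exact: (measurableT_comp (f := fun a => extp p a n) (measurable_extp n) predictable_quantile).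
have mlife : measurable (pst `&` [set z | life_of z.2 <= pairing (Xm z.1 (time z.2)) alpha]).
  rewrite (_ : [set z | _] = [set z : predT Ft time | (fun z : predT Ft time => life_of z.2) z <=
    (fun z : predT Ft time => pairing (Xm z.1 (time z.2)) alpha) z])//.
  apply: measurable_ler_set => //.
  - exact: (predictable_point measurable_life_of).
  - exact: (predictable_pairing mt halpha).
rewrite (_ : birth_set = ((pst `&` [set z | 0 < life_of z.2]) `&`
   (pst `&` [set z | life_of z.2 <= pairing (Xm z.1 (time z.2)) alpha])) `&`
   (pst `&` [set z | E_ z.2.1.2]) `&` (pst `&` [set z | 0 < level_of z.2]) `&`
   \bigcup_n ((pst `&` (fun z => litter_of z.2) @^-1` [set n]) `&`
     (pst `&` [set z | level_of z.2 <= extp p (A_ alpha (Xm z.1 (time z.2)) (mark_of z.2)) n]))).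
  apply: measurableI; last first.
    apply: bigcupT_measurable => n; apply: measurableI; last exact: mlev.
    exact: (predictable_point measurable_litter_of).
  apply: measurableI; last exact: (mpt _ measurable_level_of).
  apply: measurableI; last exact: mE.
  by apply: measurableI; [exact: (mpt _ measurable_life_of)|exact: mlife].
apply/seteqP; split => z.
  move=> [pz [/andP[u0 u1] Ez /andP[v0 v1]]]; split; last by exists (litter_of z.2).
  by split => //; split.
by move=> [[[[[pz u0] [_ u1]] [_ Ez]] [_ v0]] [n _ [[_ /= nE] [_ v1]]]]; split => //;
  split => //; rewrite ?u0 ?u1 ?v0 ?nE.
Qed.

Lemma birth_domainE w t : Theta w ->
  birth_domain alpha p (Xm w) t = xsection birth_set w `&` [set q | time q <= t].
Proof.
move=> Tw; apply/seteqP; split => -[[[s u] [[y n] z]] v]; rewrite /xsection/= inE/=.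
  by move=> [/andP[s0 st] u1 E1 v1].
by move=> [[[_ s0] [u1 E1 v1]] st]; split => //; apply/andP.
Qed.

End birth_predictable.

(** * The compensator of the births *)

Lemma pairing_EFin {R : realType} (mu : posMeasure R) (g : R -> R) (C : R) :
  measurable_fun (`]0, +oo[%classic : set R) g ->
  (forall x, (`]0, +oo[%classic : set R) x -> `|g x| <= C) ->
  (pairing mu g)%:E = (\int[mu]_(x in `]0%R, +oo[) (g x)%:E)%E.
Proof.
move=> mg gC; rewrite /pairing /Rintegral fineK//.
by apply: integral_fune_fin_num => //; exact: pairing_integrable gC.
Qed.

Section compensator.
Context {R : realType} {d} {Omega : measurableType d} {P : probability Omega R}
  {Ft : R -> set (set Omega)}.
Hypothesis hFt : usual_filtration P Ft.
Local Notation D0 := (`]0, +oo[%classic : set R).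
Local Notation RT := (measurableTypeR R).
Local Notation leb := (@lebesgue_measure R).
Variables (alpha : R -> R) (p : R -> nat -> R).
Hypothesis halpha : bounded_continuous D0 alpha.
Hypothesis alpha0 : positive_on D0 alpha.
Hypothesis hp : forall n, bounded_continuous D0 (p ^~ n).
Hypothesis hp1 : forall n x, D0 x -> 0 <= p x n <= 1.
Variables (X : R -> Omega -> posMeasure R) (Xm : Omega -> R -> posMeasure R).
Variable Theta : set Omega.
Variable Ginf : probability (seqT R) R.
Hypothesis FTheta : Ft 0 Theta.
Hypothesis mX : forall t, 0 <= t -> weakly_measurable (Ft t) (X t).
Hypothesis XmE : forall w s, Theta w -> 0 < s -> left_limit (X ^~ w) s (Xm w s).
Local Notation time := (@time_of R).
Local Notation mt := (measurable_time_of (R := R)).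
Local Notation birth := (birth_set alpha p Xm Theta (Ft := Ft)).

Lemma extp_ext0 a n : extp p a n = ext0 (p ^~ n) a.
Proof. by []. Qed.

Lemma extp_ge0 a n : 0 <= extp p a n.
Proof.
case: a => [x| |] //=; case: ifPn => // x0.
have Dx : D0 x by rewrite /= in_itv/= andbT.
by have /andP[] := hp1 n Dx.
Qed.

Lemma measurable_mark_level w s n : Theta w -> 0 < s ->
  measurable_fun setT ((fun y => extp p (A_ alpha (Xm w s) y) n) : RT -> RT).
Proof.
move=> Tw s0.
pose pst := (@past R _ Omega Ft Theta _ _ time).
pose g (z : predT Ft time) : RT := extp p (A_ alpha (Xm z.1 (time z.2)) (mark_of z.2)) n.
have mg : measurable_fun setT (g \_ pst).
  apply: (measurable_restrictT g (measurable_past FTheta mt)).1.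
  exact: (measurableT_comp (f := fun a => extp p a n) (measurable_extp hp n)
    (predictable_quantile hFt halpha alpha0 FTheta mX XmE)).
have := pred_section hFt w mg.
pose e (y : RT) : pointT R := ((s, 1), ((y, 0%N), (fun=> 1) : seqT R), 1).
have me : measurable_fun setT e.
  apply/measurable_fun_pairP; split; last exact: measurable_cst.
  apply/measurable_fun_pairP; split; first exact: measurable_cst.
  apply/measurable_fun_pairP; split; last exact: measurable_cst.
  by apply/measurable_fun_pairP; split; [exact: measurable_id|exact: measurable_cst].
move=> ms; have := measurableT_comp ms me.
apply: eq_measurable_fun => y _; rewrite /= patchE mem_set//.
Qed.

Lemma lebesgue_indic_itv (c : R) : 0 <= c ->
  (\int[leb]_u (\1_`]0%R, c] u)%:E = c%:E)%E.
Proof.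
move=> c0; rewrite integral_indic//= setIT lebesgue_measure_itv/= lte_fin.
by move: c0; rewrite le_eqVlt => /orP[/eqP<-|c0]; rewrite ?ltxx// c0 sube0.
Qed.

Lemma pairing_ge0 (mu : posMeasure R) g : positive_on D0 g -> 0 <= pairing mu g.
Proof. by move=> g0; apply: Rintegral_ge0 => x Dx; exact: g0. Qed.

(** The integrals over v and u give the factors p and <X_{s-}, alpha>; the one
    over y is the quantile law, applied to p (., n). *)
Lemma compensator_slice w s (k : nat -> seqT R -> \bar R) : Theta w -> 0 < s ->
  (forall n, measurable_fun setT (k n)) -> (forall n z, (0 <= k n z)%E) ->
  (\int[leb]_u \int[leb]_y \sum_(n <oo) \int[Ginf]_z \int[leb]_v
     ((\1_`]0, pairing (Xm w s) alpha] u * \1_`]0, 1] y * \1_(@posseq R) z *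
       \1_`]0, extp p (A_ alpha (Xm w s) y) n] v)%:E * k n z)
   = \sum_(n <oo) (pairing (Xm w s) (fun x => alpha x * p x n))%:E *
      \int[Ginf]_(z in @posseq R) k n z)%E.
Proof.
move=> Tw s0 mk k0.
set c := pairing (Xm w s) alpha; pose e n y : R := extp p (A_ alpha (Xm w s) y) n.
have c0 : 0 <= c by exact: pairing_ge0.
have e0 n y : 0 <= e n y by exact: extp_ge0.
have me n : measurable_fun setT (e n : RT -> RT) by exact: measurable_mark_level.
pose kappa n := (\int[Ginf]_(z in @posseq R) k n z)%E.
have ka0 n : (0 <= kappa n)%E by apply: integral_ge0.
(* the integrals over v, of length e n y, and over z *)
have inner u y n : (\int[Ginf]_z \int[leb]_v
     ((\1_`]0, c] u * \1_`]0, 1] y * \1_(@posseq R) z *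
       \1_`]0, e n y] v)%:E * k n z) = (\1_`]0, c] u)%:E * ((\1_`]0%R, 1%R] y * e n y)%:E * kappa n))%E.
  have h z : (\int[leb]_v ((\1_`]0, c] u * \1_`]0, 1] y * \1_(@posseq R) z *
       \1_`]0, e n y] v)%:E * k n z) = (\1_`]0, c] u * (\1_`]0%R, 1%R] y * e n y))%:E * ((k n z) * (\1_(@posseq R) z)%:E))%E.
    have a0 : 0 <= \1_`]0, c] u * \1_`]0, 1] y * \1_(@posseq R) z :> R by rewrite !mulr_ge0.
    transitivity (\int[leb]_v ((\1_`]0, e n y] v)%:E * ((\1_`]0, c] u * \1_`]0, 1] y * \1_(@posseq R) z)%:E * k n z)))%E.
      by apply: eq_integral => v _; rewrite muleA -EFinM; congr (_%:E * _)%E; ring.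
    rewrite ge0_integralZr//.
    - by rewrite lebesgue_indic_itv// [(k n z * _)%E]muleC !muleA -!EFinM; congr (_%:E * _)%E; ring.
    - by apply/measurable_EFinP; exact: measurable_indic.
    - by rewrite mule_ge0// lee_fin.
  transitivity (\int[Ginf]_z ((\1_`]0, c] u * (\1_`]0%R, 1%R] y * e n y))%:E * ((k n z) * (\1_(@posseq R) z)%:E)))%E.
    by apply: eq_integral => z _; exact: h.
  rewrite ge0_integralZl_EFin//; last by rewrite !mulr_ge0.
  - rewrite EFinM -muleA; congr (_ * (_ * _))%E.
    by rewrite /kappa [RHS]integral_mkcond epatch_indic; apply: eq_integral.
  - by move=> z _; rewrite mule_ge0// lee_fin.
  - apply: emeasurable_funM; first exact: mk.
    by apply/measurable_EFinP; apply: measurable_indic; exact: measurable_posseq.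
have mye n : measurable_fun setT (fun y : RT => (\1_`]0%R, 1%R] y * e n y)%:E).
  by apply/measurable_EFinP; apply: measurable_funM; [exact: measurable_indic|exact: me].
have ye0 n y : (0 <= (\1_`]0%R, 1%R] y * e n y)%:E)%E by rewrite lee_fin mulr_ge0.
pose q n := (\int[leb]_(y in `]0%R, 1%R]) (e n y)%:E)%E.
have hy n : (\int[leb]_y ((\1_`]0%R, 1%R] y * e n y)%:E) = q n)%E.
  rewrite /q [RHS]integral_mkcond epatch_indic; apply: eq_integral => y _.
  by rewrite mulrC EFinM.
have q0 n : (0 <= q n)%E by apply: integral_ge0 => y _; rewrite lee_fin.
have hu u : (\int[leb]_y \sum_(n <oo) (\1_`]0, c] u)%:E * ((\1_`]0%R, 1%R] y * e n y)%:E * kappa n)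
    = (\1_`]0, c] u)%:E * \sum_(n <oo) q n * kappa n)%E.
  transitivity (\int[leb]_y ((\1_`]0, c] u)%:E * \sum_(n <oo) ((\1_`]0%R, 1%R] y * e n y)%:E * kappa n)))%E.
    by apply: eq_integral => y _; rewrite nneseriesZl// => n _; rewrite mule_ge0.
  have mt' n : measurable_fun setT (fun y : RT => ((\1_`]0%R, 1%R] y * e n y)%:E * kappa n)%E).
    by apply: emeasurable_funM => //; exact: measurable_cst.
  rewrite ge0_integralZl_EFin//.
  - congr (_ * _)%E; rewrite integral_nneseries//; last by move=> n y _; rewrite mule_ge0.
    by apply: eq_eseriesr => n _; rewrite ge0_integralZr// hy.
  - by move=> y _; apply: nneseries_ge0 => n _ _; rewrite mule_ge0.
  - by apply: ge0_emeasurable_sum => // n y _ _; rewrite mule_ge0.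
transitivity (\int[leb]_u ((\1_`]0, c] u)%:E * \sum_(n <oo) (q n * kappa n)))%E.
  apply: eq_integral => u _; rewrite -hu; apply: eq_integral => y _.
  by apply: eq_eseriesr => n _; exact: inner.
rewrite ge0_integralZr//.
- rewrite lebesgue_indic_itv// -nneseriesZl; last by move=> n _; rewrite mule_ge0.
  apply: eq_eseriesr => n _; rewrite muleA; congr (_ * _)%E.
  have [C C0 alC] := bounded_continuous_bound halpha.
  apply: (etrans (@quantile_law R alpha (Xm w s) C (bounded_continuous_measurable halpha) alpha0 alC (p ^~ n) _ _)).
  + exact: bounded_continuous_measurable.
  + by move=> x Dx; have /andP[] := hp1 n Dx.
  symmetry; apply: (@pairing_EFin _ _ _ C).
    by apply: measurable_funM; exact: bounded_continuous_measurable.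
  move=> x Dx; rewrite normrM -[leRHS]mulr1; apply: ler_pM => //; first exact: alC.
  by have /andP[a b] := hp1 n Dx; rewrite ger0_norm.
- by apply/measurable_EFinP; exact: measurable_indic.
- by apply: nneseries_ge0 => n _ _; rewrite mule_ge0.
Qed.

Lemma measurable_birth_section w : measurable (xsection birth w).
Proof.
have mb : measurable_fun setT (\1_birth : predT Ft time -> RT).
  have mB := measurable_birth_set hFt halpha alpha0 hp FTheta mX XmE.
  exact: measurable_indic.
have := pred_section hFt w mb => /(_ measurableT [set 1%R] (measurable_set1 1)).
rewrite setTI; congr (measurable _); apply/seteqP; split => q; rewrite /xsection/= indicE inE.
  by case: (boolP (_ \in _)) => [/set_mem//|_] /eqP; rewrite eq_sym oner_eq0.
by move=> qb; rewrite mem_set.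
Qed.

Lemma measurable_birth_window w u t :
  measurable (xsection birth w `&` [set q | u < time q <= t]).
Proof.
apply: measurableI; first exact: measurable_birth_section.
rewrite (_ : mkset _ = time @^-1` `]u, t]); last by apply/seteqP; split => q; rewrite /= in_itv.
by rewrite -[X in measurable X]setTI; exact: mt.
Qed.

Lemma birth_sectionE w q : Theta w -> xsection birth w q <->
  [/\ 0 < time q, 0 < life_of q <= pairing (Xm w (time q)) alpha, 0 < mark_of q <= 1,
   posseq (lives_of q) & 0 < level_of q <= extp p (A_ alpha (Xm w (time q)) (mark_of q)) (litter_of q)].
Proof.
move=> Tw; rewrite /xsection/= inE/=; split.
  by move=> [[/= _ q0] [q1 [q2 q3 q4] q5]]; split => //; apply/andP.
by move=> [q0 q1 /andP[q2 q3] q4 q5]; do 2 split => //.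
Qed.

(** Fubini: [compensator_slice] is the slice at time s. *)
Lemma compensator_formula w (u t : R) (h : R -> nat -> seqT R -> \bar R) : Theta w -> 0 <= u ->
  measurable_fun setT (fun q : pointT R => h (time q) (litter_of q) (lives_of q)) ->
  (forall s n z, (0 <= h s n z)%E) ->
  (\int[intensity_measure Ginf]_(q in xsection birth w `&` [set q | (u < time q <= t)%R])
     h (time q) (litter_of q) (lives_of q)
   = \int[leb]_(s in `]u, t]) \sum_(n <oo) (pairing (Xm w s) (fun x => alpha x * p x n))%:E *
      \int[Ginf]_(z in @posseq R) h s n z)%E.
Proof.
move=> Tw u0 mh h0.
have mS := measurable_birth_window w u t.
set S := (X in integral _ X _).
have Spd : S `<=` @point_domain R.
  move=> [[[s l] [[y n] z]] v] [/(birth_sectionE _ Tw)[/= s0 /andP[l0 _] /andP[y0 y1] z0 /andP[v0 v1]] _].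
  split => //; split => //; apply: (le_trans v1); rewrite extp_ext0.
  case: (A_ _ _ _) => [x| |]//=; case: ifPn => // x0.
  have Dx : D0 x by rewrite /= in_itv/= andbT.
  by have /andP[] := hp1 n Dx.
pose g := (fun q : pointT R => h (time q) (litter_of q) (lives_of q)) \_ S.
have mg : measurable_fun setT g by apply: (measurable_restrictT _ mS).1; exact: measurable_funTS.
have g0 q : (0 <= g q)%E by rewrite /g patchE; case: ifP.
rewrite integral_mkcond -/g integral_mrestr// (integral_mkcond (@point_domain R)).
rewrite (_ : g \_ _ = g); last first.
  apply/funext => q; rewrite patchE; case: ifPn => // nq; rewrite /g patchE.
  case: ifPn => // /set_mem /Spd qp; by rewrite mem_set in nq.
rewrite integral_point_measure// [RHS]integral_mkcond; apply: eq_integral => s _.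
rewrite [RHS]patchE mem_setE in_itv/=; case: ifPn => [/andP[us st]|ust].
  have s0 : 0 < s by exact: le_lt_trans us.
  apply: (etrans _ (compensator_slice (k := h s) Tw s0 _ _)).
  - apply: eq_integral => l _; apply: eq_integral => y _; apply: eq_eseriesr => n _.
    apply: eq_integral => z _; apply: eq_integral => v _.
    rewrite /g patchE; case: ifPn => [/set_mem [/(birth_sectionE _ Tw)[/= q1 q2 q3 q4 q5] _]|/negP nS].
      by rewrite !indicE !mem_set ?mul1r ?mul1e.
    rewrite !indicE !mem_setE !in_itv/=.
    case: (boolP (0 < l <= _)) => [q2|]; last by rewrite !mul0r mul0e.
    case: (boolP (0 < y <= 1)) => [q3|]; last by rewrite mulr0 !mul0r mul0e.
    case: (boolP (z \in _)) => [/set_mem q4|]; last by rewrite mulr0 !mul0r mul0e.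
    case: (boolP (0 < v <= _)) => [q5|]; last by rewrite mulr0 mul0e.
    by exfalso; apply: nS; apply: mem_set; split; [apply/(birth_sectionE _ Tw)|rewrite /= us st].
  - move=> n; pose e (z : seqT R) : pointT R := ((s, 1), ((1, n), z), 1).
    have me : measurable_fun setT e.
      apply/measurable_fun_pairP; split; last exact: measurable_cst.
      apply/measurable_fun_pairP; split; first exact: measurable_cst.
      by apply/measurable_fun_pairP; split; [exact: measurable_cst|exact: measurable_id].
    exact: (measurableT_comp mh me).
  - by [].
transitivity (\int[leb]_(l in setT) (cst 0%E l : \bar R))%E; last by rewrite integral_cst// mul0e.
apply: eq_integral => l _.
transitivity (\int[leb]_(y in setT) (cst 0%E y : \bar R))%E; last by rewrite integral_cst// mul0e.
apply: eq_integral => y _; rewrite eseries0// => n _ _.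
transitivity (\int[Ginf]_(z in setT) (cst 0%E z : \bar R))%E; last by rewrite integral_cst// mul0e.
apply: eq_integral => z _.
transitivity (\int[leb]_(l in setT) (cst 0%E l : \bar R))%E; last by rewrite integral_cst// mul0e.
apply: eq_integral => v _; rewrite /g patchE; case: ifPn => // /set_mem [_ /=].
by rewrite (negPf ust).
Qed.
End compensator.

(** * The mass along a path *)

(** Consider the infimum of the bad times: it is good by the first hypothesis,
    and so is a right neighbourhood of it by the second. *)
Lemma real_induction {R : realType} (T : R) (Q : R -> Prop) :
  (forall t, 0 <= t <= T -> (forall s, 0 <= s < t -> Q s) -> Q t) ->
  (forall t, 0 <= t < T -> (forall s, 0 <= s <= t -> Q s) ->
     exists2 e, 0 < e & forall s, t < s < t + e -> s <= T -> Q s) ->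
  forall t, 0 <= t <= T -> Q t.
Proof.
move=> Qle Qr t tT; apply: contrapT => nQ.
pose Bad := [set s | 0 <= s <= T /\ ~ Q s].
have Bad_t : Bad t by [].
have lB : has_lbound Bad by exists 0 => s [/andP[]].
have hB : has_inf Bad by split => //; exists t.
set sg := inf Bad.
have sg0 : 0 <= sg by apply: lb_le_inf; [exists t|move=> s [/andP[]]].
have sgt : sg <= t by exact: ge_inf.
have sgT : sg <= T by case/andP: tT => _; exact: le_trans.
have Qlt s : 0 <= s < sg -> Q s.
  move=> /andP[s0 ss]; apply: contrapT => nQs.
  have : sg <= s by apply: ge_inf => //; split => //; rewrite s0 (le_trans (ltW ss)).
  by rewrite leNgt ss.
have Qs : Q sg by apply: Qle => //; rewrite sg0.
have sglt : sg < T.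
  rewrite lt_neqAle sgT andbT; apply/negP => /eqP sgE.
  by apply: nQ; rewrite (_ : t = sg)//; apply/eqP; rewrite eq_le sgt sgE; case/andP: tT => _ ->.
have [|s /andP[s0 ss]|e e0 he] := Qr sg.
- by rewrite sg0.
- by move: ss; rewrite le_eqVlt => /orP[/eqP->//|ss]; apply: Qlt; rewrite s0.
have [b [/andP[b0 bT] nQb] bs] := inf_adherent e0 hB.
have : sg <= b by apply: ge_inf => //; split; rewrite ?b0.
move=> sb; apply: nQb; move: sb.
rewrite le_eqVlt => /orP[/eqP<-//|sb].
by apply: he => //; rewrite sb.
Qed.

Section litters.
Context {R : realType}.
Local Notation RT := (measurableTypeR R).

(** The litter takes countably many values. *)
Lemma measurable_litter_case d (Y : measurableType d) (g : nat -> pointT R -> Y) :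
  (forall n, measurable_fun setT (g n)) -> measurable_fun setT (fun q => g (litter_of q) q).
Proof.
move=> mg _ B mB; rewrite setTI.
rewrite (_ : _ @^-1` _ = \bigcup_n (@litter_of R @^-1` [set n] `&` g n @^-1` B)).
  apply: bigcupT_measurable => n; apply: measurableI.
    by rewrite -[X in measurable X]setTI; exact: measurable_litter_of.
  by rewrite -[X in measurable X]setTI; exact: mg.
apply/seteqP; split => q /=; first by move=> h; exists (litter_of q).
by move=> [n _ [/= <-]].
Qed.

Lemma measurable_litter_sum (phi : R -> R -> R) :
  measurable_fun setT ((fun z => phi z.1 z.2) : (RT * RT)%type -> RT) ->
  measurable_fun setT ((fun q : pointT R => \sum_(i < litter_of q) phi (time_of q) (lives_of q i)) : pointT R -> RT).
Proof.
move=> mphi; apply: (measurable_litter_case (Y := RT) (g := fun n q => \sum_(i < n) phi (time_of q) (lives_of q i))) => n.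
apply: measurable_sum => i.
apply: (measurableT_comp (f := fun z => phi z.1 z.2) (g := fun q : pointT R => ((time_of q, lives_of q i) : RT * RT)) mphi).
apply/measurable_fun_pairP; split; first exact: measurable_time_of.
exact: (measurableT_comp (measurable_coord i) measurable_lives_of).
Qed.

Lemma measurable_litterR : measurable_fun setT ((fun q : pointT R => (litter_of q)%:R) : pointT R -> RT).
Proof. exact: (measurable_litter_case (Y := RT) (g := fun n _ => n%:R)). Qed.

Lemma measurable_births (t x : R) : measurable_fun setT (births t x : pointT R -> RT).
Proof.
rewrite (_ : births t x = fun q => \sum_(i < litter_of q) \1_`]0, x] (lives_of q i - (t - time_of q))); last first.
  by apply/funext => -[[[s u] [[y n] z]] v].
apply: (measurable_litter_sum (phi := fun s a => \1_`]0, x] (a - (t - s)))).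
apply: measurableT_comp; first exact: measurable_indic.
apply: measurable_funB; first exact: measurable_snd.
by apply: measurable_funB; [exact: measurable_cst|exact: measurable_fst].
Qed.

Lemma births_bound (t x : R) q : 0 <= births t x q <= (litter_of q)%:R.
Proof.
move: q => [[[s u] [[y n] z]] v]; rewrite /births /litter_of/=; apply/andP; split.
  by apply: sumr_ge0.
rewrite -[X in _ <= X%:R]card_ord -sumr_const; apply: ler_sum => i _.
by rewrite indicE lern1 leq_b1.
Qed.

End litters.

Lemma mass_le_dist {R : realType} (mu : posMeasure R) (B : \bar R) :
  (forall x, 0 < x -> ((dist_fun mu x)%:E <= B)%E) -> ((mass mu)%:E <= B)%E.
Proof.
move=> h; rewrite massE -mass_D0.
have c : (mu \o (fun n : nat => `]0, n.+1%:R]%classic)) n @[n --> \oo] --> mu (\bigcup_n (fun n : nat => `]0, n.+1%:R]%classic : set (measurableTypeR R)) n).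
  apply: nondecreasing_cvg_mu.
  - by move=> n; exact: measurable_itv.
  - by apply: bigcup_measurable => n _; exact: measurable_itv.
  - apply/nondecreasing_seqP => n; apply/subsetPset => x; rewrite /= !in_itv/= => /andP[-> xn].
    by rewrite (le_trans xn)// ler_nat.
rewrite [X in (mu X <= _)%E](_ : _ = \bigcup_n (fun n : nat => `]0, n.+1%:R]%classic : set (measurableTypeR R)) n); last first.
  apply/seteqP; split => x.
    rewrite /= in_itv/= andbT => x0; exists (Num.truncn x) => //=; rewrite in_itv/= x0/=.
    by apply: ltW; exact: truncnS_gt.
  by move=> [n _]; rewrite /= !in_itv/= andbT => /andP[].
rewrite -(cvg_lim _ c)//; apply: lime_le; first by apply/cvg_ex; eexists; exact: c.
apply: nearW => n /=; have := h n.+1%:R; rewrite ltr0n => /(_ isT).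
by rewrite /dist_fun fineK// ge0_fin_numE//; exact: pos_measure_fin.
Qed.

Section path_mass.
Context {R : realType}.
Local Notation D0 := (`]0, +oo[%classic : set R).
Local Notation RT := (measurableTypeR R).
Variables (alpha : R -> R) (p : R -> nat -> R).
Variables (m : {measure set (pointT R) -> \bar R}) (Y Ym : R -> posMeasure R).
Hypothesis Yright : weakly_right_continuous Y.
Hypothesis Yleft : forall s, 0 < s -> left_limit Y s (Ym s).
Local Notation D := (birth_domain alpha p Ym).
Hypothesis YE : forall t x, 0 <= t -> 0 < x ->
  ((dist_fun (Y t) x)%:E = (dist_fun (Y 0) (x + t) - dist_fun (Y 0) t)%:E +
   \int[m]_(q in D t) (births t x q)%:E)%E.
Hypothesis mD : forall t, measurable (D t).

Lemma birth_domain_time s t : s <= t -> D s = D t `&` [set q | time_of q <= s].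
Proof.
move=> st; apply/seteqP; split => -[[[r u] [[y n] z]] v] /=.
  by move=> [/andP[r0 rs] h1 h2 h3]; split => //; split => //; rewrite r0 (le_trans rs).
by move=> [[/andP[r0 rt] h1 h2 h3] rs]; split => //; rewrite r0.
Qed.

Lemma birth_domain_pos t q : D t q -> 0 < time_of q <= t.
Proof. by move: q => [[[r u] [[y n] z]] v] []. Qed.

Lemma bounded_continuous_cst (c : R) : bounded_continuous D0 (fun=> c).
Proof.
split; first by apply: (@bounded_byP _ _ _ _ `|c|).
by apply: continuous_subspaceT => x; exact: cst_continuous.
Qed.

Lemma mass_right t : 0 <= t -> mass (Y r) @[r --> t^'+] --> mass (Y t).
Proof.
move=> t0; have := Yright t0 (bounded_continuous_cst 1).
rewrite pairing_cst mul1r; apply: cvg_trans; apply: near_eq_cvg.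
by apply: nearW => r; rewrite pairing_cst mul1r.
Qed.

(** The flow creates no mass, and a birth adds at most as many atoms as its
    litter. *)
Lemma mass_le_births t : 0 <= t ->
  ((mass (Y t))%:E <= (mass (Y 0))%:E + \int[m]_(q in D t) (litter_of q)%:R%:E)%E.
Proof.
move=> t0; apply: mass_le_dist => x x0; rewrite YE//; apply: leeD.
  rewrite lee_fin lerBlDr (le_trans (_ : _ <= mass (Y 0)))// ?lerDl ?fine_ge0//.
  rewrite -lee_fin massE /dist_fun fineK.
    by apply: le_measure => //; rewrite inE//; exact: measurable_itv.
  by rewrite ge0_fin_numE//; exact: pos_measure_fin.
apply: ge0_le_integral => //.
- by move=> q _; rewrite lee_fin; have /andP[] := births_bound t x q.
- by apply/measurable_EFinP; apply: measurable_funTS; exact: measurable_births.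
- by apply/measurable_EFinP; apply: measurable_funTS; exact: measurable_litterR.
- by move=> q _; rewrite lee_fin; have /andP[] := births_bound t x q.
Qed.

(** In the left limit mass can only get lost, at 0: test against the cutoffs. *)
Lemma mass_left s K : 0 < s -> (forall r, 0 <= r < s -> mass (Y r) <= K) -> mass (Ym s) <= K.
Proof.
move=> s0 hK.
have := @pairing_cutoff _ (Ym s) _ (bounded_continuous_cst 1); rewrite pairing_cst mul1r => c.
rewrite -(cvg_lim _ c)//; apply: limr_le; first by apply/cvg_ex; eexists; exact: c.
apply: nearW => n; have [bn n0] := cutoff_bc n (bounded_continuous_cst 1).
have c' := Yleft s0 bn n0.
rewrite -(cvg_lim _ c')//; apply: limr_le; first by apply/cvg_ex; eexists; exact: c'.
near=> r; apply: le_trans (ler_norm _) _.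
have r0 : 0 <= r by near: r; exact: nbhs_left_ge.
have rs : r < s by near: r; exact: nbhs_left_lt.
apply: (@le_trans _ _ (1 * mass (Y r))); last by rewrite mul1r; apply: hK; rewrite r0.
apply: pairing_le; first exact: bounded_continuous_measurable.
move=> x Dx; have x0 : 0 < x by move: Dx; rewrite /= in_itv/= andbT.
by rewrite mul1r ger0_norm /cutoff ?le_min ?ge_min ?lexx// ler01/= mulr_ge0// ltW.
Unshelve. all: by end_near.
Qed.

(** Only rational times are tested, which makes the set measurable; by right-
    continuity this decides for all times. *)
Definition mass_below (K : nat) : set R := [set s | forall r : rat,
  (0 : R) <= ratr r < s -> mass (Y (ratr r)) <= K%:R].

Lemma mass_belowP K s : mass_below K s <-> forall r, 0 <= r < s -> mass (Y r) <= K%:R.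
Proof.
split; last by move=> h r; exact: h.
move=> h r /andP[r0 rs]; rewrite leNgt; apply/negP => Kr.
have : \forall x \near r^'+, K%:R < mass (Y x).
  by have /cvgrPdist_lt := mass_right r0; move=> /(_ (mass (Y r) - K%:R));
    rewrite subr_gt0 => /(_ Kr); apply: filterS => x; rewrite ltr_norml => /andP[_]; lra.
move=> [e /= e0 he].
have /rat_in_itvoo[x] : r < Num.min s (r + e) by rewrite lt_min rs ltrDl.
rewrite in_itv/= lt_min => /and3P[rx xs xe].
have := h x; rewrite xs (ltW (le_lt_trans r0 rx)) => /(_ isT).
apply/negP; rewrite -ltNge; apply: he => //=.
by rewrite ltr_distlC; apply/andP; split; lra.
Qed.

Lemma measurable_mass_below K : measurable (mass_below K : set RT).
Proof.
rewrite (_ : mass_below K = \bigcap_(r : rat)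
  (if (0 <= ratr r :> R) && ~~ (mass (Y (ratr r)) <= K%:R) then `]-oo, ratr r]%classic else setT)).
  rewrite -[X in measurable X]setCK setC_bigcap; apply: measurableC.
  apply: bigcupT_measurable_rat => r; apply: measurableC; case: ifP => _; [exact: measurable_itv|exact: measurableT].
apply/seteqP; split => s h.
  move=> r _; case: ifPn => // /andP[r0 Kr]; rewrite /= in_itv/= leNgt; apply/negP => rs.
  by move: Kr; rewrite h// r0.
move=> r /andP[r0 rs]; apply: contrapT => /negP Kr.
by have := h r I; rewrite r0 Kr/= in_itv/= leNgt rs.
Qed.

Lemma mass_below_le K s t : s <= t -> mass_below K t -> mass_below K s.
Proof. by move=> st h r /andP[r0 rs]; apply: h; rewrite r0 (lt_le_trans rs). Qed.

Lemma mass_below_nd K L s : (K <= L)%N -> mass_below K s -> mass_below L s.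
Proof. by move=> KL h r rs; apply: (le_trans (h r rs)); rewrite ler_nat. Qed.

Definition mass_bounded : set R := \bigcup_K mass_below K.

Lemma mass_boundedP B s : (forall r, 0 <= r < s -> mass (Y r) <= B) -> mass_bounded s.
Proof.
move=> h; exists (Num.truncn B).+1 => //; apply/mass_belowP => r rs.
by apply: (le_trans (h r rs)); apply: ltW; exact: truncnS_gt.
Qed.

(** While the mass stays bounded before t, the integral over the births with
    bounded past controls the mass at t; right-continuity takes this a little
    beyond t. By real induction the mass is bounded on [0, T], and all births up
    to T have a bounded past. *)
Lemma no_explosion T : 0 <= T ->
  (\int[m]_(q in D T `&` @time_of R @^-1` mass_bounded) (litter_of q)%:R%:E < +oo)%E ->
  (forall t, 0 <= t <= T -> ((mass (Y t))%:E <= (mass (Y 0))%:E +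
    \int[m]_(q in D T `&` @time_of R @^-1` mass_bounded) (litter_of q)%:R%:E)%E) /\
  D T `<=` @time_of R @^-1` mass_bounded.
Proof.
move=> T0; set V := (\int[m]_(q in _) _)%E => Voo.
have V0 : (0 <= V)%E by apply: integral_ge0 => q _; rewrite lee_fin.
pose B := mass (Y 0) + fine V.
have BE : ((mass (Y 0))%:E + V = B%:E)%E by rewrite /B EFinD (@fineK _ V)// ge0_fin_numE.
have mb : measurable (mass_bounded : set RT) by apply: bigcup_measurable => K _; exact: measurable_mass_below.
have mV : measurable (D T `&` @time_of R @^-1` mass_bounded).
  apply: measurableI => //; rewrite -[X in measurable X]setTI; exact: measurable_time_of.
(* all births before t have a bounded past, so V counts them *)
have key t : 0 <= t <= T -> (forall r, 0 <= r <= t -> mass_bounded r) -> mass (Y t) <= B.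
  move=> /andP[t0 tT] h; rewrite -lee_fin -BE; apply: (le_trans (mass_le_births t0)).
  apply: leeD => //; apply: ge0_subset_integral => //.
  - by apply/measurable_EFinP; apply: measurable_funTS; exact: measurable_litterR.
  - move=> q Dq; split; first by move: Dq; rewrite (birth_domain_time tT) => -[].
    by apply: h; have /andP[/ltW -> ->] := birth_domain_pos Dq.
have bound : forall t, 0 <= t <= T -> mass (Y t) <= B.
  apply: real_induction => [t tT h|t /andP[t0 tT] h].
    apply: key => // r /andP[r0 rt]; apply: (mass_boundedP (B := B)) => s /andP[s0 sr].
    by apply: h; rewrite s0 (lt_le_trans sr).
  have /cvgrPdist_lt/(_ 1 ltr01) [e /= e0 he] := mass_right t0.
  exists e => // s /andP[ts se] sT; apply: key; first by rewrite (ltW (le_lt_trans t0 ts)).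
  move=> r /andP[r0 rs]; apply: (mass_boundedP (B := B + 1)) => x /andP[x0 xr].
  have [xt|tx] := leP x t.
    by apply: le_trans (h x _) _; rewrite ?x0// lerDl.
  have := he x; rewrite /= ltr_distlC => /(_ _ tx).
  have -> : t - e < x < t + e by apply/andP; split; lra.
  move=> /(_ isT); rewrite ltr_norml => /andP[h1 _].
  have := h t; rewrite t0 lexx => /(_ isT); lra.
split; first by move=> t tT; rewrite BE lee_fin; exact: bound.
move=> q /birth_domain_pos/andP[q0 qT]; apply: (mass_boundedP (B := B)) => r /andP[r0 rq].
by apply: bound; rewrite r0 (le_trans (ltW rq)).
Qed.

End path_mass.

(** * The mean number of births *)

Lemma ge0_le_integral_any d (T : measurableType d) (R : realType)
    (mu : {measure set T -> \bar R}) (D : set T) (f g : T -> \bar R) :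
  (forall x, D x -> 0 <= f x)%E -> (forall x, D x -> f x <= g x)%E ->
  (\int[mu]_(x in D) f x <= \int[mu]_(x in D) g x)%E.
Proof.
move=> f0 fg; have g0 x : D x -> (0 <= g x)%E by move=> Dx; exact: le_trans (f0 _ Dx) (fg _ Dx).
rewrite !ge0_integralE//; apply: le_ereal_sup => _ [h hf <-]; exists h => // x.
apply: (le_trans (hf x)); rewrite !patchE; case: ifPn => // /set_mem Dx; exact: fg.
Qed.

Section predictable_compensation.
Context {R : realType} {d} {Omega : measurableType d} {P : probability Omega R}
  {Ft : R -> set (set Omega)} {Ginf : probability (seqT R) R}
  {M : Omega -> {measure set (pointT R) -> \bar R}}.
Hypothesis hFt : usual_filtration P Ft.
Hypothesis hM : filtered_poisson P (@time_of R) Ft (intensity Ginf) M.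
Local Notation m := (intensity_measure Ginf).
Local Open Scope ereal_scope.

Lemma predictable_compensation (S : set (predT Ft (@time_of R))) (H : Omega * pointT R -> \bar R) :
  measurable S -> (forall z, S z -> (0 < time_of z.2)%R) ->
  measurable_fun S (H : predT Ft (@time_of R) -> \bar R) -> (forall z, S z -> 0 <= H z) ->
  [/\ measurable_fun setT (fun w => \int[M w]_(q in xsection S w) H (w, q)),
      measurable_fun setT (fun w => \int[m]_(q in xsection S w) H (w, q)) &
   \int[P]_w \int[M w]_(q in xsection S w) H (w, q) =
   \int[P]_w \int[m]_(q in xsection S w) H (w, q)].
Proof.
move=> mS S0 mH H0.
have hM' : filtered_poisson P (@time_of R) Ft m M by [].
have mHS : measurable_fun setT ((H \_ S) : predT Ft (@time_of R) -> \bar R).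
  exact: (measurable_restrictT _ mS).1.
have HS0 z : 0 <= (H \_ S) z by rewrite patchE; case: ifPn => // /set_mem; exact: H0.
have E (L : {measure set (pointT R) -> \bar R}) w :
    \int[L]_(q in pos_time (@time_of R)) (H \_ S) (w, q) = \int[L]_(q in xsection S w) H (w, q).
  rewrite [LHS]integral_mkcond [RHS]integral_mkcond; apply: eq_integral => q _.
  rewrite !patchE mem_xsection; case: ifPn => //; case: ifPn => // /set_mem Swq.
  by rewrite notin_setE => /(_ (S0 _ Swq)).
have := poisson_compensation hFt hM' measurable_window nd_window bigcup_window
  (intensity_window_fin Ginf) mHS HS0.
move=> [h1 h2 h3]; split.
- by move: h1; under eq_fun do rewrite E.
- by move: h2; under eq_fun do rewrite E.
- by move: h3; under eq_integral do rewrite E; under [RHS]eq_integral do rewrite E.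
Qed.

End predictable_compensation.

Section moments.
Context {R : realType} {d} {Omega : measurableType d} {P : probability Omega R}
  {Ft : R -> set (set Omega)} {Ginf : probability (seqT R) R}
  {M : Omega -> {measure set (pointT R) -> \bar R}}.
Hypothesis hFt : usual_filtration P Ft.
Hypothesis hM : filtered_poisson P (@time_of R) Ft (intensity Ginf) M.
Local Notation D0 := (`]0, +oo[%classic : set R).
Local Notation RT := (measurableTypeR R).
Local Notation leb := (@lebesgue_measure R).
Local Notation m := (intensity_measure Ginf).
Local Notation time := (@time_of R).
Local Notation mt := (measurable_time_of (R := R)).
Variables (alpha : R -> R) (p : R -> nat -> R) (C mb : R).
Hypothesis halpha : bounded_continuous D0 alpha.
Hypothesis alpha0 : positive_on D0 alpha.
Hypothesis alphaC : forall x, D0 x -> alpha x <= C.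
Hypothesis hp : forall n, bounded_continuous D0 (p ^~ n).
Hypothesis hp1 : forall n x, D0 x -> 0 <= p x n <= 1.
Hypothesis hpm : forall x, D0 x -> (\sum_(n <oo) (n%:R * p x n)%:E <= mb%:E)%E.
Variables (X : R -> Omega -> posMeasure R) (Xm : Omega -> R -> posMeasure R).
Variable Theta : set Omega.
Hypothesis FTheta : Ft 0 Theta.
Hypothesis mX : forall t, 0 <= t -> weakly_measurable (Ft t) (X t).
Hypothesis Xright : forall w, Theta w -> weakly_right_continuous (X ^~ w).
Hypothesis XmE : forall w s, Theta w -> 0 < s -> left_limit (X ^~ w) s (Xm w s).
Hypothesis XE : forall w t x, Theta w -> 0 <= t -> 0 < x ->
  ((dist_fun (X t w) x)%:E = (dist_fun (X 0 w) (x + t) - dist_fun (X 0 w) t)%:E +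
   \int[M w]_(q in birth_domain alpha p (Xm w) t) (births t x q)%:E)%E.
Local Notation birth := (birth_set alpha p Xm Theta (Ft := Ft)).
Local Notation pst := (@past R _ Omega Ft Theta _ _ time).

Definition birth_window (u t : R) : set (predT Ft time) := birth `&` [set z | u < time z.2 <= t].

Lemma measurable_birth_windowT u t : measurable (birth_window u t).
Proof.
have mB := measurable_birth_set hFt halpha alpha0 hp FTheta mX XmE.
rewrite (_ : birth_window u t = birth `&` (pst `&` (fun z => time z.2) @^-1` `]u, t])); last first.
  apply/seteqP; split => z; rewrite /birth_window/= in_itv/=.
    by move=> [bz zt]; split => //; split => //; case: bz.
  by move=> [bz [_ zt]].
apply: measurableI => //; apply: (predictable_point FTheta mt) => //.
exact: (measurable_past FTheta mt).
Qed.

Lemma birth_window_section w u t :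
  xsection (birth_window u t) w = xsection birth w `&` [set q | u < time q <= t].
Proof. by apply/seteqP; split => q; rewrite /xsection/= !inE. Qed.

Lemma birth_window_domain w t : Theta w ->
  xsection (birth_window 0 t) w = birth_domain alpha p (Xm w) t.
Proof.
move=> Tw; rewrite birth_window_section (@birth_domainE R d Omega Ft alpha p Xm Theta w t Tw).
apply/seteqP; split => q [bq]; first by move=> /= /andP[_ ->].
by move=> /= ->; split => //; rewrite andbT; case/(birth_sectionE _ _ _ _ Tw): bq.
Qed.

Lemma birth_windowP u t z : birth_window u t z -> Theta z.1 /\ 0 < time z.2.
Proof. by move=> [[[]]]. Qed.

Lemma measurable_birth_domain w t : Theta w -> measurable (birth_domain alpha p (Xm w) t).
Proof.
move=> Tw; rewrite -(birth_window_domain _ Tw) birth_window_section.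
exact: (measurable_birth_window hFt halpha alpha0 hp FTheta mX XmE).
Qed.

Lemma predictable_mass_below K :
  measurable (pst `&` [set z | mass_below (X ^~ z.1) K (time z.2)]).
Proof.
have mm (r : R) : 0 <= r -> Ft r [set w | ~~ (mass (X r w) <= K%:R)].
  move=> r0; have := sub_measurable_pairing hFt r0 (mX r0) (bounded_continuous_cst 1).
  move=> /(_ `]K%:R, +oo[%classic (measurable_itv _)); congr (Ft r _).
  by apply/seteqP; split => w /=; rewrite pairing_cst mul1r in_itv/= andbT -ltNge.
rewrite (_ : _ `&` _ = pst `\` \bigcup_(r : rat) (if 0 <= (ratr r : R) then
   [set w | ~~ (mass (X (ratr r) w) <= K%:R)] `*` [set q | ratr r < time q] else set0)); last first.
  apply/seteqP; split => -[w q] [pz] h; split => //.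
    move=> [r _]; case: ifPn => // r0 [/= /negP Kr rq]; apply: Kr; apply: h.
    by rewrite r0.
  move=> r /andP[r0 rq]; apply: contrapT => /negP Kr; apply: h; exists r => //.
  by rewrite r0.
apply: measurableD; first exact: (measurable_past FTheta mt).
apply: bigcupT_measurable_rat => r; case: ifPn => // r0.
apply: sub_sigma_algebra; exists (ratr r), [set w | ~~ (mass (X (ratr r) w) <= K%:R)], [set q | ratr r < time q].
split => //; first exact: mm.
rewrite (_ : mkset _ = time @^-1` `]ratr r, +oo[); last by apply/seteqP; split => q; rewrite /= in_itv/= andbT.
by rewrite -[X in measurable X]setTI; exact: mt.
Qed.

(** The births are counted while the mass is below K, so that all means are
    finite before the moment bound is known. *)
Definition small_litter K (z : Omega * pointT R) : \bar R :=
  ((litter_of z.2)%:R * \1_(mass_below (X ^~ z.1) K) (time z.2))%:E.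

Lemma small_litter_ge0 K z : (0 <= small_litter K z)%E.
Proof. by rewrite lee_fin mulr_ge0. Qed.

Lemma predictable_litter : measurable_fun pst (fun z => (litter_of z.2)%:R : RT).
Proof. exact: (predictable_point FTheta measurable_litterR). Qed.

Lemma measurable_small_litter K u t :
  measurable_fun (birth_window u t) (small_litter K : predT Ft time -> \bar R).
Proof.
have sub : birth_window u t `<=` pst by move=> z [[]].
have mp := measurable_past FTheta mt.
apply: (measurable_funS mp sub); apply/measurable_EFinP; apply: measurable_funM.
  exact: predictable_litter.
rewrite (_ : (fun _ => _) = (fun z : predT Ft time => \1_[set z : predT Ft time | mass_below (X ^~ z.1) K (time z.2)] z)); last first.
  by apply/funext => z; rewrite !indicE; congr (_%:R); apply/idP/idP => /set_mem h; exact/mem_set.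
move=> _ B mB; rewrite (_ : _ `&` _ =
   (pst `&` [set z | mass_below (X ^~ z.1) K (time z.2)] `&` (if 1 \in B then setT else set0)) `|`
   ((pst `\` (pst `&` [set z | mass_below (X ^~ z.1) K (time z.2)])) `&` (if 0 \in B then setT else set0))).
  apply: measurableU; apply: measurableI; try by case: ifP.
    exact: predictable_mass_below.
  by apply: measurableD => //; exact: predictable_mass_below.
apply/seteqP; split => z /=.
  move=> [pz]; rewrite indicE; case: (boolP (z \in _)) => [/set_mem/= zm B1|].
    by left; split => //; rewrite (mem_set B1).
  rewrite notin_setE => zm B0; right; split; first by split => // -[].
  by rewrite (mem_set B0).
move=> [[[pz zm]]|[[pz zm]]]; case: ifP => // /set_mem Bz _; split => //; rewrite indicE.
  by rewrite mem_set.
by rewrite memNset// => h; apply: zm.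
Qed.

Definition stock K u t w : \bar R := (\int[M w]_(q in xsection (birth_window u t) w) small_litter K (w, q))%E.

Lemma stock_ge0 K u t w : (0 <= stock K u t w)%E.
Proof. by apply: integral_ge0 => q _; exact: small_litter_ge0. Qed.

Lemma stock_compensation K u t :
  [/\ measurable_fun setT (stock K u t),
      measurable_fun setT (fun w => \int[m]_(q in xsection (birth_window u t) w) small_litter K (w, q))%E &
   (\int[P]_w stock K u t w =
   \int[P]_w \int[m]_(q in xsection (birth_window u t) w) small_litter K (w, q))%E].
Proof.
apply: (predictable_compensation hFt hM).
- exact: measurable_birth_windowT.
- by move=> z /birth_windowP[].
- exact: measurable_small_litter.
- by move=> z _; exact: small_litter_ge0.
Qed.

Hypothesis C0 : 0 <= C.

(** alpha is at most C and the mean offspring at most mb. *)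
Lemma mean_offspring (mu : posMeasure R) :
  (\sum_(n <oo) (pairing mu (fun x => alpha x * p x n))%:E * n%:R%:E <= (C * mb * mass mu)%:E)%E.
Proof.
have map_ n : measurable_fun (D0 : set RT) ((fun x => alpha x * p x n) : RT -> RT).
  by apply: measurable_funM; exact: bounded_continuous_measurable.
have ap0 n x : D0 x -> 0 <= alpha x * p x n.
  by move=> Dx; apply: mulr_ge0; [exact: alpha0|have /andP[] := hp1 n Dx].
have apC n x : D0 x -> `|alpha x * p x n| <= C.
  move=> Dx; rewrite ger0_norm ?ap0// -[leRHS]mulr1; have /andP[a b] := hp1 n Dx.
  by apply: ler_pM => //; [exact: alpha0|exact: alphaC].
rewrite (_ : (\sum_(n <oo) _)%E = (\sum_(n <oo) \int[mu]_(x in D0) (alpha x * p x n * n%:R)%:E)%E); last first.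
  apply: eq_eseriesr => n _; rewrite (pairing_EFin mu (map_ n) (apC n)) muleC -ge0_integralZl_EFin//.
  - by apply: eq_integral => x _; rewrite -EFinM mulrC.
  - by move=> x Dx; rewrite lee_fin; exact: ap0.
  - by apply/measurable_EFinP; exact: map_.
rewrite -integral_nneseries//; last 2 first.
- by move=> n; apply/measurable_EFinP; apply: measurable_funM => //; exact: map_.
- by move=> n x Dx; rewrite lee_fin mulr_ge0// ap0.
apply: (@le_trans _ _ (\int[mu]_(x in D0) (C * mb)%:E)%E).
  apply: ge0_le_integral_any.
    by move=> x Dx; apply: nneseries_ge0 => n _ _; rewrite lee_fin mulr_ge0// ap0.
  move=> x Dx; have := hpm Dx => pmb.
  rewrite (_ : (\sum_(n <oo) _)%E = (alpha x)%:E * \sum_(n <oo) (n%:R * p x n)%:E)%E; last first.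
    rewrite -nneseriesZl; last by move=> n _; rewrite lee_fin mulr_ge0//; have /andP[] := hp1 n Dx.
    by apply: eq_eseriesr => n _; rewrite -EFinM; congr EFin; ring.
  have s0 : (0 <= \sum_(n <oo) (n%:R * p x n)%:E)%E.
    by apply: nneseries_ge0 => n _ _; rewrite lee_fin mulr_ge0//; have /andP[] := hp1 n Dx.
  rewrite EFinM; apply: lee_pmul => //; rewrite lee_fin; first exact: alpha0.
  exact: alphaC.
rewrite integral_cst// [leRHS]EFinM massE.
by rewrite [X in (_ * X <= _)%E](_ : _ = mu setT); last exact: mass_D0.
Qed.

Lemma mean_litter_ge0 : (exists x, D0 x) -> 0 <= mb.
Proof.
move=> [x Dx]; rewrite -lee_fin; apply: le_trans (hpm Dx).
by apply: nneseries_ge0 => n _ _; rewrite lee_fin mulr_ge0//; have /andP[] := hp1 n Dx.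
Qed.

Lemma stock_rate_bound K u t w (B : \bar R) : Theta w -> 0 <= u -> u <= t -> (0 <= B)%E ->
  (forall s, u < s <= t -> mass_below (X ^~ w) K s -> ((mass (Xm w s))%:E <= B)%E) ->
  (\int[m]_(q in xsection (birth_window u t) w) small_litter K (w, q) <=
   ((t - u) * (C * mb))%:E * B)%E.
Proof.
move=> Tw u0 ut B0 hB.
have mb0 : 0 <= mb by apply: mean_litter_ge0; exists 1; rewrite /= in_itv/= andbT.
pose h s (n : nat) (z : seqT R) : \bar R := (n%:R * \1_(mass_below (X ^~ w) K) s)%:E.
have mbel : measurable (mass_below (X ^~ w) K : set RT) by exact: measurable_mass_below.
rewrite birth_window_section (compensator_formula hFt halpha alpha0 hp hp1 Ginf FTheta mX XmE (h := h) (u := u) t Tw u0); last 2 first.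
- apply/measurable_EFinP; apply: measurable_funM; first exact: measurable_litterR.
  have mi : measurable_fun setT (\1_(mass_below (X ^~ w) K) : RT -> RT) by exact: measurable_indic.
  exact: (measurableT_comp mi mt).
- by move=> s n z; rewrite lee_fin mulr_ge0.
apply: (@le_trans _ _ (\int[leb]_(s in `]u, t]) ((C * mb)%:E * B))%E).
  apply: ge0_le_integral_any => s.
    move=> _; apply: nneseries_ge0 => n _ _; apply: mule_ge0.
      rewrite lee_fin; apply: pairing_ge0 => x Dx.
      by apply: mulr_ge0; [exact: alpha0|have /andP[] := hp1 n Dx].
    by apply: integral_ge0 => z _; rewrite lee_fin mulr_ge0.
  rewrite /= in_itv/= => st.
  have CB0 : (0 <= (C * mb)%:E * B)%E by apply: mule_ge0 => //; rewrite lee_fin mulr_ge0.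
  case: (pselect (mass_below (X ^~ w) K s)) => [sK|nsK]; last first.
    rewrite eseries0// => n _ _; rewrite (eq_integral (cst 0%E)).
      by rewrite integral_cst ?mul0e ?mule0//; exact: measurable_posseq.
    by move=> z _; rewrite /h indicE memNset// mulr0.
  apply: (@le_trans _ _ (\sum_(n <oo) (pairing (Xm w s) (fun x => alpha x * p x n))%:E * n%:R%:E)%E).
    apply: lee_nneseries => [n _ _|n _].
      apply: mule_ge0; last by apply: integral_ge0 => z _; rewrite lee_fin mulr_ge0.
      rewrite lee_fin; apply: pairing_ge0 => x Dx.
      by apply: mulr_ge0; [exact: alpha0|have /andP[] := hp1 n Dx].
    apply: lee_pmul => //.
    - rewrite lee_fin; apply: pairing_ge0 => x Dx.
      by apply: mulr_ge0; [exact: alpha0|have /andP[] := hp1 n Dx].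
    - by apply: integral_ge0 => z _; rewrite lee_fin mulr_ge0.
    rewrite /h integral_cst//; last exact: measurable_posseq.
    rewrite indicE mem_set// mulr1 -[leRHS]mule1; apply: lee_pmul => //.
    by apply: probability_le1; exact: measurable_posseq.
  apply: (le_trans (mean_offspring _)); rewrite EFinM; apply: lee_pmul => //.
  - by rewrite lee_fin mulr_ge0.
  - by rewrite lee_fin mass_ge0.
  - exact: hB.
rewrite integral_cst// (_ : ((t - u) * (C * mb))%:E * B = (C * mb)%:E * B * (t - u)%:E)%E; last first.
  by rewrite EFinM -muleA muleC.
apply: lee_wpmul2l; first by apply: mule_ge0 => //; rewrite lee_fin mulr_ge0.
have lE : lebesgue_measure (`]u, t] : set R) = (t - u)%:E.
  rewrite lebesgue_measure_itv/= lte_fin; case: ltP => // tu.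
  by rewrite (_ : t = u) ?subrr//; apply/eqP; rewrite eq_le tu.
by rewrite [leLHS](_ : _ = (t - u)%:E); last exact: lE.
Qed.

(** The rate is at most C mb times the mass, which is bounded by K because of
    the truncation, and by the initial mass plus the children born so far. *)
Lemma stock_rate K u t w : Theta w -> 0 <= u -> u <= t ->
  (\int[m]_(q in xsection (birth_window u t) w) small_litter K (w, q) <=
   ((t - u) * (C * mb))%:E * K%:R%:E)%E /\
  (\int[m]_(q in xsection (birth_window u t) w) small_litter K (w, q) <=
   ((t - u) * (C * mb))%:E * ((mass (X 0 w))%:E + stock K 0 t w))%E.
Proof.
move=> Tw u0 ut.
have st0 : (0 <= stock K 0 t w)%E by exact: stock_ge0.
split; apply: stock_rate_bound => //.
- move=> s /andP[us _] /mass_belowP sK; rewrite lee_fin.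
  apply: (mass_left (Y := X ^~ w)).
  + by move=> r r0; exact: XmE.
  + exact: le_lt_trans us.
  + by apply: sK; exact: Xright.
- by rewrite adde_ge0// lee_fin mass_ge0.
- move=> s /andP[us st] sK.
  have [->|fin] := eqVneq (stock K 0 t w) +oo%E; first by rewrite addey// leey.
  have fE : stock K 0 t w = (fine (stock K 0 t w))%:E by rewrite fineK// ge0_fin_numE// ltey.
  rewrite fE -EFinD lee_fin; apply: (mass_left (Y := X ^~ w)).
  + by move=> r r0; exact: XmE.
  + exact: le_lt_trans us.
  move=> r /andP[r0 rs]; rewrite -lee_fin EFinD -fE.
  apply: (le_trans (mass_le_births (Y := X ^~ w) (fun v x v0 x0 => XE Tw v0 x0)
    (fun v => measurable_birth_domain v Tw) r0)).
  apply: leeD => //.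
  have rt : r <= t by rewrite (le_trans (ltW rs)).
  rewrite /stock birth_window_domain// (birth_domain_time _ _ _ rt).
  rewrite [leLHS]integral_mkcondr; apply: ge0_le_integral_any => q Dq.
    by rewrite patchE; case: ifP => // _; rewrite lee_fin.
  rewrite patchE; case: ifPn => [/set_mem/= qr|_]; last exact: small_litter_ge0.
  rewrite /small_litter/= indicE mem_set ?mulr1//.
  by apply: mass_below_le sK; rewrite (le_trans qr (ltW rs)).
Qed.

Lemma birth_window_off u t w : ~ Theta w -> xsection (birth_window u t) w = set0.
Proof. by move=> nT; apply/seteqP; split => q //; rewrite /xsection/= inE => /birth_windowP[]. Qed.

Lemma measurable_section u t w : measurable (xsection (birth_window u t) w).
Proof.
rewrite birth_window_section.
exact: (measurable_birth_window hFt halpha alpha0 hp FTheta mX XmE).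
Qed.

Lemma measurable_small_litter_section K w A : measurable_fun A (fun q => small_litter K (w, q)).
Proof.
apply: measurable_funTS; apply/measurable_EFinP; apply: measurable_funM; first exact: measurable_litterR.
have mbel : measurable (mass_below (X ^~ w) K : set RT) by exact: measurable_mass_below.
have mi : measurable_fun setT (\1_(mass_below (X ^~ w) K) : RT -> RT) by exact: measurable_indic.
exact: (measurableT_comp mi mt).
Qed.

Let x0 := (\int[P]_(w in Theta) (mass (X 0 w))%:E)%E.

Lemma stock_mean_fin K u t : 0 <= u -> u <= t -> (\int[P]_w stock K u t w < +oo)%E.
Proof.
move=> u0 ut; have [_ _ ->] := stock_compensation K u t.
have mb0 : 0 <= mb by apply: mean_litter_ge0; exists 1; rewrite /= in_itv/= andbT.
apply: (@le_lt_trans _ _ (\int[P]_w (((t - u) * (C * mb))%:E * K%:R%:E))%E).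
  apply: ge0_le_integral_any => w _; first by apply: integral_ge0 => q _; exact: small_litter_ge0.
  have [Tw|nT] := pselect (Theta w); first by have [] := stock_rate K Tw u0 ut.
  by rewrite birth_window_off// integral_set0 -EFinM lee_fin !mulr_ge0// subr_ge0.
rewrite integral_cst// [X in (_ * X < _)%E](_ : _ = 1%E); last exact: probability_setT.
by rewrite mule1 ltry.
Qed.

Lemma stock_mean_rate K u t : 0 <= u -> u <= t ->
  (\int[P]_w stock K u t w <= ((t - u) * (C * mb))%:E * (x0 + \int[P]_w stock K 0 t w))%E.
Proof.
move=> u0 ut; have [_ _ ->] := stock_compensation K u t.
have mb0 : 0 <= mb by apply: mean_litter_ge0; exists 1; rewrite /= in_itv/= andbT.
have mTheta : measurable Theta by exact: filt_measurable hFt _ _ (lexx 0) FTheta.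
have [mst _ _] := stock_compensation K 0 t.
have mm : measurable_fun Theta (fun w => (mass (X 0 w))%:E).
  apply/measurable_EFinP; apply: measurable_funTS => _ B mB; rewrite setTI.
  apply: (filt_measurable hFt (lexx 0)).
  have := sub_measurable_pairing hFt (lexx 0) (mX (lexx 0)) (bounded_continuous_cst 1) mB.
  by congr (Ft 0 _); apply/seteqP; split => w /=; rewrite pairing_cst mul1r.
apply: (@le_trans _ _ (\int[P]_(w in Theta) (((t - u) * (C * mb))%:E * ((mass (X 0 w))%:E + stock K 0 t w)))%E).
  rewrite [leRHS]integral_mkcond.
  apply: ge0_le_integral_any => w _; first by apply: integral_ge0 => q _; exact: small_litter_ge0.
  rewrite patchE; case: ifPn => [/set_mem Tw|/negP nT]; first by have [] := stock_rate K Tw u0 ut.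
  by rewrite birth_window_off ?integral_set0// => Tw; apply: nT; exact: mem_set.
rewrite ge0_integralZl_EFin//; last 3 first.
- by move=> w _; rewrite adde_ge0// ?lee_fin ?mass_ge0// stock_ge0.
- by apply: emeasurable_funD => //; exact: measurable_funTS.
- by rewrite !mulr_ge0// subr_ge0.
apply: lee_pmul => //.
- by rewrite lee_fin !mulr_ge0// subr_ge0.
- by apply: integral_ge0 => w _; rewrite adde_ge0// ?lee_fin ?mass_ge0// stock_ge0.
rewrite ge0_integralD//; last 3 first.
- by move=> w _; rewrite lee_fin mass_ge0.
- by move=> w _; exact: stock_ge0.
- exact: measurable_funTS.
apply: leeD => //; apply: ge0_subset_integral => //.
by move=> w _; exact: stock_ge0.
Qed.

Lemma stock_add K u t w : 0 <= u -> u <= t -> stock K 0 t w = (stock K 0 u w + stock K u t w)%E.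
Proof.
move=> u0 ut; rewrite /stock.
have E : xsection (birth_window 0 t) w = xsection (birth_window 0 u) w `|` xsection (birth_window u t) w.
  rewrite !birth_window_section -setIUr; congr (_ `&` _).
  apply/seteqP; split => q /=.
    by move=> /andP[q0 qt]; have [qu|uq] := leP (time q) u; [left; rewrite q0|right].
  by move=> [/andP[-> qu]|/andP[uq ->]]; rewrite ?(le_trans qu)// (le_lt_trans u0).
rewrite E ge0_integral_setU//.
- exact: measurable_section.
- exact: measurable_section.
- exact: measurable_small_litter_section.
- by move=> q _; exact: small_litter_ge0.
- apply/disj_setPLR => q; rewrite !birth_window_section => -[_ /= /andP[_ qu]] [_ /= /andP[]].
  by rewrite ltNge qu.
Qed.

Hypothesis x0fin : (x0 < +oo)%E.
(** A time step so small that delta * (C * mb) <= 1/2. *)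
Let delta : R := (2 * (C * mb + 1))^-1.

(** Gronwall in steps: with x0 the initial mean, v the mean at one grid time and
    v' at the next, [stock_mean_rate] gives v' <= v + (x0 + v') / 2, that is v'
    <= 2 v + x0. *)
Lemma stock_mean_bound K j :
  (\int[P]_w stock K 0 (j%:R * delta) w <= (2 ^+ j * fine x0)%:E)%E.
Proof.
have mb0 : 0 <= mb by apply: mean_litter_ge0; exists 1; rewrite /= in_itv/= andbT.
have Cmb0 : 0 <= C * mb by rewrite mulr_ge0.
have d0 : 0 < delta by rewrite /delta invr_gt0 mulr_gt0// ltr_wpDl.
have x00 : (0 <= x0)%E by apply: integral_ge0 => w _; rewrite lee_fin mass_ge0.
have xE : x0 = (fine x0)%:E by rewrite fineK// ge0_fin_numE.
have xr : 0 <= fine x0 by exact: fine_ge0.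
have jd (i : nat) : 0 <= i%:R * delta by rewrite mulr_ge0// ltW.
have [v [vE v0]] : exists v : nat -> R,
    (forall i, (\int[P]_w stock K 0 (i%:R * delta) w)%E = (v i)%:E) /\ forall i, 0 <= v i.
  exists (fun j => fine (\int[P]_w stock K 0 (j%:R * delta) w)%E); split => i.
    rewrite fineK// ge0_fin_numE; first exact: stock_mean_fin.
    by apply: integral_ge0 => w _; exact: stock_ge0.
  by apply: fine_ge0; apply: integral_ge0 => w _; exact: stock_ge0.
suff : v j <= (2 ^+ j - 1) * fine x0.
  by rewrite vE lee_fin => h; apply: (le_trans h); rewrite ler_wpM2r// lerBlDr lerDl.
elim: j => [|j IH].
  rewrite expr0 subrr mul0r -lee_fin -vE mul0r (_ : (\int[P]_w _)%E = 0%E)//.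
  under eq_integral => w _.
    rewrite /stock birth_window_section (_ : [set q | 0 < time q <= 0] = set0); last first.
      by apply/seteqP; split => q //= /andP[h1 h2]; move: (lt_le_trans h1 h2); rewrite ltxx.
    rewrite setI0 integral_set0; over.
  by rewrite integral_cst// mul0e.
have le1 : j%:R * delta <= j.+1%:R * delta by apply: ler_wpM2r; [exact: ltW|rewrite ler_nat].
have : (v j.+1)%:E = ((v j)%:E + \int[P]_w stock K (j%:R * delta) (j.+1%:R * delta) w)%E.
  rewrite -!vE; transitivity (\int[P]_w (stock K 0 (j%:R * delta) w + stock K (j%:R * delta) (j.+1%:R * delta) w))%E.
    by apply: eq_integral => w _; exact: stock_add.
  apply: ge0_integralD; first exact: measurableT.
  - by move=> w _; exact: stock_ge0.
  - by have [] := stock_compensation K 0 (j%:R * delta).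
  - by move=> w _; exact: stock_ge0.
  - by have [] := stock_compensation K (j%:R * delta) (j.+1%:R * delta).
move=> h2; have h1 := stock_mean_rate K (jd j) le1.
rewrite vE xE -EFinD -EFinM in h1.
have : ((v j.+1)%:E <= (v j)%:E + ((j.+1%:R * delta - j%:R * delta) * (C * mb) * (fine x0 + v j.+1))%:E)%E.
  by rewrite h2 leeD2l//.
rewrite -EFinD lee_fin.
have -> : j.+1%:R * delta - j%:R * delta = delta by rewrite -mulrBl -natrB// subSnn mul1r.
have : delta * (C * mb) <= 2^-1.
  have : delta * (2 * (C * mb + 1)) = 1 by rewrite /delta mulVf// gt_eqF// mulr_gt0// ltr_wpDl.
  by move: d0; lra.
set a := delta * _ => ha h.
have a0 : 0 <= a by rewrite /a mulr_ge0// ltW.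
have : a * (fine x0 + v j.+1) <= 2^-1 * (fine x0 + v j.+1) by rewrite ler_wpM2r// addr_ge0.
by rewrite exprS; lra.
Qed.

Definition bounded_stock t w : \bar R := (\int[M w]_(q in xsection (birth_window 0 t) w)
  ((litter_of q)%:R * \1_(mass_bounded (X ^~ w)) (time q))%:E)%E.

Lemma stock_cvg t w : stock K 0 t w @[K --> \oo] --> bounded_stock t w.
Proof.
have hc q : small_litter K (w, q) @[K --> \oo] --> ((litter_of q)%:R * \1_(mass_bounded (X ^~ w)) (time q))%:E.
  apply: cvg_near_cst; have [[K0 _ hK]|nb] := pselect (mass_bounded (X ^~ w) (time q)).
    near=> K; rewrite /small_litter/= !indicE !mem_set//.
      by exists K0.
    by apply: mass_below_nd hK; near: K; exact: nbhs_infty_ge.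
  near=> K; rewrite /small_litter/= !indicE !memNset// => hK; apply: nb; by exists K.
have := @cvg_monotone_convergence _ _ _ (M w) (xsection (birth_window 0 t) w) (measurable_section 0 t w)
  (fun K q => small_litter K (w, q)).
have -> : (fun q => limn (small_litter ^~ (w, q))) = (fun q => ((litter_of q)%:R * \1_(mass_bounded (X ^~ w)) (time q))%:E).
  by apply/funext => q; apply/cvg_lim => //; exact: hc.
apply.
- by move=> K; exact: measurable_small_litter_section.
- by move=> K q _; exact: small_litter_ge0.
- move=> q _ K L KL; rewrite /small_litter lee_fin ler_wpM2l//= !indicE.
  case: (boolP (_ \in mass_below _ K)) => // /set_mem hK.
  by rewrite mem_set//; exact: mass_below_nd hK.
Unshelve. all: by end_near.
Qed.

Lemma bounded_stock_mean j :
  (\int[P]_w bounded_stock (j%:R * delta) w <= (2 ^+ j * fine x0)%:E)%E.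
Proof.
have c : (\int[P]_w stock K 0 (j%:R * delta) w)%E @[K --> \oo] --> (\int[P]_w bounded_stock (j%:R * delta) w)%E.
  have := @cvg_monotone_convergence _ _ _ P setT measurableT (fun K w => stock K 0 (j%:R * delta) w).
  have -> : (fun w => limn (fun K => stock K 0 (j%:R * delta) w)) = bounded_stock (j%:R * delta).
    by apply/funext => w; apply/cvg_lim => //; exact: stock_cvg.
  apply.
  - by move=> K; have [] := stock_compensation K 0 (j%:R * delta).
  - by move=> K w _; exact: stock_ge0.
  - move=> w _ K L KL; apply: ge0_le_integral_any => q _; first exact: small_litter_ge0.
    rewrite /small_litter lee_fin ler_wpM2l//= !indicE.
    case: (boolP (_ \in mass_below _ K)) => // /set_mem hK.
    by rewrite mem_set//; exact: mass_below_nd hK.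
rewrite -(cvg_lim _ c)//; apply: lime_le; first by apply/cvg_ex; eexists; exact: c.
by apply: nearW => K; exact: stock_mean_bound.
Qed.

Lemma measurable_bounded_stock t : measurable_fun setT (bounded_stock t).
Proof.
apply: (emeasurable_fun_cvg (fun K => stock K 0 t)).
  by move=> K; have [] := stock_compensation K 0 t.
by move=> w _; exact: stock_cvg.
Qed.

Definition litter_stock t w : \bar R :=
  (\int[M w]_(q in xsection (birth_window 0 t) w) (litter_of q)%:R%:E)%E.

Lemma litter_stock_ge0 t w : (0 <= litter_stock t w)%E.
Proof. by apply: integral_ge0 => q _; rewrite lee_fin. Qed.

Lemma measurable_litter_stock t : measurable_fun setT (litter_stock t).
Proof.
have [] // := predictable_compensation hFt hM (S := birth_window 0 t) (H := fun z => (litter_of z.2)%:R%:E).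
- exact: measurable_birth_windowT.
- by move=> z /birth_windowP[].
- have sub : birth_window 0 t `<=` pst by move=> z [[]].
  apply: (measurable_funS (measurable_past FTheta mt) sub); apply/measurable_EFinP.
  exact: predictable_litter.
Qed.

Lemma litter_stock_le s t w : s <= t -> (litter_stock s w <= litter_stock t w)%E.
Proof.
move=> st; apply: ge0_subset_integral => //.
- exact: measurable_section.
- exact: measurable_section.
- by apply/measurable_EFinP; apply: measurable_funTS; exact: measurable_litterR.
- move=> q; rewrite !birth_window_section => -[bq /= /andP[q0 qs]]; split => //=.
  by rewrite q0 (le_trans qs).
Qed.

(** When this integral is finite there is no explosion, so that the truncation
    removes nothing. *)
Lemma bounded_stockE t w : 0 <= t -> (bounded_stock t w < +oo)%E -> litter_stock t w = bounded_stock t w.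
Proof.
move=> t0; have [Tw|nT] := pselect (Theta w); last first.
  by rewrite /litter_stock /bounded_stock birth_window_off// !integral_set0.
have E : bounded_stock t w = (\int[M w]_(q in birth_domain alpha p (Xm w) t `&` time @^-1` mass_bounded (X ^~ w)) (litter_of q)%:R%:E)%E.
  rewrite integral_mkcondr /bounded_stock birth_window_domain//; apply: eq_integral => q _.
  rewrite patchE indicE; case: ifPn => [/set_mem/= h|nh]; first by rewrite mem_set// mulr1.
  by rewrite memNset ?mulr0// => h; move: nh; rewrite mem_set.
rewrite E => fin.
have [_ sub] := no_explosion (Y := X ^~ w) (Xright Tw) (fun v x v0 x0 => XE Tw v0 x0)
    (fun v => measurable_birth_domain v Tw) t0 fin.
by rewrite /litter_stock birth_window_domain// setIidl.
Qed.

(** The bound of [stock_mean_bound] is uniform in K; let K tend to infinity. *)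
Theorem litter_moment :
  {ae P, forall w, forall t, (litter_stock t w < +oo)%E} /\
  forall t, (\int[P]_w litter_stock t w < +oo)%E.
Proof.
have mb0 : 0 <= mb by apply: mean_litter_ge0; exists 1; rewrite /= in_itv/= andbT.
have d0 : 0 < delta by rewrite /delta invr_gt0 mulr_gt0// ltr_wpDl// mulr_ge0.
have jd (i : nat) : 0 <= i%:R * delta by rewrite mulr_ge0// ltW.
have jt t : exists j : nat, t <= j%:R * delta.
  by exists (Num.truncn (t / delta)).+1; rewrite -ler_pdivrMr// ltW// truncnS_gt.
have fin j : {ae P, forall w, (bounded_stock (j%:R * delta) w < +oo)%E}.
  have : P.-integrable setT (bounded_stock (j%:R * delta)).
    apply/integrableP; split; first exact: measurable_bounded_stock.
    rewrite (eq_integral (bounded_stock (j%:R * delta))).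
      by apply: le_lt_trans (bounded_stock_mean j) _; rewrite ltry.
    move=> w _; rewrite gee0_abs//; apply: integral_ge0 => q _; rewrite lee_fin mulr_ge0//.
  move=> /(integrable_ae measurableT); apply: filterS => w /(_ I).
  by rewrite fin_numE => /andP[_]; rewrite -ltey.
split.
  have /ae_foralln := fin; apply: filterS => w h t; have [j tj] := jt t.
  apply: (le_lt_trans (litter_stock_le _ tj)).
  by rewrite bounded_stockE.
move=> t; have [j tj] := jt t.
apply: (@le_lt_trans _ _ (\int[P]_w litter_stock (j%:R * delta) w)%E).
  apply: ge0_le_integral_any => w _; [exact: litter_stock_ge0|exact: litter_stock_le].
rewrite (ge0_ae_eq_integral (g := bounded_stock (j%:R * delta)))//.
- by apply: le_lt_trans (bounded_stock_mean j) _; rewrite ltry.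
- exact: measurable_litter_stock.
- exact: measurable_bounded_stock.
- by move=> w _; exact: litter_stock_ge0.
- by move=> w _; apply: integral_ge0 => q _; rewrite lee_fin mulr_ge0.
- by apply: filterS (fin j) => w h _; rewrite bounded_stockE.
Qed.

End moments.

(** * Genealogy of a path *)

Section ancestral_measure.
Context {R : realType}.
Local Notation D0 := (`]0, +oo[%classic : set R).
Local Notation RT := (measurableTypeR R).
Local Notation time := (@time_of R).
Variables (m : {measure set (pointT R) -> \bar R}) (mu : posMeasure R) (D : set (pointT R)).
Hypothesis mD : measurable D.

Definition founder (x : RT) : RT * RT := (0, x).

Definition child (i : nat) (q : pointT R) : RT * RT := (time q, time q + lives_of q i).

Lemma measurable_founder : measurable_fun setT founder.
Proof. by apply/measurable_fun_pairP; split; [exact: measurable_cst|exact: measurable_id]. Qed.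

Lemma measurable_child i : measurable_fun setT (child i).
Proof.
apply/measurable_fun_pairP; split; first exact: measurable_time_of.
apply: measurable_funD; first exact: measurable_time_of.
exact: (measurableT_comp (measurable_coord i) measurable_lives_of).
Qed.

Lemma measurable_litter_gt (i : nat) : measurable (D `&` [set q | (i < litter_of q)%N]).
Proof.
apply: measurableI => //.
rewrite (_ : mkset _ = @litter_of R @^-1` [set n | (i < n)%N])//.
by rewrite -[X in measurable X]setTI; exact: measurable_litter_of.
Qed.

Local Open Scope ereal_scope.

(** The sum of the images of mu under x |-> (0, x) and, for each i, of the
    births with more than i children under q |-> (time, time + i-th life). *)
Lemma ancestral_measure : exists L : {measure set (RT * RT)%type -> \bar R},
  forall phi : RT * RT -> \bar R, measurable_fun setT phi -> (forall z, 0 <= phi z) ->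
  \int[L]_z phi z = \int[mu]_(x in D0) phi (0%R, x) +
    \int[m]_(q in D) \sum_(i < litter_of q) phi (time q, (time q + lives_of q i)%R).
Proof.
pose L0 : {measure set (RT * RT)%type -> \bar R} :=
  push (mrestr mu (measurable_itv `]0%R, +oo[)) measurable_founder.
pose Li i : {measure set (RT * RT)%type -> \bar R} :=
  push (mrestr m (measurable_litter_gt i)) (measurable_child i).
pose L1 : {measure set (RT * RT)%type -> \bar R} := mseries Li 0.
exists (measure_add L0 L1) => phi mphi phi0.
rewrite ge0_integral_measure_add//; congr (_ + _).
  by rewrite integral_push// integral_mrestr//; apply: measurableT_comp => //; exact: measurable_founder.
rewrite ge0_integral_measure_series//.
have mc i : measurable_fun setT (fun q => phi (child i q)).
  by apply: measurableT_comp => //; exact: measurable_child.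
transitivity (\sum_(0 <= i <oo) \int[m]_(q in D) ((fun q => phi (child i q)) \_ [set q | (i < litter_of q)%N]) q).
  apply: eq_eseriesr => i _; rewrite integral_push// integral_mrestr//.
  by rewrite integral_mkcondr.
rewrite -integral_nneseries//.
- apply: eq_integral => q _; rewrite (nneseries_split 0 (litter_of q))//; last first.
    by move=> i _; rewrite patchE; case: ifP.
  rewrite add0n [X in _ + X]eseries0 ?adde0; last first.
    by move=> i ni _; rewrite patchE memNset//= ltnNge ni.
  rewrite big_mkord; apply: eq_bigr => i _; rewrite patchE mem_set//=.
- move=> i; apply: measurable_funTS; apply/measurable_restrict => //.
  + rewrite (_ : mkset _ = @litter_of R @^-1` [set n | (i < n)%N])//.
    by rewrite -[X in measurable X]setTI; exact: measurable_litter_of.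
  + by rewrite setTI; exact: measurable_funTS.
- by move=> i q _; rewrite patchE; case: ifP.
Qed.

End ancestral_measure.

Section transport.
Context {R : realType}.
Local Notation D0 := (`]0, +oo[%classic : set R).
Local Notation RT := (measurableTypeR R).
Local Notation time := (@time_of R).
Variables (alpha : R -> R) (p : R -> nat -> R).
Variables (m : {measure set (pointT R) -> \bar R}) (Y Ym : R -> posMeasure R).
Local Notation D := (birth_domain alpha p Ym).
Hypothesis YE : forall t x, 0 <= t -> 0 < x ->
  ((dist_fun (Y t) x)%:E = (dist_fun (Y 0) (x + t) - dist_fun (Y 0) t)%:E +
   \int[m]_(q in D t) (births t x q)%:E)%E.
Hypothesis mD : forall t, measurable (D t).
Variable T : R.
Hypothesis finT : (\int[m]_(q in D T) (litter_of q)%:R%:E < +oo)%E.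
Variable L : {measure set (RT * RT)%type -> \bar R}.
Hypothesis LE : forall phi : RT * RT -> \bar R, measurable_fun setT phi -> (forall z, (0 <= phi z)%E) ->
  (\int[L]_z phi z = \int[Y 0%R]_(x in D0) phi (0%R, x) +
    \int[m]_(q in D T) \sum_(i < litter_of q) phi (time q, (time q + lives_of q i)%R))%E.

Lemma ancestral_fin : (L setT < +oo)%E.
Proof.
rewrite -[ltLHS]mul1e -integral_cst// LE//.
rewrite integral_cst// mul1e; apply: lte_add_pinfty; first exact: pos_measure_fin.
rewrite (eq_integral (fun q => (litter_of q)%:R%:E))// => q _.
by rewrite sumEFin sumr_const card_ord.
Qed.

Let alive (t : R) : set (RT * RT) := [set z | z.1 <= t /\ t < z.2].

Let m_alive t : measurable (alive t).
Proof.
have mf1 : measurable_fun setT (fst : RT * RT -> RT) by exact: measurable_fst.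
have mf2 : measurable_fun setT (snd : RT * RT -> RT) by exact: measurable_snd.
rewrite (_ : alive t = fst @^-1` `]-oo, t] `&` snd @^-1` `]t, +oo[).
  apply: measurableI; rewrite -[X in measurable X]setTI.
    by apply: mf1 => //; exact: measurable_itv.
  by apply: mf2 => //; exact: measurable_itv.
by apply/seteqP; split => z /=; rewrite !in_itv/= andbT.
Qed.

Let m_shift (t : R) : measurable_fun setT ((fun z => z.2 - t) : RT * RT -> RT).
Proof. by apply: measurable_funB; [exact: measurable_snd|exact: measurable_cst]. Qed.

Lemma dist_fun_itv (mu : posMeasure R) (a b : R) : 0 <= a -> a <= b ->
  (dist_fun mu b - dist_fun mu a)%:E = mu `]a, b]%classic.
Proof.
move=> a0 ab.
have f A : measurable A -> mu A \is a fin_num.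
  by move=> mA; rewrite ge0_fin_numE//; exact: pos_measure_fin.
have E : mu `]0, b]%classic = (mu `]0%R, a]%classic + mu `]a, b]%classic)%E.
  rewrite -measureU//.
  - congr (mu _); apply/seteqP; split => x /=; rewrite !in_itv/=.
      by move=> /andP[x0 xb]; case: (leP x a) => xa; [left; rewrite x0|right].
    by move=> [/andP[-> xa]|/andP[ax ->]]; rewrite ?(le_trans xa)// (le_lt_trans a0).
  - by apply/seteqP; split => x //=; rewrite !in_itv/= => -[/andP[_ xa] /andP[]]; rewrite ltNge xa.
rewrite EFinB /dist_fun !fineK ?f//; try exact: measurable_itv.
by rewrite E addeAC subee ?add0e//; apply: f; exact: measurable_itv.
Qed.

(** The equation is an identity of distribution functions. An atom born at s
    that dies at r is alive at t when s <= t < r, and sits then at r - t. *)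
Lemma transport_law t A : 0 <= t <= T -> measurable A ->
  Y t A = L (alive t `&` (fun z => z.2 - t) @^-1` A).
Proof.
move=> /andP[t0 tT] mA.
pose nu : {measure set RT -> \bar R} := push (mrestr L (m_alive t)) (m_shift t).
suff : Y t A = nu A by rewrite /nu/= /pushforward /mrestr setIC.
move: A mA; apply: measure_unique_le; first exact: pos_measure_fin.
move=> x; have [x0|x0] := leP x 0.
  transitivity (0%E : \bar R).
    apply/eqP; rewrite -measure_le0 -(pos_measure_le0 (Y t)); apply: le_measure.
    - by rewrite inE; exact: measurable_itv.
    - by rewrite inE; exact: measurable_itv.
    - by move=> y; rewrite /= !in_itv/= => /le_trans; apply.
  rewrite /nu/= /pushforward /mrestr (_ : _ `&` _ = set0) ?measure0//.
  by apply/seteqP; split => z //= []; rewrite in_itv/= => h [_ h2]; lra.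
transitivity ((dist_fun (Y t) x)%:E).
  rewrite /dist_fun fineK; last by rewrite ge0_fin_numE//; exact: pos_measure_fin.
  rewrite -[RHS]add0e -(pos_measure_le0 (Y t)) -measureU//.
  - congr (Y t _); apply/seteqP; split => y /=; rewrite !in_itv/=.
      by move=> yx; case: (leP y 0) => y0; [left|right; rewrite yx].
    by move=> [/le_trans|/andP[_ //]]; apply; exact: ltW.
  - by apply/seteqP; split => y //=; rewrite !in_itv/= => -[y0 /andP[]]; rewrite ltNge y0.
have mB : measurable ((fun z : RT * RT => z.2 - t) @^-1` `]-oo, x]%classic `&` alive t).
  by apply: measurableI => //; rewrite -[X in measurable X]setTI; apply: m_shift.
have tx : t <= x + t by lra.
rewrite YE// dist_fun_itv//.
rewrite /nu/= /pushforward /mrestr -[RHS]mul1e -integral_cst// integral_mkcond LE; last 2 first.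
- by apply: (measurable_restrictT _ _).1 => //; exact: measurable_cst.
- by move=> z; rewrite patchE; case: ifP => // _; rewrite lee_fin.
congr (_ + _)%E.
  transitivity (\int[Y 0%R]_(y in D0) (\1_`]t, (x + t)%R] y)%:E)%E; last first.
    apply: eq_integral => y /set_mem; rewrite /= in_itv/= andbT => y0; rewrite patchE indicE.
    rewrite (_ : (((0, y) : RT * RT) \in _) = (y \in `]t, x + t]%classic)); first by case: ifP.
    apply/idP/idP => /set_mem/=; rewrite in_itv/=.
      by move=> [h1 [h2 h3]]; apply/mem_set; rewrite /= in_itv/=; apply/andP; split => //; lra.
    by move=> /andP[h1 h2]; apply/mem_set => /=; rewrite in_itv/=; split; [lra|split].
  rewrite integral_indic//; congr (Y 0 _).
  by apply/seteqP; split => y; [move=> yt; split => //|by move=> []]; move: yt; rewrite /= !in_itv/= andbT => /andP[h _]; exact: le_lt_trans h.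
rewrite (birth_domain_time _ _ _ tT) integral_mkcondr; apply: eq_integral => q _.
rewrite patchE; move: q => [[[s u] [[y n] z]] v]; rewrite /births/= /litter_of/=.
case: ifPn => [/set_mem/= st|st].
  rewrite -sumEFin; apply: eq_bigr => i _; rewrite patchE indicE /lives_of/= /time_of/=.
  rewrite (_ : (((s, s + z i) : RT * RT) \in _) = (z i - (t - s) \in `]0, x]%classic)); first by case: ifP.
  apply/idP/idP => /set_mem/=; rewrite in_itv/=.
    by move=> [h1 [/= h2 h3]]; apply/mem_set; rewrite /= in_itv/=; apply/andP; split; lra.
  by move=> /andP[h1 h2]; apply/mem_set => /=; rewrite in_itv/=; split; [lra|split => //=; lra].
rewrite big1// => i _; rewrite patchE memNset// => -[_ [/= h _]].
by move: st; rewrite mem_set.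
Qed.

Lemma transport_integral t (g : RT -> \bar R) : 0 <= t <= T -> measurable_fun setT g ->
  (forall x, (0 <= g x)%E) ->
  (\int[Y t]_(x in D0) g x = \int[L]_z ((\1_[set z : RT * RT | (z.1 <= t)%R] z)%:E * (g \_ D0) (z.2 - t)%R))%E.
Proof.
move=> tT mg g0.
pose nu : {measure set RT -> \bar R} := push (mrestr L (m_alive t)) (m_shift t).
rewrite (eq_measure_integral nu); last first.
  by move=> A mA _; apply: (etrans (transport_law tT mA)); rewrite /nu/= /pushforward /mrestr setIC.
have mgD : measurable_fun setT (g \_ D0).
  by apply: (measurable_restrictT _ _).1 => //; exact: measurable_funTS.
have gD0 x : (0 <= (g \_ D0) x)%E by rewrite patchE; case: ifP.
rewrite integral_mkcond /nu integral_push// integral_mrestr//; last first.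
  by apply: measurableT_comp => //; exact: m_shift.
rewrite [LHS]integral_mkcond; apply: eq_integral => z _; rewrite !patchE indicE.
rewrite mem_setE in_itv/= andbT subr_gt0.
case: (leP z.1 t) => zt; case: (ltP t z.2) => tz.
- by rewrite !mem_set// mul1e.
- by rewrite memNset ?mule0// => -[_]; rewrite ltNge tz.
- by rewrite !memNset ?mul0e// => [/= h|[h _]]; move: zt; rewrite ltNge h.
- by rewrite !memNset ?mul0e// => [/= h|[h _]]; move: zt; rewrite ltNge h.
Qed.

End transport.

(** * Pairings along a path *)

Section calculus.
Context {R : realType}.
Local Notation D0 := (`]0, +oo[%classic : set R).
Local Notation RT := (measurableTypeR R).

Lemma derivative_on_is_derive (D : set R) (g g' : R -> R) (x : R) : derivative_on D g g' -> nbhs x D ->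
  is_derive x 1 g (g' x).
Proof.
move=> dg nD.
have Dx : D x by exact: nbhs_singleton.
have c : h^-1 *: ((g \o shift x) (h *: 1) - g x) @[h --> 0^'] --> g' x.
  have := dg x Dx; apply: cvg_trans.
  have n0 : \forall h \near (0 : R)^', D (x + h).
    apply: cvg_within; have : x + h @[h --> (0 : R)] --> x + 0 by apply: cvgD; [exact: cvg_cst|exact: cvg_id].
    by rewrite addr0; apply.
  rewrite (_ : within _ _ = (0 : R)^')//; last first.
    by apply/seteqP; split => A; rewrite /within/= => h; [apply: filterS2 n0 h => y Dy; exact|apply: filterS h].
  apply: near_eq_cvg; apply: nearW => h /=.
  have e : h *: (1 : R) = h by exact: mulr1.
  by rewrite /shift/= e [h + x]addrC.
by split; [apply/cvg_ex; eexists; exact: c|exact/cvg_lim].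
Qed.

(** The limit 0 of g at 0 makes its extension by 0 continuous there. *)
Lemma restrict_continuous g : bounded_continuous D0 g -> g x @[x --> 0^'+] --> 0 ->
  continuous (g \_ D0).
Proof.
move=> [_ cg] g0 x.
have posE y : 0 < y -> (g \_ D0) y = g y by move=> y0; rewrite patchE mem_set//= in_itv/= andbT.
have negE y : y <= 0 -> (g \_ D0) y = 0.
  by move=> y0; rewrite patchE memNset//= in_itv/= andbT; apply/negP; rewrite -leNgt.
have [x0|x0|->] := ltgtP x 0.
- rewrite /continuous_at negE ?ltW//; apply: cvg_near_cst; near=> y; rewrite negE//.
  by apply: ltW; near: y; exact: lt_nbhsl.
- rewrite /continuous_at posE//.
  have gx : g y @[y --> x] --> g x.
    move: cg; rewrite continuous_open_subspace; last exact: interval_open.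
    by apply; rewrite inE/= in_itv/= andbT.
  apply: cvg_trans gx; apply: near_eq_cvg; near=> y; rewrite posE//.
  by near: y; exact: lt_nbhsr.
- apply/left_right_continuousP; rewrite negE//; split.
    by apply: cvg_near_cst; near=> y; rewrite negE//; near: y; exact: nbhs_left_le.
  apply: cvg_trans g0; apply: near_eq_cvg; near=> y; rewrite posE//.
Unshelve. all: by end_near.
Qed.

(** Mean value theorem on the half-line, continued across 0 by the limit of g
    there. It bounds the difference quotients of atoms that die during the
    increment. *)
Lemma restrict_lipschitz g g' (C : R) : derivative_on D0 g g' -> (forall x, D0 x -> `|g' x| <= C) ->
  g x @[x --> 0^'+] --> 0 ->
  forall a b, a <= b -> `|(g \_ D0) b - (g \_ D0) a| <= C * (b - a).
Proof.
move=> dg gC g0.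
have C0 : 0 <= C by apply: le_trans (normr_ge0 _) (gC 1 _); rewrite /= in_itv/= andbT.
have der (x : R) : 0 < x -> is_derive x 1 g (g' x).
  move=> x0; apply: (derivative_on_is_derive dg).
  by apply: filterS (lt_nbhsr x0) => y y0; rewrite /= in_itv/= andbT.
have pos (a b : R) : 0 < a -> a <= b -> `|g b - g a| <= C * (b - a).
  move=> a0 ab.
  have [||c cab ->] := @MVT_segment _ g g' a b ab.
  - by move=> x; rewrite in_itv/= => /andP[ax _]; apply: der; exact: lt_trans ax.
  - apply: derivable_within_continuous => x; rewrite in_itv/= => /andP[ax _].
    by have [] := der x (lt_le_trans a0 ax).
  rewrite normrM [X in _ * X]ger0_norm ?subr_ge0// ler_wpM2r ?subr_ge0//; apply: gC.
  by move: cab; rewrite /= !in_itv/= andbT => /andP[ac _]; exact: lt_le_trans ac.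
move=> a b ab; rewrite !patchE !mem_setE !in_itv/= !andbT.
have [b0|b0] := ltP 0 b; have [a0|a0] := ltP 0 a.
- exact: pos.
- rewrite subr0; apply: (@le_trans _ _ (C * b)); last by rewrite ler_wpM2l// lerDl oppr_ge0.
  have c : `|g b - g x| @[x --> 0^'+] --> `|g b|.
    have e : `|g b| = `|g b - 0| by rewrite subr0.
    by rewrite e; apply: cvg_norm; apply: cvgB => //; exact: cvg_cst.
  rewrite -(cvg_lim _ c)//; apply: limr_le; first by apply/cvg_ex; eexists; exact: c.
  near=> x; apply: (le_trans (pos x b _ _)).
  + by near: x; exact: nbhs_right_gt.
  + by near: x; exact: nbhs_right_le.
  + by rewrite ler_wpM2l// gerBl; near: x; exact: nbhs_right_ge.
- by have := lt_le_trans a0 ab; rewrite ltNge b0.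
- by rewrite subrr normr0 mulr_ge0// subr_ge0.
Unshelve. all: by end_near.
Qed.

(** An atom moves to the left. At x <= 0 the quotient only sees values of the
    extension on ]-oo, 0], which are 0. *)
Lemma restrict_left_quotient g g' x : derivative_on D0 g g' ->
  h^-1 * ((g \_ D0) (x - h) - (g \_ D0) x) @[h --> 0^'+] --> - (g' \_ D0) x.
Proof.
move=> dg.
have posE y : 0 < y -> (g \_ D0) y = g y by move=> y0; rewrite patchE mem_set//= in_itv/= andbT.
have posE' y : 0 < y -> (g' \_ D0) y = g' y by move=> y0; rewrite patchE mem_set//= in_itv/= andbT.
have negE (k : R -> R) y : y <= 0 -> (k \_ D0) y = 0.
  by move=> y0; rewrite patchE memNset//= in_itv/= andbT; apply/negP; rewrite -leNgt.
have [x0|x0] := leP x 0.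
  rewrite (negE g')// oppr0; apply: cvg_near_cst; near=> h.
  rewrite !negE ?subrr ?mulr0// lerBlDr (le_trans x0)// add0r.
  by near: h; exact: nbhs_right_ge.
rewrite posE'//.
have [dx dE] : is_derive x 1 g (g' x).
  apply: (derivative_on_is_derive dg).
  by apply: filterS (lt_nbhsr x0) => y y0; rewrite /= in_itv/= andbT.
have c : h^-1 *: ((g \o shift x) (h *: 1) - g x) @[h --> 0^'] --> g' x by rewrite -dE.
have cl := cvg_dnbhs_at_left c.
have /cvg_at_leftNP := cl; rewrite oppr0 => cr.
have cn : - ((- h)^-1 *: ((g \o shift x) ((- h) *: 1) - g x)) @[h --> 0^'+] --> - g' x by exact: (cvgN cr).
apply: cvg_trans cn; apply: near_eq_cvg; near=> h.
have hx : h < x by near: h; exact: nbhs_right_lt.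
have e : (- h) *: (1 : R) = - h by exact: mulr1.
by rewrite /= /shift/= e !posE ?subr_gt0// invrN scaleNr opprK [- h + x]addrC.
Unshelve. all: by end_near.
Qed.

End calculus.

Section transport_real.
Context {R : realType}.
Local Notation D0 := (`]0, +oo[%classic : set R).
Local Notation RT := (measurableTypeR R).
Variables (L : {measure set (RT * RT)%type -> \bar R}) (Y Ym : R -> posMeasure R) (T : R).
Hypothesis Lfin : (L setT < +oo)%E.
Hypothesis Yleft : forall s, 0 < s -> left_limit Y s (Ym s).
Hypothesis YL : forall t (g : RT -> \bar R), 0 <= t <= T -> measurable_fun setT g ->
  (forall x, (0 <= g x)%E) ->
  (\int[Y t]_(x in D0) g x =
   \int[L]_z ((\1_[set z : RT * RT | (z.1 <= t)%R] z)%:E * (g \_ D0) (z.2 - t)%R))%E.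

(** The contribution to a pairing at time t of an atom z, given by its birth and
    death times. The atoms born at t are counted here, and not in [flow_lt]
    below. *)
Definition flow_le (t : R) (g : R -> R) (z : RT * RT) : R :=
  \1_[set z : RT * RT | z.1 <= t] z * (g \_ D0) (z.2 - t).

Definition flow_lt (t : R) (g : R -> R) (z : RT * RT) : R :=
  \1_[set z : RT * RT | z.1 < t] z * (g \_ D0) (z.2 - t).

Lemma measurable_fst_le (t : R) : measurable [set z : RT * RT | z.1 <= t].
Proof.
have mf1 : measurable_fun setT (fst : RT * RT -> RT) by exact: measurable_fst.
rewrite (_ : mkset _ = fst @^-1` `]-oo, t]); last by apply/seteqP; split => z; rewrite /= in_itv.
by rewrite -[X in measurable X]setTI; apply: mf1 => //; exact: measurable_itv.
Qed.

Lemma measurable_fst_lt (t : R) : measurable [set z : RT * RT | z.1 < t].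
Proof.
have mf1 : measurable_fun setT (fst : RT * RT -> RT) by exact: measurable_fst.
rewrite (_ : mkset _ = fst @^-1` `]-oo, t[); last by apply/seteqP; split => z; rewrite /= in_itv.
by rewrite -[X in measurable X]setTI; apply: mf1 => //; exact: measurable_itv.
Qed.

Lemma measurable_patch0 (g : R -> R) : measurable_fun (D0 : set RT) (g : RT -> RT) ->
  measurable_fun setT ((g \_ D0) : RT -> RT).
Proof. by move=> mg; apply: (measurable_restrictT _ _).1 => //; exact: measurable_itv. Qed.

Lemma measurable_shift (g : R -> R) (t : R) : measurable_fun (D0 : set RT) (g : RT -> RT) ->
  measurable_fun setT ((fun z => (g \_ D0) (z.2 - t)) : RT * RT -> RT).
Proof.
move=> mg; apply: (measurableT_comp (measurable_patch0 mg)).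
by apply: measurable_funB; [exact: measurable_snd|exact: measurable_cst].
Qed.

Lemma measurable_flow_le (g : R -> R) (t : R) : measurable_fun (D0 : set RT) (g : RT -> RT) ->
  measurable_fun setT (flow_le t g : RT * RT -> RT).
Proof.
move=> mg; apply: measurable_funM; last exact: measurable_shift.
by apply: measurable_indic; exact: measurable_fst_le.
Qed.

Lemma flow_le_bound (g : R -> R) (C t : R) z : 0 <= C -> (forall x, D0 x -> `|g x| <= C) ->
  `|flow_le t g z| <= C.
Proof.
move=> C0 gC; rewrite /flow_le normrM indicE; case: (_ \in _); rewrite ?normr0 ?mul0r// normr1 mul1r.
by rewrite patchE; case: ifPn => [/set_mem|_]; [exact: gC|rewrite normr0].
Qed.

Lemma transport_pairing t (g : R -> R) : 0 <= t <= T ->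
  measurable_fun (D0 : set RT) (g : RT -> RT) ->
  pairing (Y t) g = \int[L]_z flow_le t g z.
Proof.
move=> tT mg; rewrite /pairing /Rintegral; congr fine.
have mgE : measurable_fun (D0 : set RT) (EFin \o g) by exact/measurable_EFinP.
have part (k : \bar R -> \bar R) : (forall x, (0 <= k x)%E) -> k 0%E = 0%E ->
    measurable_fun setT (fun x => k ((g \_ D0) x)%:E) ->
    (\int[Y t]_(x in D0) k (g x)%:E = \int[L]_z k (flow_le t g z)%:E)%E.
  move=> k0 k00 mk.
  transitivity (\int[Y t]_(x in D0) k ((g \_ D0) x)%:E)%E.
    by apply: eq_integral => x xD; rewrite patchE xD.
  rewrite YL//; apply: eq_integral => z _; rewrite /flow_le indicE.
  case: (_ \in _); rewrite ?mul1e ?mul1r ?mul0e ?mul0r//.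
  by rewrite [LHS]patchE; case: ifPn => // yD; rewrite patchE (negbTE yD) k00.
have mgp := measurable_patch0 mg.
rewrite [LHS]integralE [RHS]integralE; congr (_ - _)%E.
  under [LHS]eq_integral do rewrite funeposE; under [RHS]eq_integral do rewrite funeposE.
  apply: (part (fun x => maxe x 0%E)) => //.
  - by move=> x; rewrite le_max lexx orbT.
  - by rewrite maxxx.
  - by apply: measurable_maxe => //; exact/measurable_EFinP.
under [LHS]eq_integral do rewrite funenegE; under [RHS]eq_integral do rewrite funenegE.
apply: (part (fun x => maxe (- x)%E 0%E)) => //.
- by move=> x; rewrite le_max lexx orbT.
- by rewrite oppe0 maxxx.
- by apply: measurable_maxe => //; apply: measurableT_comp => //; exact/measurable_EFinP.
Qed.

(** Before t the atoms born at t are missing. As g vanishes at 0, the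
    contribution of an atom that dies at t is continuous. *)
Lemma transport_left t (g : R -> R) : 0 < t <= T -> bounded_continuous D0 g ->
  g x @[x --> 0^'+] --> 0 -> pairing (Ym t) g = \int[L]_z flow_lt t g z.
Proof.
move=> /andP[t0 tT] bg g0; have [C C0 gC] := bounded_continuous_bound bg.
have mg := bounded_continuous_measurable bg.
have cg := restrict_continuous bg g0.
have c1 : pairing (Y r) g @[r --> t^'-] --> pairing (Ym t) g by exact: Yleft.
have c2 : pairing (Y r) g @[r --> t^'-] --> \int[L]_z flow_lt t g z.
  have : (\int[L]_(z in setT) flow_le r g z) @[r --> t^'-] --> \int[L]_z flow_lt t g z.
    apply: (@cvg_at_left_bounded_Rintegral _ _ _ L setT C (t - 1) t) => //.
    - by rewrite gtrBl.
    - by move=> r; exact: measurable_flow_le.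
    - by move=> r z _ _; exact: flow_le_bound.
    move=> z _; rewrite /flow_le /flow_lt.
    have [zt|zt] := ltP z.1 t.
      rewrite (_ : \1_[set z0 : RT * RT | z0.1 < t] z = 1 :> R); last by rewrite indicE mem_set.
      rewrite mul1r.
      have : (g \_ D0) (z.2 - r) @[r --> t^'-] --> (g \_ D0) (z.2 - t).
        apply: cvg_at_left_filter; apply: continuous_cvg; first exact: cg.
        by apply: cvgB; [exact: cvg_cst|exact: cvg_id].
      apply: cvg_trans; apply: near_eq_cvg; near=> r.
      rewrite indicE mem_set ?mul1r//=; near: r; exact: nbhs_left_ge.
    rewrite (_ : \1_[set z0 : RT * RT | z0.1 < t] z = 0 :> R); last first.
      by rewrite indicE memNset//=; apply/negP; rewrite -leNgt.
    rewrite mul0r; apply: cvg_near_cst; near=> r.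
    rewrite indicE memNset ?mul0r//=; apply/negP; rewrite -ltNge.
    by apply: lt_le_trans zt; near: r; exact: nbhs_left_lt.
  apply: cvg_trans; apply: near_eq_cvg; near=> r; rewrite transport_pairing//.
  apply/andP; split; first by near: r; exact: nbhs_left_ge.
  by apply: le_trans tT; near: r; exact: nbhs_left_le.
exact: (cvg_unique _ c1 c2).
Unshelve. all: by end_near.
Qed.

(** If no atom is born at t, the two flows agree almost everywhere for g
    vanishing at 0; the cutoffs reach the other g. *)
Lemma left_limitE t (g : R -> R) : 0 < t <= T -> L [set z | z.1 = t] = 0%E ->
  bounded_continuous D0 g -> pairing (Ym t) g = pairing (Y t) g.
Proof.
move=> tT Lt bg; have t0T : 0 <= t <= T by case/andP: tT => /ltW -> ->.
have E n : pairing (Ym t) (fun x => g x * cutoff n x) = pairing (Y t) (fun x => g x * cutoff n x).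
  have [bgn gn0] := cutoff_bc n bg.
  rewrite transport_left// transport_pairing//; last exact: bounded_continuous_measurable.
  rewrite /Rintegral; congr fine; apply: ae_eq_integral => //.
  - apply/measurable_EFinP; apply: measurable_funM.
      by apply: measurable_indic; exact: measurable_fst_lt.
    by apply: measurable_shift; exact: bounded_continuous_measurable.
  - by apply/measurable_EFinP; apply: measurable_flow_le; exact: bounded_continuous_measurable.
  exists [set z | z.1 = t]; split => //.
    have -> : [set z : RT * RT | z.1 = t] = [set z | z.1 <= t] `\` [set z | z.1 < t].
      apply/seteqP; split => z /=; first by move=> ->; rewrite ltxx lexx.
      by move=> [h1 /negP]; rewrite -leNgt => h2; apply/eqP; rewrite eq_le h1.
    by apply: measurableD; [exact: measurable_fst_le|exact: measurable_fst_lt].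
  move=> z /= h; apply: contrapT => zt; apply: h => _; rewrite /flow_le /flow_lt !indicE.
  congr ((nat_of_bool _)%:R * _)%:E; apply/idP/idP => /set_mem/= h; apply/mem_set => /=; first exact: ltW.
  by rewrite lt_neqAle h andbT; apply/eqP.
have c1 := @pairing_cutoff _ (Ym t) _ bg; have c2 := @pairing_cutoff _ (Y t) _ bg.
move: c2; under eq_fun do rewrite -E; move=> c2.
exact: (cvg_unique _ c1 c2).
Qed.

End transport_real.

(** * Change of variables along a path *)

Section one_sided_calculus.
Context {R : realType}.

Lemma chain_right (F : R -> R) (dF k0 dk : R) (k : R -> R) : is_derive k0 1 F dF ->
  h^-1 * (k h - k0) @[h --> 0^'+] --> dk ->
  h^-1 * (F (k h) - F k0) @[h --> 0^'+] --> dF * dk.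
Proof.
move=> [dx dE] kc.
have c : h^-1 *: ((F \o shift k0) (h *: 1) - F k0) @[h --> 0^'] --> dF by rewrite -dE.
pose Q (u : R) := if u == 0 then dF else u^-1 * (F (k0 + u) - F k0).
have Q0 : Q u @[u --> (0 : R)] --> dF.
  apply/cvgrPdist_lt => e e0; move/cvgrPdist_lt : c => /(_ e e0).
  rewrite /dnbhs near_withinE/= => hq; apply: filterS hq => u h; rewrite /Q; case: eqP => [_|/eqP u0].
    by rewrite subrr normr0.
  have := h u0; rewrite /shift/=; have -> : u *: (1 : R) = u by exact: mulr1.
  by rewrite [u + k0]addrC.
have kQ h : F (k h) - F k0 = Q (k h - k0) * (k h - k0).
  rewrite /Q; case: eqP => [e|/eqP e]; first by rewrite e mulr0; move/eqP: e; rewrite subr_eq0 => /eqP ->; rewrite subrr.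
  by rewrite mulrAC mulVf// mul1r addrCA subrr addr0.
have k0c : k h - k0 @[h --> 0^'+] --> 0.
  have : h * (h^-1 * (k h - k0)) @[h --> 0^'+] --> 0 * dk.
    by apply: cvgM => //; apply: cvg_at_right_filter; exact: cvg_id.
  rewrite mul0r => c0; apply: cvg_trans c0; apply: near_eq_cvg; near=> h.
  have h0 : 0 < h by near: h; exact: nbhs_right_gt.
  by rewrite mulrA mulfV ?mul1r// gt_eqF.
under eq_fun do rewrite kQ mulrCA.
apply: cvgM => //.
apply: (cvg_comp _ _ k0c); exact: Q0.
Unshelve. all: by end_near.
Qed.

Local Notation leb := (@lebesgue_measure R).

Lemma Rintegral_increment (b : R -> R) (T B c e r t : R) :
  measurable_fun (`]0, T]%classic : set (measurableTypeR R)) (b : R -> measurableTypeR R) ->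
  (forall s, 0 < s <= T -> `|b s| <= B) ->
  0 <= r -> r <= t -> t <= T -> (forall s, r < s <= t -> `|b s - c| <= e) ->
  `|\int[leb]_(s in `]0, t]) b s - \int[leb]_(s in `]0, r]) b s - c * (t - r)| <= e * (t - r).
Proof.
move=> mb bB r0 rt tT be.
have sub u v : 0 <= u -> v <= T -> `]u, v]%classic `<=` `]0, T]%classic.
  by move=> u0 vT x; rewrite /= !in_itv/= => /andP[ux xv]; rewrite (le_lt_trans u0)// (le_trans xv).
have lebE u v : u <= v -> leb `]u, v]%classic = (v - u)%:E.
  move=> uv; rewrite lebesgue_measure_itv/= lte_fin; case: ltP => // vu.
  by rewrite (_ : u = v) ?subrr//; apply/eqP; rewrite eq_le uv.
have ib u v : 0 <= u -> u <= v -> v <= T -> leb.-integrable `]u, v]%classic (EFin \o b).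
  move=> u0 uv vT; apply: measurable_bounded_integrable => //.
  - by rewrite /= [X in (X < _)%E](_ : _ = (v - u)%:E) ?ltry//; exact: lebE.
  - by apply: measurable_funS mb; [exact: measurable_itv|exact: sub].
  - apply: (@bounded_byP _ _ _ _ B) => x xs; apply: bB; have := sub _ _ u0 vT _ xs.
    by rewrite /= in_itv.
have ic (u v k : R) : u <= v -> leb.-integrable `]u, v]%classic (EFin \o (cst k)).
  move=> uv; apply: measurable_bounded_integrable => //.
  - by rewrite /= [X in (X < _)%E](_ : _ = (v - u)%:E) ?ltry//; exact: lebE.
  - by apply: (@bounded_byP _ _ _ _ `|k|).
have cE (k : R) : \int[leb]_(s in `]r, t]) (cst k s) = k * (t - r).
  by rewrite Rintegral_cst; [rewrite [X in fine X](_ : _ = (t - r)%:E)//; exact: lebE|exact: measurable_itv].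
have E : \int[leb]_(s in `]0, t]) b s = \int[leb]_(s in `]0, r]) b s + \int[leb]_(s in `]r, t]) b s.
  have U : `]0, t]%classic = `]0, r]%classic `|` `]r, t]%classic.
    apply/seteqP; split => x /=; rewrite !in_itv/=.
      by move=> /andP[x0 xt]; case: (leP x r) => xr; [left; rewrite x0|right].
    by move=> [/andP[-> xr]|/andP[rx ->]]; rewrite ?(le_trans xr)// (le_lt_trans r0).
  rewrite U Rintegral_setU//.
  - by rewrite -U; apply: ib => //; exact: le_trans rt.
  - apply/disj_setPLR => x /=; rewrite !in_itv/= => /andP[_ xr] /andP[rx _].
    by move: (lt_le_trans rx xr); rewrite ltxx.
rewrite E [X in `|X - _|](_ : _ = \int[leb]_(s in `]r, t]) b s); last by rewrite addrAC subrr add0r.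
rewrite ler_norml; apply/andP; split.
  rewrite lerBrDl -mulNr -mulrDl -cE; apply: le_Rintegral => //; [exact: ic|exact: ib|].
  move=> s; rewrite /= in_itv/= => /be; rewrite ler_norml => /andP[h _]; lra.
rewrite lerBlDl -mulrDl -cE; apply: le_Rintegral => //; [exact: ib|exact: ic|].
move=> s; rewrite /= in_itv/= => /be; rewrite ler_norml => /andP[_ h]; lra.
Qed.

End one_sided_calculus.

Section ito.
Context {R : realType}.
Local Notation D0 := (`]0, +oo[%classic : set R).
Local Notation RT := (measurableTypeR R).
Local Notation leb := (@lebesgue_measure R).
Local Notation time := (@time_of R).
Variables (L : {measure set (RT * RT)%type -> \bar R}) (Y Ym : R -> posMeasure R) (T : R).
Hypothesis T0 : 0 <= T.
Hypothesis Lfin : (L setT < +oo)%E.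
Hypothesis Yright : weakly_right_continuous Y.
Hypothesis Yleft : forall s, 0 < s -> left_limit Y s (Ym s).
Hypothesis YL : forall t (g : RT -> \bar R), 0 <= t <= T -> measurable_fun setT g ->
  (forall x, (0 <= g x)%E) ->
  (\int[Y t]_(x in D0) g x =
   \int[L]_z ((\1_[set z : RT * RT | (z.1 <= t)%R] z)%:E * (g \_ D0) (z.2 - t)%R))%E.
Variables (m : {measure set (pointT R) -> \bar R}) (S : set (pointT R)).
Hypothesis mS : measurable S.
Hypothesis Sfin : (m S < +oo)%E.
Hypothesis Snat : forall B, measurable B -> nat_valued (m (B `&` S)).
Hypothesis Ssimple : forall s, (m (time @^-1` [set s] `&` S) <= 1)%E.
Hypothesis Spos : forall q, S q -> 0 < time q /\ posseq (lives_of q).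
Hypothesis LS : forall phi : RT * RT -> \bar R, measurable_fun setT phi -> (forall z, (0 <= phi z)%E) ->
  (forall x, phi (0, x) = 0%E) ->
  (\int[L]_z phi z = \int[m]_(q in S) \sum_(i < litter_of q) phi (time q, (time q + lives_of q i)%R))%E.
Variables f f' F F' : R -> R.
Hypothesis hf : C1_deriv D0 f f'.
Hypothesis hf0 : f x @[x --> 0^'+] --> 0.
Hypothesis hF : C1_deriv setT F F'.

Local Notation y_ t := (pairing (Y t) f).
Local Notation ym t := (pairing (Ym t) f).
Definition jump_sum (q : pointT R) : R := \sum_(i < litter_of q) f (lives_of q i).
Definition jump_gain (q : pointT R) : R := F (ym (time q) + jump_sum q) - F (ym (time q)).
Local Notation H := jump_gain.
Hypothesis mH : measurable_fun S (H : pointT R -> RT).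
Let b (s : R) : R := F' (y_ s) * pairing (Y s) f'.
Hypothesis mb : measurable_fun (`]0, T]%classic : set RT) (b : RT -> RT).

Let bf : bounded_continuous D0 f. Proof. by case: hf. Qed.
Let bf' : bounded_continuous D0 f'. Proof. by case: hf. Qed.
Let df : derivative_on D0 f f'. Proof. by case: hf. Qed.

Let cF : continuous F.
Proof. by case: hF => -[_ h] _ _; apply/continuous_subspace_setT. Qed.

Let F_bound : exists2 C : R, 0 <= C & forall x, `|F x| <= C.
Proof. by case: hF => h _ _; have [C C0 h'] := bounded_continuous_bound h; exists C => // x; exact: h'. Qed.

Let F'_bound : exists2 C : R, 0 <= C & forall x, `|F' x| <= C.
Proof. by case: hF => _ h _; have [C C0 h'] := bounded_continuous_bound h; exists C => // x; exact: h'. Qed.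

Let cF' : continuous F'.
Proof. by case: hF => _ [_ h] _; apply/continuous_subspace_setT. Qed.

Let dF (x : R) : is_derive x 1 F (F' x).
Proof. by case: hF => _ _ h; apply: (derivative_on_is_derive h); exact: filterT. Qed.

Let m_time (A : set RT) : measurable A -> measurable (time @^-1` A).
Proof. by move=> mA; rewrite -[X in measurable X]setTI; exact: measurable_time_of. Qed.

Let b_bound : exists B, forall s, 0 < s <= T -> `|b s| <= B.
Proof.
have [C1 C10 h1] := F'_bound; have [C2 C20 h2] := bounded_continuous_bound bf'.
exists (C1 * (C2 * fine (L setT))) => s /andP[s0 sT]; rewrite /b normrM.
apply: ler_pM => //; rewrite (transport_pairing YL); last exact: bounded_continuous_measurable.
  have Lf : L setT \is a fin_num by rewrite ge0_fin_numE.
  have mg := bounded_continuous_measurable bf'.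
  have il : L.-integrable setT (EFin \o flow_le s f').
    apply: measurable_bounded_integrable => //; first exact: measurable_flow_le.
    by apply: (@bounded_byP _ _ _ _ C2) => z _; exact: flow_le_bound.
  apply: (le_trans (le_normr_Rintegral _ il)) => //.
  apply: (@le_trans _ _ (\int[L]_z (cst C2 z))); last by rewrite Rintegral_cst.
  apply: le_Rintegral => //.
  - by apply: measurable_bounded_integrable => //; [exact: measurableT_comp (measurable_flow_le _ mg)|
      apply: (@bounded_byP _ _ _ _ C2) => z _; rewrite normr_id; exact: flow_le_bound].
  - by apply: measurable_bounded_integrable => //; apply: (@bounded_byP _ _ _ _ `|C2|).
  - by move=> z _; exact: flow_le_bound.
by rewrite (ltW s0).
Qed.

Let Z t : R := \int[leb]_(s in `]0, t]) b s.
Let J t : R := \int[m]_(q in S) (\1_[set q | time q <= t] q * H q).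

Let H_bound : exists2 C : R, 0 <= C & forall q, `|H q| <= C.
Proof.
have [C C0 h] := F_bound; exists (C + C) => [|q]; first exact: addr_ge0.
by rewrite /H (le_trans (ler_normB _ _))// lerD.
Qed.

Let mJ (A : set RT) : measurable A -> measurable_fun S (fun q => \1_(time @^-1` A) q * H q : RT).
Proof.
move=> mA; apply: measurable_funM => //; apply: measurable_indic; exact: m_time.
Qed.

(** The masses of the births in ]t, t + 1/k] decrease to 0 and are integers, so
    they vanish eventually. *)
Lemma birth_gap t : 0 <= t -> exists2 e, 0 < e & m (S `&` [set q | t < time q <= t + e]) = 0%E.
Proof.
move=> t0; pose A (k : nat) := S `&` time @^-1` `]t, t + k.+1%:R^-1].
have mA k : measurable (A k) by apply: measurableI => //; apply: m_time; exact: measurable_itv.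
have cA : m (A k) @[k --> \oo] --> m (\bigcap_k A k).
  apply: nonincreasing_cvg_mu => //.
  - by apply: le_lt_trans Sfin; apply: le_measure; rewrite ?inE// => q [].
  - by apply: bigcapT_measurable.
  - move=> k l kl; apply/subsetPset => q [Sq]; rewrite /= !in_itv/= => /andP[tq qt]; split => //.
    by rewrite /= in_itv/= tq (le_trans qt)// lerD2l lef_pV2 ?posrE ?ltr0n// ler_nat.
have A0 : \bigcap_k A k = set0.
  apply/seteqP; split => q // hq; have [_] := hq 0%N I; rewrite /= in_itv/= => /andP[tq _].
  have [_] := hq (Num.truncn ((time q - t)^-1)) I.
  rewrite /= in_itv/= => /andP[_]; apply/negP; rewrite -ltNge -ltrBrDl.
  have d0 : 0 < time q - t by rewrite subr_gt0.
  rewrite invf_plt ?posrE ?ltr0n//; exact: truncnS_gt.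
rewrite A0 measure0 in cA.
have : \forall k \near \oo, (m (A k) < 1)%E.
  have Af k : m (A k) \is a fin_num.
    by rewrite ge0_fin_numE//; apply: le_lt_trans Sfin; apply: le_measure; rewrite ?inE// => q [].
  have /fine_cvgP[_] := cA; move=> /cvgrPdist_lt/(_ 1 ltr01); apply: filterS => k /=.
  rewrite sub0r normrN ger0_norm ?fine_ge0// => h.
  by rewrite -(fineK (Af k)) lte_fin.
move=> [k _ /(_ k (leqnn k))] Ak; exists k.+1%:R^-1; first by rewrite invr_gt0.
rewrite (_ : [set q | t < time q <= _] = time @^-1` `]t, t + k.+1%:R^-1]); last first.
  by apply/seteqP; split => q; rewrite /= in_itv.
have mt' : measurable (time @^-1` `]t, t + k.+1%:R^-1]) by apply: m_time; exact: measurable_itv.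
have [n nE] := Snat mt'; rewrite setIC in nE; move: Ak; rewrite /A nE.
by case: n nE => [//|n] _; rewrite lte_fin ltNge ler1n.
Qed.

Lemma flow_gap (u t : R) : 0 <= u -> m (S `&` [set q | u < time q <= t]) = 0%E ->
  L [set z | u < z.1 <= t] = 0%E.
Proof.
move=> u0 mu0.
have mz : measurable [set z : RT * RT | u < z.1 <= t].
  have mf1 : measurable_fun setT (fst : RT * RT -> RT) by exact: measurable_fst.
  rewrite (_ : mkset _ = fst @^-1` `]u, t]); last by apply/seteqP; split => z; rewrite /= in_itv.
  by rewrite -[X in measurable X]setTI; apply: mf1 => //; exact: measurable_itv.
transitivity (\int[L]_z (\1_[set z : RT * RT | (u < z.1 <= t)%R] z)%:E)%E.
  by rewrite integral_indic// setIT.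
rewrite LS; last 3 first.
- by apply/measurable_EFinP; exact: measurable_indic.
- by move=> z; rewrite lee_fin.
- by move=> x; rewrite indicE memNset//= ltNge u0.
transitivity (\int[m]_(q in S `&` [set q | (u < time q <= t)%R]) (litter_of q)%:R%:E)%E.
  rewrite [RHS]integral_mkcondr; apply: eq_integral => q _; rewrite patchE.
  case: ifPn => [/set_mem/= qt|qt].
    rewrite (eq_bigr (fun=> 1%E)); first by rewrite sumEFin sumr_const card_ord.
    by move=> i _; rewrite indicE mem_set.
  by rewrite big1// => i _; rewrite indicE memNset// => h; move: qt; rewrite mem_set.
apply: null_set_integral => //.
- apply: measurableI => //; rewrite (_ : mkset _ = time @^-1` `]u, t]).
    by apply: m_time; exact: measurable_itv.
  by apply/seteqP; split => q; rewrite /= in_itv.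
- by apply/measurable_EFinP; apply: measurable_funTS; exact: measurable_litterR.
Qed.

Let J_bounded : exists2 C, 0 <= C & forall (A : set RT) q, `|\1_(time @^-1` A) q * H q| <= C.
Proof.
have [C C0 h] := H_bound; exists C => // B r; rewrite normrM indicE.
by case: (_ \in _); rewrite ?normr1 ?mul1r ?normr0 ?mul0r.
Qed.

Let JE t : J t = \int[m]_(q in S) (\1_(time @^-1` `]-oo, t]) q * H q).
Proof.
by rewrite /J; apply: eq_Rintegral => q _; congr (\1_ _ q * _); apply/seteqP; split => r; rewrite /= in_itv.
Qed.

Lemma gain_left t : J r @[r --> t^'-] --> \int[m]_(q in S) (\1_(time @^-1` `]-oo, t[) q * H q).
Proof.
have [C C0 hC] := J_bounded.
have : (\int[m]_(q in S) (\1_(time @^-1` `]-oo, r]) q * H q)) @[r --> t^'-] -->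
   \int[m]_(q in S) (\1_(time @^-1` `]-oo, t[) q * H q).
  apply: (@cvg_at_left_bounded_Rintegral _ _ _ m S C (t - 1) t) => //.
  - by rewrite gtrBl.
  - by move=> r; apply: mJ; exact: measurable_itv.
  move=> q _; apply: cvgM; last exact: cvg_cst.
  have [qt|qt] := ltP (time q) t.
    rewrite (_ : \1_(time @^-1` `]-oo, t[) q = 1 :> R); last by rewrite indicE mem_set//= in_itv.
    apply: cvg_near_cst; near=> r; rewrite indicE mem_set//= in_itv/=.
    by near: r; exact: nbhs_left_ge.
  rewrite (_ : \1_(time @^-1` `]-oo, t[) q = 0 :> R); last by rewrite indicE memNset//= in_itv/= ltNge qt.
  apply: cvg_near_cst; near=> r; rewrite indicE memNset//= in_itv/=; apply/negP; rewrite -ltNge.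
  by apply: lt_le_trans qt; near: r; exact: nbhs_left_lt.
by under eq_fun do rewrite -JE.
Unshelve. all: by end_near.
Qed.

Let St t := time @^-1` [set t] `&` S.
Let mSt t : measurable (St t).
Proof. by apply: measurableI => //; exact: m_time. Qed.

Let Im (A : set RT) : measurable A -> m.-integrable S (EFin \o (fun q => \1_(time @^-1` A) q * H q)).
Proof.
move=> mA; have [C C0 hC] := J_bounded.
apply: measurable_bounded_integrable => //; first exact: mJ.
by apply: (@bounded_byP _ _ _ _ C) => q _; exact: hC.
Qed.

Lemma gain_jump t : J t - \int[m]_(q in S) (\1_(time @^-1` `]-oo, t[) q * H q) = \int[m]_(q in St t) H q.
Proof.
rewrite JE -RintegralB//; last 2 first.
- by apply: Im; exact: measurable_itv.
- by apply: Im; exact: measurable_itv.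
rewrite /St setIC Rintegral_mkcondr; apply: eq_Rintegral => q _.
rewrite patchE -mulrBl !indicE; case: ifPn => [/set_mem/= qt|qt].
  by rewrite mem_set ?memNset ?subr0 ?mul1r//= in_itv/= qt ?ltxx.
rewrite (_ : (q \in time @^-1` `]-oo, t]) = (q \in time @^-1` `]-oo, t[)) ?subrr ?mul0r//.
apply/idP/idP => /set_mem/=; rewrite in_itv/= => h; apply/mem_set; rewrite /= in_itv/=; last exact: ltW.
rewrite lt_neqAle h andbT; apply/eqP => e; move: qt; rewrite mem_set//=.
Qed.

Let fp (x : R) : R := Num.max (f x) 0.
Let fn (x : R) : R := Num.max (- f x) 0.
Let fpn x : f x = fp x - fn x.
Proof. by rewrite /fp /fn; case: (leP (f x) 0); case: (leP (- f x) 0); lra. Qed.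
Let mfp : measurable_fun (D0 : set RT) (fp : RT -> RT).
Proof. by apply: measurable_maxr => //; exact: bounded_continuous_measurable. Qed.
Let mfn : measurable_fun (D0 : set RT) (fn : RT -> RT).
Proof. by apply: measurable_maxr => //; apply: measurableT_comp => //; exact: bounded_continuous_measurable. Qed.

(** An atom born at t sits at its life length. *)
Lemma flow_jump t (g : R -> R) (C : R) : 0 < t -> measurable_fun (D0 : set RT) (g : RT -> RT) ->
  (forall x, D0 x -> 0 <= g x <= C) ->
  (\int[L]_z ((\1_[set z : RT * RT | z.1 = t] z) * (g \_ D0) (z.2 - t)%R)%:E =
   \int[m]_(q in St t) (\sum_(i < litter_of q) (g \_ D0) (lives_of q i))%:E)%E.
Proof.
move=> t0 mg gC.
have g0 x : 0 <= (g \_ D0) x.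
  by rewrite patchE; case: ifPn => // /set_mem /gC/andP[].
have mt1 : measurable [set z : RT * RT | z.1 = t].
  have mf1 : measurable_fun setT (fst : RT * RT -> RT) by exact: measurable_fst.
  rewrite (_ : mkset _ = fst @^-1` [set t])//.
  by rewrite -[X in measurable X]setTI; apply: mf1.
rewrite LS; last 3 first.
- apply/measurable_EFinP; apply: measurable_funM; last exact: measurable_shift.
  exact: measurable_indic.
- by move=> z; rewrite lee_fin mulr_ge0.
- by move=> x; rewrite indicE memNset ?mul0r//= => e; move: t0; rewrite -e ltxx.
rewrite /St setIC [RHS]integral_mkcondr; apply: eq_integral => q _; rewrite patchE.
case: ifPn => [/set_mem/= qt|qt].
  rewrite -sumEFin; apply: eq_bigr => i _; rewrite indicE mem_set//= mul1r qt.
  by rewrite addrAC subrr add0r.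
by rewrite big1// => i _; rewrite indicE memNset ?mul0r// => h; move: qt; rewrite mem_set.
Qed.

Let sigma (g : R -> R) (q : pointT R) : R := \sum_(i < litter_of q) (g \_ D0) (lives_of q i).

Let m_sigma g : measurable_fun (D0 : set RT) (g : RT -> RT) ->
  measurable_fun setT (sigma g : pointT R -> RT).
Proof.
move=> mg; apply: (measurable_litter_sum (phi := fun _ a => (g \_ D0) a)).
exact: (measurableT_comp (measurable_patch0 mg) measurable_snd).
Qed.

Lemma ae_mrestr d (U : measurableType d) (mu : {measure set U -> \bar R}) (A : set U)
    (mA : measurable A) (Q : U -> Prop) :
  {ae mrestr mu mA, forall x, Q x} -> {ae mu, forall x, A x -> Q x}.
Proof.
move=> [N [mN N0 sub]]; exists (N `&` A); split => //; first exact: measurableI.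
move=> x /= nQ; have [Ax nQx] : A x /\ ~ Q x.
  by split; [apply: contrapT => h; apply: nQ => /h|move=> Qx; exact: nQ].
by split => //; exact: sub.
Qed.

(** Restricted to a set of mass 1, the integer-valued measure m only takes the
    values 0 and 1. *)
Let sigma_cst t g : m (St t) = 1%E -> measurable_fun (D0 : set RT) (g : RT -> RT) ->
  exists c, {ae m, forall q, St t q -> sigma g q = c}.
Proof.
move=> mS1 mg.
have [||c hc] := zero_one_ae_cst (mu := mrestr m (mSt t)) (m_sigma mg).
- by transitivity (m (setT `&` St t)) => //; rewrite setTI.
- move=> A mA.
  have E : mrestr m (mSt t) A = m (A `&` time @^-1` [set t] `&` S) by rewrite -setIA.
  have [k kE] := Snat (measurableI _ _ mA (m_time (measurable_set1 t))).
  have : (m (A `&` time @^-1` [set t] `&` S) <= 1)%E.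
    by rewrite -mS1; apply: le_measure; rewrite ?inE//; [apply: measurableI => //; apply: measurableI => //; exact: m_time|move=> q [[]]].
  rewrite kE lee_fin (ler_nat R k 1); case: k kE => [|[|]]// kE _.
    by left; exact: etrans E kE.
  by right; exact: etrans E kE.
by exists c; exact: ae_mrestr hc.
Qed.

(** At time t there is no birth or exactly one. In the latter case every
    function of the point is almost everywhere constant, and the constant of the
    sum over the children is the jump of y. *)
Lemma ito_jump t : 0 < t <= T -> F (y_ t) - F (ym t) = \int[m]_(q in St t) H q.
Proof.
move=> tT; have t0 : 0 < t by case/andP: tT.
have t0T : 0 <= t <= T by case/andP: tT => /ltW -> ->.
have [C C0 fC] := bounded_continuous_bound bf.
have mf := bounded_continuous_measurable bf.
have fpC x : D0 x -> 0 <= fp x <= C.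
  move=> Dx; rewrite /fp le_max lexx orbT/= ge_max C0 andbT.
  by apply: le_trans (fC x Dx); exact: ler_norm.
have fnC x : D0 x -> 0 <= fn x <= C.
  move=> Dx; rewrite /fn le_max lexx orbT/= ge_max C0 andbT.
  by apply: le_trans (fC x Dx); rewrite -normrN; exact: ler_norm.
have mt1 : measurable [set z : RT * RT | z.1 = t].
  have mf1 : measurable_fun setT (fst : RT * RT -> RT) by exact: measurable_fst.
  rewrite (_ : mkset _ = fst @^-1` [set t])//.
  by rewrite -[X in measurable X]setTI; apply: mf1.
pose phi (g : R -> R) (z : RT * RT) : R := \1_[set z : RT * RT | z.1 = t] z * (g \_ D0) (z.2 - t).
have iphi g : measurable_fun (D0 : set RT) (g : RT -> RT) -> (forall x, D0 x -> 0 <= g x <= C) ->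
    L.-integrable setT (EFin \o phi g).
  move=> mg gC; apply: measurable_bounded_integrable => //.
    by apply: measurable_funM; [exact: measurable_indic|exact: measurable_shift].
  apply: (@bounded_byP _ _ _ _ C) => z _; rewrite /phi normrM indicE.
  case: (_ \in _); rewrite ?normr0 ?mul0r// normr1 mul1r patchE.
  by case: ifPn => [/set_mem/gC/andP[g0 gc]|_]; rewrite ?normr0// ger0_norm.
have iflow_le : L.-integrable setT (EFin \o flow_le t f).
  apply: measurable_bounded_integrable => //; first exact: measurable_flow_le.
  by apply: (@bounded_byP _ _ _ _ C) => z _; exact: flow_le_bound.
have iflow_lt : L.-integrable setT (EFin \o flow_lt t f).
  apply: measurable_bounded_integrable => //.
    apply: measurable_funM; last exact: measurable_shift.
    by apply: measurable_indic; exact: measurable_fst_lt.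
  apply: (@bounded_byP _ _ _ _ C) => z _; rewrite /flow_lt normrM indicE.
  case: (_ \in _); rewrite ?normr0 ?mul0r// normr1 mul1r patchE.
  by case: ifPn => [/set_mem/fC//|_]; rewrite normr0.
(* f is split into its signs because L and m are linked on nonnegative functions *)
have yE : y_ t - ym t = \int[L]_z phi fp z - \int[L]_z phi fn z.
  rewrite (transport_pairing YL)// (transport_left Lfin Yleft YL)//.
  rewrite -!RintegralB//; [|exact: iphi|exact: iphi].
  apply: eq_Rintegral => z _; rewrite /flow_le /flow_lt /phi -mulrBl -mulrBr.
  have -> : (f \_ D0) (z.2 - t) = (fp \_ D0) (z.2 - t) - (fn \_ D0) (z.2 - t).
    by rewrite !patchE; case: ifP => _; [exact: fpn|rewrite subrr].
  congr (_ * _); rewrite !indicE.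
  have -> : (z \in [set z0 : RT * RT | z0.1 <= t]) = (z.1 <= t).
    by apply/idP/idP => [/set_mem//|h]; exact: mem_set.
  have -> : (z \in [set z0 : RT * RT | z0.1 < t]) = (z.1 < t).
    by apply/idP/idP => [/set_mem//|h]; exact: mem_set.
  have -> : (z \in [set z0 : RT * RT | z0.1 = t]) = (z.1 == t).
    by apply/idP/eqP => [/set_mem//|h]; exact: mem_set.
  by case: ltgtP; rewrite ?subrr ?subr0.
have phiE g : measurable_fun (D0 : set RT) (g : RT -> RT) -> (forall x, D0 x -> 0 <= g x <= C) ->
    \int[L]_z phi g z = fine (\int[m]_(q in St t) (sigma g q)%:E).
  by move=> mg gC; rewrite /Rintegral (flow_jump t0 mg gC).
(* no birth at t, or a single one *)
have [k kE] := Snat (m_time (measurable_set1 t)).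
have := Ssimple t; rewrite kE lee_fin (ler_nat R k 1); case: k kE => [|[|//]] kE _.
  have nul g : measurable_fun (D0 : set RT) (g : RT -> RT) -> (\int[m]_(q in St t) (sigma g q)%:E = 0)%E.
    move=> mg; apply: null_set_integral => //.
    by apply/measurable_EFinP; apply: measurable_funTS; exact: m_sigma.
  have e : y_ t = ym t.
    by apply/eqP; rewrite -subr_eq0 yE !phiE// !nul// subrr.
  rewrite e subrr /Rintegral null_set_integral//.
  by apply/measurable_EFinP; apply: measurable_funS mH => // q [].
have [cp hcp] := sigma_cst kE mfp; have [cn hcn] := sigma_cst kE mfn.
have intc (h : pointT R -> R) c : measurable_fun (St t) (h : pointT R -> RT) ->
    {ae m, forall q, St t q -> h q = c} -> \int[m]_(q in St t) h q = c.
  move=> mh hc; rewrite /Rintegral (ae_eq_integral (EFin \o cst c))//.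
  - rewrite /= integral_cst// [X in (_ * X)%E](_ : _ = 1%E) ?mule1//; exact: kE.
  - exact/measurable_EFinP.
  - exact/measurable_EFinP.
  - by apply: filterS hc => q h1 Sq /=; rewrite h1.
have phic g c : measurable_fun (D0 : set RT) (g : RT -> RT) -> (forall x, D0 x -> 0 <= g x <= C) ->
    {ae m, forall q, St t q -> sigma g q = c} -> \int[L]_z phi g z = c.
  move=> mg gC hc; rewrite phiE//; apply: intc => //.
  by apply: measurable_funTS; exact: m_sigma.
have {}yE : y_ t = ym t + (cp - cn).
  by rewrite -(phic _ _ mfp fpC hcp) -(phic _ _ mfn fnC hcn) -yE addrC subrK.
symmetry; apply: intc; first by apply: measurable_funS mH => // q [].
apply: filterS2 hcp hcn => q h1 h2 Sq; rewrite /jump_gain yE.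
have -> : time q = t by case: Sq.
congr (F (_ + _) - _); rewrite -(h1 Sq) -(h2 Sq) /jump_sum /sigma -sumrB.
apply: eq_bigr => i _; have [_ lpos] := Spos Sq.2.
by rewrite !patchE mem_set//= in_itv/= andbT.
Qed.

(** For some time after t there is no birth and the atoms only move to the left. *)
Lemma ito_right t : 0 <= t < T ->
  h^-1 * (F (y_ (t + h)) - F (y_ t)) @[h --> 0^'+] --> - b t.
Proof.
move=> /andP[t0 tT]; have [C C0 fC] := bounded_continuous_bound bf'.
have [Cf Cf0 fCf] := bounded_continuous_bound bf.
have mf := bounded_continuous_measurable bf.
have mf' := bounded_continuous_measurable bf'.
have [e e0 he] := birth_gap t0.
pose G (h : R) (z : RT * RT) : R := \1_[set z : RT * RT | z.1 <= t] z *
  (h^-1 * ((f \_ D0) (z.2 - t - h) - (f \_ D0) (z.2 - t))).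
pose G0 (z : RT * RT) : R := \1_[set z : RT * RT | z.1 <= t] z * - (f' \_ D0) (z.2 - t).
have mshift (g : R -> R) (h : R) : measurable_fun (D0 : set RT) (g : RT -> RT) ->
    measurable_fun setT ((fun z => (g \_ D0) (z.2 - t - h)) : RT * RT -> RT).
  move=> mg; apply: (measurableT_comp (measurable_patch0 mg)).
  apply: measurable_funB; last exact: measurable_cst.
  by apply: measurable_funB; [exact: measurable_snd|exact: measurable_cst].
have mle : measurable_fun setT (\1_[set z : RT * RT | z.1 <= t] : RT * RT -> RT).
  by apply: measurable_indic; exact: measurable_fst_le.
have c : \int[L]_z G h z @[h --> 0^'+] --> \int[L]_z G0 z.
  apply: (@cvg_at_right_bounded_Rintegral _ _ _ L setT C 1 0) => //.
  - move=> h; apply: measurable_funM => //; apply: measurable_funM => //.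
    by apply: measurable_funB; [exact: mshift|exact: measurable_shift].
  - move=> h z /andP[h0 _] _; rewrite /G normrM indicE; case: (_ \in _); last by rewrite normr0 mul0r.
    have hi : 0 <= h^-1 by rewrite invr_ge0 ltW.
    rewrite normr1 mul1r normrM (ger0_norm hi) mulrC ler_pdivrMr//.
    rewrite distrC.
    have := restrict_lipschitz df fC hf0 (_ : z.2 - t - h <= z.2 - t); rewrite gerBl ltW// => /(_ isT).
    by have -> : z.2 - t - (z.2 - t - h) = h by ring.
  - move=> z _; apply: cvgM; first exact: cvg_cst.
    exact: restrict_left_quotient.
have cy : h^-1 * (y_ (t + h) - y_ t) @[h --> 0^'+] --> - pairing (Y t) f'.
  have -> : - pairing (Y t) f' = \int[L]_z G0 z.
    rewrite (transport_pairing YL)//; last by rewrite t0 ltW.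
    rewrite -[RHS]opprK; congr (- _); rewrite -mulN1r -RintegralZl//.
      by apply: eq_Rintegral => z _; rewrite /flow_le /G0 mulN1r mulrN opprK.
    apply: measurable_bounded_integrable => //.
      by apply: measurable_funM => //; apply: measurableT_comp => //; exact: measurable_shift.
    apply: (@bounded_byP _ _ _ _ C) => z _; rewrite /G0 mulrN normrN; exact: (flow_le_bound t z C0 fC).
  apply: cvg_trans c; apply: near_eq_cvg; near=> h.
  have h0 : 0 < h by near: h; exact: nbhs_right_gt.
  have hhe : h <= e by near: h; exact: nbhs_right_le.
  have thT : t + h <= T.
    by rewrite -lerBrDl; near: h; apply: nbhs_right_le; rewrite subr_gt0.
  pose K (z : RT * RT) : R := \1_[set z : RT * RT | z.1 <= t] z * (f \_ D0) (z.2 - t - h).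
  have iK : L.-integrable setT (EFin \o K).
    apply: measurable_bounded_integrable => //.
      by apply: measurable_funM => //; exact: mshift.
    apply: (@bounded_byP _ _ _ _ Cf) => z _; rewrite /K normrM indicE.
    case: (_ \in _); rewrite ?normr0 ?mul0r// normr1 mul1r patchE.
    by case: ifPn => [/set_mem/fCf//|_]; rewrite normr0.
  have il : L.-integrable setT (EFin \o flow_le t f).
    apply: measurable_bounded_integrable => //; first exact: measurable_flow_le.
    by apply: (@bounded_byP _ _ _ _ Cf) => z _; exact: flow_le_bound.
  have -> : y_ (t + h) = \int[L]_z K z.
    rewrite (transport_pairing YL)//; last by rewrite addr_ge0// ltW.
    rewrite /Rintegral; congr fine; apply: ae_eq_integral => //.
    - by apply/measurable_EFinP; exact: measurable_flow_le.
    - by case/integrableP : iK.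
    exists [set z | t < z.1 <= t + e]; split; last first.
      move=> z /= nz; apply: contrapT => zt; apply: nz => _; rewrite /flow_le /K opprD addrA.
      congr ((nat_of_bool _)%:R * _)%:E; apply/idP/idP => /set_mem/= zh; apply/mem_set => /=.
        rewrite leNgt; apply/negP => tz; apply: zt; rewrite tz/= (le_trans zh)// lerD2l//.
      by rewrite (le_trans zh)// lerDl ltW.
    - exact: flow_gap.
    have mf1 : measurable_fun setT (fst : RT * RT -> RT) by exact: measurable_fst.
    rewrite (_ : mkset _ = fst @^-1` `]t, t + e]); last by apply/seteqP; split => z; rewrite /= in_itv.
    by rewrite -[X in measurable X]setTI; apply: mf1 => //; exact: measurable_itv.
  rewrite (transport_pairing YL)//; last by rewrite t0 ltW.
  rewrite -RintegralB// -RintegralZl//; last first.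
    by have := integrableB measurableT iK il.
  by apply: eq_Rintegral => z _; rewrite /G /K /flow_le -mulrBr mulrCA.
have := chain_right (dF (y_ t)) cy; rewrite mulrN; exact.
Unshelve. all: by end_near.
Qed.

Let b_right t : 0 <= t -> b r @[r --> t^'+] --> b t.
Proof.
move=> t0; apply: cvgM; last exact: (Yright t0 bf').
apply: (cvg_comp _ _ (Yright t0 bf)); exact: cF'.
Qed.

(** Let Phi be the difference of the two sides as a function of the upper time.
    Its jumps cancel by [ito_jump], so it is left-continuous, and its right
    derivative is 0 by [ito_right]; real induction then gives |Phi t| <= e t for
    every e > 0. *)
Theorem ito_formula : F (y_ T) - F (y_ 0) = - Z T + \int[m]_(q in S) (\1_[set q | time q <= T] q * H q).
Proof.
rewrite -/(J T); pose Phi t := F (y_ t) - F (y_ 0) + Z t - J t.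
suff : Phi T = 0 by rewrite /Phi => /eqP; rewrite subr_eq0 => /eqP <-; rewrite addrCA addNr addr0.
have [B bB] := b_bound.
have claim (e : R) : 0 < e -> forall t, 0 <= t <= T -> `|Phi t| <= e * t.
  move=> e0; apply: real_induction => [t /andP[]|t /andP[t0 tT] hQ].
    rewrite le_eqVlt => /orP[/eqP <- _ _|t0 tT hQ].
      rewrite mulr0 /Phi subrr add0r /Z set_itvxx//= (_ : \int[leb]_(s in _) b s = 0); last first.
        by rewrite Rintegral_set0.
      rewrite (_ : J 0 = 0) ?subrr ?normr0// /J.
      transitivity (\int[m]_(q in S) (cst 0 q)); last by rewrite Rintegral_cst// mul0r.
      apply: eq_Rintegral => q /set_mem Sq.
      by rewrite indicE memNset ?mul0r//=; apply/negP; rewrite -ltNge; case: (Spos Sq).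
    (* the jump of F (y) cancels that of the sum over births *)
    have cPhi : Phi r @[r --> t^'-] --> Phi t.
      have -> : Phi t = F (ym t) - F (y_ 0) + Z t -
          \int[m]_(q in S) (\1_(time @^-1` `]-oo, t[) q * H q).
        rewrite /Phi; have := gain_jump t; rewrite -ito_jump ?t0//; lra.
      apply: cvgB; last exact: gain_left.
      apply: cvgD.
        apply: cvgB; last exact: cvg_cst.
        by apply: (cvg_comp _ _ (Yleft t0 bf hf0)); exact: cF.
      have B0 : 0 <= B by apply: le_trans (normr_ge0 _) (bB t _); rewrite t0.
      apply/cvgrPdist_le => d d0; near=> r.
      have r0 : 0 <= r by near: r; exact: nbhs_left_ge.
      have rt : r <= t by near: r; exact: nbhs_left_le.
      have := @Rintegral_increment _ b T B 0 B r t mb bB r0 rt tT.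
      rewrite mul0r subr0 => h; apply: (le_trans (h _)).
        by move=> s /andP[rs st]; rewrite subr0; apply: bB; rewrite (le_lt_trans r0)//= (le_trans st).
      apply: (@le_trans _ _ ((B + 1) * (t - r))); first by rewrite ler_wpM2r ?subr_ge0// lerDl.
      rewrite mulrC -ler_pdivlMr; last by rewrite ltr_wpDl.
      rewrite lerBlDr -lerBlDl; near: r; apply: nbhs_left_ge.
      by rewrite ltrBlDr ltrDl divr_gt0// ltr_wpDl.
    rewrite -(cvg_lim _ (cvg_norm cPhi))//; apply: limr_le.
      by apply/cvg_ex; eexists; exact: (cvg_norm cPhi).
    near=> r; have rt : r < t by near: r; exact: nbhs_left_lt.
    apply: (le_trans (hQ r _)).
      by rewrite rt andbT; near: r; exact: nbhs_left_ge.
    by rewrite ler_pM2l// ltW.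
  have [d d0 hd] := birth_gap t0.
  have e20 : 0 < e / 2 by rewrite divr_gt0.
  have n1 : \forall h \near 0^'+, `|- b t - h^-1 * (F (y_ (t + h)) - F (y_ t))| <= e / 2.
    by have /cvgrPdist_le := ito_right (introT andP (conj t0 tT)); exact.
  have n2 : \forall r \near t^'+, `|b t - b r| <= e / 2.
    by have /cvgrPdist_le := b_right t0; exact.
  have [d1 /= d10 h1] := n1; have [d2 /= d20 h2] := n2.
  exists (Num.min d (Num.min d1 d2)); first by rewrite !lt_min d0 d10.
  move=> s /andP[ts]; rewrite -ltrBlDl !lt_min => /and3P[sd s1 s2] sT.
  have st0 : 0 < s - t by rewrite subr_gt0.
  have := h1 (s - t); rewrite /= sub0r normrN gtr0_norm// => /(_ s1 st0).
  rewrite [t + _]addrC subrK => q1.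
  have q2 := @Rintegral_increment _ b T B (b t) (e / 2) t s mb bB t0 (ltW ts) sT.
  have {}q2 := q2 _ ; have {}q2 : `|Z s - Z t - b t * (s - t)| <= e / 2 * (s - t).
    apply: q2 => r /andP[tr rs]; rewrite distrC; apply: h2 => //=.
    by rewrite distrC gtr0_norm ?subr_gt0// (le_lt_trans _ s2)// lerD2r.
  (* no birth in ]t, s] *)
  have q3 : J s = J t.
    rewrite !JE; apply/eqP; rewrite -subr_eq0 -RintegralB//; last 2 first.
    - by apply: Im; exact: measurable_itv.
    - by apply: Im; exact: measurable_itv.
    rewrite /Rintegral (ae_eq_integral (cst 0%E))//.
    - by rewrite integral_cst// mul0e.
    - apply/measurable_EFinP; apply: measurable_funB; apply: mJ; exact: measurable_itv.
    exists (S `&` [set q | t < time q <= t + d]); split => //.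
      apply: measurableI => //; rewrite (_ : mkset _ = time @^-1` `]t, t + d]).
        by apply: m_time; exact: measurable_itv.
      by apply/seteqP; split => q; rewrite /= in_itv.
    move=> q /= nq; apply: contrapT => nin; apply: nq => Sq.
    have nt : ~~ (t < time q <= t + d) by apply/negP => h; apply: nin.
    rewrite -mulrBl !indicE (_ : (q \in time @^-1` `]-oo, s]) = (q \in time @^-1` `]-oo, t])) ?subrr ?mul0r//.
    apply/idP/idP => /set_mem/=; rewrite in_itv/= => h; apply/mem_set; rewrite /= in_itv/=; last first.
      exact: le_trans h (ltW ts).
    by move: nt; rewrite negb_and -leNgt => /orP[//|]; rewrite -ltNge; lra.
  have q1' : `|F (y_ s) - F (y_ t) + b t * (s - t)| <= e / 2 * (s - t).
    rewrite -[_ + _]opprK normrN.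
    have -> : - (F (y_ s) - F (y_ t) + b t * (s - t)) =
       (- b t - (s - t)^-1 * (F (y_ s) - F (y_ t))) * (s - t).
      have n0 : s - t != 0 by rewrite gt_eqF.
      have alg (u v w : R) : w != 0 -> - (v + u * w) = (- u - w^-1 * v) * w by move=> w0; field.
      exact: alg.
    by rewrite normrM [X in _ * X]gtr0_norm// ler_pM2r.
  have := hQ t; rewrite t0 lexx => /(_ isT) q4.
  have -> : Phi s = Phi t + (F (y_ s) - F (y_ t) + b t * (s - t)) + (Z s - Z t - b t * (s - t)).
    by rewrite /Phi q3; ring.
  apply: (le_trans (ler_normD _ _)).
  have -> : e * s = e * t + e / 2 * (s - t) + e / 2 * (s - t) by field.
  by apply: lerD => //; apply: (le_trans (ler_normD _ _)); exact: lerD.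
apply/eqP; rewrite -normr_le0; apply/ler_addgt0Pr => e e0; rewrite add0r.
have T1 : 0 < T + 1 by rewrite ltr_wpDl.
apply: (le_trans (claim (e / (T + 1)) _ T _)).
- by rewrite divr_gt0.
- by rewrite T0 lexx.
- by rewrite mulrAC ler_pdivrMr// ler_pM2l// lerDl.
Unshelve. all: by end_near.
Qed.

End ito.

(** * The generator as a difference of gain rates *)

Lemma nneseries_cvg_real {R : realType} (a : nat -> R) (A : R) : (forall n, 0 <= a n) ->
  (\sum_(n <oo) (a n)%:E = A%:E)%E -> \sum_(0 <= i < n) a i @[n --> \oo] --> A.
Proof.
move=> a0 aA; apply: cvg_EFin'.
have : (\sum_(0 <= i < n) (a i)%:E)%E @[n --> \oo] --> (\sum_(n <oo) (a n)%:E)%E.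
  by apply: is_cvg_nneseries => n _ _; rewrite lee_fin.
by rewrite aA; under eq_fun do rewrite sumEFin.
Qed.

Section generator_split.
Context {R : realType}.
Local Notation D0 := (`]0, +oo[%classic : set R).
Local Notation RT := (measurableTypeR R).
Variables (alpha : R -> R) (p : R -> nat -> R) (C mb : R) (Ginf : probability (seqT R) R).
Hypothesis halpha : bounded_continuous D0 alpha.
Hypothesis alpha0 : positive_on D0 alpha.
Hypothesis C0 : 0 <= C.
Hypothesis alphaC : forall x, D0 x -> alpha x <= C.
Hypothesis hp : forall n, bounded_continuous D0 (p ^~ n).
Hypothesis hp1 : forall n x, D0 x -> 0 <= p x n <= 1.
Hypothesis hpm : forall x, D0 x -> (\sum_(n <oo) (n%:R * p x n)%:E <= mb%:E)%E.
Variables f f' F F' : R -> R.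
Hypothesis bf : bounded_continuous D0 f.
Variable CF : R.
Hypothesis CF0 : 0 <= CF.
Hypothesis FC : forall x, `|F x| <= CF.
Hypothesis cF : continuous F.

Definition litter_value (n : nat) (z : seqT R) : R := \sum_(i < n) f (z i).

(** The gain of F at a jump v, for e = 1, or its loss, for e = -1: splitting the
    increment keeps all integrals and series those of nonnegative terms. *)
Definition signed_gain (e y v : R) : R := Num.max (e * (F (y + v) - F y)) 0.

Lemma signed_gain_ge0 e y v : 0 <= signed_gain e y v.
Proof. by rewrite /signed_gain le_max lexx orbT. Qed.

Lemma signed_gain_le e y v : `|e| <= 1 -> signed_gain e y v <= 2 * CF.
Proof.
move=> e1; rewrite /signed_gain ge_max mulr_ge0// andbT.
apply: (le_trans (ler_norm _)); rewrite normrM -[leRHS]mul1r; apply: ler_pM => //.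
apply: (le_trans (ler_normB _ _)); have := FC (y + v); have := FC y; lra.
Qed.

Lemma signed_gainB y v : signed_gain 1 y v - signed_gain (-1) y v = F (y + v) - F y.
Proof.
rewrite /signed_gain mul1r mulN1r; set u := F _ - F _.
by case: (leP u 0); case: (leP (- u) 0); lra.
Qed.

Lemma measurable_litter_value n :
  measurable_fun (@posseq R) (litter_value n : seqT R -> RT).
Proof.
apply: measurable_sum => i.
have mfb : measurable_fun setT ((f \_ D0) : RT -> RT).
  by apply: measurable_patch0; exact: bounded_continuous_measurable.
have := measurable_funTS (D := @posseq R) (measurableT_comp mfb (measurable_coord i)).
apply: eq_measurable_fun => z /set_mem zp; rewrite /= patchE mem_set//= in_itv/= andbT; exact: zp.
Qed.

Lemma measurable_signed_gain e d (U : measurableType d) (A : set U) (g1 g2 : U -> RT) :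
  measurable_fun A g1 -> measurable_fun A g2 ->
  measurable_fun A ((fun u => signed_gain e (g1 u) (g2 u)) : U -> RT).
Proof.
move=> m1 m2.
have mF : measurable_fun setT (F : RT -> RT) by exact: continuous_measurable_fun.
apply: measurable_maxr => //; apply: measurable_funM => //; apply: measurable_funB.
  exact: (measurableT_comp mF (measurable_funD m1 m2)).
exact: (measurableT_comp mF m1).
Qed.

Definition mean_gain e n y : \bar R :=
  (\int[Ginf]_(z in @posseq R) (signed_gain e y (litter_value n z))%:E)%E.

Lemma mean_gain_ge0 e n y : (0 <= mean_gain e n y)%E.
Proof. by apply: integral_ge0 => z _; rewrite lee_fin signed_gain_ge0. Qed.

(** Nothing is gained without children, and 2 CF bounds any gain; the factor n
    makes the sum over the litters converge. *)
Lemma mean_gain_le e n y : `|e| <= 1 -> (mean_gain e n y <= (2 * CF * n%:R)%:E)%E.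
Proof.
move=> e1; case: n => [|n].
  rewrite mulr0 /mean_gain (eq_integral (cst 0%E)) ?integral_cst ?mul0e//; first exact: measurable_posseq.
  by move=> z _; rewrite /litter_value big_ord0 /signed_gain addr0 subrr mulr0 maxxx.
apply: (@le_trans _ _ (\int[Ginf]_(z in @posseq R) (2 * CF)%:E)%E).
  apply: ge0_le_integral_any => z _; first by rewrite lee_fin signed_gain_ge0.
  by rewrite lee_fin; exact: signed_gain_le.
rewrite integral_cst//; last exact: measurable_posseq.
rewrite [leRHS]EFinM; apply: lee_pmul => //; first by rewrite lee_fin mulr_ge0.
apply: (@le_trans _ _ 1%E); first by apply: probability_le1; exact: measurable_posseq.
by rewrite lee_fin ler1n.
Qed.

Lemma measurable_mean_gain e n : measurable_fun setT (mean_gain e n : RT -> \bar R).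
Proof.
pose h (z : RT * seqT R) : \bar R := ((fun z : RT * seqT R => (signed_gain e z.1 (litter_value n z.2))%:E) \_ (setT `*` @posseq R)) z.
have mX : measurable (setT `*` @posseq R : set (RT * seqT R)).
  by apply: measurableX => //; exact: measurable_posseq.
have mh : measurable_fun setT h.
  apply: (measurable_restrictT _ mX).1; apply/measurable_EFinP.
  have mv : measurable_fun (setT `*` @posseq R) ((fun z => litter_value n z.2) : RT * seqT R -> RT).
    rewrite (_ : setT `*` _ = snd @^-1` @posseq R); last by apply/seteqP; split => z //= -[].
    apply: (measurable_comp (F := @posseq R)) => //; first exact: measurable_posseq.
    - by move=> _ [z zp <-].
    - exact: measurable_litter_value.
    - by apply: measurable_funTS; exact: measurable_snd.
  apply: measurable_signed_gain => //.
  by apply: measurable_funTS; exact: measurable_fst.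
have h0 z : (0 <= h z)%E by rewrite /h patchE; case: ifP => // _; rewrite lee_fin signed_gain_ge0.
have := measurable_fun_fubini_tonelli_F (m2 := Ginf) h mh h0.
apply: eq_measurable_fun => y _; rewrite /fubini_F /mean_gain [RHS]integral_mkcond.
apply: eq_integral => z _; rewrite /h !patchE; congr (if _ then _ else _).
by apply/idP/idP => [/set_mem[_ zp]|/set_mem zp]; apply/mem_set => //; split.
Qed.

Definition gain_rate e (mu : posMeasure R) : \bar R :=
  (\sum_(n <oo) (pairing mu (fun x => alpha x * p x n))%:E * mean_gain e n (pairing mu f))%E.

Lemma ap_ge0 (mu : posMeasure R) n : 0 <= pairing mu (fun x => alpha x * p x n).
Proof.
apply: pairing_ge0 => x Dx; apply: mulr_ge0; first exact: alpha0.
by have /andP[] := hp1 n Dx.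
Qed.

Lemma gain_rate_ge0 e mu : (0 <= gain_rate e mu)%E.
Proof. by apply: nneseries_ge0 => n _ _; apply: mule_ge0; [rewrite lee_fin ap_ge0|exact: mean_gain_ge0]. Qed.

Lemma gain_rate_le e mu : `|e| <= 1 -> (gain_rate e mu <= (2 * CF * (C * mb * mass mu))%:E)%E.
Proof.
move=> e1; apply: (@le_trans _ _ ((2 * CF)%:E * \sum_(n <oo) (pairing mu (fun x => alpha x * p x n))%:E * n%:R%:E)%E).
  rewrite -nneseriesZl; last by move=> n _; apply: mule_ge0; rewrite lee_fin ?ap_ge0.
  apply: lee_nneseries => [n _ _|n _].
    by apply: mule_ge0; [rewrite lee_fin ap_ge0|exact: mean_gain_ge0].
  rewrite muleCA; apply: lee_pmul => //; first by rewrite lee_fin ap_ge0.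
    exact: mean_gain_ge0.
  by rewrite -EFinM; exact: mean_gain_le.
rewrite [leRHS]EFinM; apply: lee_pmul => //.
- by rewrite lee_fin mulr_ge0.
- by apply: nneseries_ge0 => n _ _; apply: mule_ge0; rewrite lee_fin ?ap_ge0.
- exact: mean_offspring.
Qed.

Lemma gain_rate_fin e mu : `|e| <= 1 -> gain_rate e mu \is a fin_num.
Proof.
move=> e1; rewrite ge0_fin_numE; last exact: gain_rate_ge0.
by apply: (le_lt_trans (gain_rate_le mu e1)); rewrite ltry.
Qed.

Lemma mean_gain_fin e n y : `|e| <= 1 -> mean_gain e n y \is a fin_num.
Proof.
move=> e1; rewrite ge0_fin_numE; last exact: mean_gain_ge0.
by apply: (le_lt_trans (mean_gain_le n y e1)); rewrite ltry.
Qed.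

(** The bracket in the generator is the loss minus the gain, and the series of
    gains and of losses converge separately. *)
Lemma generator_split mu : generator alpha p Ginf f f' F F' mu =
  - pairing mu f' * F' (pairing mu f) + (fine (gain_rate 1 mu) - fine (gain_rate (-1) mu)).
Proof.
have n1 : `|1 : R| <= 1 by rewrite normr1.
have nN1 : `|-1 : R| <= 1 by rewrite normrN normr1.
rewrite /generator; congr (_ + _); rewrite -[RHS]opprB; congr (- _).
set y := pairing mu f.
pose a e n := pairing mu (fun x => alpha x * p x n) * fine (mean_gain e n y).
have a0 e n : 0 <= a e n by rewrite mulr_ge0 ?ap_ge0// fine_ge0// mean_gain_ge0.
have aE e : `|e| <= 1 -> (\sum_(n <oo) (a e n)%:E = (fine (gain_rate e mu))%:E)%E.
  move=> e1; rewrite fineK; last exact: gain_rate_fin.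
  by apply: eq_eseriesr => n _; rewrite /a EFinM (fineK (mean_gain_fin n y e1)).
have c : \sum_(0 <= i < n) (a (-1) i - a 1 i) @[n --> \oo] --> fine (gain_rate (-1) mu) - fine (gain_rate 1 mu).
  under eq_fun do rewrite sumrB.
  by apply: cvgB; apply: nneseries_cvg_real => //; exact: aE.
rewrite -(cvg_lim _ c)//; congr (lim (_ @ \oo)); apply/funext => N; apply: eq_bigr => n _.
have mg e : measurable_fun (@posseq R) ((fun z => signed_gain e y (litter_value n z)) : seqT R -> RT).
  by apply: measurable_signed_gain; [exact: measurable_cst|exact: measurable_litter_value].
have ig e : `|e| <= 1 -> Ginf.-integrable (@posseq R) (EFin \o (fun z => signed_gain e y (litter_value n z))).
  move=> e1; apply: measurable_bounded_integrable => //; first exact: measurable_posseq.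
  - by apply: (@le_lt_trans _ _ 1%E); [apply: probability_le1; exact: measurable_posseq|exact: ltry].
  - exact: mg.
  - apply: (@bounded_byP _ _ _ _ (2 * CF)) => z _; rewrite ger0_norm ?signed_gain_ge0//.
    exact: signed_gain_le.
have kE : \int[Ginf]_(z in @posseq R) (F y - F (y + \sum_(i < n) f (z i))) =
    fine (mean_gain (-1) n y) - fine (mean_gain 1 n y).
  rewrite -[fine (mean_gain (-1) n y)]/(\int[Ginf]_(z in @posseq R) signed_gain (-1) y (litter_value n z)).
  rewrite -[fine (mean_gain 1 n y)]/(\int[Ginf]_(z in @posseq R) signed_gain 1 y (litter_value n z)).
  rewrite -RintegralB//; [|exact: measurable_posseq|exact: ig|exact: ig].
  apply: eq_Rintegral => z _; rewrite -[RHS]opprB signed_gainB opprB.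
  by [].
rewrite kE /pairing RintegralZr//; first by rewrite /a mulrBr.
have := @pairing_integrable _ mu (fun x => alpha x * p x n) C; apply.
  by apply: measurable_funM; exact: bounded_continuous_measurable.
move=> x Dx; have /andP[p0 p1] := hp1 n Dx.
rewrite ger0_norm ?mulr_ge0// ?alpha0// -[leRHS]mulr1; apply: ler_pM => //; first exact: alpha0.
exact: alphaC.
Qed.

End generator_split.

(** * Compensated sums over the births *)

Section compensated_process.
Context {R : realType} {d} {Omega : measurableType d} {P : probability Omega R}
  {Ft : R -> set (set Omega)} {Ginf : probability (seqT R) R}
  {M : Omega -> {measure set (pointT R) -> \bar R}}.
Hypothesis hFt : usual_filtration P Ft.
Hypothesis hM : filtered_poisson P (@time_of R) Ft (intensity Ginf) M.
Local Notation D0 := (`]0, +oo[%classic : set R).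
Local Notation m := (intensity_measure Ginf).
Local Notation time := (@time_of R).
Variables (alpha : R -> R) (p : R -> nat -> R).
Hypothesis halpha : bounded_continuous D0 alpha.
Hypothesis alpha0 : positive_on D0 alpha.
Hypothesis hp : forall n, bounded_continuous D0 (p ^~ n).
Variables (X : R -> Omega -> posMeasure R) (Xm : Omega -> R -> posMeasure R).
Variable Theta : set Omega.
Hypothesis FTheta : Ft 0 Theta.
Hypothesis mX : forall t, 0 <= t -> weakly_measurable (Ft t) (X t).
Hypothesis XmE : forall w s, Theta w -> 0 < s -> left_limit (X ^~ w) s (Xm w s).
Local Notation bw := (birth_window (Ft := Ft) alpha p Xm Theta).
Variable G : Omega * pointT R -> \bar R.
Hypothesis G0 : forall z, (0 <= G z)%E.
Hypothesis mG : forall u t, measurable_fun (bw u t) (G : predT Ft time -> \bar R).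

Definition counted u t w : \bar R := (\int[M w]_(q in xsection (bw u t) w) G (w, q))%E.
Definition expected u t w : \bar R := (\int[m]_(q in xsection (bw u t) w) G (w, q))%E.

Lemma counted_ge0 u t w : (0 <= counted u t w)%E.
Proof. by apply: integral_ge0. Qed.

Lemma expected_ge0 u t w : (0 <= expected u t w)%E.
Proof. by apply: integral_ge0. Qed.

Let mbw u t : measurable (bw u t).
Proof. exact: (measurable_birth_windowT hFt halpha alpha0 hp FTheta mX XmE). Qed.

Lemma measurable_counted u t : measurable_fun setT (counted u t).
Proof.
by have [] // := predictable_compensation hFt hM (mbw u t) (fun z bz => (birth_windowP bz).2) (@mG u t) (fun z _ => G0 z).
Qed.

Lemma measurable_expected u t : measurable_fun setT (expected u t).
Proof.
by have [] // := predictable_compensation hFt hM (mbw u t) (fun z bz => (birth_windowP bz).2) (@mG u t) (fun z _ => G0 z).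
Qed.

(** Cutting the window down to A x ]u, +oo[, with A known at time u, leaves it
    predictable; so the compensation formula holds on A. *)
Lemma counted_expected u t A : 0 <= u -> Ft u A ->
  (\int[P]_(w in A) counted u t w = \int[P]_(w in A) expected u t w)%E.
Proof.
move=> u0 FA; pose S : set (predT Ft time) := bw u t `&` (A `*` [set q | u < time q]).
have mS : measurable S.
  apply: measurableI => //; apply: sub_sigma_algebra; exists u, A, [set q | u < time q].
  split => //; rewrite (_ : mkset _ = time @^-1` `]u, +oo[).
    by rewrite -[X in measurable X]setTI; exact: measurable_time_of.
  by apply/seteqP; split => q; rewrite /= in_itv/= andbT.
have xS w : xsection S w = if w \in A then xsection (bw u t) w else set0.
  apply/seteqP; split => q; rewrite /xsection/= inE.
    by move=> [bq [/= Aw _]]; rewrite mem_set//= inE.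
  case: ifPn => // /set_mem Aw; rewrite /= inE => bq; split => //; split => //=.
  by case: bq => _ /= /andP[].
have E (L : Omega -> {measure set (pointT R) -> \bar R}) w :
    (\int[L w]_(q in xsection S w) G (w, q) = ((fun w => \int[L w]_(q in xsection (bw u t) w) G (w, q)) \_ A) w)%E.
  by rewrite xS patchE; case: ifP => // _; rewrite integral_set0.
have sub : S `<=` bw u t by move=> z [].
have [_ _] := predictable_compensation hFt hM mS (fun z bz => (birth_windowP (sub z bz)).2)
  (measurable_funS (mbw u t) sub (@mG u t)) (fun z _ => G0 z).
under eq_integral do rewrite E; under [in RHS]eq_integral do rewrite (E (fun=> m)).
by rewrite -!integral_mkcond.
Qed.

Lemma measurable_window_section u t w : measurable (xsection (bw u t) w).
Proof. exact: (measurable_section hFt halpha alpha0 hp FTheta mX XmE). Qed.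

Lemma measurable_gain_section u t w : measurable_fun (xsection (bw u t) w) (fun q => G (w, q)).
Proof.
have mGT : measurable_fun setT ((G \_ (bw u t)) : predT Ft time -> \bar R).
  by apply: (measurable_restrictT _ _).1.
have := measurable_funTS (D := xsection (bw u t) w) (pred_section hFt w mGT).
apply: eq_measurable_fun => q; rewrite mem_xsection => /set_mem bq.
by rewrite patchE mem_set.
Qed.

Lemma window_split s t w : 0 <= s -> s <= t ->
  xsection (bw 0 t) w = xsection (bw 0 s) w `|` xsection (bw s t) w /\
  [disjoint xsection (bw 0 s) w & xsection (bw s t) w].
Proof.
move=> s0 st; split.
  rewrite !birth_window_section -setIUr; congr (_ `&` _).
  apply/seteqP; split => q /=.
    by move=> /andP[q0 qt]; have [qu|uq] := leP (time q) s; [left; rewrite q0|right].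
  by move=> [/andP[-> qu]|/andP[uq ->]]; rewrite ?(le_trans qu)// (le_lt_trans s0).
apply/disj_setPLR => q; rewrite !birth_window_section => -[_ /= /andP[_ qu]] [_ /= /andP[]].
by rewrite ltNge qu.
Qed.

Lemma counted_add s t w : 0 <= s -> s <= t -> counted 0 t w = (counted 0 s w + counted s t w)%E.
Proof.
move=> s0 st; have [E dis] := window_split w s0 st.
have mU := @measurable_gain_section 0 t w; rewrite E in mU.
by rewrite /counted E ge0_integral_setU//; exact: measurable_window_section.
Qed.

Lemma expected_add s t w : 0 <= s -> s <= t -> expected 0 t w = (expected 0 s w + expected s t w)%E.
Proof.
move=> s0 st; have [E dis] := window_split w s0 st.
have mU := @measurable_gain_section 0 t w; rewrite E in mU.
by rewrite /expected E ge0_integral_setU//; exact: measurable_window_section.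
Qed.

Hypothesis fin_counted : forall t w, (counted 0 t w < +oo)%E.
Hypothesis fin_expected : forall t w, (expected 0 t w < +oo)%E.
Hypothesis fin_mean : forall t, 0 <= t -> (\int[P]_w counted 0 t w < +oo)%E.

Definition compensated t w : R := fine (counted 0 t w) - fine (expected 0 t w).

Let countedE t w : (fine (counted 0 t w))%:E = counted 0 t w.
Proof. by rewrite fineK// ge0_fin_numE// counted_ge0. Qed.

Let expectedE t w : (fine (expected 0 t w))%:E = expected 0 t w.
Proof. by rewrite fineK// ge0_fin_numE// expected_ge0. Qed.

Let mean_expected t : 0 <= t -> (\int[P]_w expected 0 t w < +oo)%E.
Proof. by move=> t0; rewrite -(counted_expected t (lexx 0) (filtT hFt (lexx 0))); exact: fin_mean. Qed.

Lemma integrable_counted t : 0 <= t -> P.-integrable setT (EFin \o (fun w => fine (counted 0 t w))).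
Proof.
move=> t0; apply/integrableP; split.
  by apply/measurable_EFinP; apply: measurableT_comp => //; exact: measurable_counted.
rewrite (eq_integral (counted 0 t)); first exact: fin_mean.
by move=> w _; rewrite [LHS]gee0_abs; [exact: countedE|rewrite lee_fin fine_ge0// counted_ge0].
Qed.

Lemma integrable_expected t : 0 <= t -> P.-integrable setT (EFin \o (fun w => fine (expected 0 t w))).
Proof.
move=> t0; apply/integrableP; split.
  by apply/measurable_EFinP; apply: measurableT_comp => //; exact: measurable_expected.
rewrite (eq_integral (expected 0 t)); first exact: mean_expected.
by move=> w _; rewrite [LHS]gee0_abs; [exact: expectedE|rewrite lee_fin fine_ge0// expected_ge0].
Qed.

Lemma integrable_compensated t : 0 <= t -> P.-integrable setT (EFin \o compensated t).
Proof.
move=> t0; rewrite /compensated/comp; under eq_fun do rewrite EFinB.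
by apply: integrableB => //; [exact: integrable_counted|exact: integrable_expected].
Qed.

(** The two terms are additive in time, and their increments after s have the
    same mean on A. *)
Lemma compensated_mean s t A : 0 <= s -> s <= t -> Ft s A ->
  (\int[P]_(w in A) (compensated s w)%:E = \int[P]_(w in A) (compensated t w)%:E)%E.
Proof.
move=> s0 st FA; have t0 : 0 <= t by exact: le_trans st.
have mA : measurable A by exact: filt_measurable hFt _ _ s0 FA.
have ic r : 0 <= r -> P.-integrable A (EFin \o (fun w => fine (counted 0 r w))).
  by move=> r0; apply: integrableS (integrable_counted r0).
have ie r : 0 <= r -> P.-integrable A (EFin \o (fun w => fine (expected 0 r w))).
  by move=> r0; apply: integrableS (integrable_expected r0).
have E r : 0 <= r -> (\int[P]_(w in A) (compensated r w)%:E =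
    \int[P]_(w in A) counted 0 r w - \int[P]_(w in A) expected 0 r w)%E.
  move=> r0; rewrite /compensated; under eq_integral do rewrite EFinB.
  rewrite integralB//; [|exact: ic|exact: ie].
  by congr (_ - _)%E; apply: eq_integral => w _ /=; rewrite ?countedE ?expectedE.
rewrite (E s s0) (E t t0).
have -> : (\int[P]_(w in A) counted 0 t w = \int[P]_(w in A) counted 0 s w + \int[P]_(w in A) counted s t w)%E.
  rewrite -ge0_integralD//.
  - by apply: eq_integral => w _; exact: counted_add.
  - by move=> w _; exact: counted_ge0.
  - by apply: measurable_funTS; exact: measurable_counted.
  - by move=> w _; exact: counted_ge0.
  - by apply: measurable_funTS; exact: measurable_counted.
have -> : (\int[P]_(w in A) expected 0 t w = \int[P]_(w in A) expected 0 s w + \int[P]_(w in A) expected s t w)%E.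
  rewrite -ge0_integralD//.
  - by apply: eq_integral => w _; exact: expected_add.
  - by move=> w _; exact: expected_ge0.
  - by apply: measurable_funTS; exact: measurable_expected.
  - by move=> w _; exact: expected_ge0.
  - by apply: measurable_funTS; exact: measurable_expected.
rewrite -(counted_expected t s0 FA).
have fc : (\int[P]_(w in A) counted s t w)%E \is a fin_num.
  rewrite ge0_fin_numE; last by apply: integral_ge0 => w _; exact: counted_ge0.
  apply: (@le_lt_trans _ _ (\int[P]_w counted 0 t w)%E); last exact: fin_mean.
  apply: (@le_trans _ _ (\int[P]_w counted s t w)%E).
    apply: ge0_subset_integral => //; first exact: measurable_counted.
    by move=> w _; exact: counted_ge0.
  apply: ge0_le_integral_any => w _; first exact: counted_ge0.
  by rewrite (@counted_add s t)// leeDr// counted_ge0.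
have fe : (\int[P]_(w in A) expected 0 s w)%E \is a fin_num.
  rewrite ge0_fin_numE; last by apply: integral_ge0 => w _; exact: expected_ge0.
  apply: (@le_lt_trans _ _ (\int[P]_w expected 0 s w)%E); last exact: mean_expected.
  apply: ge0_subset_integral => //; first exact: measurable_expected.
  by move=> w _; exact: expected_ge0.
have alg (a b c : \bar R) : b \is a fin_num -> c \is a fin_num -> (a - b = a + c - (b + c))%E.
  move=> bf cf; rewrite -(fineK bf) -(fineK cf); case: a => //= a.
  by rewrite -!EFinD; congr (_%:E); ring.
exact: alg.
Qed.

End compensated_process.

(** * The change of variables for a path of the equation *)

(** By Fubini the masses of the lines z.1 = s integrate to the L-integral of the
    Lebesgue measure of a point, which is 0. *)
Lemma atomless_ae {R : realType} (L : {measure set (measurableTypeR R * measurableTypeR R)%type -> \bar R}) :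
  (L setT < +oo)%E ->
  {ae @lebesgue_measure R, forall s : R, L [set z | z.1 = s] = 0%E}.
Proof.
move=> Lfin.
pose LF : {finite_measure set (measurableTypeR R * measurableTypeR R)%type -> \bar R} :=
  mfrestr (@measurableT _ (measurableTypeR R * measurableTypeR R)%type) Lfin.
have LFE A : LF A = L A by transitivity (L (A `&` setT)) => //; rewrite setIT.
pose dg : set (measurableTypeR R * (measurableTypeR R * measurableTypeR R)) := [set z | z.2.1 = z.1].
have mdg : measurable dg.
  rewrite (_ : dg = (fun z => z.1 - z.2.1) @^-1` [set 0]).
    rewrite -[X in measurable X]setTI.
    have m1 : measurable_fun setT ((fun z : measurableTypeR R * (measurableTypeR R * measurableTypeR R) => z.1 - z.2.1) : _ -> measurableTypeR R).
      by apply: measurable_funB => //; exact: measurableT_comp measurable_fst measurable_snd.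
    by apply: m1 => //; exact: measurable_set1.
  by apply/seteqP; split => z /=; rewrite /dg/=; [move=> ->; rewrite subrr|move/eqP; rewrite subr_eq0 => /eqP ->].
have I0 : (\int[@lebesgue_measure R]_s L [set z | z.1 = s] = 0)%E.
  transitivity (\int[@lebesgue_measure R]_s \int[LF]_z (\1_dg (s, z))%:E)%E.
    apply: eq_integral => s _; rewrite integral_indic//.
      by rewrite setIT [RHS]LFE; congr (L _); apply/seteqP; split => z /=; rewrite /dg/=.
    have : measurable (fst @^-1` [set s] : set (measurableTypeR R * measurableTypeR R)); last by [].
    by rewrite -[X in measurable X]setTI; apply: measurable_fst.
  rewrite (@fubini_tonelli _ _ _ _ _ _ _ (fun z => (\1_dg z)%:E))//=; last first.
    by apply/measurable_EFinP; exact: measurable_indic.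
  apply: integral0_eq => z _.
  have dz : (fun s => dg (s, z)) = [set z.1] by apply/seteqP; split => s; rewrite /dg/=; move=> ->.
  have mdz : measurable (fun s : measurableTypeR R => dg (s, z)) by rewrite dz; exact: measurable_set1.
  rewrite (integral_indic _ measurableT mdz) setIT.
  by transitivity (@lebesgue_measure R [set z.1]); [rewrite dz|exact: lebesgue_measure_set1].
have mL : measurable_fun setT (fun s : measurableTypeR R => L [set z | z.1 = s]).
  have := @measurable_fun_xsection _ _ (measurableTypeR R) _ R LF dg mdg.
  apply: eq_measurable_fun => s _ /=; rewrite [LHS]LFE; congr (L _).
  by apply/seteqP; split => z; rewrite /xsection/= inE.
have /(ae_eq_integral_abs (@lebesgue_measure R) measurableT) [h _] := mL.
have abs0 : (\int[@lebesgue_measure R]_s `|L [set z | z.1 = s]| = 0)%E.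
  by rewrite -[RHS]I0; apply: eq_integral => s _; rewrite gee0_abs.
by apply: negligibleS (h abs0); apply: subsetC => s; exact.
Qed.

Section path_ito.
Context {R : realType}.
Local Notation D0 := (`]0, +oo[%classic : set R).
Local Notation RT := (measurableTypeR R).
Local Notation leb := (@lebesgue_measure R).
Local Notation time := (@time_of R).
Variables (alpha : R -> R) (p : R -> nat -> R).
Hypothesis hp1 : forall n x, D0 x -> 0 <= p x n <= 1.
Variables (m : {measure set (pointT R) -> \bar R}) (Y Ym : R -> posMeasure R).
Hypothesis Yright : weakly_right_continuous Y.
Hypothesis Yleft : forall s, 0 < s -> left_limit Y s (Ym s).
Local Notation D := (birth_domain alpha p Ym).
Hypothesis YE : forall t x, 0 <= t -> 0 < x ->
  ((dist_fun (Y t) x)%:E = (dist_fun (Y 0) (x + t) - dist_fun (Y 0) t)%:E +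
   \int[m]_(q in D t) (births t x q)%:E)%E.
Hypothesis mD : forall t, measurable (D t).

(** The part of a window that carries its intensity. *)
Definition core (k : nat) : set (pointT R) := window k `&` @point_domain R.

Lemma measurable_core k : measurable (core k).
Proof. by apply: measurableI; [exact: measurable_window|exact: measurable_point_domain]. Qed.

Hypothesis core_nat : forall k B, measurable B -> nat_valued (m (B `&` core k)).
Hypothesis core_simple : forall k (s : R), (m (time @^-1` [set s] `&` core k) <= 1)%E.

Lemma birth_domain_sub T : D T `<=` @point_domain R.
Proof.
move=> [[[s u] [[y n] z]] v] /= [/andP[s0 _] /andP[u0 _] E0 /andP[v0 vp]]; split => //; split => //.
apply: (le_trans vp); rewrite /extp; case: (A_ _ _ _) => [x| |] //.
by case: ifP => // x0; have /andP[] := hp1 n (x := x) ltac:(by rewrite /= in_itv/= x0).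
Qed.

Lemma core_cvg (A : set (pointT R)) : measurable A -> A `<=` @point_domain R ->
  m (A `&` core k) @[k --> \oo] --> m A.
Proof.
move=> mA AD; have AE : A = \bigcup_k (A `&` core k).
  rewrite -setI_bigcupr; apply/seteqP; split => q; last by case.
  move=> Aq; split => //; have Dq := AD q Aq.
  have : pos_time time q by move: Dq; rewrite point_domainE /pos_time/= => -[[[[]]]]; rewrite /= in_itv/= andbT.
  by rewrite -(bigcup_window (R := R)) => -[k _ wk]; exists k.
rewrite [in X in _ --> X]AE; apply: nondecreasing_cvg_mu.
- by move=> k; apply: measurableI => //; exact: measurable_core.
- by rewrite -AE.
- move=> i j ij; apply/subsetPset; apply: setIS; apply: setSI.
  exact/subsetPset/nd_window.
Qed.

Variable T : R.
Hypothesis T0 : 0 <= T.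
Hypothesis finT : (\int[m]_(q in D T) (litter_of q)%:R%:E < +oo)%E.

Let S : set (pointT R) := D T `&` [set q | (0 < litter_of q)%N].

Let mS : measurable S.
Proof. exact: measurable_litter_gt. Qed.

Let Sfin : (m S < +oo)%E.
Proof.
apply: le_lt_trans finT.
rewrite -[m S]mul1e -integral_cst//.
apply: (@le_trans _ _ (\int[m]_(q in S) (litter_of q)%:R%:E)%E).
  by apply: ge0_le_integral_any => q [_ /=] // q0; rewrite lee_fin ler1n.
apply: ge0_subset_integral => //.
- apply/measurable_EFinP; apply: measurable_funTS; exact: measurable_litterR.
- by move=> q [].
Qed.

Let SD : S `<=` @point_domain R.
Proof. by move=> q [/birth_domain_sub]. Qed.

Let Snat B : measurable B -> nat_valued (m (B `&` S)).
Proof.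
move=> mB; apply: (@nat_valued_cvg R (fun k => m ((B `&` S) `&` core k))).
- by move=> k; apply: core_nat; exact: measurableI.
- by apply: core_cvg; [exact: measurableI|move=> q [_ /SD]].
- apply: le_lt_trans Sfin; apply: le_measure; rewrite ?inE//; first exact: measurableI.
Qed.

Let Ssimple (s : R) : (m (time @^-1` [set s] `&` S) <= 1)%E.
Proof.
have mt : measurable (time @^-1` [set s]).
  by rewrite -[X in measurable X]setTI; exact: measurable_time_of.
have /cvg_lim <- // := core_cvg (measurableI _ _ mt mS) (fun q h => SD h.2).
apply: lime_le; first by apply: ereal_nondecreasing_is_cvgn => i j ij;
  apply: le_measure; rewrite ?inE; [exact: measurableI (measurableI _ _ mt mS) (measurable_core _)|
    exact: measurableI (measurableI _ _ mt mS) (measurable_core _)|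
    apply: setIS; apply: setSI; exact/subsetPset/nd_window].
apply: nearW => k; apply: le_trans (core_simple k s); apply: le_measure; rewrite ?inE.
- exact: measurableI (measurableI _ _ mt mS) (measurable_core _).
- exact: measurableI mt (measurable_core _).
- by move=> q [[]].
Qed.

Let ancestors : exists L : {measure set (RT * RT)%type -> \bar R},
  [/\ (L setT < +oo)%E,
   forall t (g : RT -> \bar R), 0 <= t <= T -> measurable_fun setT g ->
  (forall x, (0 <= g x)%E) ->
  (\int[Y t]_(x in D0) g x =
   \int[L]_z ((\1_[set z : RT * RT | (z.1 <= t)%R] z)%:E * (g \_ D0) (z.2 - t)%R))%E &
   forall phi : RT * RT -> \bar R, measurable_fun setT phi -> (forall z, (0 <= phi z)%E) ->
  (forall x, phi (0, x) = 0%E) ->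
  (\int[L]_z phi z = \int[m]_(q in S) \sum_(i < litter_of q) phi (time q, (time q + lives_of q i)%R))%E].
Proof.
have [L LE] := ancestral_measure m (Y 0) (mD T); exists L; split.
- exact: (ancestral_fin finT LE).
- by move=> t g tT mg g0; exact: (transport_integral YE LE).
- move=> phi mphi phi0 z0; rewrite LE// integral0_eq ?add0e; last by move=> x _; rewrite z0.
  rewrite integral_mkcond [RHS]integral_mkcond; apply: eq_integral => q _.
  rewrite !patchE; case: ifPn => [/set_mem Dq|nD]; last first.
    by rewrite ifF//; apply/negbTE; apply: contra nD => /set_mem[Dq _]; rewrite mem_set.
  case: ifPn => // nS; case: (posnP (litter_of q)) => [->|l0]; first by rewrite big_ord0.
  by move/negP: nS; case; rewrite mem_set.
Qed.

(** Left limit and value differ at birth times only, and these are atoms of the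
    first marginal of L. *)
Lemma ae_left_limit : {ae leb, forall s : R, 0 < s <= T ->
  forall g, bounded_continuous D0 g -> pairing (Ym s) g = pairing (Y s) g}.
Proof.
have [L [Lfin YL _]] := ancestors.
apply: negligibleS (atomless_ae Lfin); apply: subsetC => s Ls sT g bg.
exact: (left_limitE Lfin Yleft YL sT Ls bg).
Qed.

Variables f f' F F' : R -> R.
Hypothesis hf : C1_deriv D0 f f'.
Hypothesis hf0 : f x @[x --> 0^'+] --> 0.
Hypothesis hF : C1_deriv setT F F'.
Hypothesis mH : measurable_fun (D T) (jump_gain Ym f F : pointT R -> RT).
Hypothesis mb : measurable_fun (`]0, T]%classic : set RT)
  ((fun s : R => F' (pairing (Y s) f) * pairing (Y s) f') : RT -> RT).

(** A birth without children changes nothing. The others form a finite integer-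
    valued measure without simultaneous points, to which [ito_formula] applies. *)
Theorem path_formula : F (pairing (Y T) f) - F (pairing (Y 0) f) =
  - (\int[leb]_(s in `]0, T]) (F' (pairing (Y s) f) * pairing (Y s) f')) +
  \int[m]_(q in D T) jump_gain Ym f F q.
Proof.
have [L [Lfin YL LS]] := ancestors.
have Spos q : S q -> 0 < time q /\ posseq (lives_of q).
  by move/SD; case: q => [[[s u] [[y n] z]] v] /= [s0 _ [_ _ z0] _].
have mHS : measurable_fun S (jump_gain Ym f F : pointT R -> RT).
  by apply: measurable_funS mH => // q [].
have := ito_formula T0 Lfin Yright Yleft YL mS Sfin Snat Ssimple Spos LS hf hf0 hF mHS mb.
move=> ->; congr (_ + _).
rewrite /Rintegral; congr fine; rewrite integral_mkcond [RHS]integral_mkcond.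
apply: eq_integral => q _; rewrite !patchE.
case: ifPn => [/set_mem[Dq _]|nS].
  rewrite mem_set// indicE mem_set ?mul1r//=.
  by have /andP[] := birth_domain_pos Dq.
case: ifPn => // /set_mem Dq; case: (posnP (litter_of q)) => [l0|l0].
  by rewrite /jump_gain /jump_sum l0 big_ord0 addr0 subrr.
by move/negP: nS; case; rewrite mem_set.
Qed.

End path_ito.

(** * Gains and losses at the births *)

Lemma bounded_continuousM {R : realType} (D : set R) (g k : R -> R) :
  bounded_continuous D g -> bounded_continuous D k -> bounded_continuous D (fun x => g x * k x).
Proof.
move=> bg bk; have [C C0 gC] := bounded_continuous_bound bg.
have [K K0 kK] := bounded_continuous_bound bk; split.
- apply: (@bounded_byP _ _ _ _ (C * K)) => x Dx; rewrite normrM.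
  by apply: ler_pM => //; [exact: gC|exact: kK].
- by move=> x; apply: cvgM; [exact: (bg.2 x)|exact: (bk.2 x)].
Qed.

Section gain_process.
Context {R : realType} {d} {Omega : measurableType d} {P : probability Omega R}
  {Ft : R -> set (set Omega)} {Ginf : probability (seqT R) R}
  {M : Omega -> {measure set (pointT R) -> \bar R}}.
Hypothesis hFt : usual_filtration P Ft.
Hypothesis hM : filtered_poisson P (@time_of R) Ft (intensity Ginf) M.
Local Notation D0 := (`]0, +oo[%classic : set R).
Local Notation RT := (measurableTypeR R).
Local Notation leb := (@lebesgue_measure R).
Local Notation m := (intensity_measure Ginf).
Local Notation time := (@time_of R).
Local Notation mt := (measurable_time_of (R := R)).
Variables (alpha : R -> R) (p : R -> nat -> R) (C mb : R).
Hypothesis halpha : bounded_continuous D0 alpha.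
Hypothesis alpha0 : positive_on D0 alpha.
Hypothesis C0 : 0 <= C.
Hypothesis alphaC : forall x, D0 x -> alpha x <= C.
Hypothesis hp : forall n, bounded_continuous D0 (p ^~ n).
Hypothesis hp1 : forall n x, D0 x -> 0 <= p x n <= 1.
Hypothesis hpm : forall x, D0 x -> (\sum_(n <oo) (n%:R * p x n)%:E <= mb%:E)%E.
Hypothesis mb0 : 0 <= mb.
Variables (X : R -> Omega -> posMeasure R) (Xm : Omega -> R -> posMeasure R).
Variable Theta : set Omega.
Hypothesis FTheta : Ft 0 Theta.
Hypothesis mX : forall t, 0 <= t -> weakly_measurable (Ft t) (X t).
Hypothesis XmE : forall w s, Theta w -> 0 < s -> left_limit (X ^~ w) s (Xm w s).
Hypothesis XE : forall w t x, Theta w -> 0 <= t -> 0 < x ->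
  ((dist_fun (X t w) x)%:E = (dist_fun (X 0 w) (x + t) - dist_fun (X 0 w) t)%:E +
   \int[M w]_(q in birth_domain alpha p (Xm w) t) (births t x q)%:E)%E.
Local Notation bw := (birth_window (Ft := Ft) alpha p Xm Theta).
Local Notation stock_ := (litter_stock (Ft := Ft) (M := M) alpha p Xm Theta).
Local Notation pst := (@past R _ Omega Ft Theta _ _ time).
Hypothesis stock_fin : forall t w, (stock_ t w < +oo)%E.
Hypothesis stock_mean : forall t, (\int[P]_w stock_ t w < +oo)%E.
Variables f f' F F' : R -> R.
Hypothesis bf : bounded_continuous D0 f.
Variable CF : R.
Hypothesis CF0 : 0 <= CF.
Hypothesis FC : forall x, `|F x| <= CF.
Hypothesis cF : continuous F.
Local Notation gain_rate e := (gain_rate alpha p Ginf f F e).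

Variable e : R.
Hypothesis e1 : `|e| <= 1.

(** f is cut off to the half-line to make the function measurable everywhere; on
    the birth domain the lives are positive. *)
Definition litter_gain (z : Omega * pointT R) : R :=
  signed_gain F e (pairing (Xm z.1 (time z.2)) f) (jump_sum (f \_ D0) z.2).

Definition gainE (z : Omega * pointT R) : \bar R := (litter_gain z)%:E.

Lemma gainE_ge0 z : (0 <= gainE z)%E.
Proof. by rewrite lee_fin signed_gain_ge0. Qed.

(** Either there is no child and no gain, or at least one child. *)
Lemma gainE_le z : (gainE z <= (2 * CF)%:E * (litter_of z.2)%:R%:E)%E.
Proof.
rewrite -EFinM lee_fin; case: (posnP (litter_of z.2)) => [l0|l0].
  by rewrite /litter_gain /jump_sum l0 big_ord0 /signed_gain addr0 subrr mulr0 maxxx mulr0.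
apply: (le_trans (signed_gain_le CF0 FC _ _ e1)); rewrite ler_peMr ?mulr_ge0//.
by rewrite ler1n.
Qed.

Lemma measurable_jump_sum : measurable_fun setT (jump_sum (f \_ D0) : pointT R -> RT).
Proof.
apply: (measurable_litter_sum (phi := fun _ a => (f \_ D0) a)).
exact: (measurableT_comp (measurable_patch0 (bounded_continuous_measurable bf)) measurable_snd).
Qed.

Lemma predictable_gain : measurable_fun pst (litter_gain : predT Ft time -> RT).
Proof.
apply: (measurable_signed_gain cF).
- exact: (predictable_pairing hFt FTheta mX XmE mt bf).
- exact: (predictable_point FTheta measurable_jump_sum).
Qed.

Lemma measurable_gainE u t : measurable_fun (bw u t) (gainE : predT Ft time -> \bar R).
Proof.
have sub : bw u t `<=` pst by move=> z [[]].
apply: (measurable_funS (measurable_past FTheta mt) sub).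
by apply/measurable_EFinP; exact: predictable_gain.
Qed.

Local Notation cnt := (counted (Ft := Ft) (M := M) alpha p Xm Theta gainE).
Local Notation xpt := (expected (Ft := Ft) (Ginf := Ginf) alpha p Xm Theta gainE).

Lemma counted_gain_le t w : (cnt 0 t w <= (2 * CF)%:E * stock_ t w)%E.
Proof.
rewrite /counted /litter_stock.
rewrite -ge0_integralZl_EFin ?mulr_ge0//.
- apply: ge0_le_integral_any => q _; first exact: gainE_ge0.
  exact: (gainE_le (w, q)).
- exact: (measurable_section hFt halpha alpha0 hp FTheta mX XmE).
- by apply/measurable_EFinP; apply: measurable_funTS; exact: measurable_litterR.
Qed.

Lemma counted_gain_fin t w : (cnt 0 t w < +oo)%E.
Proof.
apply: (le_lt_trans (counted_gain_le t w)).
by rewrite lte_mul_pinfty// ?lee_fin ?mulr_ge0//; exact: stock_fin.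
Qed.

Lemma counted_gain_mean t : 0 <= t -> (\int[P]_w cnt 0 t w < +oo)%E.
Proof.
move=> t0; apply: (@le_lt_trans _ _ (\int[P]_w ((2 * CF)%:E * stock_ t w))%E).
  apply: ge0_le_integral_any => w _; last exact: counted_gain_le.
  by apply: integral_ge0 => q _; exact: gainE_ge0.
rewrite ge0_integralZl_EFin ?mulr_ge0//.
- by rewrite lte_mul_pinfty// ?lee_fin ?mulr_ge0//; exact: stock_mean.
- by move=> w _; exact: litter_stock_ge0.
- exact: (measurable_litter_stock hFt hM halpha alpha0 hp FTheta mX XmE).
Qed.

Lemma measurable_left_value w g : Theta w -> bounded_continuous D0 g ->
  measurable_fun setT (((fun s => pairing (Xm w s) g) \_ D0) : RT -> RT).
Proof.
move=> Tw bg.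
have mp := measurable_past FTheta (@measurable_id _ RT setT).
have mg := (measurable_restrictT _ mp).1 (predictable_pairing hFt FTheta mX XmE (@measurable_id _ RT setT) bg).
have := pred_section hFt w mg.
apply: eq_measurable_fun => s _; rewrite !patchE.
have E : ((w, s) \in @past R _ Omega Ft Theta _ _ (fun x : RT => x)) = (s \in D0).
  apply/idP/idP => /set_mem h; apply/mem_set; first by case: h => _; rewrite /pos_time/= in_itv/= andbT.
  by split => //; move: h; rewrite /pos_time/= in_itv/= andbT.
by rewrite E.
Qed.

Lemma expected_gain t w : Theta w ->
  xpt 0 t w = (\int[leb]_(s in `]0%R, t]) gain_rate e (Xm w s))%E.
Proof.
move=> Tw.
pose h (s : R) (n : nat) (z : seqT R) : \bar R :=
  (signed_gain F e (((fun s => pairing (Xm w s) f) \_ D0) s) (litter_value (f \_ D0) n z))%:E.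
have mh : measurable_fun setT (fun q : pointT R => h (time q) (litter_of q) (lives_of q)).
  apply/measurable_EFinP; apply: (measurable_signed_gain cF).
    exact: (measurableT_comp (measurable_left_value Tw bf) mt).
  exact: measurable_jump_sum.
have h0 s n z : (0 <= h s n z)%E by rewrite lee_fin signed_gain_ge0.
have := compensator_formula hFt halpha alpha0 hp hp1 Ginf FTheta mX XmE t Tw (lexx 0) mh h0.
rewrite -birth_window_section => E; transitivity (\int[m]_(q in xsection (bw 0 t) w) h (time q) (litter_of q) (lives_of q))%E.
  apply: eq_integral => q; rewrite mem_xsection => /set_mem /birth_windowP[/= _ q0].
  by rewrite /gainE /litter_gain /h patchE mem_set//= in_itv/= q0.
rewrite {}E; apply: eq_integral => s /set_mem; rewrite /= in_itv/= => /andP[s0 _].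
apply: eq_eseriesr => n _; congr (_ * _)%E; apply: eq_integral => z /set_mem zp.
rewrite /h patchE mem_set/= ?in_itv/= ?s0//; congr (signed_gain _ _ _ _)%:E.
apply: eq_bigr => i _; rewrite patchE mem_set//= in_itv/= andbT; exact: zp.
Qed.

Lemma mass_le_stock (s t : R) w : Theta w -> 0 <= s <= t -> mass (X s w) <= mass (X 0 w) + fine (stock_ t w).
Proof.
move=> Tw /andP[s0 st].
have XE' t' x (t0 : 0 <= t') (x0 : 0 < x) := XE Tw t0 x0.
have mD r : measurable (birth_domain alpha p (Xm w) r).
  exact: (measurable_birth_domain hFt halpha alpha0 hp FTheta mX XmE).
rewrite -lee_fin EFinD [(fine (stock_ t w))%:E]fineK; last first.
  by rewrite ge0_fin_numE ?litter_stock_ge0//; exact: stock_fin.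
apply: (le_trans (mass_le_births XE' mD s0)); apply: leeD2l.
apply: (@le_trans _ _ (stock_ s w)).
  by rewrite /litter_stock birth_window_domain.
exact: (litter_stock_le hFt halpha alpha0 hp FTheta mX XmE).
Qed.

Lemma left_mass_le (t s : R) w : Theta w -> 0 < s <= t ->
  mass (Xm w s) <= mass (X 0 w) + fine (stock_ t w).
Proof.
move=> Tw /andP[s0 st]; apply: (mass_left (Y := X ^~ w)) => //; first by move=> r; exact: XmE.
by move=> r /andP[r0 rs]; apply: mass_le_stock => //; rewrite r0 ltW// (lt_le_trans rs).
Qed.

Lemma left_gain_rate_le t w s : Theta w -> 0 < s <= t ->
  (gain_rate e (Xm w s) <= (2 * CF * (C * mb * (mass (X 0 w) + fine (stock_ t w))))%:E)%E.
Proof.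
move=> Tw st; apply: (le_trans (gain_rate_le Ginf halpha alpha0 alphaC hp hp1 hpm f CF0 FC (Xm w s) e1)).
rewrite lee_fin; apply: ler_wpM2l; first by rewrite mulr_ge0.
by apply: ler_wpM2l; [rewrite mulr_ge0|exact: left_mass_le].
Qed.

Lemma expected_gain_fin t w : (xpt 0 t w < +oo)%E.
Proof.
have [Tw|nT] := pselect (Theta w); last first.
  by rewrite /expected birth_window_off// integral_set0 ltry.
rewrite expected_gain//; pose B := 2 * CF * (C * mb * (mass (X 0 w) + fine (stock_ t w))).
apply: (@le_lt_trans _ _ (\int[leb]_(s in `]0%R, t]) (cst B%:E) s)%E).
  apply: ge0_le_integral_any => s; rewrite /= in_itv/= => st.
    exact: gain_rate_ge0.
  exact: left_gain_rate_le.
have lE : (lebesgue_measure (`]0%R, t] : set R) < +oo)%E.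
  by rewrite lebesgue_measure_itv/= lte_fin; case: ifP => // _; rewrite -EFinB ltry.
rewrite integral_cst// lte_mul_pinfty// lee_fin !mulr_ge0// addr_ge0 ?mass_ge0//.
by rewrite fine_ge0// litter_stock_ge0.
Qed.

End gain_process.

(** * The martingale on an event of time 0 *)

Section progressive_integral.
Context {R : realType} {d} {Omega : measurableType d} {P : probability Omega R}
  {Ft : R -> set (set Omega)}.
Hypothesis hFt : usual_filtration P Ft.
Variable Theta : set Omega.
Hypothesis FTheta : Ft 0 Theta.
Local Notation RT := (measurableTypeR R).
Local Notation leb := (@lebesgue_measure R).
Local Notation FT t := (FtT (Ft := Ft) t).

Lemma progressive_measurable (t : R) : 0 <= t ->
  measurable (Theta `*` `]0, t]%classic : set (FT t * RT)).
Proof.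
move=> t0; apply: measurableX; last exact: measurable_itv.
rewrite (FtTE hFt)//; exact: filtS hFt _ _ _ (lexx 0) t0 FTheta.
Qed.

Lemma progressive_section (t : R) (w : Omega) (b : Omega * R -> R) : 0 <= t -> Theta w ->
  measurable_fun (Theta `*` `]0, t]%classic : set (FT t * RT)) (b : FT t * RT -> RT) ->
  measurable_fun (`]0, t]%classic : set RT) ((fun s => b (w, s)) : RT -> RT).
Proof.
move=> t0 Tw mb; have mD := progressive_measurable t0.
have := measurable_funTS (D := (`]0, t]%classic : set RT))
  (measurableT_comp ((measurable_restrictT _ mD).1 mb) (@measurable_pair1 _ _ (FT t) RT w)).
apply: eq_measurable_fun => s /set_mem st; rewrite /= patchE mem_set//.
Qed.

(** Fubini on ]0, t] times Omega, the latter with the sigma-algebra of time t. *)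
Lemma adapted_integral (t : R) (b : Omega * R -> R) : 0 <= t ->
  measurable_fun (Theta `*` `]0, t]%classic : set (FT t * RT)) (b : FT t * RT -> RT) ->
  measurable_fun (Theta : set (FT t)) ((fun w => \int[leb]_(s in `]0, t]) b (w, s)) : FT t -> RT).
Proof.
move=> t0 mb; have mD := progressive_measurable t0.
pose bE : FT t * RT -> \bar R := (EFin \o b) \_ (Theta `*` `]0, t]%classic).
have mbE : measurable_fun setT bE.
  apply: (measurable_restrictT _ mD).1.
  exact: ((measurable_EFinP _ _).2 mb).
have m1 := measurable_fun_fubini_tonelli_F (m2 := leb) bE^\+%E (measurable_funepos mbE) (funepos_ge0 bE).
have m2 := measurable_fun_fubini_tonelli_F (m2 := leb) bE^\-%E (measurable_funeneg mbE) (funeneg_ge0 bE).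
have mf : measurable_fun setT (fine : \bar R -> RT) by [].
have := measurable_funTS (D := (Theta : set (FT t))) (measurableT_comp mf (emeasurable_funB m1 m2)).
apply: eq_measurable_fun => w /set_mem Tw; rewrite /= /fubini_F /Rintegral; congr fine.
have inD s : ((w, s) \in (Theta `*` `]0, t]%classic : set (FT t * RT))) = (s \in (`]0, t]%classic : set R)).
  by apply/idP/idP => /set_mem; [move=> [_ /= st]; exact/mem_set|move=> st; apply/mem_set; split].
rewrite [RHS]integralE; congr (_ - _)%E; rewrite [RHS]integral_mkcond; apply: eq_integral => s _.
  by rewrite patchE !funeposE /bE patchE inD; case: ifP => //= _; rewrite maxxx.
by rewrite patchE !funenegE /bE patchE inD; case: ifP => //= _; rewrite oppr0 maxxx.
Qed.

End progressive_integral.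

Section gain_martingale.
Context {R : realType} {d} {Omega : measurableType d} {P : probability Omega R}
  {Ft : R -> set (set Omega)} {Ginf : probability (seqT R) R}
  {M : Omega -> {measure set (pointT R) -> \bar R}}.
Hypothesis hFt : usual_filtration P Ft.
Hypothesis hM : filtered_poisson P (@time_of R) Ft (intensity Ginf) M.
Local Notation D0 := (`]0, +oo[%classic : set R).
Local Notation RT := (measurableTypeR R).
Local Notation leb := (@lebesgue_measure R).
Local Notation time := (@time_of R).
Local Notation mt := (measurable_time_of (R := R)).
Variables (alpha : R -> R) (p : R -> nat -> R) (C mb : R).
Hypothesis halpha : bounded_continuous D0 alpha.
Hypothesis alpha0 : positive_on D0 alpha.
Hypothesis C0 : 0 <= C.
Hypothesis alphaC : forall x, D0 x -> alpha x <= C.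
Hypothesis hp : forall n, bounded_continuous D0 (p ^~ n).
Hypothesis hp1 : forall n x, D0 x -> 0 <= p x n <= 1.
Hypothesis hpm : forall x, D0 x -> (\sum_(n <oo) (n%:R * p x n)%:E <= mb%:E)%E.
Hypothesis mb0 : 0 <= mb.
Variables (X : R -> Omega -> posMeasure R) (Xm : Omega -> R -> posMeasure R).
Variable Theta : set Omega.
Hypothesis FTheta : Ft 0 Theta.
Hypothesis mX : forall t, 0 <= t -> weakly_measurable (Ft t) (X t).
Hypothesis Xright : forall w, Theta w -> weakly_right_continuous (X ^~ w).
Hypothesis XmE : forall w s, Theta w -> 0 < s -> left_limit (X ^~ w) s (Xm w s).
Hypothesis XE : forall w t x, Theta w -> 0 <= t -> 0 < x ->
  ((dist_fun (X t w) x)%:E = (dist_fun (X 0 w) (x + t) - dist_fun (X 0 w) t)%:E +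
   \int[M w]_(q in birth_domain alpha p (Xm w) t) (births t x q)%:E)%E.
Hypothesis Mnat : forall w k B, Theta w -> measurable B -> nat_valued (M w (B `&` core k)).
Hypothesis Msimple : forall w k s, Theta w -> (M w (time @^-1` [set s] `&` core k) <= 1)%E.
Local Notation bw := (birth_window (Ft := Ft) alpha p Xm Theta).
Local Notation stock_ := (litter_stock (Ft := Ft) (M := M) alpha p Xm Theta).
Hypothesis stock_fin : forall t w, (stock_ t w < +oo)%E.
Hypothesis stock_mean : forall t, (\int[P]_w stock_ t w < +oo)%E.
Variables f f' F F' : R -> R.
Hypothesis hf : C1_deriv D0 f f'.
Hypothesis hf0 : f x @[x --> 0^'+] --> 0.
Hypothesis hF : C1_deriv setT F F'.
Variable CF : R.
Hypothesis CF0 : 0 <= CF.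
Hypothesis FC : forall x, `|F x| <= CF.
Hypothesis cF : continuous F.
Local Notation gain_rate e := (gain_rate alpha p Ginf f F e).

Local Notation FT t := (FtT (Ft := Ft) t).
Local Notation comp e := (compensated (Ft := Ft) (Ginf := Ginf) (M := M) alpha p Xm Theta (gainE Xm f F e)).
Local Notation cnt e := (counted (Ft := Ft) (M := M) alpha p Xm Theta (gainE Xm f F e)).
Local Notation xpt e := (expected (Ft := Ft) (Ginf := Ginf) alpha p Xm Theta (gainE Xm f F e)).
Local Notation mart := (mart_part alpha p Ginf f f' F F' X).

Let bf : bounded_continuous D0 f. Proof. by have [] := hf. Qed.
Let bf' : bounded_continuous D0 f'. Proof. by have [] := hf. Qed.
Let n1 : `|1 : R| <= 1. Proof. by rewrite normr1. Qed.
Let nN1 : `|-1 : R| <= 1. Proof. by rewrite normrN normr1. Qed.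
Let cF' : continuous F'.
Proof. by case: hF => _ [_ h] _; apply/continuous_subspace_setT. Qed.

Lemma progressive_pairing (t : R) g : 0 <= t -> bounded_continuous D0 g ->
  measurable_fun (Theta `*` `]0, t]%classic : set (FT t * RT))
    ((fun z => pairing (X z.2 z.1) g) : FT t * RT -> RT).
Proof.
move=> t0 bg.
apply: (progressive_right_limit hFt FTheta t0 (Y := fun s w => pairing (X s w) g)).
  by move=> r r0; exact: (sub_measurable_pairing hFt r0 (mX r0) bg).
by move=> w s Tw s0; exact: Xright.
Qed.

Let bap n : bounded_continuous D0 (fun x => alpha x * p x n).
Proof. exact: bounded_continuousM. Qed.

Lemma measurable_rate d' (U : measurableType d') (A : set U) (mu : U -> posMeasure R) e :
  (forall g, bounded_continuous D0 g -> measurable_fun A ((fun u => pairing (mu u) g) : U -> RT)) ->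
  measurable_fun A (fun u => gain_rate e (mu u)).
Proof.
move=> mmu; apply: ge0_emeasurable_sum => [n u _ _|n _].
  by apply: mule_ge0; [rewrite lee_fin ap_ge0|exact: mean_gain_ge0].
apply: emeasurable_funM.
  by apply/measurable_EFinP; exact: mmu.
exact: (measurableT_comp (measurable_mean_gain Ginf bf cF e n) (mmu _ bf)).
Qed.

Lemma generatorE : generator alpha p Ginf f f' F F' =
  fun mu => - pairing mu f' * F' (pairing mu f) + (fine (gain_rate 1 mu) - fine (gain_rate (-1) mu)).
Proof. by apply/funext => mu; exact: (generator_split Ginf halpha alpha0 alphaC hp hp1 hpm f' F' bf CF0 FC cF). Qed.

Lemma progressive_generator (t : R) : 0 <= t ->
  measurable_fun (Theta `*` `]0, t]%classic : set (FT t * RT))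
    ((fun z => generator alpha p Ginf f f' F F' (X z.2 z.1)) : FT t * RT -> RT).
Proof.
move=> t0; have mp g : bounded_continuous D0 g -> _ := progressive_pairing t0 (g := g).
have mr e : measurable_fun (Theta `*` `]0, t]%classic : set (FT t * RT)) (fun z => gain_rate e (X z.2 z.1)).
  exact: (measurable_rate (mu := fun z : FT t * RT => X z.2 z.1)).
have mf : measurable_fun setT (fine : \bar R -> RT) by [].
rewrite generatorE; apply: measurable_funD.
  apply: measurable_funM; first by apply: measurableT_comp => //; exact: mp.
  by apply: (measurableT_comp (continuous_measurable_fun cF')); exact: mp.
by apply: measurable_funB; exact: (measurableT_comp mf (mr _)).
Qed.

Lemma adapted_pairing (t : R) : 0 <= t ->
  measurable_fun setT ((fun w => F (pairing (X t w) f)) : FT t -> RT).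
Proof.
move=> t0; apply: (measurableT_comp (continuous_measurable_fun cF)).
move=> _ B mB; rewrite setTI (FtTE hFt)//.
exact: (sub_measurable_pairing hFt t0 (mX t0) bf).
Qed.

Lemma adapted_mart (t : R) : 0 <= t ->
  sub_measurable (Ft t) ((fun w => \1_Theta w * mart t w) : Omega -> RT).
Proof.
move=> t0 B mB.
have mT : measurable (Theta : set (FT t)).
  by rewrite (FtTE hFt)//; exact: filtS hFt _ _ _ (lexx 0) t0 FTheta.
have m0 : measurable_fun setT ((fun w => F (pairing (X 0 w) f)) : FT t -> RT).
  move=> _ A mA; rewrite setTI (FtTE hFt)//.
  have := adapted_pairing (lexx 0) measurableT mA; rewrite setTI (FtTE hFt)//.
  exact: filtS hFt _ _ _ (lexx 0) t0.
have mg := adapted_integral hFt FTheta t0 (progressive_generator t0).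
have mm : measurable_fun (Theta : set (FT t)) (mart t : FT t -> RT).
  apply: measurable_funB => //; apply: measurable_funTS.
  by apply: measurable_funB => //; exact: adapted_pairing.
have := (measurable_restrictT _ mT).1 mm measurableT B mB.
rewrite setTI (FtTE hFt)// (_ : mart t \_ Theta = (fun w => \1_Theta w * mart t w))//.
by apply/funext => w; rewrite patchE indicE; case: ifP => _; rewrite ?mul1r ?mul0r.
Qed.

(** The compensator involves the left limits, which may be replaced by the
    values for almost every time. *)
Lemma expected_rate (t : R) w e : `|e| <= 1 -> Theta w -> 0 <= t ->
  fine (xpt e 0 t w) = \int[leb]_(s in `]0, t]) fine (gain_rate e (X s w)).
Proof.
move=> e1 Tw t0.
rewrite (expected_gain hFt halpha alpha0 hp hp1 FTheta mX XmE bf cF)// /Rintegral; congr fine.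
have XE' t' x (t'0 : 0 <= t') (x0 : 0 < x) := XE Tw t'0 x0.
have mD r : measurable (birth_domain alpha p (Xm w) r).
  exact: (measurable_birth_domain hFt halpha alpha0 hp FTheta mX XmE).
have finT : (\int[M w]_(q in birth_domain alpha p (Xm w) t) (litter_of q)%:R%:E < +oo)%E.
  by rewrite -(birth_window_domain (Ft := Ft) alpha p Xm t Tw); exact: stock_fin.
have XmE' s (s0 : 0 < s) := XmE Tw s0.
have ae_left := ae_left_limit XmE' XE' mD finT.
apply: ge0_ae_eq_integral => //.
- apply: (measurable_rate (mu := fun s : RT => Xm w s)) => g bg.
  have := measurable_funTS (D := (`]0, t]%classic : set RT)) (measurable_left_value hFt FTheta mX XmE Tw bg).
  apply: eq_measurable_fun => s /set_mem; rewrite /= in_itv/= => /andP[s0 _].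
  by rewrite patchE mem_set//= in_itv/= s0.
- apply/measurable_EFinP; have mf : measurable_fun setT (fine : \bar R -> RT) by [].
  apply: (measurableT_comp mf).
  apply: (measurable_rate (mu := fun s : RT => X s w)) => g bg.
  exact: (progressive_section hFt FTheta (b := fun z => pairing (X z.2 z.1) g) t0 Tw (progressive_pairing t0 bg)).
- by move=> s _; exact: gain_rate_ge0.
- by move=> s _; rewrite lee_fin fine_ge0// gain_rate_ge0.
apply: negligibleS ae_left; apply: subsetC => s hs; rewrite /= in_itv/= => st.
rewrite (fineK (gain_rate_fin Ginf halpha alpha0 alphaC hp hp1 hpm f CF0 FC _ e1)).
by apply: eq_eseriesr => n _; rewrite (hs st _ bf) (hs st _ (bap n)).
Qed.

Let sum_E w q : birth_domain alpha p (Xm w) (time q) q ->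
  jump_sum (f \_ D0) q = jump_sum f q.
Proof.
move=> Dq; apply: eq_bigr => i _; rewrite patchE mem_set//= in_itv/= andbT.
by case: q Dq i => [[[s u] [[y n] z]] v] /= [_ _ [_ _ z0] _] i; exact: z0.
Qed.

Let bw_P t w q : Theta w -> birth_domain alpha p (Xm w) t q -> birth_domain alpha p (Xm w) (time q) q.
Proof.
by move=> _; case: q => [[[s u] [[y n] z]] v] /= [/andP[s0 _] u1 E1 v1]; split => //; rewrite s0 lexx.
Qed.

Let fin_c e : `|e| <= 1 -> forall t w, (cnt e 0 t w < +oo)%E.
Proof. by move=> e1 t w; exact: (counted_gain_fin hFt halpha alpha0 hp FTheta mX XmE stock_fin f CF0 FC e1). Qed.

Let mG e u t : measurable_fun (bw u t) (gainE Xm f F e : predT Ft time -> \bar R).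
Proof. exact: (measurable_gainE hFt FTheta mX XmE bf cF e). Qed.

Lemma jump_integral (t : R) w : Theta w -> 0 <= t ->
  \int[M w]_(q in birth_domain alpha p (Xm w) t) jump_gain (Xm w) f F q =
  fine (cnt 1 0 t w) - fine (cnt (-1) 0 t w).
Proof.
move=> Tw t0.
have ii e : `|e| <= 1 -> (M w).-integrable (birth_domain alpha p (Xm w) t) (EFin \o (fun q => litter_gain Xm f F e (w, q))).
  move=> e1; apply/integrableP; split.
    rewrite -(birth_window_domain (Ft := Ft) alpha p Xm t Tw).
    exact: (measurable_gain_section hFt halpha alpha0 hp FTheta mX XmE (@mG e)).
  have := fin_c e1 t w; rewrite /counted birth_window_domain//.
  by congr (_ < _)%E; apply: eq_integral => q _; rewrite [RHS]gee0_abs// lee_fin signed_gain_ge0.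
have mD : measurable (birth_domain alpha p (Xm w) t).
  exact: (measurable_birth_domain hFt halpha alpha0 hp FTheta mX XmE).
transitivity (\int[M w]_(q in birth_domain alpha p (Xm w) t) (litter_gain Xm f F 1 (w, q) - litter_gain Xm f F (-1) (w, q))).
  apply: eq_Rintegral => q /set_mem Dq.
  by rewrite /litter_gain signed_gainB (sum_E (bw_P Tw Dq)).
rewrite RintegralB//; [|exact: ii|exact: ii].
by rewrite /counted birth_window_domain.
Qed.

(** By the path formula the increment of F is the drift plus the sum of the
    gains and losses; by [generator_split] the generator is the drift plus their
    rates. The drift cancels. *)
Lemma mart_compensated (t : R) w : Theta w -> 0 <= t ->
  mart t w = comp 1 t w - comp (-1) t w.
Proof.
move=> Tw t0.
have XE' t' x (t'0 : 0 <= t') (x0 : 0 < x) := XE Tw t'0 x0.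
have mD r : measurable (birth_domain alpha p (Xm w) r).
  exact: (measurable_birth_domain hFt halpha alpha0 hp FTheta mX XmE).
have finT : (\int[M w]_(q in birth_domain alpha p (Xm w) t) (litter_of q)%:R%:E < +oo)%E.
  by rewrite -(birth_window_domain (Ft := Ft) alpha p Xm t Tw); exact: stock_fin.
have XmE' s (s0 : 0 < s) := XmE Tw s0.
have mH : measurable_fun (birth_domain alpha p (Xm w) t) (jump_gain (Xm w) f F : pointT R -> RT).
  have mv : measurable_fun setT ((fun q => ((fun s => pairing (Xm w s) f) \_ D0) (time q)) : pointT R -> RT).
    exact: (measurableT_comp (measurable_left_value hFt FTheta mX XmE Tw bf) mt).
  have mFv : measurable_fun setT ((fun q => F (((fun s => pairing (Xm w s) f) \_ D0) (time q) + jump_sum (f \_ D0) q) - F (((fun s => pairing (Xm w s) f) \_ D0) (time q))) : pointT R -> RT).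
    apply: measurable_funB; apply: (measurableT_comp (continuous_measurable_fun cF)) => //.
    by apply: measurable_funD => //; exact: measurable_jump_sum.
  have := measurable_funTS (D := birth_domain alpha p (Xm w) t) mFv.
  apply: eq_measurable_fun => q /set_mem Dq.
  rewrite /jump_gain (sum_E (bw_P Tw Dq)) patchE mem_set//= in_itv/= andbT.
  by have /andP[] := birth_domain_pos Dq.
pose b s := F' (pairing (X s w) f) * pairing (X s w) f'.
have mpair g : bounded_continuous D0 g -> measurable_fun (`]0, t]%classic : set RT) ((fun s => pairing (X s w) g) : RT -> RT).
  move=> bg; exact: (progressive_section hFt FTheta (b := fun z => pairing (X z.2 z.1) g) t0 Tw (progressive_pairing t0 bg)).
have mbt : measurable_fun (`]0, t]%classic : set RT) (b : RT -> RT).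
  apply: measurable_funM; last exact: mpair.
  by apply: (measurableT_comp (continuous_measurable_fun cF')); exact: mpair.
have leb_fin : (leb (`]0%R, t]) < +oo)%E.
  by rewrite lebesgue_measure_itv/= lte_fin; case: ifP => // _; rewrite -EFinB ltry.
have [C' C'0 FC'] := bounded_continuous_bound (let: And3 _ h _ := hF in h).
have [Cf Cf0 fCf] := bounded_continuous_bound bf'.
pose K := mass (X 0 w) + fine (stock_ t w).
have K0 : 0 <= K by rewrite addr_ge0 ?mass_ge0// fine_ge0// litter_stock_ge0.
have massK s : s \in (`]0, t]%classic : set R) -> mass (X s w) <= K.
  by move/set_mem; rewrite /= in_itv/= => /andP[s0 st]; apply: (mass_le_stock hFt halpha alpha0 hp FTheta mX XmE XE stock_fin Tw); rewrite ltW.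
have ib : leb.-integrable (`]0, t]%classic : set R) (EFin \o b).
  apply: measurable_bounded_integrable => //.
  apply: (@bounded_byP _ _ _ _ (C' * (Cf * K))) => s /mem_set /massK sK; rewrite normrM.
  apply: ler_pM => //; first exact: FC'.
  apply: (le_trans (pairing_le (X s w) (bounded_continuous_measurable bf') fCf)).
  exact: ler_wpM2l.
have ig e : `|e| <= 1 -> leb.-integrable (`]0, t]%classic : set R) (EFin \o (fun s => fine (gain_rate e (X s w)))).
  move=> e1; apply: measurable_bounded_integrable => //.
    have mf : measurable_fun setT (fine : \bar R -> RT) by [].
    apply: (measurableT_comp mf).
    exact: (measurable_rate (mu := fun s : RT => X s w)).
  apply: (@bounded_byP _ _ _ _ (2 * CF * (C * mb * K))) => s /mem_set /massK sK.
  rewrite ger0_norm ?fine_ge0 ?gain_rate_ge0// -lee_fin.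
  rewrite (fineK (gain_rate_fin Ginf halpha alpha0 alphaC hp hp1 hpm f CF0 FC _ e1)).
  apply: (le_trans (gain_rate_le Ginf halpha alpha0 alphaC hp hp1 hpm f CF0 FC _ e1)).
  by rewrite lee_fin; apply: ler_wpM2l; rewrite ?mulr_ge0//; apply: ler_wpM2l; rewrite ?mulr_ge0.
(* the generator integrates to the compensators minus the drift *)
have gE : \int[leb]_(s in `]0, t]) generator alpha p Ginf f f' F F' (X s w) =
    (fine (xpt 1 0 t w) - fine (xpt (-1) 0 t w)) - (\int[leb]_(s in `]0, t]) b s).
  rewrite (expected_rate n1 Tw t0) (expected_rate nN1 Tw t0) -RintegralB//; [|exact: ig|exact: ig].
  rewrite -RintegralB//.
  - by apply: eq_Rintegral => s _; rewrite generatorE /b; ring.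
  - have mI : measurable (`]0, t]%classic : set RT) by exact: measurable_itv.
    have := integrableB mI (ig _ n1) (ig _ nN1).
    by congr (leb.-integrable _ _); apply/funext => s /=; rewrite EFinB.
rewrite /mart_part gE.
rewrite (path_formula hp1 (Xright Tw) XmE' XE' mD (fun k B mB => Mnat k Tw mB) (fun k s => Msimple k s Tw) t0 finT hf hf0 hF mH mbt).
rewrite jump_integral// /compensated.
have alg (z a a' c c' : R) : - z + (a - a') - (c - c' - z) = a - c - (a' - c') by ring.
exact: alg.
Qed.

Let N t w : R := \1_Theta w * mart t w.

Let N_E (t : R) : 0 <= t -> N t = fun w => comp 1 t w - comp (-1) t w.
Proof.
move=> t0; apply/funext => w; rewrite /N indicE; case: (boolP (w \in Theta)) => [/set_mem Tw|].
  by rewrite mul1r mart_compensated.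
rewrite notin_setE => nT; rewrite mul0r /compensated /counted /expected !birth_window_off// !integral_set0.
by rewrite !subrr.
Qed.

Let fin_x e : `|e| <= 1 -> forall t w, (xpt e 0 t w < +oo)%E.
Proof.
move=> e1 t w.
exact: (expected_gain_fin hFt halpha alpha0 C0 alphaC hp hp1 hpm mb0 FTheta mX XmE XE stock_fin bf CF0 FC cF e1).
Qed.

Let fin_m e : `|e| <= 1 -> forall t, 0 <= t -> (\int[P]_w cnt e 0 t w < +oo)%E.
Proof.
move=> e1 t t0.
exact: (counted_gain_mean hFt hM halpha alpha0 hp FTheta mX XmE stock_mean f CF0 FC e1).
Qed.

Let comp_int e (t : R) : `|e| <= 1 -> 0 <= t -> P.-integrable setT (EFin \o comp e t).
Proof.
move=> e1 t0; exact: (integrable_compensated hFt hM halpha alpha0 hp FTheta mX XmE (@gainE_ge0 _ _ _ _ _ _ e) (@mG e) (fin_c e1) (fin_x e1) (fin_m e1) t0).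
Qed.

(** On Theta the process is a difference of two compensated sums, and off Theta
    it is 0. *)
Theorem indicator_martingale : martingale P Ft (fun t w => \1_Theta w * mart t w).
Proof.
have iN t : 0 <= t -> P.-integrable setT (EFin \o N t).
  move=> t0; rewrite N_E//; have := integrableB measurableT (comp_int n1 t0) (comp_int nN1 t0).
  by congr (P.-integrable _ _).
split=> [t t0|s t s0 st]; first by split; [exact: adapted_mart|exact: iN].
have t0 : 0 <= t by exact: le_trans st.
split; [exact: adapted_mart|exact: iN|] => A FA.
have mA : measurable A by exact: filt_measurable hFt _ _ s0 FA.
have E r : 0 <= r -> (\int[P]_(w in A) (N r w)%:E =
    \int[P]_(w in A) (comp 1 r w)%:E - \int[P]_(w in A) (comp (-1) r w)%:E)%E.
  move=> r0; rewrite N_E//; under eq_integral do rewrite EFinB.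
  by rewrite integralB//; [apply: integrableS (comp_int n1 r0)|apply: integrableS (comp_int nN1 r0)].
rewrite -[LHS]/(\int[P]_(w in A) (N s w)%:E)%E -[RHS]/(\int[P]_(w in A) (N t w)%:E)%E (E s s0) (E t t0).
have cm e (e1 : `|e| <= 1) := compensated_mean hFt hM halpha alpha0 hp FTheta mX XmE (@gainE_ge0 _ _ _ _ _ _ e) (@mG e) (fin_c e1) (fin_x e1) (fin_m e1) s0 st FA.
by rewrite (cm 1 n1) (cm (-1) nN1).
Qed.

End gain_martingale.

(** * Reflection of F and modification of processes *)

Section reflection.
Context {R : realType}.
Local Notation D1 := (`[0, +oo[%classic : set R).
Variables F F' : R -> R.

(** The point reflection at (0, F 0): F x for x >= 0, and 2 F 0 - F (- x) for x
    <= 0. Written without distinction of cases, it is visibly continuous. *)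
Definition odd_extension (x : R) : R := F (Num.max x 0) + F 0 - F (Num.max (- x) 0).

Definition even_extension (x : R) : R := F' `|x|.

Lemma odd_extension_ge0 x : 0 <= x -> odd_extension x = F x.
Proof. by move=> x0; rewrite /odd_extension max_l// max_r ?oppr_le0// addrK. Qed.

Lemma odd_extension_lt0 x : x <= 0 -> odd_extension x = 2 * F 0 - F (- x).
Proof. by move=> x0; rewrite /odd_extension max_r// max_l ?oppr_ge0//; ring. Qed.

Lemma even_extension_ge0 x : 0 <= x -> even_extension x = F' x.
Proof. by move=> x0; rewrite /even_extension ger0_norm. Qed.

Lemma comp_half_line_continuous (g k : R -> R) : {within D1, continuous g} -> continuous k ->
  (forall x, 0 <= k x) -> continuous (g \o k).
Proof.
move=> cg ck k0 x; apply/cvgrPdist_lt => e e0.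
have Dk : D1 (k x) by rewrite /= in_itv/= k0.
have /cvgrPdist_lt/(_ e e0) := (@subspace_continuousP _ _ _ g).1 cg _ Dk.
rewrite near_withinE => h; apply: (@filterS _ (nbhs x) _ _ _ _ (ck x _ h)) => y /= hy.
by apply: hy; rewrite /= in_itv/= k0.
Qed.

(** At x < 0 the difference quotient with increment y is that of F at - x with
    increment - y. At 0 the quotients from both sides are those of F at 0. *)
Lemma C1_reflection : C1_deriv D1 F F' -> C1_deriv setT odd_extension even_extension.
Proof.
move=> [bF bF' dF].
have [C C0 FC] := bounded_continuous_bound bF; have [C' C'0 FC'] := bounded_continuous_bound bF'.
have cmax : continuous (fun x : R => Num.max x 0).
  by move=> x; apply: (@continuous_max R R id (cst 0)); [exact: cvg_id|exact: cst_continuous].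
have cmaxN : continuous (fun x : R => Num.max (- x) 0).
  move=> x; apply: (@continuous_max R R (fun x => - x) (cst 0)); last exact: cst_continuous.
  exact: opp_continuous.
have m0 (x : R) : 0 <= Num.max x 0 by rewrite le_max lexx orbT.
have FC1 x : 0 <= x -> `|F x| <= C by move=> x0; apply: FC; rewrite /= in_itv/= x0.
split.
- split.
    apply: (@bounded_byP _ _ _ _ (3 * C)) => x _; rewrite /odd_extension.
    apply: (le_trans (ler_normB _ _)); apply: (le_trans (lerD (ler_normD _ _) (lexx _))).
    have := FC1 _ (m0 x); have := FC1 _ (m0 (- x)); have := FC1 _ (lexx 0); lra.
  suff c : continuous odd_extension by exact: continuous_subspaceT.
  move=> x; rewrite /continuous_at /odd_extension; apply: cvgB.
    apply: cvgD; last exact: cvg_cst.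
    exact: (comp_half_line_continuous bF.2 cmax m0).
  exact: (comp_half_line_continuous bF.2 cmaxN (fun x => m0 (- x))).
- split.
    apply: (@bounded_byP _ _ _ _ C') => x _; apply: FC'.
    by rewrite /= in_itv/= normr_ge0.
  suff c : continuous even_extension by exact: continuous_subspaceT.
  by apply: (comp_half_line_continuous bF'.2) => [x|x]; [exact: norm_continuous|exact: normr_ge0].
move=> x _; have Dx : D1 `|x| by rewrite /= in_itv/= normr_ge0.
apply/cvgrPdist_lt => e e0.
have /cvgrPdist_lt/(_ e e0) := dF _ Dx.
rewrite !near_withinE !near_simpl /dnbhs => h.
have {}h : \forall h \near (0 : R), h != 0 -> D1 (`|x| + h) -> `|F' `|x| - h^-1 * (F (`|x| + h) - F `|x|)| < e.
  by apply: filterS h => y hy y0 Dy; exact: hy.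
have /nbhs_ballP[r /= r0 hr] := h.
have small : forall y : R, `|y| < r -> y != 0 -> 0 <= `|x| + y -> `|F' `|x| - y^-1 * (F (`|x| + y) - F `|x|)| < e.
  move=> y yr y0 xy; apply: hr => //; last by rewrite /= in_itv/= xy.
  by rewrite /ball/= sub0r normrN.
pose r' := if x == 0 then r else Num.min r `|x|.
have r'0 : 0 < r'.
  by rewrite /r'; case: ifPn => // x0; rewrite lt_min r0 normr_gt0.
have r'r : r' <= r by rewrite /r'; case: ifPn => // _; rewrite ge_min lexx.
suff key : forall y : R, `|y| < r' -> y != 0 ->
    `|even_extension x - y^-1 * (odd_extension (x + y) - odd_extension x)| < e.
  apply/nbhs_ballP; exists r' => //= y; rewrite /ball/= sub0r normrN => yr y0 _.
  exact: key.
move=> y yr y0; have yr' : `|y| < r := lt_le_trans yr r'r.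
rewrite /even_extension; have [x0|x0] := leP 0 x.
  have [xy|xy] := leP 0 (x + y).
    rewrite !odd_extension_ge0//.
    have := small y yr' y0; rewrite (ger0_norm x0); exact.
  have xE : x = 0.
    apply/eqP; move: yr; rewrite /r'; case: ifPn => // x1; rewrite lt_min => /andP[_].
    rewrite (ger0_norm x0) => yx; have : - `|y| <= y by rewrite lerNl ler_normr lexx orbT.
    by lra.
  subst x; rewrite add0r in xy *; rewrite odd_extension_lt0; last exact: ltW.
  rewrite odd_extension_ge0//; have := small (- y); rewrite normrN oppr_eq0 normr0 add0r => /(_ yr' y0).
  rewrite oppr_ge0 => /(_ (ltW xy)); congr (_ < _); congr (`|_ - _|).
  by rewrite invrN; ring.
have xy : x + y < 0.
  have := ler_norm y; move: yr; rewrite /r' (lt_eqF x0) lt_min => /andP[_].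
  by rewrite (ltr0_norm x0); lra.
rewrite odd_extension_lt0; last exact: ltW.
rewrite odd_extension_lt0; last exact: ltW.
rewrite (ltr0_norm x0) in small *; have := small (- y); rewrite normrN oppr_eq0 => /(_ yr' y0).
rewrite -opprD oppr_ge0 => /(_ (ltW xy)); congr (_ < _); congr (`|_ - _|).
by rewrite invrN; ring.
Qed.

End reflection.

(** For f >= 0 all the arguments of F and F' are nonnegative. *)
Lemma mart_part_congr {R : realType} (alpha : R -> R) (p : R -> nat -> R) (Ginf : probability (seqT R) R)
    (f f' F F' G G' : R -> R) (Omega : Type) (X : R -> Omega -> posMeasure R) :
  positive_on `]0, +oo[ f -> (forall x, 0 <= x -> F x = G x) -> (forall x, 0 <= x -> F' x = G' x) ->
  mart_part alpha p Ginf f f' F F' X = mart_part alpha p Ginf f f' G G' X.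
Proof.
move=> f0 FG FG'; apply/funext => t; apply/funext => w; rewrite /mart_part.
have pf (mu : posMeasure R) : 0 <= pairing mu f by exact: pairing_ge0.
have gE mu : generator alpha p Ginf f f' F F' mu = generator alpha p Ginf f f' G G' mu.
  pose k (H : R -> R) n y := alpha y * p y n *
    \int[Ginf]_(z in @posseq R) (H (pairing mu f) - H (pairing mu f + \sum_(i < n) f (z i))).
  pose gen (b : R) (k : nat -> R -> R) := - pairing mu f' * b -
    \big[+%R/0]_(0 <= n <oo) pairing mu (k n).
  rewrite -[LHS]/(gen (F' (pairing mu f)) (k F)) -[RHS]/(gen (G' (pairing mu f)) (k G)).
  rewrite (FG' _ (pf mu)) (_ : k F = k G)//; apply/funext => n; apply/funext => y.
  congr (_ * _); apply: eq_Rintegral => z /set_mem zp.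
  have s0 : 0 <= \sum_(i < n) f (z i).
    by apply: sumr_ge0 => i _; apply: f0; rewrite /= in_itv/= andbT; exact: zp.
  by rewrite (FG _ (pf mu)) (FG _ (addr_ge0 (pf mu) s0)).
rewrite (FG _ (pf (X t w))) (FG _ (pf (X 0 w))).
by have -> : generator alpha p Ginf f f' F F' = generator alpha p Ginf f f' G G' by apply/funext.
Qed.

Section modification.
Context {R : realType} {d} {Omega : measurableType d} {P : probability Omega R}
  {Ft : R -> set (set Omega)}.
Hypothesis hFt : usual_filtration P Ft.
Local Notation RT := (measurableTypeR R).
Variables N1 N2 : R -> Omega -> R.
Hypothesis N12 : {ae P, forall w, forall t, 0 <= t -> N1 t w = N2 t w}.

(** The null sets belong to all the sigma-algebras, so that a modification is
    still adapted. *)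
Lemma martingale_modification : martingale P Ft N1 -> martingale P Ft N2.
Proof.
move=> [h1 h2].
have ad t : 0 <= t -> sub_measurable (Ft t) (N2 t : Omega -> RT).
  move=> t0 B mB; pose E := [set w | forall t, 0 <= t -> N1 t w = N2 t w].
  have FE : Ft t E by apply: (filt_ae hFt).
  have -> : N2 t @^-1` B = (N1 t @^-1` B `&` E) `|` (N2 t @^-1` B `\` E).
    apply/seteqP; split => w /=.
      move=> Bw; have [Ew|nE] := pselect (E w); last by right.
      by left; split => //; rewrite (Ew t t0).
    by move=> [[Bw Ew]|[]//]; rewrite -(Ew t t0).
  apply: (filtU hFt) => //; first by apply: (filtI hFt) => //; exact: (h1 t t0).1.
  apply: (filt_negligible hFt) => //.
  by apply: negligibleS N12 => w [].
have meas (N : R -> Omega -> R) t : 0 <= t -> sub_measurable (Ft t) (N t : Omega -> RT) ->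
    measurable_fun setT (EFin \o N t).
  move=> t0 aN; apply/measurable_EFinP => _ B mB; rewrite setTI.
  exact: (filt_measurable hFt t0 (aN B mB)).
have aeq (A : set Omega) t : 0 <= t -> measurable A ->
    (\int[P]_(w in A) (N1 t w)%:E = \int[P]_(w in A) (N2 t w)%:E)%E.
  move=> t0 mA; apply: ae_eq_integral => //.
  - by apply: measurable_funTS; apply: meas => //; exact: (h1 t t0).1.
  - by apply: measurable_funTS; apply: meas => //; exact: ad.
  - by apply: negligibleS N12; apply: subsetC => w hw _; rewrite hw.
have int t : 0 <= t -> P.-integrable setT (EFin \o N2 t).
  move=> t0; apply/integrableP; split; first by apply: meas => //; exact: ad.
  have [_ /integrableP[_]] := h1 t t0; congr (_ < _)%E.
  apply: ae_eq_integral => //.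
  - by apply: measurableT_comp => //; apply: meas => //; exact: (h1 t t0).1.
  - by apply: measurableT_comp => //; apply: meas => //; exact: ad.
  - by apply: negligibleS N12; apply: subsetC => w hw _ /=; rewrite hw.
split=> [t t0|s t s0 st]; first by split; [exact: ad|exact: int].
have t0 : 0 <= t by exact: le_trans st.
split; [exact: ad|exact: int|] => A FA.
have mA : measurable A by exact: filt_measurable hFt _ _ s0 FA.
rewrite -(aeq A s s0 mA) -(aeq A t t0 mA).
by have [_ _] := h2 s t s0 st; exact.
Qed.

End modification.

(** * The martingale problem *)

Section core_counts.
Context {R : realType} {d} {Omega : measurableType d} {P : probability Omega R}
  {Ft : R -> set (set Omega)} {Ginf : probability (seqT R) R}
  {M : Omega -> {measure set (pointT R) -> \bar R}}.
Hypothesis hM : filtered_poisson P (@time_of R) Ft (intensity Ginf) M.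
Local Notation m := (intensity_measure Ginf).
Local Notation time := (@time_of R).

Let hM' : filtered_poisson P time Ft m M := hM.

Let core_window k : core k `<=` @window R k.
Proof. by move=> q []. Qed.

Lemma core_nat_valued : {ae P, forall w, forall k B, measurable B ->
  nat_valued (M w (B `&` core k))}.
Proof.
apply/ae_foralln => k.
apply: (ae_nat_valued hM' (measurable_core k) _ (countably_generated_point R)).
apply: le_lt_trans (intensity_window_fin Ginf k).
by apply: le_measure; rewrite ?inE; [exact: measurable_core|exact: measurable_window|exact: core_window].
Qed.

Lemma core_simple_times : {ae P, forall w, forall k (s : R),
  (M w (time @^-1` [set s] `&` core k) <= 1)%E}.
Proof.
apply/ae_foralln => k.
apply: (ae_simple_times hM' (measurable_core k) (K := k) (c := k%:R * k.+1%:R)).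
- by rewrite mulr_ge0.
- exact: measurable_time_of.
- move=> a b ab; apply: le_trans (intensity_window_le Ginf k ab).
  have mt : measurable (time @^-1` `]a, b]%classic).
    by rewrite -[X in measurable X]setTI; exact: measurable_time_of.
  apply: le_measure; rewrite ?inE; [exact: measurableI mt (measurable_core k)|
    exact: measurableI mt (measurable_window k)|exact: setIS (@core_window k)].
- move=> q [[/= q0 [nD|[[qk _] _]]] Dq]; first by [].
  by move: q0 qk; rewrite /= !in_itv/= andbT => -> ->.
Qed.

End core_counts.

Section offspring_bounds.
Context {R : realType} {p : R -> nat -> R}.
Hypothesis hp : offspring_law p.
Local Notation D0 := (`]0, +oo[%classic : set R).

Let gt0 x : D0 x -> 0 < x. Proof. by rewrite /= in_itv/= andbT. Qed.

Lemma offspring_bc n : bounded_continuous D0 (p ^~ n).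
Proof. by have [/(_ n) [[p' []]]] := hp. Qed.

Let p0 n x : D0 x -> 0 <= p x n.
Proof. by have [/(_ n) [_ h] _ _] := hp; exact: h. Qed.

Lemma offspring_le1 n x : D0 x -> 0 <= p x n <= 1.
Proof.
move=> Dx; rewrite p0//=; have [_ /(_ x (gt0 Dx)) h _] := hp.
rewrite -lee_fin -h; apply: (@le_trans _ _ (\sum_(0 <= i < n.+1) (p x i)%:E)%E).
  rewrite big_nat_recr//= -[leLHS]add0e; apply: leeD2r.
  by apply: sume_ge0 => i _; rewrite lee_fin p0.
by apply: nneseries_lim_ge => i _ _; rewrite lee_fin p0.
Qed.

Lemma offspring_mean : exists2 mb : R, 0 <= mb &
  forall x, D0 x -> (\sum_(n <oo) (n%:R * p x n)%:E <= mb%:E)%E.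
Proof.
have [_ _] := hp; set E := ereal_sup _ => Efin.
have bnd x : D0 x -> (\sum_(n <oo) (n%:R * p x n)%:E <= E)%E.
  move=> Dx; rewrite nneseries_recl//; last by move=> k _; rewrite lee_fin mulr_ge0// p0.
  by rewrite mul0r add0e; apply: ereal_sup_ubound; exists x.
have E0 : (0 <= E)%E.
  apply: le_trans (bnd 1 _); last by rewrite /= in_itv/= ltr01.
  by apply: nneseries_ge0 => n _ _; rewrite lee_fin mulr_ge0// p0//= in_itv/= ltr01.
by exists (fine E); [exact: fine_ge0|move=> x Dx; rewrite fineK ?ge0_fin_numE//; exact: bnd].
Qed.

End offspring_bounds.

Section localized.
Context {R : realType} {d} {Omega : measurableType d} {P : probability Omega R}
  {Ft : R -> set (set Omega)} {Ginf : probability (seqT R) R}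
  {M : Omega -> {measure set (pointT R) -> \bar R}}.
Local Notation D0 := (`]0, +oo[%classic : set R).
Local Notation RT := (measurableTypeR R).
Variables (alpha : R -> R) (p : R -> nat -> R) (X : R -> Omega -> posMeasure R).
Variables f f' F F' : R -> R.
Hypothesis halpha : C1 D0 alpha.
Hypothesis alpha0 : positive_on D0 alpha.
Hypothesis hp : offspring_law p.
Hypothesis hFt : usual_filtration P Ft.
Hypothesis hM : filtered_poisson P (@time_of R) Ft (intensity Ginf) M.
Hypothesis hX : is_solution P alpha p Ft M X.
Hypothesis hf : C1_deriv D0 f f'.
Hypothesis hf0 : f x @[x --> 0^'+] --> 0.
Hypothesis hF : C1_deriv setT F F'.
Local Notation mart := (mart_part alpha p Ginf f f' F F' X).

Lemma initial_mass_measurable : sub_measurable (Ft 0) ((fun w => mass (X 0 w)) : Omega -> RT).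
Proof.
have := sub_measurable_pairing hFt (lexx 0) (hX.1 _ (lexx 0)) (bounded_continuous_cst 1).
by under [X in sub_measurable _ X]funext do rewrite pairing_cst mul1r.
Qed.

(** Cut theta down to the outcomes for which the equation holds, M is integer-
    valued without simultaneous points, and the births are finite in number.
    This loses a null set, so the event is still in F_0, and
    [indicator_martingale] applies to it. *)
Theorem localized_martingale (theta : set Omega) : Ft 0 theta ->
  (\int[P]_(w in theta) (mass (X 0 w))%:E < +oo)%E ->
  martingale P Ft (fun t w => \1_theta w * mart t w).
Proof.
move=> Fth x0fin; have [mX aeX] := hX.
have ba : bounded_continuous D0 alpha by case: halpha => alpha' [].
have [C C0 aC] := bounded_continuous_bound ba.
have alphaC x : D0 x -> alpha x <= C by move=> Dx; exact: le_trans (ler_norm _) (aC x Dx).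
have [mb mb0 hpm] := offspring_mean hp.
(* Y is a candidate for the left limits of the path w *)
pose sol w (Y : R -> posMeasure R) :=
  (forall s, 0 < s -> left_limit (X ^~ w) s (Y s)) /\
  (forall t x, 0 <= t -> 0 < x ->
     ((dist_fun (X t w) x)%:E =
      (dist_fun (X 0 w) (x + t) - dist_fun (X 0 w) t)%:E +
      \int[M w]_(q in birth_domain alpha p Y t) (births t x q)%:E)%E).
pose Xm w := if pselect (exists Y, sol w Y) is left h then projT1 (cid h) else X ^~ w.
have XmP w : (exists Y, sol w Y) -> sol w (Xm w).
  by rewrite /Xm => h; case: pselect => // h'; exact: (projT2 (cid h')).
pose good := [set w | (weakly_right_continuous (X ^~ w) /\ exists Y, sol w Y) /\
  ((forall k B, measurable B -> nat_valued (M w (B `&` core k))) /\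
   (forall k (s : R), (M w (@time_of R @^-1` [set s] `&` core k) <= 1)%E))].
have ae_good : {ae P, forall w, good w}.
  by apply: filterS2 aeX (filterI (core_nat_valued hM) (core_simple_times hM)) => w h1 h2; split.
have Fgood : Ft 0 good by exact: (filt_ae hFt (lexx 0) ae_good).
pose Theta0 := good `&` theta.
have FTheta0 : Ft 0 Theta0 by exact: (filtI hFt (lexx 0) Fgood Fth).
have XmE w s : good w -> 0 < s -> left_limit (X ^~ w) s (Xm w s).
  by move=> [[_ h] _]; exact: (XmP w h).1.
have XE w t x : good w -> 0 <= t -> 0 < x ->
  ((dist_fun (X t w) x)%:E = (dist_fun (X 0 w) (x + t) - dist_fun (X 0 w) t)%:E +
   \int[M w]_(q in birth_domain alpha p (Xm w) t) (births t x q)%:E)%E.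
  by move=> [[_ h] _]; exact: (XmP w h).2.
have mmass : measurable_fun setT (fun w => (mass (X 0 w))%:E).
  apply/measurable_EFinP => _ B mB; rewrite setTI.
  exact: (filt_measurable hFt (lexx 0) (initial_mass_measurable mB)).
have x0fin' : (\int[P]_(w in Theta0) (mass (X 0 w))%:E < +oo)%E.
  apply: le_lt_trans x0fin; apply: ge0_subset_integral.
  - exact: (filt_measurable hFt (lexx 0) FTheta0).
  - exact: (filt_measurable hFt (lexx 0) Fth).
  - exact: measurable_funTS mmass.
  - by move=> w _; rewrite lee_fin mass_ge0.
  - by move=> w [].
have sub0 w : Theta0 w -> good w by case.
have [ae_stock mean_stock] := litter_moment hFt hM ba alpha0 alphaC (offspring_bc hp)
  (offspring_le1 hp) hpm FTheta0 mX (fun w T0 => (sub0 w T0).1.1)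
  (fun w s T0 => XmE w s (sub0 w T0)) (fun w t x T0 => XE w t x (sub0 w T0)) C0 x0fin'.
pose fin_stock := [set w | forall t, (litter_stock (Ft := Ft) (M := M) alpha p Xm Theta0 t w < +oo)%E].
pose Theta := Theta0 `&` fin_stock.
have FTheta : Ft 0 Theta.
  by apply: (filtI hFt (lexx 0) FTheta0); exact: (filt_ae hFt (lexx 0) ae_stock).
have subT w : Theta w -> good w by case=> /sub0.
have stockE t w : litter_stock (Ft := Ft) (M := M) alpha p Xm Theta t w =
    if pselect (Theta w) is left _ then litter_stock (Ft := Ft) (M := M) alpha p Xm Theta0 t w else 0%E.
  rewrite /litter_stock; case: pselect => [Tw|nT]; last by rewrite birth_window_off// integral_set0.
  rewrite (birth_window_domain (Ft := Ft) alpha p Xm t Tw).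
  by rewrite (birth_window_domain (Ft := Ft) alpha p Xm t (Theta := Theta0)) //; case: Tw.
have stock_fin t w : (litter_stock (Ft := Ft) (M := M) alpha p Xm Theta t w < +oo)%E.
  by rewrite stockE; case: pselect => [[_ h]|_]; [exact: h|exact: ltry].
have stock_mean t : (\int[P]_w litter_stock (Ft := Ft) (M := M) alpha p Xm Theta t w < +oo)%E.
  apply: le_lt_trans (mean_stock t); apply: ge0_le_integral_any => w _.
    exact: litter_stock_ge0.
  by rewrite stockE; case: pselect => // _; exact: litter_stock_ge0.
have [CF CF0 FC] := bounded_continuous_bound (let: And3 h _ _ := hF in h).
have cF : continuous F by case: hF => [[_ h] _ _]; apply/continuous_subspace_setT.
have := indicator_martingale hFt hM ba alpha0 C0 alphaC (offspring_bc hp) (offspring_le1 hp) hpm mb0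
  FTheta mX (fun w Tw => (subT w Tw).1.1) (fun w s Tw => XmE w s (subT w Tw))
  (fun w t x Tw => XE w t x (subT w Tw)) (fun w k B Tw => (subT w Tw).2.1 k B)
  (fun w k s Tw => (subT w Tw).2.2 k s) stock_fin stock_mean hf hf0 hF CF0 (fun x => FC x I) cF.
apply: (martingale_modification hFt).
apply: filterS2 ae_good ae_stock => w gw sw t t0; congr (_ * _); rewrite !indicE; congr ((nat_of_bool _)%:R).
by apply/idP/idP => /set_mem h; apply/mem_set; [case: h => [[]]|split].
Qed.

(** Never stop if the initial mass is at most k, stop at time 0 otherwise. As
    the process starts at 0, stopping multiplies it by an indicator known at
    time 0. *)
Let tau (k : nat) (w : Omega) : \bar R := if mass (X 0 w) <= k%:R then +oo%E else 0%E.

Let Ftheta (k : nat) : Ft 0 [set w | mass (X 0 w) <= k%:R].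
Proof.
have := initial_mass_measurable (measurable_itv `]-oo, (k%:R : R)]).
by congr (Ft 0 _); apply/seteqP; split => w; rewrite /= in_itv.
Qed.

Let mart0 w : mart 0 w = 0.
Proof. by rewrite /mart_part subrr set_itvoc0 Rintegral_set0 subr0. Qed.

Lemma local_martingale_mart : local_martingale P Ft mart.
Proof.
exists tau; split.
- move=> k; split; first by move=> w; rewrite /tau; case: ifP.
  move=> t t0; have := filtC hFt (lexx 0) (Ftheta k) => /(filtS hFt (lexx 0) t0).
  congr (Ft t _); apply/seteqP; split => w /=; rewrite /tau.
    by case: ifP => // _ _; rewrite lee_fin.
  by case: ifP.
- apply: aeW => w; split.
    move=> i j ij; rewrite /tau; case: ifP => [mi|_]; last by case: ifP.
    by rewrite ifT// (le_trans mi)// ler_nat.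
  apply: cvg_near_cst; near=> k; rewrite /tau ifT//.
  apply: (@le_trans _ _ (Num.truncn (mass (X 0 w))).+1%:R); first exact/ltW/truncnS_gt.
  rewrite ler_nat; near: k; exact: nbhs_infty_ge.
- move=> k; have := @localized_martingale _ (Ftheta k).
  have fin : (\int[P]_(w in [set w | (mass (X 0 w) <= k%:R)%R]) (mass (X 0 w))%:E < +oo)%E.
    apply: (@le_lt_trans _ _ (\int[P]_(w in [set w | (mass (X 0 w) <= k%:R)%R]) cst k%:R%:E w)%E).
      by apply: ge0_le_integral_any => w /= h; rewrite lee_fin ?mass_ge0.
    have mth := filt_measurable hFt (lexx 0) (Ftheta k).
    rewrite integral_cst//; apply: (@le_lt_trans _ _ (k%:R%:E * 1)%E); last by rewrite mule1 ltry.
    by apply: lee_wpmul2l; [rewrite lee_fin|exact: probability_le1].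
  move=> /(_ fin); apply: (martingale_modification hFt); apply: aeW => w t t0.
  rewrite /stopped /tau indicE; case: ifPn => mk.
    by rewrite mem_set//= mul1r min_l// leey.
  by rewrite memNset ?mul0r ?min_r ?lee_fin//= ?mart0//; exact/negP.
Unshelve. all: by end_near. Qed.

Lemma martingale_mart : (\int[P]_w X 0%R w setT < +oo)%E -> martingale P Ft mart.
Proof.
move=> x0; have := @localized_martingale setT (filtT hFt (lexx 0)).
have -> : (\int[P]_w (mass (X 0 w))%:E = \int[P]_w X 0%R w setT)%E.
  by apply: eq_integral => w _; exact: massE.
move=> /(_ x0); apply: (martingale_modification hFt); apply: aeW => w t _.
by rewrite indicT mul1r.
Qed.

End localized.

Theorem proposition3p9 (R : realType)
  (alpha : R -> R) (p : R -> nat -> R)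
  (G : probability (measurableTypeR R) R) (Ginf : probability (seqT R) R)
  (d : measure_display) (Omega : measurableType d) (P : probability Omega R)
  (Ft : R -> set (set Omega))
  (M : Omega -> {measure set (pointT R) -> \bar R})
  (X : R -> Omega -> posMeasure R)
  (f f' F F' : R -> R)
  (halpha : C1 `]0, +oo[ alpha) (halpha0 : positive_on `]0, +oo[ alpha)
  (hp : offspring_law p)
  (hG : continuous_law G) (hGinf : product_law G Ginf)
  (hFt : usual_filtration P Ft)
  (hM : filtered_poisson P time_of Ft (intensity Ginf) M)
  (hX : is_solution P alpha p Ft M X)
  (hf : C1_deriv `]0, +oo[ f f')
  (hf0 : f x @[x --> 0^'+] --> 0) (hfoo : f x @[x --> +oo] --> 0)
  (hf'0 : f' x @[x --> 0^'+] --> 0)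
  (hF : C1_deriv `[0, +oo[ F F')
  (hfF : positive_on `]0, +oo[ f \/ C1_deriv setT F F') :
  local_martingale P Ft (mart_part alpha p Ginf f f' F F' X) /\
  ((\int[P]_w X 0%R w setT < +oo)%E ->
   martingale P Ft (mart_part alpha p Ginf f f' F F' X)).
Proof.
case: hfF => [f0|hFT]; last first.
  split; first exact: (local_martingale_mart halpha halpha0 hp hFt hM hX hf hf0 hFT).
  exact: (martingale_mart halpha halpha0 hp hFt hM hX hf hf0 hFT).
(* f >= 0: replace F by its reflection *)
have FE x : 0 <= x -> F x = odd_extension F x by move=> x0; rewrite odd_extension_ge0.
have FE' x : 0 <= x -> F' x = even_extension F' x by move=> x0; rewrite even_extension_ge0.
rewrite (mart_part_congr alpha p Ginf f' X f0 FE FE').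
have hFT := C1_reflection hF.
split; first exact: (local_martingale_mart halpha halpha0 hp hFt hM hX hf hf0 hFT).
exact: (martingale_mart halpha halpha0 hp hFt hM hX hf hf0 hFT).
Qed.
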